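(* In addition to the standing assumptions of the context, suppose that for every $\psi\in\{\sigma^{\alpha}_{k},b^{\alpha}_{k},c^{\alpha}-\lambda,f^{\alpha}: k=\pm1,\dots,\pm d_1,\ \alpha\in A\}$, every $x\in\mathbb R^{d}$ and all $t,s\in\mathbb R$, $|\psi(t,x)-\psi(s,x)|\le K|t-s|^{1/2}$. Let $h>0$. Then there exists a unique bounded solution $v_h(t,x)$ of $$\frac{\partial}{\partial t}u(t,x)+F(\Delta_{h,\ell_k}u(t,x),\delta_{h,\ell_k}u(t,x),u(t,x),t,x)=0\quad\text{in }H_T=[0,T)\times\mathbb R^d$$ with terminal condition $u(T,x)=g(x)$, $x\in\mathbb R^d$. Furthermore, there exists a constant $N_1$ depending only on $K,T,d$ and $d_1$ such that $$|v-v_h|\le N_1h^{1/2}\quad\text{in }H_T.$$ Finally, there is a constant $N_2$ depending only on $K$ and $d_1$ such that if $\lambda\ge N_2$, then $N_1$ is independent of $T$.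
   Context: Standing data and assumptions. $A$ is a separable metric space; $T\in(0,\infty)$, $K\in[1,\infty)$, $\lambda\in[0,\infty)$ are constants; $d,d_1\ge1$ are integers; the index $k$ runs through $\pm1,\dots,\pm d_1$. Given are vectors $\ell_k\in\mathbb R^{d}$ and real-valued functions $\sigma^{\alpha}_k(t,x)$, $b^{\alpha}_k(t,x)$, $c^{\alpha}(t,x)$, $f^{\alpha}(t,x)$ ($\alpha\in A$, $(t,x)\in\mathbb R\times\mathbb R^{d}$) and $g(x)$ with $\ell_k=-\ell_{-k}$, $|\ell_k|\le K$, $\sigma^{\alpha}_k=\sigma^{\alpha}_{-k}$, $b^{\alpha}_k\ge0$, $c^{\alpha}\ge\lambda$. The functions $\sigma,b,c,f$ are Borel in $t$ and continuous in $\alpha$. For every $\psi\in\{\sigma^{\alpha}_k,b^{\alpha}_k,c^{\alpha}-\lambda,f^{\alpha},g\}$, $t\in[0,T]$, $x,y\in\mathbb R^{d}$: $|\psi(t,x)|\le K$ and $|\psi(t,x)-\psi(t,y)|\le K|x-y|$. Put $a^{\alpha}_k=\tfrac12(\sigma^{\alpha}_k)^2$. Notation. $D_{l}u=\sum_i u_{x^i}l^i$, $D^2_{l}u=\sum_{i,j}u_{x^ix^j}l^il^j$, $\delta_{h,l}u(t,x)=\frac{u(t,x+hl)-u(t,x)}{h}$, $\Delta_{h,l}u(t,x)=\frac{u(t,x+hl)-2u(t,x)+u(t,x-hl)}{h^2}$, and $$F(p_k,q_k,r,t,x)=\sup_{\alpha\in A}\Big[\sum_k a^{\alpha}_k(t,x)p_k+\sum_k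 b^{\alpha}_k(t,x)q_k-c^{\alpha}(t,x)r+f^{\alpha}(t,x)\Big].$$ $v$ is the probabilistic solution (value function of the associated controlled diffusion problem), equivalently the unique bounded viscosity solution, of $\frac{\partial}{\partial t}u+F(D^2_{\ell_k}u,D_{\ell_k}u,u,t,x)=0$ in $H_T$ with $u(T,x)=g(x)$. *)

(* Defs.v *)
From HB Require Import structures.
From mathcomp Require Import all_boot all_order all_algebra.
From mathcomp Require Import all_classical all_reals all_analysis.

Set Implicit Arguments.
Unset Strict Implicit.
Unset Printing Implicit Defensive.

Import Order.TTheory GRing.Theory Num.Theory.
Import numFieldNormedType.Exports.

Local Open Scope classical_set_scope.
Local Open Scope ring_scope.

(* The library norm on 'rV[R]_d is the sup norm; it induces the same topology,
   but the constants below refer to the Euclidean length. *)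
Definition enorm (R : realType) (d : nat) (x : 'rV[R]_d) : R :=
  Num.sqrt (\sum_(i < d) x ord0 i ^+ 2).

Definition separable_space (A : topologicalType) : Prop :=
  exists2 S : set A, countable S & dense S.

(* The index k = +1, ..., +d1, -1, ..., -d1, with (true, i) standing for
   +(i + 1) and (false, i) for -(i + 1). *)
Definition dindex (d1 : nat) : finType := (bool * 'I_d1)%type.

Definition dopp (d1 : nat) (k : dindex d1) : dindex d1 := (~~ k.1, k.2).

Record bellman_data (R : realType) (d d1 : nat) (A : Type) := BellmanData {
  ell_ : dindex d1 -> 'rV[R]_d;
  sigma_ : A -> dindex d1 -> R -> 'rV[R]_d -> R;
  b_ : A -> dindex d1 -> R -> 'rV[R]_d -> R;
  c_ : A -> R -> 'rV[R]_d -> R;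
  f_ : A -> R -> 'rV[R]_d -> R;
  g_ : 'rV[R]_d -> R }.

Definition a_ (R : realType) (d d1 : nat) (A : Type)
    (E : bellman_data R d d1 A) (alpha : A) (k : dindex d1)
    (t : R) (x : 'rV[R]_d) : R :=
  2^-1 * sigma_ E alpha k t x ^+ 2.

Definition bounded_lipschitz (R : realType) (d : nat) (K T : R)
    (psi : R -> 'rV[R]_d -> R) : Prop :=
  forall (t : R) (x y : 'rV[R]_d), 0 <= t <= T ->
    `|psi t x| <= K /\ `|psi t x - psi t y| <= K * enorm (x - y).

Definition holder_half (R : realType) (d : nat) (K : R)
    (psi : R -> 'rV[R]_d -> R) : Prop :=
  forall (x : 'rV[R]_d) (t s : R),
    `|psi t x - psi s x| <= K * Num.sqrt `|t - s|.

Record standing_assumptions (R : realType) (d d1 : nat) (A : topologicalType)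
    (K T lambda : R) (E : bellman_data R d d1 A) : Prop := {
  ell_opp : forall k, ell_ E k = - ell_ E (dopp k);
  ell_le : forall k, enorm (ell_ E k) <= K;
  sigma_opp : forall alpha k t x,
    sigma_ E alpha k t x = sigma_ E alpha (dopp k) t x;
  b_ge0 : forall alpha k t x, 0 <= b_ E alpha k t x;
  c_ge : forall alpha t x, lambda <= c_ E alpha t x;
  sigma_borel : forall alpha k x,
    measurable_fun setT (fun t => sigma_ E alpha k t x);
  b_borel : forall alpha k x,
    measurable_fun setT (fun t => b_ E alpha k t x);
  c_borel : forall alpha x, measurable_fun setT (fun t => c_ E alpha t x);
  f_borel : forall alpha x, measurable_fun setT (fun t => f_ E alpha t x);
  sigma_cont : forall k t x, continuous (fun alpha => sigma_ E alpha k t x);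
  b_cont : forall k t x, continuous (fun alpha => b_ E alpha k t x);
  c_cont : forall t x, continuous (fun alpha => c_ E alpha t x);
  f_cont : forall t x, continuous (fun alpha => f_ E alpha t x);
  sigma_bl : forall alpha k, bounded_lipschitz K T (sigma_ E alpha k);
  b_bl : forall alpha k, bounded_lipschitz K T (b_ E alpha k);
  c_bl : forall alpha,
    bounded_lipschitz K T (fun t x => c_ E alpha t x - lambda);
  f_bl : forall alpha, bounded_lipschitz K T (f_ E alpha);
  g_bl : bounded_lipschitz K T (fun=> g_ E) }.

Record time_holder (R : realType) (d d1 : nat) (A : Type)
    (K lambda : R) (E : bellman_data R d d1 A) : Prop := {
  sigma_holder : forall alpha k, holder_half K (sigma_ E alpha k);
  b_holder : forall alpha k, holder_half K (b_ E alpha k);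
  c_holder : forall alpha,
    holder_half K (fun t x => c_ E alpha t x - lambda);
  f_holder : forall alpha, holder_half K (f_ E alpha) }.

(* Under the standing assumptions, A nonempty and 0 <= t <= T, the real-valued
   supremum is taken over a nonempty bounded set. *)
Definition bellmanF (R : realType) (d d1 : nat) (A : Type)
    (E : bellman_data R d d1 A) (p q : dindex d1 -> R) (r t : R)
    (x : 'rV[R]_d) : R :=
  sup [set \sum_k a_ E alpha k t x * p k + \sum_k b_ E alpha k t x * q k
           - c_ E alpha t x * r + f_ E alpha t x | alpha in [set: A]].

Definition fdelta (R : realType) (d : nat) (h : R) (l : 'rV[R]_d)
    (u : R -> 'rV[R]_d -> R) (t : R) (x : 'rV[R]_d) : R :=
  (u t (x + h *: l) - u t x) / h.

Definition fDelta (R : realType) (d : nat) (h : R) (l : 'rV[R]_d)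
    (u : R -> 'rV[R]_d -> R) (t : R) (x : 'rV[R]_d) : R :=
  (u t (x + h *: l) - 2 * u t x + u t (x - h *: l)) / h ^+ 2.

Definition bounded_upto (R : realType) (d : nat) (T : R)
    (u : R -> 'rV[R]_d -> R) : Prop :=
  exists M : R, forall (t : R) (x : 'rV[R]_d), 0 <= t <= T -> `|u t x| <= M.

(* Time derivative relative to [0, T]: two-sided inside, one-sided at 0. *)
Definition has_time_derivative (R : realType) (d : nat) (T : R)
    (u : R -> 'rV[R]_d -> R) (t : R) (x : 'rV[R]_d) (l : R) : Prop :=
  (u s x - u t x) / (s - t) @[s --> within `[0, T] t^'] --> l.

(* Continuity in time up to T is what ties the terminal value to the equation
   on [0, T). *)
Definition bounded_fd_solution (R : realType) (d d1 : nat) (A : Type) (T h : R)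
    (E : bellman_data R d d1 A) (u : R -> 'rV[R]_d -> R) : Prop :=
  [/\ bounded_upto T u,
      forall x : 'rV[R]_d, {within `[0, T], continuous (fun t => u t x)},
      forall (t : R) (x : 'rV[R]_d), 0 <= t < T ->
        exists2 ut : R, has_time_derivative T u t x ut &
          ut + bellmanF E (fun k => fDelta h (ell_ E k) u t x)
                          (fun k => fdelta h (ell_ E k) u t x)
                          (u t x) t x = 0
    & forall x : 'rV[R]_d, u T x = g_ E x].

Definition dt (R : realType) (d : nat) (phi : R -> 'rV[R]_d -> R)
    (t : R) (x : 'rV[R]_d) : R :=
  'D_1 (fun s : R => phi s x) t.

Definition dx (R : realType) (d : nat) (i : 'I_d) (phi : R -> 'rV[R]_d -> R)
    (t : R) (x : 'rV[R]_d) : R :=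
  'D_(delta_mx ord0 i) (phi t) x.

Definition D1 (R : realType) (d : nat) (l : 'rV[R]_d)
    (u : R -> 'rV[R]_d -> R) (t : R) (x : 'rV[R]_d) : R :=
  \sum_(i < d) dx i u t x * l ord0 i.

Definition D2 (R : realType) (d : nat) (l : 'rV[R]_d)
    (u : R -> 'rV[R]_d -> R) (t : R) (x : 'rV[R]_d) : R :=
  \sum_(i < d) \sum_(j < d) dx j (dx i u) t x * l ord0 i * l ord0 j.

Definition jointly_continuous (R : realType) (d : nat)
    (phi : R -> 'rV[R]_d -> R) : Prop :=
  continuous (fun z : R * 'rV[R]_d => phi z.1 z.2).

(* Class C^{1,2}(R x R^d). *)
Record C12 (R : realType) (d : nat) (phi : R -> 'rV[R]_d -> R) : Prop := {
  C12_cont : jointly_continuous phi;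
  C12_dt : forall t x, derivable (fun s : R => phi s x) t 1;
  C12_dt_cont : jointly_continuous (dt phi);
  C12_dx : forall i t x, derivable (phi t) x (delta_mx ord0 i);
  C12_dx_cont : forall i, jointly_continuous (dx i phi);
  C12_dxx : forall i j t x, derivable (dx i phi t) x (delta_mx ord0 j);
  C12_dxx_cont : forall i j, jointly_continuous (dx j (dx i phi)) }.

(* u - phi has a local maximum at (t, x) relative to [0, T) x R^d. *)
Definition touches_above (R : realType) (d : nat) (T : R)
    (u phi : R -> 'rV[R]_d -> R) (t : R) (x : 'rV[R]_d) : Prop :=
  \forall z \near (t, x), 0 <= z.1 < T ->
    u z.1 z.2 - phi z.1 z.2 <= u t x - phi t x.

Definition touches_below (R : realType) (d : nat) (T : R)
    (u phi : R -> 'rV[R]_d -> R) (t : R) (x : 'rV[R]_d) : Prop :=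
  \forall z \near (t, x), 0 <= z.1 < T ->
    u t x - phi t x <= u z.1 z.2 - phi z.1 z.2.

Definition bellman_at (R : realType) (d d1 : nat) (A : Type)
    (E : bellman_data R d d1 A) (u phi : R -> 'rV[R]_d -> R)
    (t : R) (x : 'rV[R]_d) : R :=
  dt phi t x + bellmanF E (fun k => D2 (ell_ E k) phi t x)
                          (fun k => D1 (ell_ E k) phi t x) (u t x) t x.

(* The equation is backward in time with operator d/dt + F, F nondecreasing in
   the second derivatives, hence the signs below. *)
Definition viscosity_sub (R : realType) (d d1 : nat) (A : Type) (T : R)
    (E : bellman_data R d d1 A) (u : R -> 'rV[R]_d -> R) : Prop :=
  forall (phi : R -> 'rV[R]_d -> R) (t : R) (x : 'rV[R]_d),
    C12 phi -> 0 <= t < T -> touches_above T u phi t x ->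
    0 <= bellman_at E u phi t x.

Definition viscosity_super (R : realType) (d d1 : nat) (A : Type) (T : R)
    (E : bellman_data R d d1 A) (u : R -> 'rV[R]_d -> R) : Prop :=
  forall (phi : R -> 'rV[R]_d -> R) (t : R) (x : 'rV[R]_d),
    C12 phi -> 0 <= t < T -> touches_below T u phi t x ->
    bellman_at E u phi t x <= 0.

Definition bounded_viscosity_solution (R : realType) (d d1 : nat) (A : Type)
    (T : R) (E : bellman_data R d d1 A) (u : R -> 'rV[R]_d -> R) : Prop :=
  [/\ bounded_upto T u,
      {within `[0, T] `*` [set: 'rV[R]_d],
         continuous (fun z : R * 'rV[R]_d => u z.1 z.2)},
      viscosity_sub T E u,
      viscosity_super T E u
    & forall x : 'rV[R]_d, u T x = g_ E x].

(* Main.v *)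
(* The scheme is monotone, so everything rests on comparison with well-chosen
   super- and subsolutions.  A Bernstein-type argument bounds the dependence of v_h on the
   coefficients by eps when they move by eps, uniformly in h; applied to translated data it
   gives a Lipschitz bound in x.  Let the controls also choose a small displacement of x in
   the coefficients ("shaking"): the solution moves by O(eps), and each of its translates
   by less than eps is a supersolution for the original coefficients, hence so is any
   average of translates.  Averaging along the directions ell_k and the axes makes it smooth
   with |D^n| = O(eps^(1-n)), and consistency with eps = h^(1/2) yields v <= v_h + N h^(1/2),
   as well as v_h <= v_h' + N h^(1/2) for h' <= h.

   For the lower bound on v no smooth subsolution is available.  For a frozen control,
   however, v is a supersolution of a linear equation, so that -v is a subsolution and the
   upper bound applies to it: v dominates, up to O(h'^(1/2)) per time step, the value U of the
   scheme with mesh h' and controls that are switched only at times of a grid of step tau.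
   Shaking and averaging U and expanding over one time step gives
   v_h' <= U + O(eps) + C(eps) tau^(1/2), uniformly in h'.  Letting h', tau and eps tend to
   zero in this order, v >= limsup v_h' >= v_h - N h^(1/2).

   When the discount is large it absorbs the exponential growth in T of these estimates. *)

Require Import Defs.
From HB Require Import structures.
From mathcomp Require Import all_boot all_order all_algebra.
From mathcomp Require Import all_classical all_reals all_analysis.
From mathcomp Require Import ring lra.

Set Implicit Arguments.
Unset Strict Implicit.
Unset Printing Implicit Defensive.

Import Order.TTheory GRing.Theory Num.Theory.
Import numFieldNormedType.Exports.

Local Open Scope classical_set_scope.
Local Open Scope ring_scope.


(** * One-sided calculus and comparison for the scheme *)

(** Convexity of [F] decides what may be averaged. A supersolution satisfies the linear inequality
    of every control, and so do its averages. A subsolution satisfies it with a control that depends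
    on the point, which averaging destroys. Hence supersolutions are smoothed throughout and
    subsolutions never; only after one control is frozen is the equation linear, so that signs may
    be reversed.

    The obstacle in the Bernstein argument is that differences of coefficients multiply second
    differences of [u], for which no bound is known. The negative parts of [(v - u) / eps] and of
    the quotients of [u] along all directions are estimated together, as one sum of squares and with
    a single control, nearly optimal for [u]. The symmetry of the directions serves twice: it turns
    bounds on negative parts into bounds on absolute values, and it writes each second difference of
    [u] as a sum of increments of members of the family, which the convexity of the square absorbs.

    Both assertions about the constant come from one argument with a parameter [theta], which splits
    every error between growth in time and the discount. *)

Section euclidean_norm.
Context {R : realType} {d : nat}.
Implicit Types x y : 'rV[R]_d.

Lemma enorm_ge0 x : 0 <= enorm x. Proof. exact: sqrtr_ge0. Qed.

Lemma enorm_sqr x : enorm x ^+ 2 = \sum_i x ord0 i ^+ 2.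
Proof. by rewrite sqr_sqrtr// sumr_ge0// => i _; exact: sqr_ge0. Qed.

Lemma enorm0 : enorm (0 : 'rV[R]_d) = 0.
Proof.
by rewrite /enorm big1 ?sqrtr0// => i _; rewrite mxE expr0n.
Qed.

Lemma enormZ a x : enorm (a *: x) = `|a| * enorm x.
Proof.
rewrite /enorm -sqrtr_sqr -sqrtrM ?sqr_ge0// mulr_sumr; congr Num.sqrt.
by apply: eq_bigr => i _; rewrite mxE exprMn.
Qed.

Lemma enormN x : enorm (- x) = enorm x.
Proof. by rewrite -scaleN1r enormZ normrN1 mul1r. Qed.

Lemma coord_le_enorm x i : `|x ord0 i| <= enorm x.
Proof.
rewrite -sqrtr_sqr ler_wsqrtr// (bigD1 i)//= lerDl sumr_ge0// => j _.
exact: sqr_ge0.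
Qed.

Lemma enorm_dot x y : \sum_i x ord0 i * y ord0 i <= enorm x * enorm y.
Proof.
have [x0|x0] := eqVneq (enorm x) 0.
  rewrite x0 mul0r big1// => i _; have := coord_le_enorm x i.
  by rewrite x0 normr_le0 => /eqP ->; rewrite mul0r.
have [y0|y0] := eqVneq (enorm y) 0.
  rewrite y0 mulr0 big1// => i _; have := coord_le_enorm y i.
  by rewrite y0 normr_le0 => /eqP ->; rewrite mulr0.
have xp : 0 < enorm x by rewrite lt_def x0 enorm_ge0.
have yp : 0 < enorm y by rewrite lt_def y0 enorm_ge0.
have : 0 <= \sum_i (enorm y * x ord0 i - enorm x * y ord0 i) ^+ 2.
  by apply: sumr_ge0 => i _; exact: sqr_ge0.
rewrite (_ : \sum_i _ = enorm y ^+ 2 * (\sum_i x ord0 i ^+ 2)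
    + enorm x ^+ 2 * (\sum_i y ord0 i ^+ 2)
    - 2 * enorm x * enorm y * \sum_i x ord0 i * y ord0 i); last first.
  rewrite !mulr_sumr -big_split/= -sumrB; apply: eq_bigr => i _.
  by rewrite sqrrB; ring.
rewrite -!enorm_sqr => H.
have xy : 0 < 2 * (enorm x * enorm y) by rewrite !mulr_gt0.
rewrite -(ler_pM2l xy); lra.
Qed.

Lemma ler_enormD x y : enorm (x + y) <= enorm x + enorm y.
Proof.
rewrite -(ler_pXn2r (n := 2))// ?nnegrE ?addr_ge0 ?enorm_ge0//.
rewrite enorm_sqr sqrrD !enorm_sqr.
rewrite (_ : \sum_i _ = \sum_i x ord0 i ^+ 2 + (\sum_i x ord0 i * y ord0 i) *+ 2
    + \sum_i y ord0 i ^+ 2).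
  by rewrite lerD2r lerD2l lerMn2r enorm_dot.
rewrite -sumrMnl -!big_split/=; apply: eq_bigr => i _.
by rewrite mxE sqrrD.
Qed.

Lemma coord_le_mxnorm x i : `|x ord0 i| <= `|x|.
Proof. by rewrite [`|x|]mx_normrE (le_bigmax _ (fun i => `|x i.1 i.2|) (ord0, i)). Qed.

(** The crude factor [d] is enough for passing from Euclidean Lipschitz bounds to continuity in the
    sup-norm topology. *)
Lemma enorm_le_norm x : enorm x <= d%:R * `|x|.
Proof.
have H : enorm x ^+ 2 <= (d%:R * `|x|) ^+ 2.
  rewrite enorm_sqr (@le_trans _ _ (\sum_(i < d) `|x| ^+ 2))//.
    apply: ler_sum => i _; rewrite -real_normK ?num_real// ler_pXn2r ?nnegrE//.
    exact: coord_le_mxnorm.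
  rewrite sumr_const card_ord exprMn -[X in X <= _]mulr_natl ler_wpM2r ?sqr_ge0//.
  by rewrite -natrX ler_nat; case: (d) => // n; rewrite expnS expn1 leq_pmulr.
by rewrite -(ler_pXn2r (n := 2)) ?nnegrE ?enorm_ge0// mulr_ge0.
Qed.

End euclidean_norm.

Section time_calculus.
Context {R : realType}.

Lemma half_gt0 (e : R) : 0 < e -> 0 < e / 2.
Proof. by move=> e0; rewrite divr_gt0. Qed.

Lemma eq_ler (p q : R) : p = q -> p <= q. Proof. by move->. Qed.

Implicit Types (a b t : R) (y z : R -> R).

(* Differentiability relative to [a, b], so one-sided at the end points. *)
Definition der_on a b y t l : Prop :=
  forall e : R, 0 < e -> exists2 r : R, 0 < r &
    forall s, a <= s <= b -> `|s - t| < r ->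
      `|y s - y t - l * (s - t)| <= e * `|s - t|.

Lemma der_on_sub a b a' b' y t l : a <= a' -> b' <= b ->
  der_on a b y t l -> der_on a' b' y t l.
Proof.
move=> aa bb H e e0; have [r r0 Hr] := H e e0; exists r => // s /andP[h1 h2].
by apply: Hr; rewrite (le_trans aa h1) (le_trans h2 bb).
Qed.

Lemma der_onD a b y z t l m : der_on a b y t l -> der_on a b z t m ->
  der_on a b (fun s => y s + z s) t (l + m).
Proof.
move=> H1 H2 e e0.
have [r r0 Hr] := H1 (e / 2) (half_gt0 e0).
have [q q0 Hq] := H2 (e / 2) (half_gt0 e0).
exists (Num.min r q); first by rewrite lt_min r0.
move=> s sab; rewrite lt_min => /andP[sr sq].
have := Hr s sab sr; have := Hq s sab sq => A B.
rewrite (_ : _ - _ = (y s - y t - l * (s - t)) + (z s - z t - m * (s - t)));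
  last by ring.
by rewrite (le_trans (ler_normD _ _))// [e]splitr mulrDl lerD.
Qed.

Lemma der_onZ a b y t l c : der_on a b y t l ->
  der_on a b (fun s => c * y s) t (c * l).
Proof.
move=> H e e0.
have c0 : 0 < `|c| + 1 by rewrite ltr_wpDl.
have [r r0 Hr] := H (e / (`|c| + 1)) (divr_gt0 e0 c0).
exists r => // s sab sr; have {}Hr := Hr s sab sr.
rewrite (_ : _ - _ = c * (y s - y t - l * (s - t))); last by ring.
rewrite normrM (le_trans (ler_wpM2l _ Hr))// mulrA ler_wpM2r//.
by rewrite mulrCA ler_piMr ?(ltW e0)// ler_pdivrMr// mul1r lerDl.
Qed.

Lemma der_on_cst a b c t : der_on a b (fun=> c) t 0.
Proof.
by move=> e e0; exists 1 => // s _ _; rewrite subrr mul0r subr0 normr0 mulr_ge0// ltW.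
Qed.

Lemma der_on_id a b t : der_on a b id t 1.
Proof.
by move=> e e0; exists 1 => // s _ _; rewrite mul1r subrr normr0 mulr_ge0// ltW.
Qed.

Lemma der_onN a b y t l : der_on a b y t l -> der_on a b (fun s => - y s) t (- l).
Proof.
move=> H; have := der_onZ (-1) H; rewrite mulN1r.
by under eq_fun do rewrite mulN1r.
Qed.

Lemma der_onB a b y z t l m : der_on a b y t l -> der_on a b z t m ->
  der_on a b (fun s => y s - z s) t (l - m).
Proof. by move=> H1 H2; exact: der_onD H1 (der_onN H2). Qed.

Lemma der_on_sum a b (I : Type) (r : seq I) (F : I -> R -> R) (l : I -> R) t :
  (forall i, der_on a b (F i) t (l i)) ->
  der_on a b (fun s => \sum_(i <- r) F i s) t (\sum_(i <- r) l i).
Proof.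
move=> H; elim: r => [|i r IH].
  by under eq_fun do rewrite big_nil; rewrite big_nil; exact: der_on_cst.
by under eq_fun do rewrite big_cons; rewrite big_cons; exact: der_onD.
Qed.

(** Maximality is asked only to the right of [t], so that the initial time is covered; this is why
    only a sign of [l] results. *)
Lemma der_on_max a b y t l : a <= t < b -> der_on a b y t l ->
  (forall s, t <= s <= b -> y s <= y t) -> l <= 0.
Proof.
move=> /andP[at_ tb] H M; rewrite leNgt; apply/negP => l0.
have [r r0 Hr] := H (l / 2) (half_gt0 l0).
pose s := t + Num.min (r / 2) (b - t).
have m0 : 0 < Num.min (r / 2) (b - t) by rewrite lt_min divr_gt0//= subr_gt0.
have st : s - t = Num.min (r / 2) (b - t) by rewrite /s; ring.
have sb : t <= s <= b.
  rewrite /s lerDl (ltW m0)/= -lerBrDl ge_min lexx orbT//.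
have sab : a <= s <= b by case/andP: sb => h1 h2; rewrite h2 (le_trans at_ h1).
have := Hr s sab; rewrite st gtr0_norm// => {}Hr.
have : Num.min (r / 2) (b - t) < r.
  by rewrite gt_min ltr_pdivrMr// ltr_pMr// ltr1n.
move=> /Hr; have := M s sb => Ms.
have : 0 < l * Num.min (r / 2) (b - t) by rewrite mulr_gt0.
rewrite ler_norml => h1 /andP[h2 h3]; lra.
Qed.

(* The supremum over space need not be attained, but near-maximality in space
   costs nothing when only difference quotients with a fixed step occur. *)
Lemma near_max (S : Type) (x1 : S) a b (Phi : R -> S -> R) :
  a <= b -> (forall x, {within `[a, b], continuous (fun t => Phi t x)}) ->
  (exists M, forall t x, a <= t <= b -> Phi t x <= M) ->
  forall e, 0 < e -> exists t0 x0, [/\ a <= t0 <= b,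
    forall t, a <= t <= b -> Phi t x0 <= Phi t0 x0 &
    forall t x, a <= t <= b -> Phi t x <= Phi t0 x0 + e].
Proof.
move=> ab cont [M HM] e e0.
pose V := [set z | exists t x, a <= t <= b /\ z = Phi t x].
have supV : has_sup V.
  split; first by exists (Phi a x1), a, x1; rewrite lexx.
  by exists M => _ [t [x [tab ->]]]; exact: HM.
(* The point [x0] is chosen first, as nearly optimal at some time; the exact maximum in time is then
   taken over the fixed [x0], so that the condition on the time derivative carries no error. *)
have [_ [t' [x0 [t'ab ->]]] He] := sup_adherent e0 supV.
have [t0 t0ab Ht0] := EVT_max ab (cont x0).
have t0ab' : a <= t0 <= b by move: t0ab; rewrite in_itv.
have HM0 t : a <= t <= b -> Phi t x0 <= Phi t0 x0.
  by move=> tab; apply: Ht0; rewrite in_itv.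
exists t0, x0; split => // t x tab.
have : Phi t x <= sup V.
  by apply: ub_le_sup; [case: supV|exists t, x].
have := HM0 _ t'ab; lra.
Qed.

End time_calculus.

Section scheme.
Context {R : realType} {d d1 : nat}.
Implicit Types (x y l : 'rV[R]_d) (p q : 'rV[R]_d -> R) (h : R).

Definition fd1 h l p x : R := (p (x + h *: l) - p x) / h.
Definition fd2 h l p x : R := (p (x + h *: l) - 2 * p x + p (x - h *: l)) / h ^+ 2.

Definition coef (K : R) (psi : R -> 'rV[R]_d -> R) : Prop :=
  [/\ forall t x, `|psi t x| <= K,
      forall t x y, `|psi t x - psi t y| <= K * enorm (x - y) &
      holder_half K psi].

(** The hypotheses in the form used throughout: bounds hold at every real time and the control set
    is a bare type, which makes the class stable under translating, shaking and freezing
    controls. *)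
Record good (A : Type) (K lambda : R) (E : bellman_data R d d1 A) : Prop := {
  good_ell_opp : forall k, ell_ E k = - ell_ E (Defs.dopp k);
  good_ell : forall k, enorm (ell_ E k) <= K;
  good_sigma_opp : forall alpha k t x,
    sigma_ E alpha k t x = sigma_ E alpha (Defs.dopp k) t x;
  good_b_ge0 : forall alpha k t x, 0 <= b_ E alpha k t x;
  good_c_ge : forall alpha t x, lambda <= c_ E alpha t x;
  good_sigma : forall alpha k, coef K (sigma_ E alpha k);
  good_b : forall alpha k, coef K (b_ E alpha k);
  good_c : forall alpha, coef K (fun t x => c_ E alpha t x - lambda);
  good_f : forall alpha, coef K (f_ E alpha);
  good_g : coef K (fun=> g_ E) }.

Section operator.
Context {A : Type} (E : bellman_data R d d1 A) (h : R).

Definition Lin (alpha : A) t p x : R :=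
  \sum_k a_ E alpha k t x * fd2 h (ell_ E k) p x +
  \sum_k b_ E alpha k t x * fd1 h (ell_ E k) p x - c_ E alpha t x * p x.

Definition Lop (alpha : A) t p x : R := Lin alpha t p x + f_ E alpha t x.

Lemma LinD alpha t p q x :
  Lin alpha t (fun y => p y + q y) x = Lin alpha t p x + Lin alpha t q x.
Proof.
rewrite /Lin mulrDr opprD !addrA.
rewrite [X in X + _ - _ - _](_ : _ = \sum_k a_ E alpha k t x * fd2 h (ell_ E k) p x +
  \sum_k a_ E alpha k t x * fd2 h (ell_ E k) q x); last first.
  by rewrite -big_split/=; apply: eq_bigr => k _; rewrite /fd2; ring.
rewrite [X in _ + X - _ - _](_ : _ = \sum_k b_ E alpha k t x * fd1 h (ell_ E k) p x +
  \sum_k b_ E alpha k t x * fd1 h (ell_ E k) q x); last first.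
  by rewrite -big_split/=; apply: eq_bigr => k _; rewrite /fd1; ring.
ring.
Qed.

Lemma LinZ alpha t c p x : Lin alpha t (fun y => c * p y) x = c * Lin alpha t p x.
Proof.
rewrite /Lin mulrBr mulrDr !mulr_sumr mulrCA; congr (_ + _ - _); apply: eq_bigr => k _.
  by rewrite /fd2; ring.
by rewrite /fd1; ring.
Qed.

Lemma LinN alpha t p x : Lin alpha t (fun y => - p y) x = - Lin alpha t p x.
Proof. by under eq_fun do rewrite -mulN1r; rewrite LinZ mulN1r. Qed.

Lemma LinB alpha t p q x :
  Lin alpha t (fun y => p y - q y) x = Lin alpha t p x - Lin alpha t q x.
Proof. by rewrite LinD LinN. Qed.

Lemma Lin_cst alpha t c x : Lin alpha t (fun=> c) x = - c_ E alpha t x * c.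
Proof.
rewrite /Lin !big1 ?addr0 ?add0r ?mulNr// => k _; rewrite ?/fd1 ?/fd2.
  by rewrite subrr mul0r mulr0.
by rewrite (_ : c - 2 * c + c = 0) ?mul0r ?mulr0//; ring.
Qed.

Definition Ch (K : R) : R := d1.*2%:R * (K ^+ 2 / h ^+ 2 + K / h).

Lemma a_ge0 alpha k t x : 0 <= a_ E alpha k t x.
Proof. by rewrite /a_ mulr_ge0// sqr_ge0. Qed.

Lemma card_dindex : #|dindex d1| = d1.*2.
Proof. by rewrite card_prod card_bool card_ord mul2n. Qed.

Lemma a_le K lambda alpha k t x : good K lambda E -> a_ E alpha k t x <= K ^+ 2 / 2.
Proof.
move=> G; have [/(_ t x) H _ _] := good_sigma G alpha k.
have K0 : 0 <= K by rewrite (le_trans _ H).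
rewrite /a_ mulrC ler_pM2r// -real_normK ?num_real// ler_pXn2r ?nnegrE//.
Qed.

(** Discrete maximum principle with a defect: at a point maximal up to [e], second differences are
    at most [2 * e / h ^+ 2] and first ones at most [e / h]. The sign of [p x] lets the lower bound
    [lambda] replace the coefficient [c]. *)
Lemma Lin_near_max K lambda alpha t p x e : good K lambda E -> 0 < h ->
  0 <= p x -> 0 <= e -> (forall y, p y <= p x + e) ->
  Lin alpha t p x <= e * Ch K - lambda * p x.
Proof.
move=> G h0 px e0 pe.
have cl : - (c_ E alpha t x * p x) <= - (lambda * p x).
  by rewrite lerN2 ler_wpM2r// (good_c_ge G).
apply: lerD => //.
rewrite /Ch (_ : e * _ = \sum_(k : dindex d1) (e * (K ^+ 2 / h ^+ 2)) +
                         \sum_(k : dindex d1) (e * (K / h))); last first.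
  by rewrite !sumr_const card_dindex -!mulrnDl -mulrDr -mulr_natl; ring.
apply: lerD; apply: ler_sum => k _.
- have a0 := a_ge0 alpha k t x; have aK := a_le alpha k t x G.
  have : fd2 h (ell_ E k) p x <= 2 * e / h ^+ 2.
    rewrite /fd2 ler_wpM2r ?invr_ge0 ?sqr_ge0//.
    by have := pe (x + h *: ell_ E k); have := pe (x - h *: ell_ E k); lra.
  move=> /(ler_wpM2l a0)/le_trans; apply.
  have e2 : 0 <= 2 * e / h ^+ 2 by rewrite divr_ge0 ?sqr_ge0// mulr_ge0.
  apply: le_trans (ler_wpM2r e2 aK) _; apply: eq_ler.
  by field; rewrite gt_eqF.
- have b0 := good_b_ge0 G alpha k t x.
  have bK : b_ E alpha k t x <= K.
    by have [/(_ t x) + _ _] := good_b G alpha k; exact/le_trans/ler_norm.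
  have : fd1 h (ell_ E k) p x <= e / h.
    rewrite /fd1 ler_wpM2r ?invr_ge0 ?(ltW h0)//.
    by have := pe (x + h *: ell_ E k); lra.
  move=> /(ler_wpM2l b0)/le_trans; apply.
  have e2 : 0 <= e / h by rewrite divr_ge0// ltW.
  by rewrite (le_trans (ler_wpM2r e2 bK))// mulrCA.
Qed.

Definition evol a b (u ut : R -> 'rV[R]_d -> R) : Prop :=
  (forall x, {within `[a, b], continuous (fun t => u t x)}) /\
  (forall t x, a <= t < b -> der_on a b (fun s => u s x) t (ut t x)).

(** The supremum over controls is unfolded: a nearly optimal control at each point for a
    subsolution, the inequality of every control for a supersolution. Supersolutions can then be
    translated and averaged directly, and no default value of [sup] on unbounded sets intervenes. *)
Definition subsol a b (u ut : R -> 'rV[R]_d -> R) : Prop :=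
  evol a b u ut /\ forall t x e, a <= t < b -> 0 < e ->
    exists alpha, - e <= ut t x + Lop alpha t (u t) x.

Definition supersol a b e (u ut : R -> 'rV[R]_d -> R) : Prop :=
  evol a b u ut /\ forall t x alpha, a <= t < b ->
    ut t x + Lop alpha t (u t) x <= e.

(** An excess [e] of the supersolution is paid either by the slope [nu] in time or by the discount
    acting on a difference of at least [beta]. The strict case is settled at a near-maximum of
    [u - v - mu * (b - t)]; the general one follows by enlarging [nu]. *)
Lemma comparison K lambda a b e beta nu u ut v vt :
  good K lambda E -> 0 <= lambda -> 0 < h -> a <= b -> subsol a b u ut -> supersol a b e v vt ->
  (exists M, forall t x, a <= t <= b -> u t x - v t x <= M) ->
  0 <= beta -> 0 <= nu -> e <= nu + lambda * beta ->
  (forall x, u b x - v b x <= beta) ->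
  forall t x, a <= t <= b -> u t x - v t x <= beta + nu * (b - t).
Proof.
move=> G lam0 h0 ab [[cu du] su] [[cv dv] sv] [M HM] be0 nu0 enu term.
have strict mu : 0 <= mu -> e < mu + lambda * beta ->
    forall t x, a <= t <= b -> u t x - v t x <= beta + mu * (b - t).
  move=> mu0 gap t1 x1 t1ab; rewrite leNgt; apply/negP => viol.
  pose Phi t x := u t x - v t x - mu * (b - t).
  have cPhi x : {within `[a, b], continuous (fun t => Phi t x)}.
    move=> t; apply: cvgB; first by apply: cvgB; [exact: cu|exact: cv].
    apply: cvgM; first exact: cvg_cst.
    apply: cvgB; first exact: cvg_cst.
    by apply: continuous_subspaceT => // z; exact: cvg_id.
  have K0 : 0 <= K.
    have [/(_ 0 0) H _ _] := good_g G; exact: le_trans H.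
  have C0 : 0 <= Ch K.
    by rewrite /Ch mulr_ge0// addr_ge0 ?divr_ge0 ?sqr_ge0 ?(ltW h0).
  pose g := mu + lambda * beta - e.
  have g0 : 0 < g by rewrite /g subr_gt0.
  pose g1 := Phi t1 x1 - beta.
  have g10 : 0 < g1 by rewrite /g1 /Phi; lra.
  (* The first bound keeps the near-maximum above [beta], hence away from the terminal time. The
     second makes the total loss [eta * (Ch K + 1)], from near-maximality and from the nearly
     optimal control, at most half of the gap [g]. *)
  pose eta := Num.min (g1 / 2) (g / (2 * (Ch K + 1))).
  have eta0 : 0 < eta.
    by rewrite lt_min !divr_gt0// mulr_gt0// ltr_wpDl.
  have bPhi : exists M, forall t x, a <= t <= b -> Phi t x <= M.
    exists M => t x tab; have := HM t x tab; rewrite /Phi.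
    have : 0 <= mu * (b - t) by rewrite mulr_ge0// subr_ge0; case/andP: tab.
    lra.
  have [t0 [x0 [t0ab tmax xmax]]] := near_max x1 ab cPhi bPhi eta0.
  have Phi0 : beta < Phi t0 x0.
    have := xmax t1 x1 t1ab; have : eta <= g1 / 2 by rewrite ge_min lexx.
    rewrite /g1; lra.
  have [t0b|tneb] := eqVneq t0 b.
    by have := term x0; move: Phi0; rewrite /Phi t0b; lra.
  case/andP: t0ab => at0 t0b; have t0b' : a <= t0 < b by rewrite at0 lt_neqAle tneb.
  have D : ut t0 x0 - vt t0 x0 + mu <= 0.
    apply: (der_on_max t0b'); last by move=> s /andP[h1 h2]; apply: tmax; rewrite h2 (le_trans at0 h1).
    rewrite (_ : mu = - (mu * (0 - 1))); last by ring.
    apply: der_onB; first by apply: der_onB; [exact: du|exact: dv].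
    by apply: der_onZ; apply: der_onB; [exact: der_on_cst|exact: der_on_id].
  have [alpha Ha] := su t0 x0 eta t0b' eta0.
  have Hv := sv t0 x0 alpha t0b'.
  have nu_t0 : 0 <= mu * (b - t0) by rewrite mulr_ge0// subr_ge0.
  have w0 : beta <= u t0 x0 - v t0 x0 by move: Phi0; rewrite /Phi; lra.
  have near y : u t0 y - v t0 y <= u t0 x0 - v t0 x0 + eta.
    by have := xmax t0 y; rewrite at0 t0b /Phi => /(_ isT); lra.
  have := @Lin_near_max K lambda alpha t0 (fun y => u t0 y - v t0 y) x0 eta G h0
    (le_trans be0 w0) (ltW eta0) near.
  rewrite LinB => Hlin.
  have l0 : lambda * beta <= lambda * (u t0 x0 - v t0 x0).
    by rewrite ler_wpM2l.
  have : eta * (Ch K + 1) <= g / 2.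
    have : eta <= g / (2 * (Ch K + 1)) by rewrite ge_min lexx orbT.
    have C1 : 0 < Ch K + 1 by rewrite ltr_wpDl.
    move=> /(ler_wpM2r (ltW C1))/le_trans; apply.
    by apply: eq_ler; field; rewrite gt_eqF// ltr_wpDl.
  move: Ha Hv; rewrite /Lop /g; lra.
move=> t x tab; apply/ler_addgt0Pr => r r0.
have bt : 0 <= b - t by rewrite subr_ge0; case/andP: tab.
(* The denominator makes the additional term at time [t] at most [r]. *)
pose mu := nu + r / (b - t + 1).
have H : nu < mu by rewrite ltrDl divr_gt0// ltr_wpDl.
have emu : e < mu + lambda * beta by apply: le_lt_trans enu _; rewrite ltrD2r.
have := strict mu (le_trans nu0 (ltW H)) emu t x tab.
move=> /le_trans; apply; rewrite -addrA lerD2l /mu mulrDl lerD2l.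
rewrite mulrAC ler_pdivrMr ?ltr_wpDl// ler_pM2l// lerDl//.
Qed.

End operator.
End scheme.

(** * Continuous dependence by the Bernstein method *)

Section bernstein_algebra.
Context {R : realType}.
Implicit Types r w z S : R.

Definition negp r : R := Num.max 0 (- r).

Lemma negp_ge0 r : 0 <= negp r. Proof. by rewrite /negp le_max lexx. Qed.

Lemma negp_ge r : - r <= negp r. Proof. by rewrite /negp le_max lexx orbT. Qed.

Lemma negpE r : negp (- r) - negp r = r.
Proof.
rewrite /negp opprK; have [r0|r0] := leP 0 r.
  by rewrite (max_idPl _) ?oppr_le0// subr0.
by rewrite (max_idPr _) ?oppr_ge0 ?ltW// sub0r opprK.
Qed.

Lemma negp_mul r : negp r * r = - negp r ^+ 2.
Proof.
rewrite /negp; have [r0|r0] := leP 0 r.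
  by rewrite (max_idPl _) ?oppr_le0// mul0r expr0n oppr0.
by rewrite (max_idPr _) ?oppr_ge0 ?ltW// expr2; ring.
Qed.

(* The squared gain on the right is what absorbs the second differences of u. *)
Lemma negp_sqr_convex w0 w :
  (negp w - negp w0) ^+ 2 - (negp w ^+ 2 - negp w0 ^+ 2) <=
  2 * (negp w0 * (w - w0)).
Proof.
rewrite (_ : (negp w - negp w0) ^+ 2 - _ = 2 * negp w0 ^+ 2 - 2 * (negp w0 * negp w));
  last by ring.
rewrite mulrBr negp_mul.
have : negp w0 * (- w) <= negp w0 * negp w by rewrite ler_wpM2l ?negp_ge0 ?negp_ge.
lra.
Qed.

Lemma ler_mul_norm z S x m : 0 <= z -> z <= S -> `|x| <= m -> - (S * m) <= z * x.
Proof.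
move=> z0 zS xm; have m0 : 0 <= m by apply: le_trans xm.
have : z * `|x| <= S * m by apply: ler_pM.
have : z * (- x) <= z * `|x| by rewrite ler_wpM2l// -normrN ler_norm.
lra.
Qed.

Lemma young r s : 2 * (r * s) <= r ^+ 2 + s ^+ 2.
Proof. have := sqr_ge0 (r - s); rewrite sqrrB; lra. Qed.

(** In the application [r = sigma / h], [r'] is its perturbation, [rho = h / ep j] and [X] is [h]
    times a second difference of [u]. Part of the squared gain of [negp_sqr_convex] survives with
    weight [1/8]; the term with [|r| * |X|] stays on the left because it can be absorbed only after
    summing over the family. *)
Lemma second_order_term r r' rho m S X w0 wp wm :
  0 <= m -> 1 <= rho -> `|r' - r| * rho <= m -> `|X| <= 2 * S ->
  negp w0 <= S -> negp wp <= S -> negp wm <= S ->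
  2^-1 * r ^+ 2 * - (negp wp ^+ 2 - 2 * negp w0 ^+ 2 + negp wm ^+ 2)
  + 8^-1 * r ^+ 2 * ((negp wp - negp w0) ^+ 2 + (negp wm - negp w0) ^+ 2)
  - 23 * (m * S) ^+ 2 - 2 * (S * (m * (`|r| * `|X|)))
  <= 2 * (negp w0 * (2^-1 * r' ^+ 2 * (wp - 2 * w0 + wm)
                     + 2^-1 * (r' ^+ 2 - r ^+ 2) * rho * X)).
Proof.
move=> m0 rho1 hr hX.
have := negp_sqr_convex w0 wp; have := negp_sqr_convex w0 wm.
have := negp_ge0 w0; have := negp_ge0 wp; have := negp_ge0 wm.
move: (negp w0) (negp wp) (negp wm) => z0 zp zm zm0 zp0 z00 cm cp z0S zpS zmS.
set P := zp - z0; set Q := zm - z0.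
have S0 : 0 <= S by apply: le_trans z0S.
have rm : `|r' - r| <= m.
  by apply: le_trans hr; rewrite ler_peMr.
have PS : `|P| <= S by rewrite ler_norml /P; lra.
have QS : `|Q| <= S by rewrite ler_norml /Q; lra.
set de := 2^-1 * (r' ^+ 2 - r ^+ 2).
have deE : de = r * (r' - r) + 2^-1 * (r' - r) ^+ 2 by rewrite /de; field.
have d2 : (r' - r) ^+ 2 = `|r' - r| * `|r' - r| by rewrite -expr2 real_normK ?num_real.
have de1 : `|de| <= m * `|r| + 2^-1 * m ^+ 2.
  rewrite deE (le_trans (ler_normD _ _))// normrM mulrC lerD//.
    by rewrite ler_wpM2r.
  rewrite ger0_norm; last by rewrite mulr_ge0 ?invr_ge0 ?sqr_ge0.
  rewrite ler_wpM2l// d2 expr2.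
  by apply: ler_pM.
have de2 : `|de * rho| <= m * `|r| + 2^-1 * m ^+ 2.
  rewrite normrM (ger0_norm (le_trans ler01 rho1)).
  rewrite (le_trans (y := (`|r| * `|r' - r| + 2^-1 * (`|r' - r| * `|r' - r|)) * rho))//.
    rewrite ler_wpM2r ?(le_trans ler01)// deE (le_trans (ler_normD _ _))//.
    rewrite normrM lerD2l ger0_norm; last by rewrite mulr_ge0 ?invr_ge0 ?sqr_ge0.
    by rewrite d2.
  rewrite mulrDl -!mulrA lerD//; first by rewrite mulrC ler_wpM2r.
  by rewrite ler_wpM2l ?invr_ge0// expr2; apply: ler_pM => //; rewrite mulr_ge0// (le_trans ler01).
have sq (x : R) : x ^+ 2 = `|x| ^+ 2 by rewrite real_normK ?num_real.
have main : 2^-1 * r' ^+ 2 * ((P ^+ 2 - (zp ^+ 2 - z0 ^+ 2)) + (Q ^+ 2 - (zm ^+ 2 - z0 ^+ 2)))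
    <= 2^-1 * r' ^+ 2 * (2 * (z0 * (wp - w0)) + 2 * (z0 * (wm - w0))).
  apply: ler_wpM2l; first by rewrite mulr_ge0 ?invr_ge0 ?sqr_ge0.
  exact: lerD.
have tX : - (S * ((m * `|r| + 2^-1 * m ^+ 2) * `|X|)) <= z0 * (de * rho * X).
  by apply: ler_mul_norm => //; rewrite normrM ler_wpM2r.
have dW w z : w ^+ 2 - z ^+ 2 = (w - z) * (w + z) by ring.
have tP : - ((m * `|r| + 2^-1 * m ^+ 2) * (`|P| * (2 * S))) <= de * - (zp ^+ 2 - z0 ^+ 2).
  rewrite -[X in _ <= X]opprK lerN2 -mulrN opprK dW.
  apply: le_trans (ler_norm _) _; rewrite normrM.
  apply: ler_pM => //; rewrite normrM ler_wpM2l// ger0_norm ?addr_ge0//; lra.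
have tQ : - ((m * `|r| + 2^-1 * m ^+ 2) * (`|Q| * (2 * S))) <= de * - (zm ^+ 2 - z0 ^+ 2).
  rewrite -[X in _ <= X]opprK lerN2 -mulrN opprK dW.
  apply: le_trans (ler_norm _) _; rewrite normrM.
  apply: ler_pM => //; rewrite normrM ler_wpM2l// ger0_norm ?addr_ge0//; lra.
(* The gain comes with the perturbed coefficient [r'], which varies over the family; it is measured
   here by the common [r], at the cost of [m ^+ 2]. *)
have rr : 4^-1 * r ^+ 2 - 2^-1 * m ^+ 2 <= 2^-1 * r' ^+ 2.
  have : (r' - r) ^+ 2 <= m ^+ 2 by rewrite d2 expr2; apply: ler_pM.
  have := sqr_ge0 (r' + (r' - r)).
  have -> : (r' + (r' - r)) ^+ 2 = 2 * r' ^+ 2 + 2 * (r' - r) ^+ 2 - r ^+ 2 by ring.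
  lra.
have D0 : 0 <= P ^+ 2 + Q ^+ 2 by rewrite addr_ge0 ?sqr_ge0.
have {}rr := ler_wpM2r D0 rr.
have PS2 : P ^+ 2 <= S ^+ 2 by rewrite sq ler_pXn2r ?nnegrE.
have QS2 : Q ^+ 2 <= S ^+ 2 by rewrite sq ler_pXn2r ?nnegrE.
have m2 : 0 <= m ^+ 2 by rewrite sqr_ge0.
have mD : m ^+ 2 * (P ^+ 2 + Q ^+ 2) <= m ^+ 2 * (S ^+ 2 + S ^+ 2).
  by rewrite ler_wpM2l// lerD.
(* These weights use up [1/9] of the available [1/4], which leaves at least [1/8]. The constant 23
   is made of 18 from the two Young inequalities, 2 from the quadratic parts of [tP] and [tQ], 2
   from that of [tX], and 1 from [rr]. *)
have yP := young (3^-1 * (`|r| * `|P|)) (3 * (m * S)).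
have yQ := young (3^-1 * (`|r| * `|Q|)) (3 * (m * S)).
have mSP : m ^+ 2 * S * `|P| <= m ^+ 2 * S * S by rewrite ler_wpM2l// mulr_ge0.
have mSQ : m ^+ 2 * S * `|Q| <= m ^+ 2 * S * S by rewrite ler_wpM2l// mulr_ge0.
have mSX : m ^+ 2 * S * `|X| <= m ^+ 2 * S * (2 * S) by rewrite ler_wpM2l// mulr_ge0.
have e1 : (3^-1 * (`|r| * `|P|)) ^+ 2 = 9^-1 * (r ^+ 2 * P ^+ 2).
  by rewrite (sq r) (sq P); field.
have e2 : (3^-1 * (`|r| * `|Q|)) ^+ 2 = 9^-1 * (r ^+ 2 * Q ^+ 2).
  by rewrite (sq r) (sq Q); field.
rewrite e1 in yP; rewrite e2 in yQ.
have rP : 0 <= r ^+ 2 * P ^+ 2 by rewrite mulr_ge0 ?sqr_ge0.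
have rQ : 0 <= r ^+ 2 * Q ^+ 2 by rewrite mulr_ge0 ?sqr_ge0.
have rde : 2^-1 * r' ^+ 2 = 2^-1 * r ^+ 2 + de by rewrite /de; ring.
move: main; rewrite (mulrDr (2^-1 * r' ^+ 2)).
have -> : 2^-1 * r' ^+ 2 * (P ^+ 2 - (zp ^+ 2 - z0 ^+ 2)) +
  2^-1 * r' ^+ 2 * (Q ^+ 2 - (zm ^+ 2 - z0 ^+ 2)) =
  2^-1 * r' ^+ 2 * (P ^+ 2 + Q ^+ 2) + 2^-1 * r ^+ 2 * - (zp ^+ 2 - 2 * z0 ^+ 2 + zm ^+ 2)
  + de * - (zp ^+ 2 - z0 ^+ 2) + de * - (zm ^+ 2 - z0 ^+ 2).
  by rewrite rde; ring.
lra.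
Qed.

(** Here the quotient [v] of [u] is itself bounded by [S], so no squared gain is called for. Of the
    3, two come from the perturbation acting on [v] and one from replacing [b'] by [b]. *)
Lemma first_order_term b b' rho m S v w0 wp : 
  0 <= m -> 0 <= b' -> 1 <= rho -> `|b' - b| * rho <= m -> `|v| <= S ->
  negp w0 <= S -> negp wp <= S ->
  b * - (negp wp ^+ 2 - negp w0 ^+ 2) - 3 * (m * S ^+ 2)
  <= 2 * (negp w0 * (b' * (wp - w0) + (b' - b) * rho * v)).
Proof.
move=> m0 b'0 rho1 hb hv.
have := negp_sqr_convex w0 wp.
have := negp_ge0 w0; have := negp_ge0 wp.
move: (negp w0) (negp wp) => z0 zp zp0 z00 cp z0S zpS.
have S0 : 0 <= S by apply: le_trans z0S.
have bm : `|b' - b| <= m by apply: le_trans hb; rewrite ler_peMr.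
have {}cp : b' * - (zp ^+ 2 - z0 ^+ 2) <= b' * (2 * (z0 * (wp - w0))).
  by rewrite ler_wpM2l//; apply: le_trans cp; rewrite lerDr sqr_ge0.
have t1 : - (S * (m * S)) <= z0 * ((b' - b) * rho * v).
  apply: ler_mul_norm => //; rewrite !normrM (ger0_norm (le_trans ler01 rho1)).
  by apply: ler_pM => //; rewrite mulr_ge0// (le_trans ler01).
have -> : b * - (zp ^+ 2 - z0 ^+ 2) = b' * - (zp ^+ 2 - z0 ^+ 2) - (b' - b) * - (zp ^+ 2 - z0 ^+ 2).
  by ring.
have t2 : - (m * S ^+ 2) <= (b' - b) * - (zp ^+ 2 - z0 ^+ 2).
  rewrite lerNl -mulrN opprK.
  apply: le_trans (ler_norm _) _; rewrite normrM ler_pM//.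
  have : zp ^+ 2 <= S ^+ 2 by rewrite ler_pXn2r ?nnegrE.
  have : z0 ^+ 2 <= S ^+ 2 by rewrite ler_pXn2r ?nnegrE.
  have := sqr_ge0 zp; have := sqr_ge0 z0; rewrite ler_norml; lra.
lra.
Qed.

End bernstein_algebra.

Section bernstein_sum.
Context {R : realType} {J : finType}.

Lemma sumr_cst (c : R) : \sum_(j : J) c = #|J|%:R * c.
Proof. by rewrite sumr_const mulr_natl. Qed.

(** [X] is a sum of increments of the two members [jA] and [jB], so [X ^+ 2] is at most twice the
    sum of all squared increments. The gain left over in [second_order_term] therefore controls it,
    whatever the size of the second differences. *)
Lemma second_order_sum (w0 wp wm : J -> R) (r : R) (r' rho : J -> R) (m S X : R) (jA jB : J) :
  jA != jB -> 0 <= m -> (forall j, 1 <= rho j) -> (forall j, `|r' j - r| * rho j <= m) ->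
  `|X| <= 2 * S ->
  (forall j, [/\ negp (w0 j) <= S, negp (wp j) <= S & negp (wm j) <= S]) ->
  X = (negp (wp jB) - negp (w0 jB)) + (negp (wm jA) - negp (w0 jA)) ->
  2^-1 * r ^+ 2 * - (\sum_j negp (wp j) ^+ 2 - 2 * \sum_j negp (w0 j) ^+ 2
                     + \sum_j negp (wm j) ^+ 2)
  - (23 * #|J|%:R + 16 * #|J|%:R ^+ 2) * (m * S) ^+ 2
  <= \sum_j 2 * (negp (w0 j) * (2^-1 * r' j ^+ 2 * (wp j - 2 * w0 j + wm j)
                     + 2^-1 * (r' j ^+ 2 - r ^+ 2) * rho j * X)).
Proof.
move=> AB m0 rho1 hr hX hS XE.
have S0 : 0 <= S by have [h1 _ _] := hS jA; rewrite (le_trans _ h1)// negp_ge0.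
pose D j := (negp (wp j) - negp (w0 j)) ^+ 2 + (negp (wm j) - negp (w0 j)) ^+ 2.
set n : R := #|J|%:R.
have D0 j : 0 <= D j by rewrite addr_ge0 ?sqr_ge0.
have DX : X ^+ 2 <= 2 * \sum_j D j.
  rewrite (bigD1 jA)//= (bigD1 jB) 1?eq_sym//= addrA.
  have : 0 <= \sum_(i | (i != jA) && (i != jB)) D i by apply: sumr_ge0.
  rewrite XE /D.
  have := sqr_ge0 ((negp (wp jB) - negp (w0 jB)) - (negp (wm jA) - negp (w0 jA))).
  have := sqr_ge0 (negp (wp jA) - negp (w0 jA)).
  have := sqr_ge0 (negp (wm jB) - negp (w0 jB)).
  rewrite (sqrrB (_ - _) (_ - _)) (sqrrD (_ - _) (_ - _)); lra.
apply: (@le_trans _ _ (\sum_j (2^-1 * r ^+ 2 * - (negp (wp j) ^+ 2 - 2 * negp (w0 j) ^+ 2 + negp (wm j) ^+ 2)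
  + 8^-1 * r ^+ 2 * D j - 23 * (m * S) ^+ 2 - 2 * (S * (m * (`|r| * `|X|)))))); last first.
  apply: ler_sum => j _; have [h1 h2 h3] := hS j.
  exact: second_order_term.
rewrite !sumrB big_split/= !sumr_cst -/n -!mulr_sumr sumrN.
rewrite big_split/= sumrB -mulr_sumr.
(* The weight [1/4] yields [r ^+ 2 * X ^+ 2 / 16], which is exactly what the gain [1/8] covers
   through [DX]; the other half is the origin of [16 * n ^+ 2]. *)
have Y := young (4^-1 * (`|r| * `|X|)) (4 * (n * (m * S))).
have e1 : (4^-1 * (`|r| * `|X|)) ^+ 2 = 16^-1 * (r ^+ 2 * X ^+ 2).
  by rewrite -(real_normK (num_real r)) -(real_normK (num_real X)); field.
rewrite e1 in Y.
clearbody n.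
have rD : r ^+ 2 * X ^+ 2 <= r ^+ 2 * (2 * \sum_j D j) by rewrite ler_wpM2l ?sqr_ge0.
lra.
Qed.

Lemma first_order_sum (w0 wp : J -> R) (c : R) (c' rho : J -> R) (m S X : R) :
  0 <= m -> (forall j, 0 <= c' j) -> (forall j, 1 <= rho j) ->
  (forall j, `|c' j - c| * rho j <= m) -> `|X| <= S ->
  (forall j, negp (w0 j) <= S /\ negp (wp j) <= S) ->
  c * - (\sum_j negp (wp j) ^+ 2 - \sum_j negp (w0 j) ^+ 2) - 3 * #|J|%:R * m * S ^+ 2
  <= \sum_j 2 * (negp (w0 j) * (c' j * (wp j - w0 j) + (c' j - c) * rho j * X)).
Proof.
move=> m0 c0 rho1 hc hX hS.
apply: (@le_trans _ _ (\sum_j (c * - (negp (wp j) ^+ 2 - negp (w0 j) ^+ 2) - 3 * (m * S ^+ 2)))).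
  rewrite sumrB -mulr_sumr sumrN sumrB sumr_cst.
  by apply: eq_ler; ring.
by apply: ler_sum => j _; have [h1 h2] := hS j; exact: first_order_term.
Qed.

End bernstein_sum.

Section shift.
Context {R : realType} {d d1 : nat} {A : Type}.
Implicit Types E : bellman_data R d d1 A.

Definition shiftE (y : 'rV[R]_d) E : bellman_data R d d1 A :=
  BellmanData (ell_ E) (fun alpha k t x => sigma_ E alpha k t (x + y))
    (fun alpha k t x => b_ E alpha k t (x + y)) (fun alpha t x => c_ E alpha t (x + y))
    (fun alpha t x => f_ E alpha t (x + y)) (fun x => g_ E (x + y)).

Lemma coef_shift K (psi : R -> 'rV[R]_d -> R) y :
  coef K psi -> coef K (fun t x => psi t (x + y)).
Proof.
move=> [h1 h2 h3]; split=> [t x|t x z|x t s]; [exact: h1| |exact: h3].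
by have := h2 t (x + y) (z + y); rewrite opprD addrACA subrr addr0.
Qed.

Lemma good_shift K lambda y E : good K lambda E -> good K lambda (shiftE y E).
Proof.
move=> G; split => //=; try by case: G.
- by move=> alpha k; exact: coef_shift (good_sigma G alpha k).
- by move=> alpha k; exact: coef_shift (good_b G alpha k).
- by move=> alpha; exact: coef_shift (good_c G alpha).
- by move=> alpha; exact: coef_shift (good_f G alpha).
- exact: coef_shift (good_g G).
Qed.

Lemma Lop_shift E h alpha t y p x :
  Lop (shiftE y E) h alpha t (fun z => p (z + y)) x = Lop E h alpha t p (x + y).
Proof.
rewrite /Lop /Lin /=; congr (_ + _ - _ + _); apply: eq_bigr => k _; congr (_ * _).
  by rewrite /fd2 (addrAC x) (addrAC x _ y).
by rewrite /fd1 (addrAC x).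
Qed.

Lemma evol_shift a b (u ut : R -> 'rV[R]_d -> R) y : evol a b u ut ->
  evol a b (fun t x => u t (x + y)) (fun t x => ut t (x + y)).
Proof. by move=> [h1 h2]; split => [x|t x tab]; [exact: h1|exact: h2]. Qed.

Lemma supersol_shift E h a b e u ut y : supersol E h a b e u ut ->
  supersol (shiftE y E) h a b e (fun t x => u t (x + y)) (fun t x => ut t (x + y)).
Proof.
move=> [ev H]; split; first exact: evol_shift.
by move=> t x alpha tab; rewrite (@Lop_shift E h alpha t y (u t) x); exact: H.
Qed.

Definition closeto D E E' : Prop :=
  (forall k, ell_ E' k = ell_ E k) /\ forall alpha t x,
  [/\ forall k, `|sigma_ E' alpha k t x - sigma_ E alpha k t x| <= D,
      forall k, `|b_ E' alpha k t x - b_ E alpha k t x| <= D,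
      `|c_ E' alpha t x - c_ E alpha t x| <= D &
      `|f_ E' alpha t x - f_ E alpha t x| <= D].

Lemma closeto_shift K lambda D E y : good K lambda E -> K * enorm y <= D ->
  closeto D E (shiftE y E).
Proof.
move=> G Ky; split => // alpha t x; have xy : x + y - x = y by rewrite addrAC subrr add0r.
split => [k|k||] /=.
- have [_ /(_ t (x + y) x) H _] := good_sigma G alpha k.
  by apply: le_trans Ky; rewrite xy in H.
- have [_ /(_ t (x + y) x) H _] := good_b G alpha k.
  by apply: le_trans Ky; rewrite xy in H.
- have [_ /(_ t (x + y) x) H _] := good_c G alpha.
  apply: le_trans Ky; rewrite xy in H; move: H.
  by rewrite opprB addrA subrK.
- have [_ /(_ t (x + y) x) H _] := good_f G alpha.
  by apply: le_trans Ky; rewrite xy in H.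
Qed.

End shift.

Section within_continuity.
Context {R : realType}.
Implicit Types (D : set R) (y z : R -> R).

Lemma within_continuousD D y z : {within D, continuous y} -> {within D, continuous z} ->
  {within D, continuous (fun t => y t + z t)}.
Proof. by move=> cy cz t; apply: cvgD; [exact: cy|exact: cz]. Qed.

Lemma within_continuousM D y z : {within D, continuous y} -> {within D, continuous z} ->
  {within D, continuous (fun t => y t * z t)}.
Proof. by move=> cy cz t; apply: cvgM; [exact: cy|exact: cz]. Qed.

Lemma within_continuous_cst D c : {within D, continuous (fun=> c : R)}.
Proof. by move=> t; exact: cvg_cst. Qed.

Lemma within_continuousB D y z : {within D, continuous y} -> {within D, continuous z} ->
  {within D, continuous (fun t => y t - z t)}.
Proof. by move=> cy cz t; apply: cvgB; [exact: cy|exact: cz]. Qed.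

Lemma within_continuous_negp D y : {within D, continuous y} ->
  {within D, continuous (fun t => negp (y t))}.
Proof.
move=> cy.
have -> : (fun t => negp (y t)) = (fun t => (`|y t| - y t) * 2^-1).
  apply/funext => t; rewrite /negp; have [y0|y0] := leP 0 (y t).
    by rewrite (ger0_norm y0) (max_idPl _) ?oppr_le0// subrr mul0r.
  by rewrite (ltr0_norm y0) (max_idPr _) ?oppr_ge0 ?ltW//; field.
apply: within_continuousM; last exact: within_continuous_cst.
apply: within_continuousB => // t; apply: cvg_norm; exact: cy.
Qed.

Lemma within_continuous_sum D (I : Type) (r : seq I) (F : I -> R -> R) :
  (forall i, {within D, continuous (F i)}) ->
  {within D, continuous (fun t => \sum_(i <- r) F i t)}.
Proof.
move=> cF; elim: r => [|i r IH].
  by under eq_fun do rewrite big_nil; exact: within_continuous_cst.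
by under eq_fun do rewrite big_cons; exact: within_continuousD.
Qed.

Lemma expRN_le (s : R) : 0 <= s -> expR (- s) <= 1 - s + s ^+ 2.
Proof.
move=> s0; rewrite expRN; have s1 : 0 < 1 + s by rewrite ltr_pwDl.
have e1 : 1 + s <= expR s by exact: expR_ge1Dx.
rewrite -[leLHS]mul1r ler_pdivrMr ?expR_gt0//.
have q0 : 0 <= 1 - s + s ^+ 2.
  have := sqr_ge0 (s - 2^-1); rewrite sqrrB; lra.
have := ler_wpM2l q0 e1; have : 0 <= s ^+ 3 by rewrite exprn_ge0.
have -> : (1 - s + s ^+ 2) * (1 + s) = 1 + s ^+ 3 by ring.
lra.
Qed.

Lemma der_on_sqr (a b t : R) : der_on a b (fun s => (s - t) ^+ 2) t 0.
Proof.
move=> e e0; exists e => // s _ se.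
rewrite subrr expr0n/= subr0 mul0r subr0 normrX expr2 ler_wpM2r// ltW//.
Qed.

(* The weighted maximum condition [expR (kappa t) * V] enters only through the tangent
   lines of the convex functions [(negp w_j) ^+ 2]. *)
Lemma weighted_max_derivative (J : finType) a b t0 kappa (w : J -> R -> R) (wt : J -> R) :
  a <= t0 < b -> 0 <= kappa -> (forall j, der_on a b (w j) t0 (wt j)) ->
  (forall s, a <= s <= b -> expR (kappa * s) * (\sum_j negp (w j s) ^+ 2) <=
     expR (kappa * t0) * (\sum_j negp (w j t0) ^+ 2)) ->
  kappa * (\sum_j negp (w j t0) ^+ 2) - 2 * \sum_j negp (w j t0) * wt j <= 0.
Proof.
move=> t0ab k0 dw M; set V0 := \sum_j negp (w j t0) ^+ 2.
have V00 : 0 <= V0 by apply: sumr_ge0 => j _; exact: sqr_ge0.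
(* Tangent lines bound the sum of squares from below, [expRN_le] bounds the weight from above;
   together they give [y s <= 0 = y t0], and [y] is differentiable without differentiating any
   [negp]. *)
pose y s := kappa * V0 * (s - t0) - 2 * (\sum_j negp (w j t0) * (w j s - w j t0))
  - kappa ^+ 2 * V0 * (s - t0) ^+ 2.
have dy : der_on a b y t0 (kappa * V0 * (1 - 0) - 2 * (\sum_j negp (w j t0) * (wt j - 0))
    - kappa ^+ 2 * V0 * 0).
  apply: der_onB; last by apply: der_onZ; exact: der_on_sqr.
  apply: der_onB; first by apply: der_onZ; apply: der_onB; [exact: der_on_id|exact: der_on_cst].
  apply: der_onZ; apply: der_on_sum => j; apply: der_onZ.
  by apply: der_onB => //; exact: der_on_cst.
have : kappa * V0 * (1 - 0) - 2 * (\sum_j negp (w j t0) * (wt j - 0))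
    - kappa ^+ 2 * V0 * 0 <= 0.
  apply: (der_on_max t0ab dy) => s /andP[ts sb].
  have -> : y t0 = 0.
    rewrite /y subrr mulr0 expr0n/= mulr0 big1 ?mulr0 ?subr0// => j _.
    by rewrite subrr mulr0.
  have sab : a <= s <= b by rewrite sb andbT; case/andP: t0ab => h _; exact: le_trans ts.
  have conv : V0 - 2 * (\sum_j negp (w j t0) * (w j s - w j t0)) <= \sum_j negp (w j s) ^+ 2.
    rewrite mulr_sumr -sumrB; apply: ler_sum => j _.
    have := negp_sqr_convex (w j t0) (w j s); have := sqr_ge0 (negp (w j s) - negp (w j t0)).
    lra.
  have : \sum_j negp (w j s) ^+ 2 <= expR (- (kappa * (s - t0))) * V0.
    have := M s sab; rewrite mulrBr opprB expRB => H.
    by rewrite -(ler_pM2l (expR_gt0 (kappa * s))) mulrA mulrCA divff ?gt_eqF ?expR_gt0// mulr1.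
  have ks : 0 <= kappa * (s - t0) by rewrite mulr_ge0// subr_ge0.
  have := ler_wpM2r V00 (expRN_le ks).
  rewrite /y exprMn; lra.
rewrite mulr0 subr0 subr0 mulr1.
by under eq_bigr do rewrite subr0.
Qed.

End within_continuity.

Section quotient.
Context {R : realType} {d d1 : nat} {A : Type}.
Implicit Types E : bellman_data R d d1 A.

(** With [U = u + e * w] the operator of [E'] acts on [w] and the coefficient differences act on
    [u]. Powers of [h] are distributed to match [second_order_term]: the quantity [|r' - r| * rho]
    becomes [|sigma' - sigma| / e], free of [h]. *)
Lemma Lop_quotient E E' h e alpha t (u U : 'rV[R]_d -> R) x :
  e != 0 -> h != 0 -> (forall k, ell_ E' k = ell_ E k) ->
  let w y := (U y - u y) / e in
  Lop E' h alpha t U x - Lop E h alpha t u x = e * (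
    \sum_k (2^-1 * (sigma_ E' alpha k t x / h) ^+ 2 *
       (w (x + h *: ell_ E k) - 2 * w x + w (x - h *: ell_ E k)) +
       2^-1 * ((sigma_ E' alpha k t x / h) ^+ 2 - (sigma_ E alpha k t x / h) ^+ 2) * (h / e)
         * (h * fd2 h (ell_ E k) u x)) +
    \sum_k (b_ E' alpha k t x / h * (w (x + h *: ell_ E k) - w x) +
       (b_ E' alpha k t x / h - b_ E alpha k t x / h) * (h / e) * fd1 h (ell_ E k) u x) +
    (- (c_ E' alpha t x * w x) - (c_ E' alpha t x - c_ E alpha t x) / e * u x
      + (f_ E' alpha t x - f_ E alpha t x) / e)).
Proof.
move=> e0 h0 EE w.
have U1 y : U y = u y + e * w y by rewrite /w mulrCA divff// mulr1 addrC subrK.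
rewrite !mulrDr !mulr_sumr /Lop /Lin.
rewrite (_ : \sum_k a_ E' alpha k t x * _ = \sum_k a_ E alpha k t x * fd2 h (ell_ E k) u x +
  \sum_k (e * (2^-1 * (sigma_ E' alpha k t x / h) ^+ 2 *
       (w (x + h *: ell_ E k) - 2 * w x + w (x - h *: ell_ E k)) +
       2^-1 * ((sigma_ E' alpha k t x / h) ^+ 2 - (sigma_ E alpha k t x / h) ^+ 2) * (h / e)
         * (h * fd2 h (ell_ E k) u x)))); last first.
  rewrite -big_split/=; apply: eq_bigr => k _; rewrite EE /a_ /fd2 !U1.
  by field; apply/andP.
rewrite (_ : \sum_k b_ E' alpha k t x * _ = \sum_k b_ E alpha k t x * fd1 h (ell_ E k) u x +
  \sum_k (e * (b_ E' alpha k t x / h * (w (x + h *: ell_ E k) - w x) +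
       (b_ E' alpha k t x / h - b_ E alpha k t x / h) * (h / e) * fd1 h (ell_ E k) u x)));
  last first.
  rewrite -big_split/=; apply: eq_bigr => k _; rewrite EE /fd1 !U1.
  by field; apply/andP.
rewrite U1; move: (\sum_k _) (\sum_k _) (\sum_k _) (\sum_k _) => s1 s2 s3 s4.
by field.
Qed.

End quotient.

Section continuous_dependence.
Context {R : realType} {d1 : nat}.

(** The size of the Bernstein family: [None] for the quotient [(v - u) / eps], and [Some k] for the
    difference quotient of [u] along [ell_k]. *)
Definition njets : R := #|{: option (dindex d1)}|%:R.
Definition ndirs : R := #|dindex d1|%:R.

(** The errors of [second_order_sum] and [first_order_sum] with [m = K ^+ 2], summed over the
    directions; [cdlin] gathers those of the zeroth order terms, which are only linear in [S]. *)
Definition cdquad (K : R) : R :=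
  ndirs * ((23 * njets + 16 * njets ^+ 2) * (K ^+ 2) ^+ 2 + 3 * njets * K ^+ 2).

Definition cdlin (K : R) : R := 2 * njets * K ^+ 2.

(* [kappa] is the exponential growth rate of the estimate; it can be taken zero as soon
   as the discount [lambda] dominates [cdrate K]. *)
Definition cdrate (K : R) : R := cdquad K + 1.

Context {d : nat} {A : Type} (E E' : bellman_data R d d1 A).
Context (K lambda h eps a b M0 M1 kappa B : R).
Context (u ut v vt : R -> 'rV[R]_d -> R).
Hypotheses (GE : good K lambda E) (GE' : good K lambda E') (lam0 : 0 <= lambda).
Hypotheses (eps0 : 0 < eps) (eps_h : eps <= h) (cE : closeto (K ^+ 2 * eps) E E').
Hypotheses (kappa0 : 0 <= kappa) (rate : cdrate K <= kappa + 2 * lambda) (ab : a <= b).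
Hypotheses (usub : subsol E h a b u ut) (usup : supersol E h a b 0 u ut).
Hypothesis vsup : supersol E' h a b 0 v vt.
Hypothesis uM : forall t x, a <= t <= b -> `|u t x| <= M0.
Hypothesis vM : forall t x, a <= t <= b -> `|v t x| <= M1.
Hypothesis BE : (cdlin K * (M0 + 1) + 1) ^+ 2 <= B.

Let h0 : 0 < h. Proof. exact: lt_le_trans eps_h. Qed.
Let K0 : 0 <= K.
Proof. by have [/(_ 0 0) H _ _] := good_g GE; exact: le_trans H. Qed.
Let m0 : 0 <= K ^+ 2. Proof. exact: sqr_ge0. Qed.

(** Both kinds of quotient are treated alike: [v] at scale [eps] and the translate of [u] by
    [h * ell_k] at scale [h] are supersolutions of problems whose distance from [E] is at most
    [K ^+ 2] times the scale. *)
Let EE (j : option (dindex d1)) := if j is Some k then shiftE (h *: ell_ E k) E else E'.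
Let ep (j : option (dindex d1)) := if j is Some k then h else eps.
Let U (j : option (dindex d1)) t x := if j is Some k then u t (x + h *: ell_ E k) else v t x.
Let Ut (j : option (dindex d1)) t x := if j is Some k then ut t (x + h *: ell_ E k) else vt t x.
Let w j t x := (U j t x - u t x) / ep j.

Let EEgood j : good K lambda (EE j).
Proof. by case: j => [k|] //=; exact: good_shift. Qed.

Let ep_gt0 j : 0 < ep j. Proof. by case: j. Qed.
Let ep_le j : ep j <= h. Proof. by case: j => [k|] /=. Qed.
Let eps_ep j : eps <= ep j. Proof. by case: j => [k|] /=. Qed.

Let EEclose j : closeto (K ^+ 2 * ep j) E (EE j).
Proof.
case: j => [k|] //=; apply: closeto_shift GE _.
rewrite enormZ gtr0_norm// mulrA mulrAC expr2 ler_wpM2r ?(ltW h0)//.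
by rewrite ler_wpM2l// (good_ell GE).
Qed.

Let Usup j : supersol (EE j) h a b 0 (U j) (Ut j).
Proof. by case: j => [k|] //=; exact: supersol_shift. Qed.

Let UM j t x : a <= t <= b -> `|U j t x| <= M0 + M1.
Proof.
move=> tab; have M00 : 0 <= M0 by apply: le_trans (uM x tab).
have M10 : 0 <= M1 by apply: le_trans (vM x tab).
case: j => [k|] /=.
  by rewrite (le_trans (uM _ tab))// lerDl.
by rewrite (le_trans (vM _ tab))// lerDr.
Qed.

(* The maximum principle for the left-hand side.  The differences of coefficients multiply
   second differences of u, which are not bounded by V; these are absorbed by the squared
   increments in [negp_sqr_convex]. *)
Lemma cd_estimate :
  (forall x, negp ((v b x - u b x) / eps) ^+ 2 +
     \sum_k negp (fd1 h (ell_ E k) (u b) x) ^+ 2 <= B) ->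
  forall t x, a <= t <= b -> negp ((v t x - u t x) / eps) ^+ 2 +
     \sum_k negp (fd1 h (ell_ E k) (u t) x) ^+ 2 <= expR (kappa * (b - t)) * B.
Proof.
pose V t x := \sum_j negp (w j t x) ^+ 2.
have VE t x : negp ((v t x - u t x) / eps) ^+ 2 +
     \sum_k negp (fd1 h (ell_ E k) (u t) x) ^+ 2 = V t x.
  rewrite /V (bigD1 None)//=; congr (_ + _).
  rewrite [RHS](reindex_omap (@Some (dindex d1)) id)/=; last by case.
  by apply: eq_big => [k|k _]; rewrite ?eqxx.
move=> term.
have {}term x : V b x <= B by rewrite -VE.
move=> t1 x1 t1ab; rewrite VE leNgt; apply/negP => viol.
pose Phi t x := expR (kappa * t) * V t x.
pose n : R := njets.
have n0 : 0 <= n by rewrite /n /njets.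
have nd0 : 0 <= ndirs by rewrite /ndirs.
pose c := cdlin K * (M0 + 1).
have M00 : 0 <= M0 by apply: le_trans (uM x1 t1ab).
have c0 : 0 <= c by rewrite /c /cdlin !mulr_ge0// addr_ge0.
pose G0 := cdquad K + 1 + ndirs * ((K / h) ^+ 2 + K / h).
pose G1 := 2 * n / eps.
have cq0 : 0 <= cdquad K.
  by rewrite /cdquad mulr_ge0// addr_ge0// !mulr_ge0// ?addr_ge0 ?mulr_ge0 ?sqr_ge0.
have Kh0 : 0 <= K / h by rewrite divr_ge0// ltW.
have G00 : 0 <= G0.
  have p1 : 0 <= ndirs * ((K / h) ^+ 2 + K / h) by rewrite mulr_ge0// addr_ge0// sqr_ge0.
  by rewrite /G0 addr_ge0// addr_ge0.
have G10 : 0 <= G1 by rewrite /G1 divr_ge0 ?mulr_ge0// ltW.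
pose eta := (G0 + G1 + 1)^-1.
have eta0 : 0 < eta by rewrite invr_gt0 ltr_wpDl// addr_ge0.
have V0 t x : 0 <= V t x by apply: sumr_ge0 => j _; exact: sqr_ge0.
pose g1 := Phi t1 x1 - expR (kappa * b) * B.
have g10 : 0 < g1.
  rewrite /g1 subr_gt0 /Phi -(ltr_pM2l (expR_gt0 (- (kappa * t1)))) !mulrA -!expRD.
  by rewrite addNr expR0 mul1r addrC -mulrBr.
pose eta' := Num.min (g1 / 2) (eta * expR (kappa * a)).
have eta'0 : 0 < eta' by rewrite lt_min half_gt0// mulr_gt0// expR_gt0.
have cw j x : {within `[a, b], continuous (fun t => w j t x)}.
  apply: within_continuousM; last exact: within_continuous_cst.
  by apply: within_continuousB; [exact: (Usup j).1.1|exact: usup.1.1].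
have cPhi x : {within `[a, b], continuous (fun t => Phi t x)}.
  apply: within_continuousM.
    apply: continuous_subspaceT => t; apply: continuous_comp; last exact: continuous_expR.
    by apply: cvgM; [exact: cvg_cst|exact: cvg_id].
  apply: within_continuous_sum => j.
  by apply: (@within_continuousM _ _ (fun t => negp (w j t x)) (fun t => negp (w j t x)));
    apply: within_continuous_negp; exact: cw.
have bPhi : exists M, forall t x, a <= t <= b -> Phi t x <= M.
  exists (expR (kappa * b) * \sum_(j : option (dindex d1)) ((M0 + M1 + M0) / eps) ^+ 2) => t x tab.
  apply: ler_pM; rewrite ?expR_ge0//; first by rewrite ler_expR ler_wpM2l//; case/andP: tab.
  have Q0 : 0 <= (M0 + M1 + M0) / eps.
    rewrite divr_ge0 ?(ltW eps0)// addr_ge0//.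
    exact: le_trans (normr_ge0 _) (UM None x tab).
  apply: ler_sum => j _; rewrite ler_pXn2r ?nnegrE ?negp_ge0//.
  have MM : `|w j t x| <= (M0 + M1 + M0) / eps.
    rewrite normrM ler_pM// ?normr_ge0//.
      by rewrite (le_trans (ler_normB _ _))// lerD// ?UM// uM.
    by rewrite gtr0_norm ?invr_gt0// lef_pV2 ?posrE.
  rewrite /negp ge_max Q0/=.
  by rewrite (le_trans _ MM)// -normrN ler_norm.
have [t0 [x0 [t0ab tmax xmax]]] := near_max x1 ab cPhi bPhi eta'0.
have Phi0 : expR (kappa * b) * B < Phi t0 x0.
  have := xmax t1 x1 t1ab; have : eta' <= g1 / 2 by rewrite ge_min lexx.
  rewrite /g1; lra.
have [t0b|tneb] := eqVneq t0 b.
  by move: Phi0; rewrite /Phi t0b ltr_pM2l ?expR_gt0// ltNge term.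
case/andP: (t0ab) => at0 t0b; have t0b' : a <= t0 < b by rewrite at0 lt_neqAle tneb.
have BV : B < V t0 x0.
  rewrite -(ltr_pM2l (expR_gt0 (kappa * t0))); apply: le_lt_trans Phi0.
  rewrite ler_wpM2r//; first exact: le_trans (sqr_ge0 _) BE.
  by rewrite ler_expR ler_wpM2l.
have near y : V t0 y <= V t0 x0 + eta.
  rewrite -(ler_pM2l (expR_gt0 (kappa * t0))) mulrDr.
  apply: le_trans (xmax t0 y t0ab) _; rewrite lerD2l.
  apply: (@le_trans _ _ (eta * expR (kappa * a))); first by rewrite ge_min lexx orbT.
  by rewrite mulrC ler_wpM2r ?(ltW eta0)// ler_expR ler_wpM2l.
(* [S ^+ 2] bounds [V] at time [t0] over the whole space, so [S] dominates all negative parts at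
   [x0] and at its neighbours. The choice of [B] forces [S > c + 1]. *)
pose S := Num.sqrt (V t0 x0 + eta).
have S2 : S ^+ 2 = V t0 x0 + eta by rewrite sqr_sqrtr// addr_ge0// ltW.
have S0 : 0 <= S by exact: sqrtr_ge0.
have cS : c + 1 < S.
  rewrite -(ltr_pXn2r (n := 2)) ?nnegrE ?addr_ge0// S2.
  by apply: le_lt_trans BE _; apply: lt_trans BV _; rewrite ltrDl.
have wS j y : negp (w j t0 y) <= S.
  rewrite -(ler_pXn2r (n := 2)) ?nnegrE ?negp_ge0// S2.
  apply: le_trans (near y); rewrite /V (bigD1 j)//= lerDl sumr_ge0// => i _.
  exact: sqr_ge0.
have [alpha Ha] := usub.2 t0 x0 eta t0b' eta0.
pose wt j := (Ut j t0 x0 - ut t0 x0) / ep j.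
have D : kappa * V t0 x0 - 2 * \sum_j negp (w j t0 x0) * wt j <= 0.
  apply: (@weighted_max_derivative _ _ a b t0 kappa (fun j t => w j t x0) wt) => //.
  move=> j; have := der_onZ (ep j)^-1 (der_onB ((Usup j).1.2 t0 x0 t0b') (usub.1.2 t0 x0 t0b')).
  have -> : (ep j)^-1 * (Ut j t0 x0 - ut t0 x0) = wt j by rewrite /wt mulrC.
  suff -> : (fun s => (ep j)^-1 * (U j s x0 - u s x0)) = (fun s => w j s x0) by [].
  by apply/funext => s; rewrite /w mulrC.
pose z j := negp (w j t0 x0).
have z0 j : 0 <= z j by exact: negp_ge0.
have epn0 j : ep j != 0 by rewrite gt_eqF.
have hn0 : h != 0 by rewrite gt_eqF.
pose Q2 j k := 2^-1 * (sigma_ (EE j) alpha k t0 x0 / h) ^+ 2 *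
  (w j t0 (x0 + h *: ell_ E k) - 2 * w j t0 x0 + w j t0 (x0 - h *: ell_ E k)) +
  2^-1 * ((sigma_ (EE j) alpha k t0 x0 / h) ^+ 2 - (sigma_ E alpha k t0 x0 / h) ^+ 2) *
  (h / ep j) * (h * fd2 h (ell_ E k) (u t0) x0).
pose Q1 j k := b_ (EE j) alpha k t0 x0 / h * (w j t0 (x0 + h *: ell_ E k) - w j t0 x0) +
  (b_ (EE j) alpha k t0 x0 / h - b_ E alpha k t0 x0 / h) * (h / ep j)
  * fd1 h (ell_ E k) (u t0) x0.
pose Q0 j := - (c_ (EE j) alpha t0 x0 * w j t0 x0)
  - (c_ (EE j) alpha t0 x0 - c_ E alpha t0 x0) / ep j * u t0 x0
  + (f_ (EE j) alpha t0 x0 - f_ E alpha t0 x0) / ep j.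
have QE j : Lop (EE j) h alpha t0 (U j t0) x0 - Lop E h alpha t0 (u t0) x0 =
    ep j * (\sum_k Q2 j k + \sum_k Q1 j k + Q0 j).
  exact: (@Lop_quotient _ _ _ _ E (EE j) h (ep j) alpha t0 (u t0) (U j t0) x0
    (epn0 j) hn0 (EEclose j).1).
have Qle j : wt j + (\sum_k Q2 j k + \sum_k Q1 j k + Q0 j) <= eta / eps.
  apply: (@le_trans _ _ (eta / ep j)); last first.
    by rewrite ler_pM2l// lef_pV2 ?posrE.
  rewrite ler_pdivlMr// mulrDl /wt divfK// mulrC [ep j * _]mulrC.
  have := (Usup j).2 t0 x0 alpha t0b'; have := QE j.
  rewrite [X in _ = X]mulrC; lra.
have sumQ : \sum_j 2 * (z j * (wt j + (\sum_k Q2 j k + \sum_k Q1 j k + Q0 j)))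
    <= n * (2 * (S * (eta / eps))).
  rewrite /n /njets -sumr_cst; apply: ler_sum => j _; rewrite ler_pM2l//.
  apply: (@le_trans _ _ (z j * (eta / eps))); first by rewrite ler_wpM2l.
  by rewrite ler_wpM2r ?wS// divr_ge0 ?ltW.
pose wk k := fd1 h (ell_ E k) (u t0) x0.
(* The opposite of [wk k] is the quotient along the opposite direction at the neighbour
   [x0 + h *: ell_ E k], where its negative part is also bounded by [S]. *)
have wkS k : `|wk k| <= S.
  have A1 : negp (wk k) <= S by exact: (wS (Some k) x0).
  have A2 : negp (- wk k) <= S.
    apply: le_trans (wS (Some (Defs.dopp k)) (x0 + h *: ell_ E k)).
    apply: eq_ler; congr negp; rewrite /w /U /wk /fd1 /= (good_ell_opp GE k).
    by rewrite scalerN subrK; field.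
  rewrite -[wk k]negpE ler_norml.
  have := negp_ge0 (wk k); have := negp_ge0 (- wk k); lra.
have cl j := (EEclose j).2 alpha t0 x0.
have rho1 j : 1 <= h / ep j by rewrite ler_pdivlMr// mul1r.
have hi0 : 0 < h^-1 by rewrite invr_gt0.
have scal (p q : R) j : `|p - q| <= K ^+ 2 * ep j -> `|p / h - q / h| * (h / ep j) <= K ^+ 2.
  move=> pq; rewrite -mulrBl normrM (gtr0_norm hi0) mulrA divfK//.
  by rewrite ler_pdivrMr.
have LB2 k : - (K / h) ^+ 2 * eta - (23 * n + 16 * n ^+ 2) * (K ^+ 2 * S) ^+ 2 <=
    \sum_j 2 * (z j * Q2 j k).
  apply: le_trans (@second_order_sum _ _ (fun j => w j t0 x0)
    (fun j => w j t0 (x0 + h *: ell_ E k)) (fun j => w j t0 (x0 - h *: ell_ E k))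
    (sigma_ E alpha k t0 x0 / h) (fun j => sigma_ (EE j) alpha k t0 x0 / h)
    (fun j => h / ep j) (K ^+ 2) S (h * fd2 h (ell_ E k) (u t0) x0)
    (Some k) (Some (Defs.dopp k)) _ m0 rho1 _ _ _ _); last first.
  - have -> : negp (w (Some (Defs.dopp k)) t0 (x0 + h *: ell_ E k)) = negp (- wk k).
      congr negp; rewrite /w /U /wk /fd1 /= (good_ell_opp GE k).
      by rewrite scalerN subrK; field.
    have -> : negp (w (Some k) t0 (x0 - h *: ell_ E k)) = negp (- wk (Defs.dopp k)).
      congr negp; rewrite /w /U /wk /fd1 /= subrK (good_ell_opp GE k) scalerN opprK.
      by field.
    have -> : negp (w (Some (Defs.dopp k)) t0 x0) = negp (wk (Defs.dopp k)) by [].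
    have -> : negp (w (Some k) t0 x0) = negp (wk k) by [].
    rewrite (_ : _ + _ = (negp (- wk k) - negp (wk k)) +
      (negp (- wk (Defs.dopp k)) - negp (wk (Defs.dopp k)))); last by ring.
    rewrite !negpE /wk /fd1 /fd2 (good_ell_opp GE (Defs.dopp k)) /Defs.dopp negbK -surjective_pairing.
    by rewrite scalerN; field.
  - by move=> j; split; exact: wS.
  - have -> : h * fd2 h (ell_ E k) (u t0) x0 = wk k + wk (Defs.dopp k).
      rewrite /wk /fd1 /fd2 (good_ell_opp GE (Defs.dopp k)) /Defs.dopp negbK -surjective_pairing.
      by rewrite scalerN; field.
    by rewrite (le_trans (ler_normD _ _))// mulr2n mulrDl !mul1r lerD.
  - by move=> j; have [/(_ k) H _ _ _] := cl j; exact: scal.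
  - by case: k => -[] i.
  rewrite -/n lerD2r.
  have r0 : 0 <= 2^-1 * (sigma_ E alpha k t0 x0 / h) ^+ 2.
    by rewrite mulr_ge0 ?invr_ge0 ?sqr_ge0.
  have rK : (sigma_ E alpha k t0 x0 / h) ^+ 2 <= (K / h) ^+ 2.
    rewrite -(real_normK (num_real (sigma_ _ _ _ _ _ / h))) ler_pXn2r ?nnegrE//.
    rewrite normrM (gtr0_norm hi0) ler_pM2r//.
    by have [/(_ t0 x0)] := good_sigma GE alpha k.
  have : - (2 * eta) <= - (V t0 (x0 + h *: ell_ E k) - 2 * V t0 x0 + V t0 (x0 - h *: ell_ E k)).
    have := near (x0 + h *: ell_ E k); have := near (x0 - h *: ell_ E k); lra.
  move=> /(ler_wpM2l r0); apply: le_trans.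
  have := ler_wpM2r (ltW eta0) rK; lra.
have LB1 k : - (K / h) * eta - 3 * n * K ^+ 2 * S ^+ 2 <= \sum_j 2 * (z j * Q1 j k).
  apply: le_trans (@first_order_sum _ _ (fun j => w j t0 x0)
    (fun j => w j t0 (x0 + h *: ell_ E k)) (b_ E alpha k t0 x0 / h)
    (fun j => b_ (EE j) alpha k t0 x0 / h)
    (fun j => h / ep j) (K ^+ 2) S (fd1 h (ell_ E k) (u t0) x0)
    m0 _ rho1 _ (wkS k) _); last first.
  - by move=> j; split; exact: wS.
  - by move=> j; have [_ /(_ k) H _ _] := cl j; exact: scal.
  - by move=> j; rewrite divr_ge0 ?(ltW h0)// (good_b_ge0 (EEgood j)).
  rewrite -/n lerD2r.
  have b0 : 0 <= b_ E alpha k t0 x0 / h by rewrite divr_ge0 ?(ltW h0)// (good_b_ge0 GE).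
  have bK : b_ E alpha k t0 x0 / h <= K / h.
    rewrite ler_pM2r//; have [/(_ t0 x0) + _ _] := good_b GE alpha k.
    exact/le_trans/ler_norm.
  have : - eta <= - (V t0 (x0 + h *: ell_ E k) - V t0 x0).
    have := near (x0 + h *: ell_ E k); lra.
  move=> /(ler_wpM2l b0); apply: le_trans.
  have := ler_wpM2r (ltW eta0) bK; lra.
have LB0 j : 2 * lambda * z j ^+ 2 - 2 * (S * (K ^+ 2 * (M0 + 1))) <= 2 * (z j * Q0 j).
  have [_ _ hc hf] := cl j.
  have -> : z j * Q0 j = c_ (EE j) alpha t0 x0 * z j ^+ 2 + z j *
      (- ((c_ (EE j) alpha t0 x0 - c_ E alpha t0 x0) / ep j * u t0 x0)
       + (f_ (EE j) alpha t0 x0 - f_ E alpha t0 x0) / ep j).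
    rewrite /Q0 -addrA mulrDr mulrN mulrCA /z negp_mul; ring.
  have cc : lambda * z j ^+ 2 <= c_ (EE j) alpha t0 x0 * z j ^+ 2.
    by rewrite ler_wpM2r ?sqr_ge0// (good_c_ge (EEgood j)).
  have ei : 0 < (ep j)^-1 by rewrite invr_gt0.
  have : - (S * (K ^+ 2 * (M0 + 1))) <= z j *
      (- ((c_ (EE j) alpha t0 x0 - c_ E alpha t0 x0) / ep j * u t0 x0)
       + (f_ (EE j) alpha t0 x0 - f_ E alpha t0 x0) / ep j).
    apply: ler_mul_norm => //; first exact: wS.
    rewrite (le_trans (ler_normD _ _))// mulrDr mulr1 normrN normrM.
    apply: lerD; last by rewrite normrM (gtr0_norm ei) ler_pdivrMr.
    apply: ler_pM => //; last exact: uM.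
    by rewrite normrM (gtr0_norm ei) ler_pdivrMr.
  lra.
have T2 : ndirs * (- (K / h) ^+ 2 * eta - (23 * n + 16 * n ^+ 2) * (K ^+ 2 * S) ^+ 2) <=
    \sum_j 2 * (z j * \sum_k Q2 j k).
  rewrite (eq_bigr (fun j => \sum_k 2 * (z j * Q2 j k))); last first.
    by move=> j _; rewrite !mulr_sumr.
  by rewrite exchange_big/= /ndirs -sumr_cst; apply: ler_sum.
have T1 : ndirs * (- (K / h) * eta - 3 * n * K ^+ 2 * S ^+ 2) <=
    \sum_j 2 * (z j * \sum_k Q1 j k).
  rewrite (eq_bigr (fun j => \sum_k 2 * (z j * Q1 j k))); last first.
    by move=> j _; rewrite !mulr_sumr.
  by rewrite exchange_big/= /ndirs -sumr_cst; apply: ler_sum.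
have T0 : 2 * lambda * V t0 x0 - n * (2 * (S * (K ^+ 2 * (M0 + 1)))) <=
    \sum_j 2 * (z j * Q0 j).
  rewrite /n /njets -sumr_cst /V mulr_sumr -sumrB; apply: ler_sum => j _.
  exact: LB0.
have sumE : \sum_j 2 * (z j * (wt j + (\sum_k Q2 j k + \sum_k Q1 j k + Q0 j))) =
    2 * (\sum_j z j * wt j) + (\sum_j 2 * (z j * \sum_k Q2 j k) +
    \sum_j 2 * (z j * \sum_k Q1 j k) + \sum_j 2 * (z j * Q0 j)).
  rewrite mulr_sumr -!big_split/=; apply: eq_bigr => j _; ring.
rewrite sumE in sumQ.
have etaG : eta * (G0 + G1 + 1) = 1.
  by rewrite mulVf// gt_eqF// ltr_wpDl// addr_ge0.
have RV := ler_wpM2r (V0 t0 x0) rate.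
have VS : V t0 x0 = S ^+ 2 - eta by rewrite S2 addrK.
(* The term [cdquad K * S ^+ 2] cancels against the rate [kappa + 2 * lambda], whose remaining unit
   gives [S ^+ 2]. As [S > c + 1], the left side is at least [S], whereas the right side is less by
   the choice of [eta]. *)
have key : S ^+ 2 - c * S <= eta * (G0 + G1 * S).
  move: D sumQ T2 T1 T0 RV; rewrite -/(z _) VS /cdrate /G0 /G1 /c /cdlin -/n.
  have -> : cdquad K = ndirs * ((23 * n + 16 * n ^+ 2) * (K ^+ 2) ^+ 2 + 3 * n * K ^+ 2) by [].
  move: (\sum_j z j * wt j) (\sum_j _) (\sum_j _) (\sum_j _) => s0 s2 s1 s3.
  lra.
have S1 : 1 <= S by apply: le_trans (ltW cS); rewrite lerDr.
have : S * (S - c - 1) >= 0 by rewrite mulr_ge0// subr_ge0; move: cS; lra.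
have : eta * (G0 + G1 * S) <= eta * ((G0 + G1) * S).
  by rewrite ler_pM2l// mulrDl lerD2r ler_peMr.
have : 0 < eta * S by rewrite mulr_gt0//; apply: lt_le_trans S1.
have : eta * (G0 + G1 + 1) * S = S by rewrite etaG mul1r.
move: key; lra.
Qed.

End continuous_dependence.

(** * Existence for the scheme *)

Section operator_estimates.
Context {R : realType} {d d1 : nat} {A : Type} (E : bellman_data R d d1 A).
Context (K lambda h : R).
Hypotheses (GE : good K lambda E) (lam0 : 0 <= lambda) (h0 : 0 < h).

Lemma good_K_ge0 : 0 <= K.
Proof. by have [/(_ 0 0) H _ _] := good_g GE; exact: le_trans H. Qed.

Let K0 := good_K_ge0.

Lemma fd2_le l p (x : 'rV[R]_d) M : `|p (x + h *: l)| <= M -> `|p x| <= M ->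
  `|p (x - h *: l)| <= M -> `|fd2 h l p x| <= 4 * M / h ^+ 2.
Proof.
move=> h1 h2 h3; rewrite /fd2 normrM (@gtr0_norm _ (h ^+ 2)^-1) ?invr_gt0 ?exprn_gt0//.
rewrite ler_pM2r ?invr_gt0 ?exprn_gt0//.
by move: h1 h2 h3; rewrite !ler_norml; lra.
Qed.

Lemma fd1_le l p (x : 'rV[R]_d) M : `|p (x + h *: l)| <= M -> `|p x| <= M ->
  `|fd1 h l p x| <= 2 * M / h.
Proof.
move=> h1 h2; rewrite /fd1 normrM (@gtr0_norm _ h^-1) ?invr_gt0//.
rewrite ler_pM2r ?invr_gt0//.
by move: h1 h2; rewrite !ler_norml; lra.
Qed.

(** These bounds blow up as [h] tends to zero. They serve existence and regularity at a fixed mesh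
    and enter no final constant. *)
Definition opnorm : R :=
  ndirs (d1 := d1) * (K ^+ 2 / 2 * (4 / h ^+ 2) + K * (2 / h)) + (lambda + K).

Definition opvar : R := ndirs (d1 := d1) * (K * (4 / h ^+ 2) + 2 / h) + 1.

Lemma opnorm_ge0 : 0 <= opnorm.
Proof.
have q1 : 0 <= 4 / h ^+ 2 by rewrite divr_ge0 ?sqr_ge0.
have q2 : 0 <= 2 / h by rewrite divr_ge0// ltW.
have q3 : 0 <= K ^+ 2 / 2 by rewrite divr_ge0 ?sqr_ge0.
by rewrite /opnorm addr_ge0 ?addr_ge0// mulr_ge0// addr_ge0// mulr_ge0.
Qed.

Lemma opvar_ge0 : 0 <= opvar.
Proof.
have q1 : 0 <= 4 / h ^+ 2 by rewrite divr_ge0 ?sqr_ge0.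
have q2 : 0 <= 2 / h by rewrite divr_ge0// ltW.
by rewrite /opvar addr_ge0// mulr_ge0// addr_ge0// mulr_ge0.
Qed.

(** One estimate for changes of time, of point and of function: [p] and [q] are compared after [x]
    and [y] have been moved to the same place. *)
Lemma Lop_diff alpha t s p q (x y : 'rV[R]_d) D P M :
  (forall k, `|sigma_ E alpha k t x - sigma_ E alpha k s y| <= D) ->
  (forall k, `|b_ E alpha k t x - b_ E alpha k s y| <= D) ->
  `|c_ E alpha t x - c_ E alpha s y| <= D -> `|f_ E alpha t x - f_ E alpha s y| <= D ->
  (forall z, `|p (x + z) - q (y + z)| <= P) -> (forall z, `|q z| <= M) ->
  `|Lop E h alpha t p x - Lop E h alpha s q y| <= opnorm * P + D * (opvar * M + 1).
Proof.
move=> Ds Db Dc Df Ppq qM.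
have D0 : 0 <= D by apply: le_trans Dc.
have P0 : 0 <= P by apply: le_trans (Ppq 0).
have M0 : 0 <= M by apply: le_trans (qM 0).
have Px : `|p x - q y| <= P by have := Ppq 0; rewrite !addr0.
have split2 (c c' r r' : R) : c * r - c' * r' = c * (r - r') + (c - c') * r' by ring.
have Ha k : `|a_ E alpha k t x * fd2 h (ell_ E k) p x - a_ E alpha k s y * fd2 h (ell_ E k) q y|
    <= K ^+ 2 / 2 * (4 * P / h ^+ 2) + D * K * (4 * M / h ^+ 2).
  rewrite split2 (le_trans (ler_normD _ _))// lerD//; rewrite normrM.
    apply: ler_pM => //; first by rewrite (ger0_norm (a_ge0 _ _ _ _ _)); exact: a_le GE.
    have -> : fd2 h (ell_ E k) p x - fd2 h (ell_ E k) q y =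
        fd2 h (ell_ E k) (fun z => p (x + z) - q (y + z)) 0.
      by rewrite /fd2 !add0r !addr0; ring.
    by apply: fd2_le.
  apply: ler_pM => //; last by apply: fd2_le.
  have -> : a_ E alpha k t x - a_ E alpha k s y = 2^-1 *
    ((sigma_ E alpha k t x - sigma_ E alpha k s y) * (sigma_ E alpha k t x + sigma_ E alpha k s y)).
    by rewrite /a_; ring.
  rewrite normrM ger0_norm ?invr_ge0// normrM.
  have [sK _ _] := good_sigma GE alpha k.
  have : `|sigma_ E alpha k t x + sigma_ E alpha k s y| <= 2 * K.
    by rewrite (le_trans (ler_normD _ _))// mulr2n mulrDl !mul1r lerD.
  move=> sp; have := ler_pM (normr_ge0 _) (normr_ge0 _) (Ds k) sp; lra.
have Hb k : `|b_ E alpha k t x * fd1 h (ell_ E k) p x - b_ E alpha k s y * fd1 h (ell_ E k) q y|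
    <= K * (2 * P / h) + D * (2 * M / h).
  rewrite split2 (le_trans (ler_normD _ _))// lerD//; rewrite normrM.
    apply: ler_pM => //; first by have [] := good_b GE alpha k.
    have -> : fd1 h (ell_ E k) p x - fd1 h (ell_ E k) q y =
        fd1 h (ell_ E k) (fun z => p (x + z) - q (y + z)) 0.
      by rewrite /fd1 !add0r !addr0; ring.
    by apply: fd1_le.
  by apply: ler_pM => //; apply: fd1_le.
have cK : `|c_ E alpha t x| <= lambda + K.
  have [/(_ t x) + _ _] := good_c GE alpha.
  have := good_c_ge GE alpha t x; have := lam0; have := K0; rewrite !ler_norml; lra.
have Hc : `|c_ E alpha t x * p x - c_ E alpha s y * q y| <= (lambda + K) * P + D * M.
  rewrite split2 (le_trans (ler_normD _ _))// !normrM lerD//; exact: ler_pM.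
have -> : Lop E h alpha t p x - Lop E h alpha s q y =
  \sum_k (a_ E alpha k t x * fd2 h (ell_ E k) p x - a_ E alpha k s y * fd2 h (ell_ E k) q y) +
  \sum_k (b_ E alpha k t x * fd1 h (ell_ E k) p x - b_ E alpha k s y * fd1 h (ell_ E k) q y) -
  (c_ E alpha t x * p x - c_ E alpha s y * q y) + (f_ E alpha t x - f_ E alpha s y).
  by rewrite !sumrB /Lop /Lin; ring.
apply: (@le_trans _ _ (ndirs (d1 := d1) * (K ^+ 2 / 2 * (4 * P / h ^+ 2) + D * K * (4 * M / h ^+ 2)) +
  ndirs (d1 := d1) * (K * (2 * P / h) + D * (2 * M / h)) + ((lambda + K) * P + D * M) + D)).
  rewrite (le_trans (ler_normD _ _))// lerD// (le_trans (ler_normB _ _))// lerD//.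
  rewrite (le_trans (ler_normD _ _))// lerD//.
    by rewrite (le_trans (ler_norm_sum _ _ _))// /ndirs -sumr_cst ler_sum.
  by rewrite (le_trans (ler_norm_sum _ _ _))// /ndirs -sumr_cst ler_sum.
by apply: eq_ler; rewrite /opnorm /opvar; ring.
Qed.

Lemma Lop_lip_function alpha t p q x P : (forall z, `|p z - q z| <= P) ->
  `|Lop E h alpha t p x - Lop E h alpha t q x| <= opnorm * P.
Proof.
move=> pq.
have -> : Lop E h alpha t p x - Lop E h alpha t q x =
  Lop E h alpha t (fun z => p z - q z) x - Lop E h alpha t (fun=> 0) x.
  by rewrite /Lop LinB Lin_cst; ring.
have := @Lop_diff alpha t t (fun z => p z - q z) (fun=> 0) x x 0 P 0.
rewrite mul0r addr0; apply => // *; rewrite ?subrr ?subr0 ?normr0//.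
Qed.

Lemma Lop_le alpha t p x M : (forall z, `|p z| <= M) ->
  `|Lop E h alpha t p x| <= opnorm * M + K.
Proof.
move=> pM; have := @Lop_lip_function alpha t p (fun=> 0) x M.
have -> : Lop E h alpha t (fun=> 0) x = f_ E alpha t x by rewrite /Lop Lin_cst mulr0 add0r.
have [/(_ t x) fK _ _] := good_f GE alpha.
move=> H; rewrite -[Lop _ _ _ _ _ _](subrK (f_ E alpha t x)) (le_trans (ler_normD _ _))//.
by rewrite lerD// H// => z; rewrite subr0.
Qed.

Definition Fop t p x : R := sup [set Lop E h alpha t p x | alpha in [set: A]].

Context (alpha0 : A).

Lemma Fop_has_sup t p x M : (forall z, `|p z| <= M) ->
  has_sup [set Lop E h alpha t p x | alpha in [set: A]].
Proof.
move=> pM; split; first by exists (Lop E h alpha0 t p x), alpha0.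
exists (opnorm * M + K) => _ [alpha _ <-].
exact: le_trans (ler_norm _) (Lop_le _ _ _ pM).
Qed.

Lemma Lop_le_Fop alpha t p x M : (forall z, `|p z| <= M) ->
  Lop E h alpha t p x <= Fop t p x.
Proof.
by move=> pM; apply: ub_le_sup; [case: (Fop_has_sup t x pM)|exists alpha].
Qed.

Lemma Fop_le t p x C : (forall alpha, Lop E h alpha t p x <= C) -> Fop t p x <= C.
Proof.
move=> H; apply: ge_sup; first by exists (Lop E h alpha0 t p x), alpha0.
by move=> _ [alpha _ <-].
Qed.

Lemma Fop_adherent t p x M e : (forall z, `|p z| <= M) -> 0 < e ->
  exists alpha, Fop t p x - e < Lop E h alpha t p x.
Proof.
move=> pM e0; have [_ [alpha _ <-] H] := sup_adherent e0 (Fop_has_sup t x pM).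
by exists alpha.
Qed.

Lemma Fop_diff t s p q x y M N C : (forall z, `|p z| <= M) -> (forall z, `|q z| <= N) ->
  (forall alpha, `|Lop E h alpha t p x - Lop E h alpha s q y| <= C) ->
  `|Fop t p x - Fop s q y| <= C.
Proof.
move=> pM qN H; rewrite ler_distl; apply/andP; split.
  rewrite lerBlDr; apply: Fop_le => alpha.
  by have := Lop_le_Fop alpha t x pM; have := H alpha; rewrite ler_norml; lra.
apply: Fop_le => alpha.
by have := Lop_le_Fop alpha s y qN; have := H alpha; rewrite ler_norml; lra.
Qed.

Lemma Fop_bound t p x M : (forall z, `|p z| <= M) -> `|Fop t p x| <= opnorm * M + K.
Proof.
move=> pM; rewrite ler_norml; apply/andP; split.
  apply: le_trans (Lop_le_Fop alpha0 t x pM).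
  by have := Lop_le alpha0 t x pM; rewrite ler_norml => /andP[].
by apply: Fop_le => alpha; apply: le_trans (ler_norm _) (Lop_le _ _ _ pM).
Qed.

End operator_estimates.

Section segment_integral.
Context {R : realType}.
Implicit Types (G H : R -> R) (s t r : R).

Definition segint G s t : R := \int[@lebesgue_measure R]_(r in `[s, t]) G r.

Lemma continuous_integrable G s t : continuous G ->
  (@lebesgue_measure R).-integrable `[s, t] (EFin \o G).
Proof.
move=> cG; apply: continuous_compact_integrable; first exact: segment_compact.
by apply: continuous_subspaceT => x; exact: cG.
Qed.

Lemma segintD G s r t : continuous G -> s <= r -> r <= t ->
  segint G s t = segint G s r + segint G r t.
Proof.
move=> cG sr rt.
have := @Rintegral_itvB R G (BLeft s) (BRight t) r (continuous_integrable s t cG).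
rewrite !bnd_simp => /(_ sr rt); rewrite -/(segint G s t) -/(segint G s r).
rewrite Rintegral_itv_obnd_cbnd; last first.
  by apply: integrableS (continuous_integrable r t cG) => //; exact: subset_itv_oc_cc.
by rewrite -/(segint G r t) => <-; rewrite addrC subrK.
Qed.

Lemma segint_cst c s t : s <= t -> segint (fun=> c) s t = c * (t - s).
Proof.
move=> st; rewrite /segint Rintegral_cst//= lebesgue_measure_itv/= lte_fin.
by move: st; rewrite le_eqVlt => /predU1P[->|->]; rewrite ?ltxx ?subrr//= .
Qed.

Lemma segint_le G H s t : continuous G -> continuous H ->
  (forall r, s <= r <= t -> G r <= H r) -> segint G s t <= segint H s t.
Proof.
move=> cG cH GH; apply: le_Rintegral; [by []|exact: continuous_integrable..|].
by move=> r /=; rewrite in_itv/=; exact: GH.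
Qed.

Lemma segint_lin G H s t c e : continuous G -> continuous H ->
  segint (fun r => c * G r + e * H r) s t = c * segint G s t + e * segint H s t.
Proof.
move=> cG cH; rewrite /segint.
have cc (F : R -> R) q : continuous F -> continuous (fun r => q * F r).
  by move=> cF r; apply: cvgM; [exact: cvg_cst|exact: cF].
rewrite RintegralD//; try by apply: continuous_integrable; exact: cc.
by rewrite !RintegralZl//; exact: continuous_integrable.
Qed.

Lemma segint_near G s t c M : continuous G -> s <= t ->
  (forall r, s <= r <= t -> `|G r - c| <= M) ->
  `|segint G s t - c * (t - s)| <= M * (t - s).
Proof.
move=> cG st H.
have Hr r : s <= r <= t -> c - M <= G r <= c + M.
  by move=> /H; rewrite ler_distl.
have h1 : segint G s t <= segint (fun=> c + M) s t.
  apply: segint_le => // [|r /Hr/andP[]//]; move=> r; exact: cvg_cst.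
have h2 : segint (fun=> c - M) s t <= segint G s t.
  apply: segint_le => // [|r /Hr/andP[]//]; move=> r; exact: cvg_cst.
by move: h1 h2; rewrite !segint_cst// ler_norml; lra.
Qed.

(* A primitive on the whole line: the two integrals are over empty segments on the
   wrong side of the origin. *)
Definition prim G t : R := segint G 0 t - segint G t 0.

Lemma segint_rev G s t : t <= s -> segint G s t = 0.
Proof.
rewrite le_eqVlt => /predU1P[->|ts]; first by rewrite /segint set_itv1 Rintegral_set1.
by rewrite /segint set_itv_ge ?Rintegral_set0// bnd_simp -ltNge.
Qed.

Lemma primB G s t : continuous G -> s <= t -> prim G t - prim G s = segint G s t.
Proof.
move=> cG st; rewrite /prim; have [s0|s0] := leP 0 s.
  rewrite (segint_rev G s0) (segint_rev G (le_trans s0 st)) (segintD cG s0 st).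
  by ring.
have [t0|t0] := leP 0 t.
  rewrite (segint_rev G (ltW s0)) (segint_rev G t0) (segintD cG (ltW s0) t0).
  by ring.
rewrite (segint_rev G (ltW s0)) (segint_rev G (ltW t0)) (segintD cG st (ltW t0)).
by ring.
Qed.

Lemma prim_near G s t M : continuous G ->
  (forall r, `|r - s| <= `|t - s| -> `|G r - G s| <= M) ->
  `|prim G t - prim G s - G s * (t - s)| <= M * `|t - s|.
Proof.
move=> cG H; have [st|ts] := leP s t.
  rewrite primB// (ger0_norm (_ : 0 <= t - s)) ?subr_ge0//.
  apply: segint_near => // r /andP[sr rt]; apply: H.
  by rewrite !ger0_norm ?subr_ge0// lerD2r.
have := @segint_near G t s (G s) M cG (ltW ts).
rewrite -(primB cG (ltW ts)) => K.
rewrite (ler0_norm (_ : t - s <= 0)) ?subr_le0 ?(ltW ts)// [- (t - s)]opprB.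
have -> : prim G t - prim G s - G s * (t - s) = - (prim G s - prim G t - G s * (s - t)).
  by ring.
rewrite normrN.
apply: K => r /andP[tr rs]; apply: H.
rewrite !ler0_norm ?subr_le0 ?(ltW ts)// lerN2 lerD2r//.
Qed.

End segment_integral.

Section more_calculus.
Context {R : realType}.

Lemma is_derive_der_on (a b t l : R) (y : R -> R) : is_derive t 1 y l -> der_on a b y t l.
Proof.
move=> [dy <-] e e0; have := dy; rewrite /derivable => /cvg_ex[/= l' yl'].
have -> : 'D_1 y t = l' by apply/cvg_lim.
move/cvgrPdist_le/(_ _ e0): yl'; rewrite /dnbhs /= near_withinE.
move=> /nbhs_ballP[r /= r0 Hr]; exists r => // s _ sr.
have [->|st] := eqVneq s t; first by rewrite !subrr mulr0 subr0 normr0 mulr0.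
have {}st : s - t != 0 by rewrite subr_eq0.
have := Hr (s - t); rewrite /ball/= sub0r normrN => /(_ sr st).
rewrite -[_ *: 1]/(_ * _) mulr1 subrK -[_ *: _]/(_ * _) => H.
have -> : y s - y t - l' * (s - t) = - (l' - (s - t)^-1 * (y s - y t)) * (s - t).
  by field.
by rewrite normrM normrN ler_wpM2r.
Qed.

(** After tilting by [e * t] the derivative is positive on [[a, b)], so the maximum can only sit at
    [b]. *)
Lemma der_on_nondecreasing (a b : R) (y l : R -> R) : a <= b ->
  {within `[a, b], continuous y} ->
  (forall t, a <= t < b -> der_on a b y t (l t)) ->
  (forall t, a <= t < b -> 0 <= l t) -> y a <= y b.
Proof.
move=> ab cy dy l0.
suff H e : 0 < e -> y a + e * a <= y b + e * b.
  rewrite leNgt; apply/negP => yba.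
  have [ab'|] := ltP a b; last first.
    by move=> ba; move: yba; rewrite (le_anti (introT andP (conj ab ba))) ltxx.
  have ab0 : 0 < b - a by rewrite subr_gt0.
  have := H ((y a - y b) / (2 * (b - a))).
  rewrite divr_gt0 ?mulr_gt0 ?subr_gt0// => /(_ isT).
  have : (y a - y b) / (2 * (b - a)) * (b - a) = (y a - y b) / 2.
    by field; rewrite gt_eqF.
  rewrite mulrBr; lra.
move=> e0.
have cz : {within `[a, b], continuous (fun t => y t + e * t)}.
  apply: within_continuousD => //; apply: within_continuousM.
    exact: within_continuous_cst.
  by apply: continuous_subspaceT => z; exact: cvg_id.
have [c cab Hc] := EVT_max ab cz.
have {}Hc t : a <= t <= b -> y t + e * t <= y c + e * c by move=> tab; apply: Hc; rewrite in_itv.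
move: cab; rewrite in_itv/= => /andP[ac cb].
have [<-|cneb] := eqVneq c b; first by apply: Hc; rewrite lexx ab.
have cab : a <= c < b by rewrite ac lt_neqAle cneb.
have : l c + e * 1 <= 0.
  apply: (der_on_max cab) => [|s /andP[cs sb]]; last first.
    by apply: Hc; rewrite sb (le_trans ac).
  by apply: der_onD; [exact: dy|apply: der_onZ; exact: der_on_id].
by have := l0 c cab; lra.
Qed.

Lemma der_on_exp (a b t kappa T : R) :
  der_on a b (fun s => expR (kappa * (T - s))) t (- kappa * expR (kappa * (T - t))).
Proof.
apply: is_derive_der_on.
have H1 : is_derive t 1 (fun s : R => kappa * (T - s)) (- kappa).
  have -> : (fun s : R => kappa * (T - s)) = (cst (kappa * T) - kappa *: (@id R)).
    by apply/funext => s /=; rewrite !fctE/= mulrBr.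
  by apply: is_derive_eq; rewrite sub0r scaler1.
rewrite [_ * expR _]mulrC.
exact: (@is_derive1_comp R expR _ t _ _ (is_derive_expR _) H1).
Qed.

(** The intervals of radius [2 * C / 2 ^+ n] around [x n] are nested; the limit is the supremum of
    their left ends. *)
Lemma geometric_limit (x : nat -> R) C :
  (forall n, `|x n.+1 - x n| <= C / 2 ^+ n) ->
  exists l, forall n, `|l - x n| <= 2 * C / 2 ^+ n.
Proof.
move=> H.
have p2 n : 0 < (2 : R) ^+ n by rewrite exprn_gt0.
have step n : x n - 2 * C / 2 ^+ n <= x n.+1 - 2 * C / 2 ^+ n.+1 /\
              x n.+1 + 2 * C / 2 ^+ n.+1 <= x n + 2 * C / 2 ^+ n.
  have := H n; have -> : 2 * C / 2 ^+ n.+1 = C / 2 ^+ n.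
    by rewrite exprS; field; rewrite gt_eqF.
  by rewrite -mulrA ler_norml; lra.
have C0 : 0 <= C.
  by have := H 0%N; rewrite expr0 divr1 => H0; exact: le_trans (normr_ge0 _) H0.
have lo n m : (n <= m)%N -> x n - 2 * C / 2 ^+ n <= x m - 2 * C / 2 ^+ m.
  move=> /subnK <-; elim: (m - n)%N => [|k IH]; first by rewrite add0n.
  by rewrite addSn (le_trans IH)//; case: (step (k + n)%N).
have hi n m : (n <= m)%N -> x m + 2 * C / 2 ^+ m <= x n + 2 * C / 2 ^+ n.
  move=> /subnK <-; elim: (m - n)%N => [|k IH]; first by rewrite add0n.
  by rewrite addSn (le_trans _ IH)//; case: (step (k + n)%N).
have cr n m : x n - 2 * C / 2 ^+ n <= x m + 2 * C / 2 ^+ m.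
  have q k : 0 <= 2 * C / 2 ^+ k by rewrite divr_ge0 ?mulr_ge0// ltW.
  have [nm|/ltnW mn] := leqP n m.
    by have := lo _ _ nm; have := q m; lra.
  by have := hi _ _ mn; have := q n; lra.
pose S := [set x n - 2 * C / 2 ^+ n | n in [set: nat]].
have supS : has_sup S.
  split; first by exists (x 0%N - 2 * C / 2 ^+ 0), 0%N.
  by exists (x 0%N + 2 * C / 2 ^+ 0) => _ [n _ <-]; exact: cr.
exists (sup S) => n; rewrite ler_distl; apply/andP; split.
  by apply: ub_le_sup; [case: supS|exists n].
apply: ge_sup; first by case: supS.
by move=> _ [m _ <-]; exact: cr.
Qed.

Definition clamp (T t : R) : R := Num.max 0 (Num.min t T).

Lemma clamp_bnd T t : 0 <= T -> 0 <= clamp T t <= T.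
Proof.
by move=> T0; rewrite /clamp le_max lexx/= ge_max T0 ge_min lexx orbT.
Qed.

Lemma clamp_id T t : 0 <= t <= T -> clamp T t = t.
Proof. by case/andP => t0 tT; rewrite /clamp (min_idPl tT) (max_idPr t0). Qed.

Lemma clamp_lip T s t : `|clamp T s - clamp T t| <= `|s - t|.
Proof.
wlog st : s t / s <= t.
  move=> H; have [/H//|/ltW/H] := leP s t.
  by rewrite distrC (distrC t).
have mono : clamp T s <= clamp T t.
  rewrite /clamp.
  by case: (lerP s T) => h1; case: (lerP t T) => h2; case: (lerP 0 s) => h3;
    case: (lerP 0 t) => h4; case: (lerP 0 T) => h5; lra.
rewrite distrC (distrC s) !ger0_norm ?subr_ge0//.
rewrite /clamp.
by case: (lerP s T) => h1; case: (lerP t T) => h2; case: (lerP 0 s) => h3;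
    case: (lerP 0 t) => h4; case: (lerP 0 T) => h5; lra.
Qed.

End more_calculus.

Section flows.
Context {R : realType} {d d1 : nat} {A : Type}.
Implicit Types (E : bellman_data R d d1 A) (u ut : R -> 'rV[R]_d -> R).

(* Outside [0, T] the right-hand side is frozen, which makes u differentiable on the whole
   line. *)
Record flow E (h T : R) u ut : Prop := {
  flow_T : forall x, u T x = g_ E x;
  flow_eq : forall t x, ut t x = - Fop E h (clamp T t) (u (clamp T t)) x;
  flow_bd : exists M, forall t x, 0 <= t <= T -> `|u t x| <= M;
  flow_lip : exists C, forall s t x, `|u s x - u t x| <= C * `|s - t|;
  flow_der : exists C, forall s t x,
    `|u s x - u t x - ut t x * (s - t)| <= C * (`|s - t| + Num.sqrt `|s - t|) * `|s - t|;
  flow_mod : exists C, forall s t x,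
    `|ut s x - ut t x| <= C * (`|s - t| + Num.sqrt `|s - t|) }.

Lemma modulus_small (C e : R) : 0 < e ->
  exists2 r, 0 < r & forall s, 0 <= s -> s < r -> C * (s + Num.sqrt s) <= e.
Proof.
move=> e0; have C1 : 0 < `|C| + 1 by rewrite ltr_wpDl.
pose q := Num.min 1 (e / (2 * (`|C| + 1))).
have q0 : 0 < q by rewrite lt_min ltr01 divr_gt0// mulr_gt0.
have q1 : q <= 1 by rewrite ge_min lexx.
exists (q ^+ 2) => [|s s0 sq]; first by rewrite exprn_gt0.
have sqq : Num.sqrt s <= q.
  by apply: le_trans (ler_wsqrtr (ltW sq)) _; rewrite sqrtr_sqr gtr0_norm.
have sq' : s <= q by apply: le_trans (ltW sq) _; rewrite expr2 ler_piMr// ltW.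
apply: (@le_trans _ _ (`|C| * (q + q))).
  apply: (@le_trans _ _ (`|C| * (s + Num.sqrt s))).
    by rewrite ler_wpM2r ?ler_norm// addr_ge0// sqrtr_ge0.
  by rewrite ler_wpM2l// lerD.
have : q <= e / (2 * (`|C| + 1)) by rewrite ge_min lexx orbT.
rewrite ler_pdivlMr ?mulr_gt0// => qq; apply: le_trans qq.
have -> : `|C| * (q + q) = q * (2 * (`|C| + 1)) - 2 * q by ring.
by move: q0; lra.
Qed.

Lemma modulus_continuous (G : R -> R) C :
  (forall s t, `|G s - G t| <= C * (`|s - t| + Num.sqrt `|s - t|)) -> continuous G.
Proof.
move=> H t; apply/cvgrPdist_le => /= e e0; have [r r0 Hr] := modulus_small C e0.
apply/nbhs_ballP; exists r => // s; rewrite /ball/= => sr.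
by apply: le_trans (H _ _) _; apply: Hr.
Qed.

Lemma modulus_der_on (a b t l C : R) (y : R -> R) :
  (forall s, `|y s - y t - l * (s - t)| <= C * (`|s - t| + Num.sqrt `|s - t|) * `|s - t|) ->
  der_on a b y t l.
Proof.
move=> H e e0; have [r r0 Hr] := modulus_small C e0; exists r => // s _ sr.
by apply: le_trans (H s) _; rewrite ler_wpM2r//; apply: Hr.
Qed.

Lemma lipschitz_within (D : set R) (y : R -> R) C :
  (forall s t, `|y s - y t| <= C * `|s - t|) -> {within D, continuous y}.
Proof.
move=> H; apply: continuous_subspaceT => t; apply: (@modulus_continuous y C) => {}t s.
apply: le_trans (H _ _) _; rewrite ler_wpM2l ?lerDl ?sqrtr_ge0//.
have := H 1 0; rewrite subr0 normr1 mulr1; exact: le_trans.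
Qed.

Section existence.
Context (E : bellman_data R d d1 A) (K lambda h T : R) (alpha0 : A).
Hypotheses (GE : good K lambda E) (lam0 : 0 <= lambda) (h0 : 0 < h) (T0 : 0 < T).

Let K0 : 0 <= K := good_K_ge0 GE.
Let L := opnorm (d1 := d1) K lambda h.
Let L0 : 0 <= L := @opnorm_ge0 R d d1 A E K lambda h GE lam0 h0.
Let T0' : 0 <= T := ltW T0.

(** The Lipschitz bound in time makes the integrand [G u x] of the Picard map continuous. The map
    reproduces it with the constant [L * M + K], which does not involve [N]. *)
Let nice (M N : R) u : Prop := (forall (t : R) x, 0 <= t <= T -> `|u t x| <= M) /\
  (forall (s t : R) x, 0 <= s <= T -> 0 <= t <= T -> `|u s x - u t x| <= N * `|s - t|).

Let G u (x : 'rV[R]_d) r := Fop E h (clamp T r) (u (clamp T r)) x.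

Let G_mod M N u x : nice M N u -> 0 <= N -> forall s t, `|G u x s - G u x t| <=
  (L * N + K * (opvar (d1 := d1) K h * M + 1)) * (`|s - t| + Num.sqrt `|s - t|).
Proof.
move=> [uM uN] N0 s t.
have M0 : 0 <= M by apply: le_trans (uM 0 0 _); rewrite ?lexx.
have cs := clamp_bnd s T0'; have ct := clamp_bnd t T0'.
have V0 : 0 <= K * (opvar (d1 := d1) K h * M + 1).
  by rewrite mulr_ge0// addr_ge0// mulr_ge0// (opvar_ge0 GE).
apply: (@le_trans _ _ (L * (N * `|s - t|) + (K * Num.sqrt `|s - t|) *
    (opvar (d1 := d1) K h * M + 1))); last first.
  have LN : 0 <= L * N by rewrite mulr_ge0.
  have h1 : 0 <= L * N * Num.sqrt `|s - t| by rewrite mulr_ge0// sqrtr_ge0.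
  have h2 : 0 <= K * (opvar (d1 := d1) K h * M + 1) * `|s - t| by rewrite mulr_ge0.
  lra.
apply: (Fop_diff GE lam0 h0 alpha0) => [z|z|alpha]; [exact: uM|exact: uM|].
have hs psi : holder_half K psi -> `|psi (clamp T s) x - psi (clamp T t) x| <=
    K * Num.sqrt `|s - t|.
  move=> H; apply: le_trans (H _ _ _) _; rewrite ler_wpM2l// ler_wsqrtr// clamp_lip//.
apply: (Lop_diff GE lam0 h0).
- by move=> k; apply: hs; have [] := good_sigma GE alpha k.
- by move=> k; apply: hs; have [] := good_b GE alpha k.
- have [_ _ H] := good_c GE alpha; have := hs _ H.
  by rewrite opprB addrA subrK.
- by apply: hs; have [] := good_f GE alpha.
- move=> z; apply: le_trans (uN _ _ _ cs ct) _.
  by rewrite ler_wpM2l// clamp_lip.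
- by move=> z; exact: uM.
Qed.

Let G_cont M N u x : nice M N u -> 0 <= N -> continuous (G u x).
Proof. by move=> nu N0; apply: modulus_continuous (G_mod x nu N0). Qed.

Let P u (t : R) x : R := g_ E x + (prim (G u x) T - prim (G u x) t).

Let G_bound M N u x r : nice M N u -> `|G u x r| <= L * M + K.
Proof.
move=> [uM _]; apply: (Fop_bound GE lam0 h0 alpha0) => z; apply: uM.
exact: clamp_bnd.
Qed.

Let P_der M N u x s t : nice M N u -> 0 <= N ->
  `|P u s x - P u t x - (- G u x t) * (s - t)| <=
  (L * N + K * (opvar (d1 := d1) K h * M + 1)) * (`|s - t| + Num.sqrt `|s - t|) * `|s - t|.
Proof.
move=> nu N0.
have -> : P u s x - P u t x - (- G u x t) * (s - t) =
   - (prim (G u x) s - prim (G u x) t - G u x t * (s - t)) by rewrite /P; ring.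
rewrite normrN; apply: prim_near; first exact: G_cont nu N0.
move=> r rt; apply: le_trans (G_mod x nu N0 _ _) _.
apply: ler_wpM2l.
  have M0 : 0 <= M by case: nu => uM _; apply: le_trans (uM 0 0 _); rewrite ?lexx.
  by rewrite addr_ge0 ?mulr_ge0// addr_ge0// mulr_ge0// (opvar_ge0 GE).
by rewrite lerD// ler_wsqrtr.
Qed.

Let P_lip M N u s t x : nice M N u -> 0 <= N ->
  `|P u s x - P u t x| <= (L * M + K) * `|s - t|.
Proof.
move=> nu N0; wlog st : s t / s <= t.
  by move=> H; have [/H//|/ltW/H] := leP s t; rewrite distrC (distrC t).
have -> : P u s x - P u t x = prim (G u x) t - prim (G u x) s by rewrite /P; ring.
rewrite primB//; last exact: G_cont nu N0.
have := @segint_near R (G u x) s t 0 (L * M + K) (@G_cont M N u x nu N0) st.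
rewrite (distrC s) (ger0_norm (_ : 0 <= t - s)) ?subr_ge0// mul0r subr0; apply => r _.
by rewrite subr0; exact: G_bound nu.
Qed.

Let P_nice M N u : nice M N u -> 0 <= N -> nice (K + (L * M + K) * T) (L * M + K) (P u).
Proof.
move=> nu N0; have Lip s t x := @P_lip M N u s t x nu N0.
split => // t x /andP[t0 tT].
have PT : P u T x = g_ E x by rewrite /P subrr addr0.
have [/(_ 0 x) gK _ _] := good_g GE.
rewrite -[P u t x](subrK (P u T x)) addrC (le_trans (ler_normD _ _))// PT lerD//.
rewrite -PT (le_trans (Lip _ _ _))// ler_wpM2l//.
  have M0 : 0 <= M by case: nu => uM _; apply: le_trans (uM 0 0 _); rewrite ?lexx ?T0'.
  by rewrite addr_ge0// mulr_ge0.
by rewrite ler0_norm ?subr_le0// opprB gerBl.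
Qed.

Let kap : R := 2 * L.
Let W (t : R) : R := expR (kap * (T - t)).

(** In the norm weighted by [W], of rate [2 * L], the Picard map halves distances: the derivative of
    the difference is at most [L * Q * W], which is minus that of [Q / 2 * W]. No smallness of [T]
    is required. *)
Let contract M N M' N' u v Q : nice M N u -> nice M' N' v -> 0 <= N -> 0 <= N' ->
  (forall t x, 0 <= t <= T -> `|u t x - v t x| <= Q * W t) ->
  forall t x, 0 <= t <= T -> `|P u t x - P v t x| <= Q / 2 * W t.
Proof.
move=> nu nv N0 N'0 H.
have W0 t : 0 < W t by exact: expR_gt0.
have Q0 : 0 <= Q.
  have := H 0 0; rewrite lexx T0' => /(_ isT) H0.
  by rewrite -(pmulr_lge0 _ (W0 0)); exact: le_trans H0.
have key (M1 N1 M2 N2 : R) (u1 u2 : R -> 'rV[R]_d -> R) :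
  nice M1 N1 u1 -> nice M2 N2 u2 -> 0 <= N1 -> 0 <= N2 ->
  (forall t x, 0 <= t <= T -> `|u1 t x - u2 t x| <= Q * W t) ->
  forall t x, 0 <= t <= T -> P u1 t x - P u2 t x <= Q / 2 * W t.
  move=> n1 n2 N10 N20 H12 t x /andP[t0 tT].
  have dP M3 N3 u3 (s : R) : nice M3 N3 u3 -> 0 <= N3 ->
      der_on t T (fun r => P u3 r x) s (- G u3 x s).
    by move=> n3 N30; apply: modulus_der_on => r; exact: P_der n3 N30.
  pose z r := P u1 r x - P u2 r x - Q / 2 * W r.
  have cP M3 N3 u3 : nice M3 N3 u3 -> 0 <= N3 ->
      {within `[t, T], continuous (fun r => P u3 r x)}.
    by move=> n3 N30; apply: lipschitz_within => r r'; exact: P_lip n3 N30.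
  have zt : z t <= z T.
    apply: (@der_on_nondecreasing R t T z (fun r => - G u1 x r - - G u2 x r
      - Q / 2 * (- kap * W r)) tT).
    - apply: within_continuousB; first by apply: within_continuousB; [exact: cP n1 N10|exact: cP n2 N20].
      apply: within_continuousM; first exact: within_continuous_cst.
      apply: continuous_subspaceT => r; apply: continuous_comp; last exact: continuous_expR.
      apply: cvgM; first exact: cvg_cst.
      by apply: cvgB; [exact: cvg_cst|exact: cvg_id].
    - move=> r /andP[tr rT]; apply: der_onB; last by apply: der_onZ; exact: der_on_exp.
      by apply: der_onB; [exact: dP n1 N10|exact: dP n2 N20].
    - move=> r /andP[tr rT].
      have rT' : 0 <= r <= T by rewrite (le_trans t0 tr) ltW.
      have : `|G u1 x r - G u2 x r| <= L * (Q * W r).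
        rewrite /G (clamp_id rT'); apply: (Fop_diff GE lam0 h0 alpha0) => [w|w|alpha].
        + by apply: n1.1.
        + by apply: n2.1.
        by apply: (Lop_lip_function GE lam0 h0) => w; exact: H12.
      rewrite ler_norml /kap => /andP[_]; lra.
  have WT : W T = 1 by rewrite /W subrr mulr0 expR0.
  move: zt; rewrite /z WT /P subrr addr0; lra.
move=> t x tT; rewrite ler_norml; apply/andP; split; last exact: (key _ _ _ _ _ _ nu nv).
rewrite lerNl opprB; apply: (key _ _ _ _ _ _ nv nu) => // s y sT; rewrite distrC; exact: H.
Qed.
Lemma flow_exists : exists u ut, flow E h T u ut.
Proof.
have W0 t : 0 < W t by exact: expR_gt0.
have Wge t : t <= T -> 1 <= W t.
  by move=> tT; rewrite -expR0 ler_expR mulr_ge0 ?subr_ge0// mulr_ge0.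
pose u_ n := iter n P (fun _ => g_ E).
have [gK _ _] := good_g GE.
have nice0 : nice K 0 (u_ 0%N).
  by split => [t x _|s t x _ _]; [exact: gK 0 x|rewrite subrr normr0 mul0r].
have nice_n n : exists M N, 0 <= N /\ nice M N (u_ n).
  elim: n => [|n [M [N [N0 nu]]]]; first by exists K, 0.
  exists (K + (L * M + K) * T), (L * M + K); split; last exact: P_nice nu N0.
  have M0 : 0 <= M by case: nu => uM _; apply: le_trans (uM 0 0 _); rewrite ?lexx.
  by rewrite addr_ge0// mulr_ge0.
pose D := (L * K + K) * T.
have D0 : 0 <= D by rewrite mulr_ge0// addr_ge0// mulr_ge0.
have step n : forall t x, 0 <= t <= T -> `|u_ n.+1 t x - u_ n t x| <= D / 2 ^+ n * W t.
  elim: n => [|n IH] t x tT.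
    have -> : u_ 1%N t x - u_ 0%N t x = P (u_ 0%N) t x - P (u_ 0%N) T x.
      by rewrite [u_ 1%N]/(P (u_ 0%N)) [P _ T x]/P subrr addr0.
    apply: le_trans (P_lip t T x nice0 (lexx 0)) _.
    rewrite expr0 divr1 -[leLHS]mulr1; apply: ler_pM => //; last by rewrite Wge//; case/andP: tT.
      by rewrite mulr_ge0// addr_ge0// mulr_ge0.
    rewrite /D ler_wpM2l ?addr_ge0 ?mulr_ge0//.
    by case/andP: tT => t0 tT; rewrite ler0_norm ?subr_le0// opprB gerBl.
  have [M [N [N0 nu]]] := nice_n n.+1; have [M' [N' [N'0 nu']]] := nice_n n.
  have := contract nu nu' N0 N'0 IH x tT.
  by congr (_ <= _ * _); rewrite exprS invfM mulrCA mulrC.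
pose C := D * W 0.
have C0 : 0 <= C by rewrite mulr_ge0// ltW.
have p2 n : 0 < (2 : R) ^+ n by rewrite exprn_gt0.
have WW t : 0 <= t -> W t <= W 0.
  by move=> t0; rewrite ler_expR ler_wpM2l ?mulr_ge0// lerD2l lerN2.
have stepC n t x : 0 <= t <= T -> `|u_ n.+1 t x - u_ n t x| <= C / 2 ^+ n.
  move=> tT; apply: le_trans (step n t x tT) _; rewrite /C mulrAC ler_pM2r ?invr_gt0//.
  by rewrite ler_wpM2l// WW//; case/andP: tT.
have : forall tx : R * 'rV[R]_d, exists l, 0 <= tx.1 <= T ->
    forall n, `|l - u_ n tx.1 tx.2| <= 2 * C / 2 ^+ n.
  move=> [t x] /=; have [tT|ntT] := boolP (0 <= t <= T); last by exists 0.
  by have [l Hl] := geometric_limit (fun n => stepC n t x tT); exists l.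
move=> /choice[f Hf]; pose u t x := f (t, x).
have lim t x n : 0 <= t <= T -> `|u t x - u_ n t x| <= 2 * C / 2 ^+ n.
  by move=> tT; exact: (Hf (t, x)).
have small c e : 0 <= c -> 0 < e -> exists n, c / (2 : R) ^+ n <= e.
  move=> c0 e0; exists (Num.bound (c / e)); rewrite ler_pdivrMr// mulrC -ler_pdivrMr//.
  apply: ltW; apply: lt_le_trans (archi_boundP _) _; first by rewrite divr_ge0// ltW.
  by rewrite -natrX ler_nat ltnW// ltn_expl.
pose M := K + 4 * C.
have M0 : 0 <= M by rewrite addr_ge0// mulr_ge0.
have c2 n : 2 * C / 2 ^+ n <= 2 * C.
  rewrite ler_pdivrMr//; apply: ler_peMr; first by rewrite mulr_ge0.
  by apply: exprn_ege1; rewrite ler1n.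
have uM2 t x : 0 <= t <= T -> `|u t x| <= K + 2 * C.
  move=> tT; rewrite -[u t x](subrK (u_ 0%N t x)) (le_trans (ler_normD _ _))// addrC lerD//.
    exact: gK 0 x.
  by apply: le_trans (lim t x 0%N tT) _; exact: c2.
have unM n t x : 0 <= t <= T -> `|u_ n t x| <= M.
  move=> tT; have := lim t x n tT; have := c2 n; have := uM2 t x tT.
  by rewrite /M !ler_norml; lra.
pose N := L * M + K.
have N0 : 0 <= N by rewrite addr_ge0// mulr_ge0.
have nice_un n : nice M N (u_ n).
  split => [t x tT|s t x sT tT]; first exact: unM.
  case: n => [|n]; first by rewrite subrr normr0 mulr_ge0.
  have [M1 [N1 [N10 nu]]] := nice_n n.
  apply: (@P_lip M N1 (u_ n) s t x) => //; split; first exact: unM.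
  by case: nu.
have nice_u : nice M N u.
  split => [t x tT|s t x sT tT].
    by apply: le_trans (uM2 t x tT) _; rewrite /M; lra.
  apply/ler_addgt0Pr => e e0; have [n Hn] := small (4 * C) e (mulr_ge0 (ler0n _ _) C0) e0.
  have := (nice_un n).2 s t x sT tT.
  have := lim s x n sT; have := lim t x n tT.
  rewrite (_ : 4 * C / 2 ^+ n = 2 * C / 2 ^+ n + 2 * C / 2 ^+ n) in Hn; last by ring.
  by move: Hn; rewrite !ler_norml; lra.
have fix_u t x : 0 <= t <= T -> P u t x = u t x.
  move=> tT; apply/eqP; rewrite -subr_eq0 -normr_le0; apply/ler_addgt0Pr => e e0.
  have CC : 0 <= 2 * C by rewrite mulr_ge0.
  have E0 : 0 <= 2 * C * W 0 + 2 * C by rewrite addr_ge0// mulr_ge0// ltW.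
  have [n Hn] := small _ e E0 e0.
  have H s y : 0 <= s <= T -> `|u s y - u_ n s y| <= 2 * C / 2 ^+ n * W s.
    move=> sT; apply: le_trans (lim s y n sT) _.
    rewrite ler_peMr ?Wge//; last by case/andP: sT.
    by rewrite divr_ge0// ltW.
  have H1 := contract nice_u (nice_un n) N0 N0 H x tT.
  have H2 := lim t x n.+1 tT.
  have q0 : 0 <= C / 2 ^+ n by rewrite divr_ge0// ltW.
  have WW0 : C / 2 ^+ n * W t <= C / 2 ^+ n * W 0.
    by rewrite ler_wpM2l// WW//; case/andP: tT.
  have qW : 0 <= C / 2 ^+ n * W 0 by rewrite mulr_ge0// ltW.
  have e1 : 2 * C / 2 ^+ n.+1 = C / 2 ^+ n by rewrite exprS; field; rewrite gt_eqF.
  rewrite e1 in H2.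
  have e2 : 2 * C / 2 ^+ n / 2 * W t = C / 2 ^+ n * W t by field; rewrite gt_eqF.
  rewrite e2 in H1.
  have e3 : (2 * C * W 0 + 2 * C) / 2 ^+ n = 2 * (C / 2 ^+ n * W 0) + 2 * (C / 2 ^+ n).
    by field; rewrite gt_eqF.
  rewrite e3 in Hn.
  have {}H1 : `|P u t x - u_ n.+1 t x| <= C / 2 ^+ n * W t by exact: H1.
  rewrite add0r; move: Hn H1 H2; rewrite !ler_norml; lra.
(* [P u] and not [u]: they agree on [[0, T]], but outside it [u] is arbitrary whereas [P u] is
   differentiable at every time. *)
exists (P u), (fun t x => - G u x t); split.
- by move=> x; rewrite /P subrr addr0.
- move=> t x; rewrite /G; congr (- Fop _ _ _ _ _); apply/funext => y.
  by rewrite fix_u//; exact: clamp_bnd.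
- by exists M => t x tT; rewrite fix_u//; exact: nice_u.1.
- by exists (L * M + K) => s t x; exact: P_lip nice_u N0.
- by exists (L * N + K * (opvar (d1 := d1) K h * M + 1)) => s t x; exact: P_der nice_u N0.
- exists (L * N + K * (opvar (d1 := d1) K h * M + 1)) => s t x.
  by rewrite -opprD normrN; exact: G_mod nice_u N0 _ _.
Qed.

End existence.
End flows.

Section flow_properties.
Context {R : realType} {d d1 : nat}.

Lemma supersol_cst (A : Type) (E : bellman_data R d d1 A) h a b e beta nu :
  (forall t x alpha, a <= t < b ->
     - nu - c_ E alpha t x * (beta + nu * (b - t)) + f_ E alpha t x <= e) ->
  supersol E h a b e (fun t _ => beta + nu * (b - t)) (fun _ _ => - nu).
Proof.
move=> H; split; last first.
  by move=> t x alpha tab; rewrite /Lop Lin_cst mulNr addrA; exact: H.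
split=> [x|t x tab].
  apply: within_continuousD; first exact: within_continuous_cst.
  apply: within_continuousM; first exact: within_continuous_cst.
  apply: within_continuousB; first exact: within_continuous_cst.
  by apply: continuous_subspaceT => z; exact: cvg_id.
have -> : - nu = 0 + nu * (0 - 1) by ring.
apply: der_onD; first exact: der_on_cst.
by apply: der_onZ; apply: der_onB; [exact: der_on_cst|exact: der_on_id].
Qed.

Lemma evol_sub (a b a' b' : R) (u ut : R -> 'rV[R]_d -> R) : a <= a' -> b' <= b ->
  evol a b u ut -> evol a' b' u ut.
Proof.
move=> aa bb [cu du]; split => [x|t x /andP[at_ tb]].
  apply: continuous_subspaceW (cu x) => t /=; rewrite !in_itv/= => /andP[h1 h2].
  by rewrite (le_trans aa h1) (le_trans h2 bb).
by apply: der_on_sub (du t x _) => //; rewrite (le_trans aa at_) (lt_le_trans tb bb).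
Qed.

Lemma evolN (a b : R) (u ut : R -> 'rV[R]_d -> R) : evol a b u ut ->
  evol a b (fun t x => - u t x) (fun t x => - ut t x).
Proof.
move=> [cu du]; split => [x|t x tab]; last by apply: der_onN; exact: du.
by move=> t; apply: cvgN; exact: cu.
Qed.

Lemma subsol_sub (A : Type) (E : bellman_data R d d1 A) h a b a' b' u ut :
  a <= a' -> b' <= b -> subsol E h a b u ut -> subsol E h a' b' u ut.
Proof.
move=> aa bb [ev H]; split; first exact: evol_sub ev.
by move=> t x e /andP[h1 h2]; apply: H; rewrite (le_trans aa h1) (lt_le_trans h2 bb).
Qed.

Lemma supersol_sub (A : Type) (E : bellman_data R d d1 A) h a b e a' b' u ut :
  a <= a' -> b' <= b -> supersol E h a b e u ut -> supersol E h a' b' e u ut.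
Proof.
move=> aa bb [ev H]; split; first exact: evol_sub ev.
by move=> t x alpha /andP[h1 h2]; apply: H; rewrite (le_trans aa h1) (lt_le_trans h2 bb).
Qed.

Lemma closeto_sym (A : Type) D (E E' : bellman_data R d d1 A) :
  closeto D E E' -> closeto D E' E.
Proof.
move=> [h1 h2]; split => [k|alpha t x]; first by rewrite h1.
have [a1 a2 a3 a4] := h2 alpha t x.
by split => [k|k||]; rewrite distrC.
Qed.

(** The Bernstein estimate admits only perturbations of size at most [h], hence only displacements
    of that length; cutting a long displacement into short ones removes the restriction. *)
Lemma lipschitz_chain (p : 'rV[R]_d -> R) (r C : R) : 0 < r ->
  (forall x y, enorm y <= r -> `|p (x + y) - p x| <= C * enorm y) ->
  forall x y, `|p (x + y) - p x| <= C * enorm y.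
Proof.
move=> r0 H.
have step n x y : enorm y <= n.+1%:R * r -> `|p (x + y) - p x| <= C * enorm y.
  elim: n x y => [|n IH] x y; first by rewrite mul1r; exact: H.
  have m0 : 0 < n.+2%:R :> R by rewrite ltr0n.
  have mE : n.+2%:R = n.+1%:R + 1 :> R by rewrite -natr1.
  move=> yn; pose s : R := n.+1%:R / n.+2%:R.
  have s0 : 0 <= s by rewrite divr_ge0.
  have s1 : 1 - s = n.+2%:R^-1.
    apply: (mulIf (lt0r_neq0 m0)).
    by rewrite mulrBl mul1r divfK ?gt_eqF// mulVf ?gt_eqF// mE addrC addKr.
  have s10 : 0 <= 1 - s by rewrite s1 invr_ge0.
  have yE : x + y = (x + s *: y) + (1 - s) *: y.
    by rewrite -addrA -scalerDl addrCA subrr addr0 scale1r.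
  have h1 : `|p (x + s *: y) - p x| <= C * (s * enorm y).
    have := IH x (s *: y); rewrite enormZ ger0_norm//; apply.
    apply: le_trans (ler_wpM2l s0 yn) _; apply: eq_ler; rewrite /s; field.
    by rewrite gt_eqF.
  have h2 : `|p (x + y) - p (x + s *: y)| <= C * ((1 - s) * enorm y).
    rewrite yE; have := H (x + s *: y) ((1 - s) *: y); rewrite enormZ ger0_norm//; apply.
    by rewrite s1 mulrC ler_pdivrMr// mulrC.
  move: h1 h2; rewrite !ler_norml; lra.
move=> x y; apply: (step (Num.bound (enorm y / r))).
rewrite -ler_pdivrMr//; apply: ltW.
apply: lt_le_trans (archi_boundP _) _; first by rewrite divr_ge0 ?enorm_ge0 ?ltW.
by rewrite ler_nat.
Qed.

Context {A : Type} (alpha0 : A).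
Implicit Types E : bellman_data R d d1 A.

Section solutions.
Context (E : bellman_data R d d1 A) (K lambda h T : R) (u ut : R -> 'rV[R]_d -> R).
Hypotheses (GE : good K lambda E) (lam0 : 0 <= lambda) (h0 : 0 < h) (T0 : 0 < T).
Hypothesis (fu : flow E h T u ut).

Lemma flow_evol : evol 0 T u ut.
Proof.
split => [x|t x tT].
  by have [C H] := flow_lip fu; apply: lipschitz_within => s t; exact: H.
by have [C H] := flow_der fu; apply: modulus_der_on => s; exact: H.
Qed.

Let bd t : 0 <= t < T -> exists M, forall x, `|u t x| <= M.
Proof.
by move=> /andP[t0 tT]; have [M H] := flow_bd fu; exists M => x; apply: H; rewrite t0 ltW.
Qed.

Lemma flow_subsol : subsol E h 0 T u ut.
Proof.
split; first exact: flow_evol.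
move=> t x e tT e0; have [M uM] := bd tT.
have [alpha Ha] := Fop_adherent GE lam0 h0 alpha0 t x uM e0.
exists alpha; rewrite (flow_eq fu) clamp_id; last by case/andP: tT => -> /ltW.
lra.
Qed.

Lemma flow_supersol : supersol E h 0 T 0 u ut.
Proof.
split; first exact: flow_evol.
move=> t x alpha tT; have [M uM] := bd tT.
rewrite (flow_eq fu) clamp_id; last by case/andP: tT => -> /ltW.
by have := Lop_le_Fop GE lam0 h0 alpha0 alpha t x uM; lra.
Qed.

(** The source, at most [K], is paid by the slope [K * theta] of the barrier and by the discount,
    which yields at least [(1 - theta) * K] because the barrier stays above [K]. *)
Lemma flow_bounded theta : 0 <= theta -> 1 - theta <= lambda -> forall t x, 0 <= t <= T ->
  `|u t x| <= K + K * theta * (T - t).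
Proof.
move=> th0 thl.
have K0 : 0 <= K := good_K_ge0 GE.
have nu0 : 0 <= K * theta by rewrite mulr_ge0.
have [M uM] := flow_bd fu.
have [gK _ _] := good_g GE.
have fK t x alpha : `|f_ E alpha t x| <= K by have [] := good_f GE alpha.
have KK : K <= K * theta + lambda * K.
  rewrite [lambda * K]mulrC -mulrDr ler_peMr//; lra.
have w0 t : t <= T -> K <= K + K * theta * (T - t).
  by move=> tT; rewrite lerDl mulr_ge0// subr_ge0.
have cw t x alpha : t <= T -> lambda * K <= c_ E alpha t x * (K + K * theta * (T - t)).
  by move=> tT; apply: ler_pM => //; [exact: (good_c_ge GE)|exact: w0].
have Bsup : supersol E h 0 T 0 (fun t _ => K + K * theta * (T - t)) (fun _ _ => - (K * theta)).
  apply: supersol_cst => t x alpha /andP[t0 /ltW tT].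
  have := cw t x alpha tT; have := fK t x alpha; rewrite ler_norml; lra.
have Bsub : subsol E h 0 T (fun t _ => - (K + K * theta * (T - t))) (fun _ _ => - - (K * theta)).
  split; first by have := evolN Bsup.1.
  move=> t x e /andP[t0 /ltW tT] e0; exists alpha0; rewrite /Lop Lin_cst.
  have := cw t x alpha0 tT; have := fK t x alpha0; rewrite ler_norml; lra.
move=> t x tT; have bnd s : 0 <= s <= T -> 0 <= K + K * theta * (T - s).
  by case/andP => _ sT; apply: le_trans (w0 s sT).
rewrite ler_norml; apply/andP; split.
  have := comparison GE lam0 h0 (ltW T0) Bsub flow_supersol (beta := 0) (nu := 0).
  rewrite mulr0 addr0 => H.
  have : - (K + K * theta * (T - t)) - u t x <= 0 + 0 * (T - t).
    apply: H => //.
      exists M => s y sT; have := uM s y sT; have := bnd s sT; rewrite ler_norml; lra.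
    move=> y; rewrite subrr mulr0 addr0 (flow_T fu); have := gK 0 y; rewrite ler_norml; lra.
  lra.
have := comparison GE lam0 h0 (ltW T0) flow_subsol Bsup (beta := 0) (nu := 0).
rewrite mulr0 addr0 => H.
have : u t x - (K + K * theta * (T - t)) <= 0 + 0 * (T - t).
  apply: H => //.
    exists M => s y sT; have := uM s y sT; have := bnd s sT; rewrite ler_norml; lra.
  move=> y; rewrite subrr mulr0 addr0 (flow_T fu); have := gK 0 y; rewrite ler_norml; lra.
lra.
Qed.

End solutions.
End flow_properties.

(** * Lipschitz bounds and shaken coefficients *)

Section lipschitz_estimates.
Context {R : realType} {d d1 : nat}.

Definition discount (K : R) : R := cdrate (d1 := d1) K + 1.

(** The first summand makes the threshold [B] large enough for [cd_estimate], the second bounds the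
    Bernstein quantity at the terminal time. *)
Definition cdbase (K M0 : R) : R :=
  (cdlin (d1 := d1) K * (M0 + 1) + 1) ^+ 2 + (ndirs (d1 := d1) + 1) * (K ^+ 2) ^+ 2.

(* Here and below [theta] interpolates between the general case [theta = 1] and the case
   [theta = 0] of a large discount; constants depend on [theta * T] only. *)
Definition lipc (K Tt : R) : R :=
  Num.sqrt (expR (cdrate (d1 := d1) K * Tt) * cdbase K (K + K * Tt)).

Lemma cdquad_ge0 (K : R) : 0 <= cdquad (d1 := d1) K.
Proof.
have n0 : 0 <= njets (R := R) (d1 := d1) by [].
have p1 : 0 <= 23 * njets (R := R) (d1 := d1) + 16 * njets (R := R) (d1 := d1) ^+ 2.
  by rewrite addr_ge0// mulr_ge0// sqr_ge0.
by rewrite /cdquad mulr_ge0// addr_ge0// mulr_ge0 ?sqr_ge0// mulr_ge0.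
Qed.

Lemma cdrate_ge1 (K : R) : 1 <= cdrate (d1 := d1) K.
Proof. by rewrite /cdrate lerDr cdquad_ge0. Qed.

Lemma lipc_ge0 K Tt : 0 <= lipc K Tt. Proof. exact: sqrtr_ge0. Qed.

Lemma cdbase_ge0 K M0 : 0 <= cdbase K M0.
Proof. by rewrite /cdbase addr_ge0 ?sqr_ge0// mulr_ge0 ?sqr_ge0// addr_ge0. Qed.

Context {A : Type} (alpha0 : A).
Implicit Types E : bellman_data R d d1 A.
Context (K lambda h theta T : R).
Hypotheses (K1 : 1 <= K) (lam0 : 0 <= lambda) (h0 : 0 < h) (T0 : 0 < T).
Hypotheses (th : 0 <= theta <= 1) (thl : discount K * (1 - theta) <= lambda).

Let K0 : 0 <= K := le_trans ler01 K1.
Let th0 : 0 <= theta. Proof. by case/andP: th. Qed.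
Let th1 : 0 <= 1 - theta. Proof. by rewrite subr_ge0; case/andP: th. Qed.
Let thl1 : 1 - theta <= lambda.
Proof.
apply: le_trans thl; rewrite ler_peMl// /discount.
by have := cdrate_ge1 K; lra.
Qed.

Lemma theta_rate : cdrate (d1 := d1) K <= cdrate (d1 := d1) K * theta + 2 * lambda.
Proof.
have := thl; have := lam0; have := th1; rewrite /discount mulrDl mul1r; lra.
Qed.

Lemma flow_bounded0 E u ut t x : good K lambda E -> flow E h T u ut -> 0 <= t <= T ->
  `|u t x| <= K + K * (theta * T).
Proof.
move=> G fu tT; apply: le_trans (flow_bounded alpha0 G lam0 h0 T0 fu th0 thl1 x tT) _.
rewrite lerD2l mulrA ler_wpM2l ?mulr_ge0// gerBl; by case/andP: tT.
Qed.

Lemma fd1_terminal E k x : good K lambda E -> `|fd1 h (ell_ E k) (g_ E) x| <= K ^+ 2.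
Proof.
move=> G; have [_ /(_ 0 (x + h *: ell_ E k) x) H _] := good_g G.
have hi0 : 0 < h^-1 by rewrite invr_gt0.
rewrite /fd1 normrM (gtr0_norm hi0) ler_pdivrMr//.
apply: le_trans H _; rewrite addrAC subrr add0r enormZ gtr0_norm// expr2 -mulrA.
by rewrite ler_wpM2l// mulrC ler_wpM2r ?(ltW h0)// (good_ell G).
Qed.

(** [cd_estimate] with [kappa = cdrate K * theta], of which only the member [(v - u) / eps] is kept:
    its negative part bounds [u - v] from above. The constant does not involve [h]. *)
Lemma flow_cd_oneside E E' u ut v vt eps : good K lambda E -> good K lambda E' ->
  closeto (K ^+ 2 * eps) E E' -> 0 < eps -> eps <= h ->
  flow E h T u ut -> flow E' h T v vt ->
  (forall x, `|g_ E' x - g_ E x| <= K ^+ 2 * eps) ->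
  forall (t : R) x, 0 <= t <= T -> u t x - v t x <= eps * lipc K (theta * T).
Proof.
move=> G G' cE eps0 eh fu fv gg t x tT.
pose M0 := K + K * (theta * T).
have kap0 : 0 <= cdrate (d1 := d1) K * theta.
  by rewrite mulr_ge0// (le_trans ler01)// cdrate_ge1.
have BE : (cdlin (d1 := d1) K * (M0 + 1) + 1) ^+ 2 <= cdbase K M0.
  by rewrite /cdbase lerDl mulr_ge0 ?sqr_ge0// addr_ge0.
have term y : negp ((v T y - u T y) / eps) ^+ 2 +
     \sum_k negp (fd1 h (ell_ E k) (u T) y) ^+ 2 <= cdbase K M0.
  have np (r : R) : `|r| <= K ^+ 2 -> negp r ^+ 2 <= (K ^+ 2) ^+ 2.
    move=> rK; rewrite ler_pXn2r ?nnegrE ?negp_ge0 ?sqr_ge0// /negp ge_max sqr_ge0/=.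
    by apply: le_trans rK; rewrite -normrN ler_norm.
  apply: (@le_trans _ _ ((K ^+ 2) ^+ 2 + \sum_(k : dindex d1) (K ^+ 2) ^+ 2)).
    apply: lerD.
      apply: np; rewrite (flow_T fu) (flow_T fv) normrM.
      by rewrite (@gtr0_norm _ eps^-1) ?invr_gt0// ler_pdivrMr.
    apply: ler_sum => k _; apply: np.
    have -> : u T = g_ E by apply/funext => z; exact: (flow_T fu).
    exact: fd1_terminal.
  rewrite sumr_cst -/ndirs /cdbase.
  by have := sqr_ge0 (cdlin (d1 := d1) K * (M0 + 1) + 1); rewrite mulrDl mul1r; lra.
have uM (s : R) y : 0 <= s <= T -> `|u s y| <= M0 by exact: flow_bounded0 G fu.
have vM (s : R) y : 0 <= s <= T -> `|v s y| <= M0 by exact: flow_bounded0 G' fv.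
have := cd_estimate G G' eps0 eh cE kap0 theta_rate (ltW T0)
  (flow_subsol alpha0 G lam0 h0 fu) (flow_supersol alpha0 G lam0 h0 fu)
  (flow_supersol alpha0 G' lam0 h0 fv) uM vM BE term x tT.
set V := negp _ ^+ 2; set S := \sum_k _ => VS.
have S0 : 0 <= S by apply: sumr_ge0 => k _; exact: sqr_ge0.
have VL : V <= lipc K (theta * T) ^+ 2.
  rewrite sqr_sqrtr; last by rewrite mulr_ge0 ?expR_ge0 ?cdbase_ge0.
  apply: (@le_trans _ _ (expR (cdrate (d1 := d1) K * theta * (T - t)) * cdbase K M0)).
    by apply: le_trans VS; rewrite lerDl.
  rewrite ler_wpM2r ?cdbase_ge0// ler_expR -mulrA ler_wpM2l//.
    by rewrite (le_trans ler01)// cdrate_ge1.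
  by rewrite ler_wpM2l// gerBl; case/andP: tT.
have : negp ((v t x - u t x) / eps) <= lipc K (theta * T).
  by move: VL; rewrite /V ler_pXn2r ?nnegrE ?negp_ge0 ?lipc_ge0.
have := negp_ge ((v t x - u t x) / eps) => H1 H2.
have := le_trans H1 H2; rewrite -mulNr opprB ler_pdivrMr// mulrC; lra.
Qed.

Lemma flow_cd E E' u ut v vt eps : good K lambda E -> good K lambda E' ->
  closeto (K ^+ 2 * eps) E E' -> 0 < eps -> eps <= h ->
  flow E h T u ut -> flow E' h T v vt ->
  (forall x, `|g_ E' x - g_ E x| <= K ^+ 2 * eps) ->
  forall t x, 0 <= t <= T -> `|v t x - u t x| <= lipc K (theta * T) * eps.
Proof.
move=> G G' cE eps0 eh fu fv gg t x tT.
have H1 := flow_cd_oneside G G' cE eps0 eh fu fv gg x tT.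
have H2 := flow_cd_oneside G' G (closeto_sym cE) eps0 eh fv fu
  (fun y => etrans (congr1 (fun z => z <= _) (distrC _ _)) (gg y)) x tT.
by rewrite mulrC ler_norml; move: H1 H2; lra.
Qed.

Lemma flow_shift E u ut y : flow E h T u ut ->
  flow (shiftE y E) h T (fun t x => u t (x + y)) (fun t x => ut t (x + y)).
Proof.
move=> [H1 H2 [M H3] [C4 H4] [C5 H5] [C6 H6]]; split.
- by move=> x; exact: H1.
- move=> t x; rewrite H2; congr (- _); rewrite /Fop; congr sup.
  by apply/seteqP; split => _ [alpha _ <-]; exists alpha => //; rewrite (@Lop_shift _ _ _ _ E).
- by exists M => t x; exact: H3.
- by exists C4 => s t x; exact: H4.
- by exists C5 => s t x; exact: H5.
- by exists C6 => s t x; exact: H6.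
Qed.

(** A translate of the solution solves the translated problem, which is within [K * enorm y] of the
    original; [1 <= K] brings this into the form [K ^+ 2 * eps] with [eps = enorm y]. *)
Lemma flow_lipschitz E u ut : good K lambda E -> flow E h T u ut ->
  forall t x y, 0 <= t <= T -> `|u t (x + y) - u t x| <= lipc K (theta * T) * enorm y.
Proof.
move=> G fu t x y tT; apply: (lipschitz_chain h0) => {}x {}y yh.
have [y0|y0] := eqVneq (enorm y) 0.
  have -> : y = 0.
    apply/rowP => i; rewrite mxE; apply/eqP; rewrite -normr_le0 -y0.
    exact: coord_le_enorm.
  by rewrite addr0 subrr normr0 mulr_ge0 ?lipc_ge0 ?enorm_ge0.
have yp : 0 < enorm y by rewrite lt_def y0 enorm_ge0.
have KK : K * enorm y <= K ^+ 2 * enorm y.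
  by rewrite expr2 -mulrA ler_peMl// mulr_ge0// ltW.
apply: (flow_cd G (good_shift y G) (closeto_shift G KK) yp yh fu (flow_shift y fu) _ x tT).
move=> z /=; have [_ /(_ 0 (z + y) z) H _] := good_g G.
by apply: le_trans H _; rewrite addrAC subrr add0r.
Qed.

End lipschitz_estimates.

Section shaken_coefficients.
Context {R : realType} {d d1 : nat} {A : Type} (alpha0 : A).
Implicit Types E : bellman_data R d d1 A.

Definition shakes (rho : R) : Type := (A * {y : 'rV[R]_d | enorm y <= rho})%type.

(** The factor [s] deforms the original coefficients ([s = 0]) into the shaken ones ([s = 1]), so
    that a radius [rho] larger than [h] is reached in steps that [flow_cd] admits. *)
Definition shakeE (s rho : R) E : bellman_data R d d1 (shakes rho) :=
  BellmanData (ell_ E)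
    (fun beta k t x => sigma_ E beta.1 k t (x + s *: sval beta.2))
    (fun beta k t x => b_ E beta.1 k t (x + s *: sval beta.2))
    (fun beta t x => c_ E beta.1 t (x + s *: sval beta.2))
    (fun beta t x => f_ E beta.1 t (x + s *: sval beta.2)) (g_ E).

Lemma good_shake K lambda s rho E : good K lambda E -> good K lambda (shakeE s rho E).
Proof.
move=> G; split => //=; try by case: G.
- by move=> beta k; exact: coef_shift (good_sigma G beta.1 k).
- by move=> beta k; exact: coef_shift (good_b G beta.1 k).
- by move=> beta; exact: coef_shift (good_c G beta.1).
- by move=> beta; exact: coef_shift (good_f G beta.1).
Qed.

Lemma closeto_shake K lambda s s' rho E : good K lambda E ->
  closeto (K * (`|s' - s| * rho)) (shakeE s rho E) (shakeE s' rho E).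
Proof.
move=> G; have K0 := good_K_ge0 G; split => // -[alpha [y yr]] t x /=.
have D : K * enorm (x + s' *: y - (x + s *: y)) <= K * (`|s' - s| * rho).
  rewrite ler_wpM2l// opprD addrACA subrr add0r -scalerBl enormZ ler_wpM2l//.
split => [k|k||].
- by have [_ H _] := good_sigma G alpha k; exact: le_trans (H t _ _) D.
- by have [_ H _] := good_b G alpha k; exact: le_trans (H t _ _) D.
- have [_ H _] := good_c G alpha; apply: le_trans D.
  by have := H t (x + s' *: y) (x + s *: y); rewrite opprB addrA subrK.
- by have [_ H _] := good_f G alpha; exact: le_trans (H t _ _) D.
Qed.

Lemma Lop_shake s rho E h (beta : shakes rho) t p x :
  Lop (shakeE s rho E) h beta t p x =
  Lop E h beta.1 t (fun z => p (z - s *: sval beta.2)) (x + s *: sval beta.2).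
Proof.
set y := s *: sval beta.2.
rewrite /Lop /Lin /= -/y; congr (_ + _ - _ + _); try apply: eq_bigr => k _.
- congr (_ * _); rewrite /fd2 addrK (addrAC x y) addrK.
  by rewrite (addrAC x y (- _)) addrK.
- by congr (_ * _); rewrite /fd1 addrK (addrAC x y) addrK.
- by rewrite addrK.
Qed.

Lemma flow_shake0 E h T rho u ut : 0 <= rho -> flow E h T u ut ->
  flow (shakeE 0 rho E) h T u ut.
Proof.
move=> r0 [H1 H2 H3 H4 H5 H6]; split => // t x; rewrite H2; congr (- _); congr sup.
have LE (beta : shakes rho) : Lop (shakeE 0 rho E) h beta (clamp T t) (u (clamp T t)) x =
    Lop E h beta.1 (clamp T t) (u (clamp T t)) x.
  rewrite Lop_shake scale0r addr0; congr Lop; apply/funext => z.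
  by rewrite subr0.
have e0 : enorm (0 : 'rV[R]_d) <= rho by rewrite enorm0.
apply/seteqP; split => _ [beta _ <-].
  by exists (beta, exist _ 0 e0) => //; rewrite LE.
by exists beta.1 => //; rewrite LE.
Qed.

Context (K lambda h theta T : R).
Hypotheses (K1 : 1 <= K) (lam0 : 0 <= lambda) (h0 : 0 < h) (T0 : 0 < T).
Hypotheses (th : 0 <= theta <= 1) (thl : discount (d1 := d1) K * (1 - theta) <= lambda).

Lemma flow_shake E u ut rho : good K lambda E -> flow E h T u ut -> 0 < rho ->
  exists v vt, flow (shakeE 1 rho E) h T v vt /\
    forall t x, 0 <= t <= T -> `|v t x - u t x| <= lipc (d1 := d1) K (theta * T) * rho.
Proof.
move=> G fu r0; pose n := Num.bound (rho / h); pose m : R := n.+1%:R.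
have m0 : 0 < m by rewrite ltr0n.
have rm0 : 0 < rho / m by rewrite divr_gt0.
have rh : rho / m <= h.
  rewrite ler_pdivrMr// mulrC -ler_pdivrMr//; apply: ltW.
  apply: lt_le_trans (archi_boundP _) _; first by rewrite divr_ge0 ?ltW.
  by rewrite ler_nat.
have K0 : 0 <= K := le_trans ler01 K1.
have e0 : enorm (0 : 'rV[R]_d) <= rho by rewrite enorm0 ltW.
suff H i : exists v vt, flow (shakeE (i%:R / m) rho E) h T v vt /\
    forall t x, 0 <= t <= T ->
      `|v t x - u t x| <= lipc (d1 := d1) K (theta * T) * (rho * (i%:R / m)).
  have [v [vt [fv Hv]]] := H n.+1; exists v, vt; split.
    by move: fv; rewrite divff// gt_eqF.
  by move=> t x tT; have := Hv t x tT; rewrite -/m divff ?gt_eqF// mulr1.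
elim: i => [|i [v [vt [fv Hv]]]].
  exists u, ut; rewrite mul0r; split; first by apply: flow_shake0 => //; exact: ltW.
  by move=> t x tT; rewrite subrr normr0 !mulr0.
have Gi := good_shake (i%:R / m) rho G; have GSi := good_shake (i.+1%:R / m) rho G.
pose beta0 : shakes rho := (alpha0, exist _ 0 e0).
have [w [wt fw]] := flow_exists beta0 GSi lam0 h0 T0.
exists w, wt; split => // t x tT.
have cl : closeto (K ^+ 2 * (rho / m)) (shakeE (i%:R / m) rho E) (shakeE (i.+1%:R / m) rho E).
  have [c1 c2] := closeto_shake (i%:R / m) (i.+1%:R / m) rho G.
  have D : K * (`|i.+1%:R / m - i%:R / m| * rho) <= K ^+ 2 * (rho / m).
    rewrite -mulrBl -natr1 addrAC subrr add0r mul1r (@ger0_norm _ m^-1) ?invr_ge0 ?(ltW m0)//.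
    by rewrite [m^-1 * _]mulrC expr2 -mulrA ler_peMl// mulr_ge0// ltW.
  split => // beta s y; have [a1 a2 a3 a4] := c2 beta s y.
  by split => [k|k||]; apply: le_trans D.
have H1 : `|w t x - v t x| <= lipc (d1 := d1) K (theta * T) * (rho / m).
  apply: (flow_cd beta0 K1 lam0 h0 T0 th thl Gi GSi cl rm0 rh fv fw) => // z /=.
  by rewrite subrr normr0 mulr_ge0 ?sqr_ge0// ltW.
have H2 := Hv t x tT.
have -> : lipc (d1 := d1) K (theta * T) * (rho * (i.+1%:R / m)) =
   lipc (d1 := d1) K (theta * T) * (rho / m) +
   lipc (d1 := d1) K (theta * T) * (rho * (i%:R / m)) by rewrite -natr1; ring.
by rewrite (le_trans (ler_distD (v t x) _ _))// lerD.
Qed.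

(** At the point [x + y] the control may pick the displacement [- y], which evaluates the
    coefficients at [x]; the translate by [y] therefore obeys the inequality of the unshaken problem
    at [x]. *)
Lemma flow_shake_le E v vt rho : good K lambda E -> 0 < rho ->
  flow (shakeE 1 rho E) h T v vt ->
  forall alpha t x y, 0 <= t < T -> enorm y <= rho ->
    vt t (x + y) + Lop E h alpha t (fun z => v t (z + y)) x <= 0.
Proof.
move=> G r0 fv alpha t x y tT yr.
have e0 : enorm (0 : 'rV[R]_d) <= rho by rewrite enorm0 ltW.
have yr' : enorm (- y) <= rho by rewrite enormN.
pose beta : shakes rho := (alpha, exist _ (- y) yr').
have := (flow_supersol (alpha0, exist _ 0 e0) (good_shake 1 rho G) lam0 h0 fv).2
  t (x + y) beta tT.
rewrite Lop_shake /= scale1r addrK.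
by under eq_fun do rewrite opprK.
Qed.

End shaken_coefficients.

(** * Averages along directions *)

Section primitives.
Context {R : realType}.

Lemma der_on_continuous (y l : R -> R) : (forall a b t, der_on a b y t (l t)) -> continuous y.
Proof.
move=> H t; apply/cvgrPdist_le => /= e e0.
have [r r0 Hr] := H (t - 1) (t + 1) t 1 ltr01.
have c0 : 0 < `|l t| + 1 by rewrite ltr_wpDl.
pose q := Num.min (Num.min r 1) (e / (`|l t| + 1)).
have q0 : 0 < q by rewrite !lt_min r0 ltr01 divr_gt0.
apply/nbhs_ballP; exists q => // s; rewrite /ball/= distrC => sq.
have sr : `|s - t| < r by apply: lt_le_trans sq _; rewrite !ge_min lexx.
have s1 : `|s - t| <= 1 by apply: le_trans (ltW sq) _; rewrite !ge_min lexx orbT.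
have se : `|s - t| <= e / (`|l t| + 1) by apply: le_trans (ltW sq) _; rewrite !ge_min lexx !orbT.
have sab : t - 1 <= s <= t + 1 by move: s1; rewrite ler_norml; lra.
have := Hr s sab sr; rewrite mul1r => {}Hr.
rewrite distrC -[y s - y t](subrK (l t * (s - t))) (le_trans (ler_normD _ _))// normrM.
move: se; rewrite ler_pdivlMr// => se; apply: le_trans se.
by rewrite [leRHS]mulrDr mulr1 addrC lerD// mulrC.
Qed.

Lemma prim_der_on (G : R -> R) a b t : continuous G -> der_on a b (prim G) t (G t).
Proof.
move=> cG e e0; have /cvgrPdist_le/(_ _ e0)/nbhs_ballP[r /= r0 Hr] := cG t.
exists r => // s _ sr; apply: prim_near => // u ur; rewrite distrC; apply: Hr.
by rewrite /ball/= distrC; apply: le_lt_trans ur sr.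
Qed.

Lemma der_on_shift a b (y : R -> R) t l r :
  der_on (a + r) (b + r) y (t + r) l -> der_on a b (fun s => y (s + r)) t l.
Proof.
move=> H e e0; have [q q0 Hq] := H e e0; exists q => // s sab sq.
have E : s + r - (t + r) = s - t by ring.
by have := Hq (s + r); rewrite E !lerD2r; exact.
Qed.

(** Two primitives of the same function: their difference has zero derivative, so it is
    nondecreasing with either sign. *)
Lemma segint_translate (G : R -> R) (r : R) : continuous G ->
  segint (fun s => G (s + r)) 0 1 = prim G (1 + r) - prim G r.
Proof.
move=> cG; pose H s := G (s + r).
have cH : continuous H.
  move=> s; apply: (@continuous_comp _ _ _ (fun s => s + r) G); last exact: cG.
  by apply: cvgD; [exact: cvg_id|exact: cvg_cst].
pose z (c t : R) := c * (prim H t - prim G (t + r)).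
have dz c a b t : der_on a b (z c) t (c * (H t - G (t + r))).
  apply: der_onZ; apply: der_onB; first exact: prim_der_on.
  by apply: der_on_shift; exact: prim_der_on.
have mono c : z c 0 <= z c 1.
  apply: (@der_on_nondecreasing _ 0 1 (z c) (fun t => c * (H t - G (t + r)))) => //.
    by apply: continuous_subspaceT; exact: der_on_continuous (dz c).
  by move=> t _; rewrite /H subrr mulr0.
have := mono 1; have := mono (-1); rewrite /z !mul1r !mulN1r add0r -primB//.
lra.
Qed.

End primitives.

Section steklov_averages.
Context {R : realType} {d : nat}.
Implicit Types (p q : 'rV[R]_d -> R) (v e x y : 'rV[R]_d) (L : R).

Definition lipx L p : Prop := forall x y, `|p (x + y) - p x| <= L * enorm y.

Lemma lipx_line_continuous L p x v : lipx L p -> continuous (fun s : R => p (x + s *: v)).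
Proof.
move=> Lp; apply: (@modulus_continuous _ _ (`|L| * enorm v)) => s t.
have -> : x + s *: v = (x + t *: v) + (s - t) *: v.
  by rewrite -addrA -scalerDl [t + _]addrC subrK.
apply: le_trans (Lp _ _) _; rewrite enormZ.
apply: (@le_trans _ _ (`|L| * enorm v * `|s - t|)).
  rewrite -mulrA [enorm v * _]mulrC ler_wpM2r ?ler_norm// mulr_ge0 ?enorm_ge0//.
by rewrite ler_wpM2l ?mulr_ge0 ?enorm_ge0// lerDl sqrtr_ge0.
Qed.

Lemma lipx_lin L M p q (c c' : R) : lipx L p -> lipx M q ->
  lipx (`|c| * L + `|c'| * M) (fun x => c * p x + c' * q x).
Proof.
move=> Lp Mq x y.
have -> : c * p (x + y) + c' * q (x + y) - (c * p x + c' * q x) =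
  c * (p (x + y) - p x) + c' * (q (x + y) - q x) by ring.
rewrite (le_trans (ler_normD _ _))// !normrM mulrDl -!mulrA lerD//.
  by rewrite ler_wpM2l.
by rewrite ler_wpM2l.
Qed.

Lemma lipx_shift L p y : lipx L p -> lipx L (fun x => p (x + y)).
Proof. by move=> Lp x z; rewrite addrAC; exact: Lp. Qed.

Lemma lipx_le L M p : L <= M -> lipx L p -> lipx M p.
Proof.
move=> LM Lp x y; apply: le_trans (Lp x y) _.
by rewrite ler_wpM2r// enorm_ge0.
Qed.

Definition avg1 v p x : R := segint (fun s => p (x + s *: v)) 0 1.

Lemma avg1_lin L M v p q (c c' : R) x : lipx L p -> lipx M q ->
  avg1 v (fun y => c * p y + c' * q y) x = c * avg1 v p x + c' * avg1 v q x.
Proof.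
by move=> Lp Mq; rewrite /avg1 segint_lin//; apply: lipx_line_continuous; eassumption.
Qed.

Lemma avg1_shift v p x y : avg1 v (fun z => p (z + y)) x = avg1 v p (x + y).
Proof. by rewrite /avg1; under eq_fun do rewrite addrAC. Qed.

Lemma avg1_cst v (c : R) x : avg1 v (fun=> c) x = c.
Proof. by rewrite /avg1 segint_cst// subr0 mulr1. Qed.

Lemma lipx_cst (c : R) : lipx 0 (fun=> c).
Proof. by move=> x y; rewrite subrr normr0 mul0r. Qed.

Lemma avg1_le L M v p q x : lipx L p -> lipx M q ->
  (forall s, 0 <= s <= 1 -> p (x + s *: v) <= q (x + s *: v)) -> avg1 v p x <= avg1 v q x.
Proof.
by move=> Lp Mq pq; apply: segint_le => //; apply: lipx_line_continuous; eassumption.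
Qed.

Lemma avg1_norm L v p x M : lipx L p -> (forall s, 0 <= s <= 1 -> `|p (x + s *: v)| <= M) ->
  `|avg1 v p x| <= M.
Proof.
move=> Lp H; rewrite ler_norml; apply/andP; split.
  rewrite -(avg1_cst v (- M) x); apply: (avg1_le (lipx_cst _) Lp) => s /H.
  by rewrite ler_norml => /andP[].
rewrite -[leRHS](avg1_cst v M x); apply: (avg1_le Lp (lipx_cst _)) => s /H.
by rewrite ler_norml => /andP[].
Qed.

Lemma avg1B L M v p q x : lipx L p -> lipx M q ->
  avg1 v (fun y => p y - q y) x = avg1 v p x - avg1 v q x.
Proof.
move=> Lp Mq; have := @avg1_lin L M v p q 1 (-1) x Lp Mq.
by rewrite mul1r mulN1r => <-; congr avg1; apply/funext => y; rewrite mul1r mulN1r.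
Qed.

Lemma lipxB L M p q : lipx L p -> lipx M q -> lipx (L + M) (fun x => p x - q x).
Proof.
move=> Lp Mq; have := lipx_lin 1 (-1) Lp Mq.
rewrite normrN normr1 !mul1r; congr lipx; apply/funext => x.
by rewrite mul1r mulN1r.
Qed.

Lemma avg1_lipx L v p : lipx L p -> lipx L (avg1 v p).
Proof.
move=> Lp x y; rewrite -avg1_shift -(avg1B _ _ (lipx_shift y Lp) Lp).
apply: (avg1_norm (lipxB (lipx_shift y Lp) Lp)) => s _; exact: Lp.
Qed.

Lemma avg1_near L v p x : 0 <= L -> lipx L p -> `|avg1 v p x - p x| <= L * enorm v.
Proof.
move=> L0 Lp; rewrite -[p x](avg1_cst v _ x) -(avg1B _ _ Lp (lipx_cst _)).
apply: (avg1_norm (lipxB Lp (lipx_cst _))) => s /andP[s0 s1].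
apply: le_trans (Lp _ _) _; rewrite ler_wpM2l// enormZ ger0_norm//.
by rewrite ler_piMl ?enorm_ge0.
Qed.

(* Derivative along e with a quadratic remainder uniform in x, a property stable under
   averaging. *)
Definition UD e p q : Prop :=
  exists C : R, forall x (s : R), `|p (x + s *: e) - p x - s * q x| <= C * s ^+ 2.

Lemma UD_lin e p p' q q' (c c' : R) : UD e p p' -> UD e q q' ->
  UD e (fun x => c * p x + c' * q x) (fun x => c * p' x + c' * q' x).
Proof.
move=> [C HC] [D HD]; exists (`|c| * C + `|c'| * D) => x s.
have -> : c * p (x + s *: e) + c' * q (x + s *: e) - (c * p x + c' * q x) -
    s * (c * p' x + c' * q' x) =
  c * (p (x + s *: e) - p x - s * p' x) + c' * (q (x + s *: e) - q x - s * q' x) by ring.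
rewrite (le_trans (ler_normD _ _))// !normrM mulrDl -!mulrA lerD//.
  by rewrite ler_wpM2l.
by rewrite ler_wpM2l.
Qed.

Lemma UD_shift e p q y : UD e p q -> UD e (fun x => p (x + y)) (fun x => q (x + y)).
Proof. by move=> [C HC]; exists C => x s; rewrite (addrAC x); exact: HC. Qed.

Lemma UD_scale e p q (c : R) : UD e p q -> UD (c *: e) p (fun x => c * q x).
Proof.
move=> [C HC]; exists (C * c ^+ 2) => x s; have := HC x (s * c).
by rewrite scalerA mulrA exprMn mulrCA [s ^+ 2 * _]mulrC mulrA.
Qed.

Lemma UD_avg1_pass L M v e p q : lipx L p -> lipx M q -> UD e p q ->
  UD e (avg1 v p) (avg1 v q).
Proof.
move=> Lp Mq [C HC]; exists C => x s.
have L1 := lipxB (lipx_shift (s *: e) Lp) Lp.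
have E1 := avg1B v x (lipx_shift (s *: e) Lp) Lp.
have E2 := @avg1_lin _ _ v (fun y => p (y + s *: e) - p y) q 1 (- s) x L1 Mq.
rewrite -avg1_shift -E1 -[avg1 v (fun _ => _ - _) x]mul1r -mulNr -E2.
apply: (avg1_norm (lipx_lin 1 (- s) L1 Mq)) => r _.
by rewrite mul1r mulNr; exact: HC.
Qed.

(** Moving by [s *: e] shifts the segment of integration by [r = s / k], and only the two end pieces
    of length [|r|] change. Lipschitz continuity of [p] alone makes the average differentiable, with
    a difference quotient as derivative. *)
Lemma UD_avg1 L (k : R) v e p : 0 <= L -> lipx L p -> k != 0 -> v = k *: e ->
  UD e (avg1 v p) (fun x => k^-1 * (p (x + v) - p x)).
Proof.
move=> L0 Lp k0 ve; exists (2 * L * enorm v * (k^-1) ^+ 2) => x s.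
pose r := s / k; pose G (t : R) := p (x + t *: v).
have cG : continuous G := @lipx_line_continuous L p x v Lp.
have E1 : avg1 v p (x + s *: e) = segint (fun t => G (t + r)) 0 1.
  rewrite /avg1 /G; congr segint; apply/funext => t; congr p.
  by rewrite scalerDl addrAC addrA ve !scalerA /r divfK.
have E2 : avg1 v p x = prim G 1 - prim G 0 by rewrite primB.
have H t : `|prim G (t + r) - prim G t - G t * r| <= L * `|r| * enorm v * `|r|.
  have := @prim_near R G t (t + r) (L * `|r| * enorm v) cG.
  have -> : t + r - t = r by ring.
  apply => u ur; rewrite /G.
  have -> : x + u *: v = (x + t *: v) + (u - t) *: v.
    by rewrite -addrA -scalerDl [t + _]addrC subrK.
  by apply: le_trans (Lp _ _) _; rewrite enormZ -mulrA ler_wpM2l// ler_wpM2r// enorm_ge0.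
rewrite E1 E2 (segint_translate r cG).
have := H 1; have := H 0; rewrite add0r /G scale0r addr0 scale1r.
have -> : 2 * L * enorm v * k^-1 ^+ 2 * s ^+ 2 = 2 * (L * `|r| * enorm v * `|r|).
  have -> : L * `|r| * enorm v * `|r| = L * enorm v * `|r| ^+ 2 by ring.
  by rewrite real_normK ?num_real// /r; ring.
have -> : s * (k^-1 * (p (x + v) - p x)) = p (x + v) * r - p x * r by rewrite /r; ring.
rewrite !ler_norml; lra.
Qed.

Lemma UD_ext e p p' q q' : p = p' -> q = q' -> UD e p q -> UD e p' q'.
Proof. by move=> -> ->. Qed.

Definition avg (vs : seq 'rV[R]_d) p := foldr avg1 p vs.

Lemma avg_lipx L vs p : lipx L p -> lipx L (avg vs p).
Proof. by move=> Lp; elim: vs => //= v vs IH; exact: avg1_lipx. Qed.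

Lemma avg_lin L M vs p q (c c' : R) x : lipx L p -> lipx M q ->
  avg vs (fun y => c * p y + c' * q y) x = c * avg vs p x + c' * avg vs q x.
Proof.
move=> Lp Mq; elim: vs x => //= v vs IH x.
have -> : avg vs (fun y => c * p y + c' * q y) = fun y => c * avg vs p y + c' * avg vs q y.
  by apply/funext.
exact: avg1_lin (avg_lipx _ Lp) (avg_lipx _ Mq).
Qed.

Lemma avg_shift vs p x y : avg vs (fun z => p (z + y)) x = avg vs p (x + y).
Proof.
elim: vs x => //= v vs IH x; rewrite -avg1_shift; congr avg1.
by apply/funext => z; exact: IH.
Qed.

Lemma avg_norm L vs p M : lipx L p -> (forall x, `|p x| <= M) -> forall x, `|avg vs p x| <= M.
Proof.
move=> Lp H; elim: vs => //= v vs IH x.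
by apply: (avg1_norm (avg_lipx vs Lp)) => s _; exact: IH.
Qed.

Lemma avg_local_le0 L vs p x : lipx L p ->
  (forall y, enorm y <= \sum_(v <- vs) enorm v -> p (x + y) <= 0) -> avg vs p x <= 0.
Proof.
move=> Lp; elim: vs x => [|v vs IH] x H /=.
  by have := H 0; rewrite big_nil enorm0 addr0; apply.
rewrite -(avg1_cst v 0 x); apply: (avg1_le (avg_lipx vs Lp) (lipx_cst _)) => s /andP[s0 s1].
apply: IH => y yl; rewrite -addrA; apply: H; rewrite big_cons.
apply: le_trans (ler_enormD _ _) _; apply: lerD => //.
by rewrite enormZ ger0_norm// ler_piMl ?enorm_ge0.
Qed.

Lemma avg_near L vs p x : 0 <= L -> lipx L p ->
  `|avg vs p x - p x| <= L * \sum_(v <- vs) enorm v.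
Proof.
move=> L0 Lp; elim: vs x => [|v vs IH] x /=; first by rewrite big_nil subrr normr0 mulr0.
rewrite big_cons mulrDr (le_trans (ler_distD (avg vs p x) _ _))// lerD//.
exact: avg1_near (avg_lipx vs Lp).
Qed.

Definition quot (k : R) v p x : R := k^-1 * (p (x + v) - p x).

Lemma quot_avg L k v vs p : lipx L p -> quot k v (avg vs p) = avg vs (quot k v p).
Proof.
move=> Lp; apply/funext => x; rewrite /quot mulrBr -mulNr -avg_shift.
rewrite -(avg_lin vs _ _ _ (lipx_shift v Lp) Lp); congr avg; apply/funext => y.
by rewrite mulrBr mulNr.
Qed.

Lemma quot_lipx L k v p : lipx L p -> lipx (2 * L / `|k|) (quot k v p).
Proof.
move=> Lp; have := lipx_lin k^-1 (- k^-1) (lipx_shift v Lp) Lp.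
rewrite normrN normfV (_ : _ + _ = 2 * L / `|k|); last by ring.
by congr lipx; apply/funext => x; rewrite /quot mulrBr mulNr.
Qed.

Lemma quot_le L k v e p x : lipx L p -> v = k *: e -> k != 0 -> `|quot k v p x| <= L * enorm e.
Proof.
move=> Lp -> k0; rewrite /quot normrM normfV mulrC ler_pdivrMr ?normr_gt0//.
by apply: le_trans (Lp _ _) _; rewrite enormZ mulrA mulrAC.
Qed.

Lemma UD_quot k v e p q : UD e p q -> UD e (quot k v p) (quot k v q).
Proof.
move=> H; apply: UD_ext (UD_lin k^-1 (- k^-1) (UD_shift v H) H).
  by apply/funext => x; rewrite /quot mulrBr mulNr.
by apply/funext => x; rewrite /quot mulrBr mulNr.
Qed.

(** Each derivative along [e] spends one occurrence of [v] in the list and turns it into a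
    difference quotient, with which the other averages commute. *)
Lemma UD_avg L (k : R) v e vs p : 0 <= L -> lipx L p -> k != 0 -> v = k *: e -> v \in vs ->
  UD e (avg vs p) (quot k v (avg (rem v vs) p)).
Proof.
move=> L0 Lp k0 ve; elim: vs => //= w vs IH; rewrite inE.
have [<- _|wv /= vvs] := eqVneq v w.
  exact: UD_avg1 L0 (avg_lipx vs Lp) k0 ve.
have {}IH := IH vvs.
have := UD_avg1_pass w (avg_lipx vs Lp) (quot_lipx k v (avg_lipx (rem v vs) Lp)) IH.
apply: UD_ext => //.
exact/esym/(quot_avg k v [:: w] (avg_lipx (rem v vs) Lp)).
Qed.

End steklov_averages.

Section taylor.
Context {R : realType}.

Lemma mean_value_bound (S M : R) (y l : R -> R) : 0 <= S ->
  {within `[0, S], continuous y} -> (forall t, 0 <= t < S -> der_on 0 S y t (l t)) ->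
  (forall t, 0 <= t < S -> `|l t| <= M) -> `|y S - y 0| <= M * S.
Proof.
move=> S0 cy dy lM.
have cM c : {within `[0, S], continuous (fun t => c * y t + M * t)}.
  apply: within_continuousD; apply: within_continuousM => //.
  - exact: within_continuous_cst.
  - exact: within_continuous_cst.
  - by apply: continuous_subspaceT => z; exact: cvg_id.
have mono c : `|c| = 1 -> c * y 0 + M * 0 <= c * y S + M * S.
  move=> c1; apply: (@der_on_nondecreasing _ 0 S (fun t => c * y t + M * t)
    (fun t => c * l t + M * 1) S0 (cM c)) => t tS.
    by apply: der_onD; apply: der_onZ; [exact: dy|exact: der_on_id].
  have : `|c * l t| <= M by rewrite normrM c1 mul1r lM.
  by rewrite ler_norml; lra.
have := mono 1 (normr1 _); have := mono (-1) (etrans (normrN 1) (normr1 _)).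
by rewrite ler_norml; lra.
Qed.

Lemma der_on_opp a b (y : R -> R) t l : der_on (- b) (- a) y (- t) l ->
  der_on a b (fun s => y (- s)) t (- l).
Proof.
move=> H e e0; have [r r0 Hr] := H e e0; exists r => // s /andP[as_ sb] sr.
have E : - s - - t = - (s - t) by ring.
have := Hr (- s); rewrite E normrN !lerN2 as_ sb => /(_ isT sr).
by rewrite mulrN mulNr.
Qed.

Definition gder (y l : R -> R) : Prop := forall a b t, der_on a b y t (l t).

Lemma gder_within y l a b : gder y l -> {within `[a, b], continuous y}.
Proof. by move=> H; apply: continuous_subspaceT; exact: der_on_continuous H. Qed.

(** The auxiliary functions [A0], [A1], [A2] are successive derivatives and vanish at 0, so the mean
    value bound is applied three times. Symmetry makes the derivative of [A2] equal to
    [y3 s - y3 (- s)], where a Lipschitz bound replaces a fourth derivative. *)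
Lemma symmetric_taylor (y y1 y2 y3 : R -> R) (N : R) : gder y y1 -> gder y1 y2 -> gder y2 y3 ->
  (forall s t, `|y3 s - y3 t| <= N * `|s - t|) -> forall h, 0 <= h ->
  `|y h - 2 * y 0 + y (- h) - h ^+ 2 * y2 0| <= 2 * N * h ^+ 4.
Proof.
move=> d0 d1 d2 H3.
have N0 : 0 <= N by have := H3 1 0; rewrite subr0 normr1 mulr1; exact: le_trans.
have dsq : gder (fun s => s ^+ 2) (fun s => 2 * s).
  move=> a b t.
  have -> : (fun s : R => s ^+ 2) = (fun s => (s - t) ^+ 2 + ((2 * t) * s - t ^+ 2)).
    by apply/funext => s; ring.
  have : der_on a b (fun s => (s - t) ^+ 2 + ((2 * t) * s - t ^+ 2)) t (0 + ((2 * t) * 1 - 0)).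
    apply: der_onD; first exact: der_on_sqr.
    by apply: der_onB; [apply: der_onZ; exact: der_on_id|exact: der_on_cst].
  by rewrite add0r subr0 mulr1.
have gopp z l : gder z l -> gder (fun s => z (- s)) (fun s => - l (- s)).
  by move=> H a b t; apply: der_on_opp; exact: H.
pose A2 s := y2 s + y2 (- s) - 2 * y2 0.
pose A1 s := y1 s - y1 (- s) - 2 * y2 0 * s.
pose A0 s := y s + y (- s) - 2 * y 0 - y2 0 * s ^+ 2.
have dA2 : gder A2 (fun s => y3 s + - y3 (- s) - 0).
  move=> a b t; apply: der_onB; last exact: der_on_cst.
  by apply: der_onD; [exact: d2|exact: (gopp _ _ d2)].
have dA1 : gder A1 (fun s => y2 s - - y2 (- s) - 2 * y2 0 * 1).
  move=> a b t; apply: der_onB; last by apply: der_onZ; exact: der_on_id.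
  by apply: der_onB; [exact: d1|exact: (gopp _ _ d1)].
have dA0 : gder A0 (fun s => y1 s + - y1 (- s) - 0 - y2 0 * (2 * s)).
  move=> a b t; apply: der_onB; last by apply: der_onZ; exact: dsq.
  apply: der_onB; last exact: der_on_cst.
  by apply: der_onD; [exact: d0|exact: (gopp _ _ d0)].
have B2 (S : R) : 0 <= S -> `|A2 S| <= 2 * N * S * S.
  move=> S0; have A20 : A2 0 = 0 by rewrite /A2 oppr0; ring.
  have := @mean_value_bound S (2 * N * S) A2 _ S0 (gder_within dA2) (fun t _ => dA2 0 S t).
  rewrite A20 subr0; apply => t /andP[t0 /ltW tS].
  rewrite subr0; apply: le_trans (H3 _ _) _; rewrite opprK ger0_norm ?addr_ge0//.
  by rewrite [2 * N]mulrC -mulrA ler_wpM2l// mulr2n mulrDl !mul1r lerD.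
have B1 (S : R) : 0 <= S -> `|A1 S| <= 2 * N * S ^+ 2 * S.
  move=> S0; have A10 : A1 0 = 0 by rewrite /A1 oppr0; ring.
  have := @mean_value_bound S (2 * N * S ^+ 2) A1 _ S0 (gder_within dA1)
    (fun t _ => dA1 0 S t).
  rewrite A10 subr0; apply => t /andP[t0 /ltW tS].
  have -> : y2 t - - y2 (- t) - 2 * y2 0 * 1 = A2 t by rewrite /A2; ring.
  apply: le_trans (B2 t t0) _; rewrite -mulrA ler_wpM2l ?mulr_ge0// expr2.
  by apply: ler_pM.
move=> h h0.
have A00 : A0 0 = 0 by rewrite /A0 oppr0 expr0n/=; ring.
have -> : y h - 2 * y 0 + y (- h) - h ^+ 2 * y2 0 = A0 h - A0 0 by rewrite A00 /A0; ring.
have -> : 2 * N * h ^+ 4 = 2 * N * h ^+ 3 * h by ring.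
apply: (@mean_value_bound h (2 * N * h ^+ 3) A0 _ h0 (gder_within dA0)
  (fun t _ => dA0 0 h t)) => t /andP[t0 /ltW th].
have -> : y1 t + - y1 (- t) - 0 - y2 0 * (2 * t) = A1 t by rewrite /A1; ring.
apply: le_trans (B1 t t0) _; rewrite -mulrA ler_wpM2l ?mulr_ge0//.
rewrite [h ^+ 3]exprSr; apply: ler_pM => //; first exact: sqr_ge0.
by rewrite ler_pXn2r ?nnegrE.
Qed.

End taylor.

Section uniform_derivatives.
Context {R : realType} {d : nat}.
Implicit Types (p q : 'rV[R]_d -> R) (e l x y : 'rV[R]_d).

Lemma UD_gder e p q x : UD e p q -> gder (fun s => p (x + s *: e)) (fun s => q (x + s *: e)).
Proof.
move=> [C HC] a b t; apply: (@modulus_der_on R a b t _ `|C|) => s.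
have -> : x + s *: e = (x + t *: e) + (s - t) *: e.
  by rewrite -addrA -scalerDl [t + _]addrC subrK.
rewrite [q _ * _]mulrC; apply: le_trans (HC _ _) _.
rewrite -real_normK ?num_real// expr2 mulrA ler_wpM2r//.
apply: (@le_trans _ _ (`|C| * `|s - t|)); first by rewrite ler_wpM2r// ler_norm.
by rewrite ler_wpM2l// lerDl sqrtr_ge0.
Qed.

Lemma fd_consistency e p p1 p2 p3 N2 N4 h x : 0 < h ->
  UD e p p1 -> UD e p1 p2 -> UD e p2 p3 -> (forall x, `|p2 x| <= N2) ->
  (forall x s, `|p3 (x + s *: e) - p3 x| <= N4 * `|s|) ->
  `|fd2 h e p x - p2 x| <= 2 * N4 * h ^+ 2 /\ `|fd1 h e p x - p1 x| <= N2 * h.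
Proof.
move=> h0 u1 u2 u3 H2 H4.
have L3 s t : `|p3 (x + s *: e) - p3 (x + t *: e)| <= N4 * `|s - t|.
  have -> : x + s *: e = (x + t *: e) + (s - t) *: e.
    by rewrite -addrA -scalerDl [t + _]addrC subrK.
  exact: H4.
have N20 : 0 <= N2 by apply: le_trans (H2 0).
split.
  have := symmetric_taylor (UD_gder x u1) (UD_gder x u2) (UD_gder x u3) L3 (ltW h0).
  rewrite !scale0r !addr0 scaleNr => H.
  have -> : fd2 h e p x - p2 x = (p (x + h *: e) - 2 * p x + p (x - h *: e) - h ^+ 2 * p2 x) / h ^+ 2.
    by rewrite /fd2; field; rewrite gt_eqF.
  rewrite normrM (@gtr0_norm _ (h ^+ 2)^-1) ?invr_gt0 ?exprn_gt0// ler_pdivrMr ?exprn_gt0//.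
  by apply: le_trans H _; apply: eq_ler; ring.
have D1 s : 0 <= s -> `|p1 (x + s *: e) - p1 x| <= N2 * s.
  move=> s0; have := @mean_value_bound R s N2 _ _ s0 (gder_within (UD_gder x u2))
    (fun t _ => UD_gder x u2 0 s t) (fun t _ => H2 _).
  by rewrite scale0r addr0.
have dG : gder (fun s => p (x + s *: e) - p1 x * s) (fun s => p1 (x + s *: e) - p1 x * 1).
  by move=> a b t; apply: der_onB; [exact: UD_gder|apply: der_onZ; exact: der_on_id].
have := @mean_value_bound R h (N2 * h) _ _ (ltW h0) (gder_within dG) (fun t _ => dG 0 h t).
rewrite scale0r addr0 mulr0 subr0 => H.
have -> : fd1 h e p x - p1 x = (p (x + h *: e) - p1 x * h - p x) / h.
  by rewrite /fd1; field; rewrite gt_eqF.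
rewrite normrM (@gtr0_norm _ h^-1) ?invr_gt0// ler_pdivrMr//; apply: H => t /andP[t0 th].
rewrite mulr1; apply: le_trans (D1 t t0) _; rewrite ler_wpM2l// ltW//.
Qed.

Lemma derive_from_bound (V : normedModType R) (f : V -> R) (a v : V) (c : R) :
  (forall e : R, 0 < e -> exists2 r : R, 0 < r & forall s : R, `|s| < r ->
     `|f (a + s *: v) - f a - s * c| <= e * `|s|) -> is_derive a v f c.
Proof.
move=> H.
have cv : h^-1 *: (f (h *: v + a) - f a) @[h --> (0 : R)^'] --> c.
  apply/cvgrPdist_le => /= e e0; have [r r0 Hr] := H e e0.
  rewrite /dnbhs near_withinE; apply/nbhs_ballP; exists r => // s.
  rewrite /ball/= sub0r normrN => sr s0.
  have {}Hr := Hr s sr; rewrite [s *: v + a]addrC.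
  have -> : c - s^-1 *: (f (a + s *: v) - f a) = - (f (a + s *: v) - f a - s * c) / s.
    by rewrite -[_ *: _]/(_ * _); field.
  by rewrite normrM normrN normfV ler_pdivrMr ?normr_gt0.
by apply: DeriveDef; [apply: cvgP cv|exact/cvg_lim].
Qed.

Lemma UD_is_derive e p q x : UD e p q -> is_derive x e p (q x).
Proof.
move=> [C HC]; apply: derive_from_bound => r r0.
have c0 : 0 < `|C| + 1 by rewrite ltr_wpDl.
exists (r / (`|C| + 1)); first by rewrite divr_gt0.
move=> s; rewrite ltr_pdivlMr// => sr; apply: le_trans (HC x s) _.
rewrite -real_normK ?num_real// expr2 mulrA ler_wpM2r//; apply: le_trans (ltW sr).
rewrite mulrC ler_wpM2l//; apply: le_trans (ler_norm _) _; by rewrite lerDl.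
Qed.

Lemma UD_uniq e p q q' : UD e p q -> UD e p q' -> q = q'.
Proof.
move=> u u'; apply/funext => x.
by have [_ <-] := UD_is_derive x u; have [_ <-] := UD_is_derive x u'.
Qed.

Lemma UD_add e f p q q' L : lipx L q -> UD e p q -> UD f p q' ->
  UD (e + f) p (fun x => q x + q' x).
Proof.
move=> Lq [C HC] [D HD]; exists (C + `|L| * enorm f + D) => x s.
have -> : x + s *: (e + f) = (x + s *: f) + s *: e by rewrite scalerDr addrA addrAC.
have H1 := HC (x + s *: f) s; have H2 := HD x s; have H3 := Lq x (s *: f).
have -> : p (x + s *: f + s *: e) - p x - s * (q x + q' x) =
  (p (x + s *: f + s *: e) - p (x + s *: f) - s * q (x + s *: f)) +
  s * (q (x + s *: f) - q x) + (p (x + s *: f) - p x - s * q' x) by ring.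
rewrite (le_trans (ler_normD _ _))// mulrDl lerD//.
rewrite (le_trans (ler_normD _ _))// mulrDl lerD//.
rewrite normrM (_ : `|L| * enorm f * s ^+ 2 = `|s| * (`|L| * enorm (s *: f))).
  by rewrite ler_wpM2l//; apply: le_trans H3 _; rewrite ler_wpM2r ?enorm_ge0 ?ler_norm.
by rewrite enormZ -real_normK ?num_real//; ring.
Qed.

Lemma UD_coord l p (q : 'I_d -> 'rV[R]_d -> R) (L : R) : (forall i, lipx L (q i)) ->
  (forall i, UD (delta_mx ord0 i) p (q i)) ->
  UD l p (fun x => \sum_i q i x * l ord0 i).
Proof.
move=> Lq U; rewrite [l in UD l]row_sum_delta.
elim: (index_enum _) => [|i r IH].
  rewrite big_nil; exists 0 => x s; rewrite scaler0 addr0 subrr big_nil mulr0 subr0.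
  by rewrite normr0 mul0r.
rewrite big_cons; have -> : (fun x => \sum_(j <- i :: r) q j x * l ord0 j) =
   (fun x => l ord0 i * q i x + \sum_(j <- r) q j x * l ord0 j).
  by apply/funext => x; rewrite big_cons mulrC.
apply: (UD_add _ _ IH); last exact: UD_scale.
by have := lipx_lin (l ord0 i) 0 (Lq i) (Lq i);
  congr lipx; apply/funext => x; rewrite mul0r addr0.
Qed.

(** A sufficient condition for joint continuity that passes to averages and to difference quotients:
    Lipschitz in space with a constant that may depend on time, and continuous in time uniformly in
    space. *)
Definition jc (Psi : R -> 'rV[R]_d -> R) : Prop :=
  (forall t, exists L, lipx L (Psi t)) /\
  (forall t (e : R), 0 < e -> exists2 r : R, 0 < r & forall s, `|s - t| < r ->
     forall x, `|Psi s x - Psi t x| <= e).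

Lemma jc_continuous Psi : jc Psi -> jointly_continuous Psi.
Proof.
move=> [H1 H2] [t x]; apply/cvgrPdist_le => /= e e0.
have [L HL] := H1 t; have [r r0 Hr] := H2 t (e / 2) (half_gt0 e0).
have c0 : 0 < `|L| * d%:R + 1 by rewrite ltr_wpDl// mulr_ge0.
pose q := e / 2 / (`|L| * d%:R + 1).
have q0 : 0 < q by rewrite divr_gt0// half_gt0.
have m0 : 0 < Num.min r q by rewrite lt_min r0.
exists (ball t (Num.min r q), ball x (Num.min r q)) => /=.
  by split; exact: nbhsx_ballx.
move=> [s y] [/= B1 B2].
have sr : `|s - t| < r.
  by move: B1; rewrite /ball/= lt_min distrC => /andP[].
have yq : `|y - x| <= q.
  move: B2; rewrite -ball_normE /ball_/= lt_min distrC => /andP[_ /ltW//].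
have h1 := Hr s sr y.
have h2 : `|Psi t y - Psi t x| <= e / 2.
  have := HL x (y - x); rewrite [x + _]addrC subrK => /le_trans; apply.
  apply: (@le_trans _ _ (`|L| * (d%:R * q))).
    apply: (@le_trans _ _ (`|L| * enorm (y - x))).
      by rewrite ler_wpM2r ?enorm_ge0// ler_norm.
    rewrite ler_wpM2l//; apply: le_trans (enorm_le_norm _) _.
    by rewrite ler_wpM2l.
  rewrite mulrA /q mulrCA ler_piMr ?(ltW (half_gt0 e0))//.
  by rewrite ler_pdivrMr// mul1r lerDl.
rewrite distrC (le_trans (ler_distD (Psi t y) _ _))// [e]splitr lerD//.
Qed.

Lemma jc_avg vs Psi : jc Psi -> jc (fun t => avg vs (Psi t)).
Proof.
move=> [H1 H2]; split=> [t|t e e0].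
  by have [L HL] := H1 t; exists L; exact: avg_lipx.
have [r r0 Hr] := H2 t e e0; exists r => // s sr x.
have [L HL] := H1 t; have [M HM] := H1 s.
have := avg_lin vs 1 (-1) x HM HL; rewrite mul1r mulN1r => <-.
apply: (avg_norm vs (lipx_lin 1 (-1) HM HL)) => y.
by rewrite mul1r mulN1r; exact: Hr.
Qed.

Lemma jc_quot k v Psi : jc Psi -> jc (fun t => quot k v (Psi t)).
Proof.
move=> [H1 H2]; split=> [t|t e e0].
  by have [L HL] := H1 t; exists (2 * L / `|k|); exact: quot_lipx.
have c0 : 0 < 2 * `|k^-1| + 1 by rewrite ltr_wpDl// mulr_ge0.
have [r r0 Hr] := H2 t (e / (2 * `|k^-1| + 1)) (divr_gt0 e0 c0).
exists r => // s sr x; rewrite /quot -mulrBr normrM.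
have h1 := Hr s sr x; have h2 := Hr s sr (x + v).
have h3 : `|Psi s (x + v) - Psi s x - (Psi t (x + v) - Psi t x)| <= 2 * (e / (2 * `|k^-1| + 1)).
  by move: h1 h2; rewrite !ler_norml; lra.
apply: le_trans (ler_wpM2l (normr_ge0 _) h3) _.
have -> : `|k^-1| * (2 * (e / (2 * `|k^-1| + 1))) = (2 * `|k^-1| * e) / (2 * `|k^-1| + 1) by ring.
rewrite ler_pdivrMr//; lra.
Qed.

End uniform_derivatives.

Section time_regularity.
Context {R : realType} {d d1 : nat} {A : Type} (alpha0 : A).
Context (E : bellman_data R d d1 A) (K lambda h theta T : R) (u ut : R -> 'rV[R]_d -> R).
Hypotheses (K1 : 1 <= K) (lam0 : 0 <= lambda) (h0 : 0 < h) (T0 : 0 < T).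
Hypotheses (th : 0 <= theta <= 1) (thl : discount (d1 := d1) K * (1 - theta) <= lambda).
Hypotheses (GE : good K lambda E) (fu : flow E h T u ut).

Lemma flow_ut_lipx : exists L, 0 <= L /\ forall t, lipx L (ut t).
Proof.
have K0 := good_K_ge0 GE.
have [M uM] := flow_bd fu; set Lp := lipc (d1 := d1) K (theta * T).
have M0 : 0 <= M by apply: le_trans (uM 0 0 _); rewrite ?lexx ?(ltW T0).
have O0 := opnorm_ge0 GE lam0 h0; have V0 := opvar_ge0 GE h0 (lambda := lambda).
exists (opnorm (d1 := d1) K lambda h * Lp + K * (opvar (d1 := d1) K h * M + 1)).
split; first by rewrite addr_ge0 ?mulr_ge0 ?lipc_ge0// addr_ge0// mulr_ge0.
move=> t x y; have tT := clamp_bnd t (ltW T0).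
rewrite !(flow_eq fu) -opprD normrN.
apply: (Fop_diff GE lam0 h0 alpha0) => [z|z|alpha]; [exact: uM|exact: uM|].
have -> : (opnorm (d1 := d1) K lambda h * Lp + K * (opvar (d1 := d1) K h * M + 1)) * enorm y =
  opnorm (d1 := d1) K lambda h * (Lp * enorm y) + K * enorm y * (opvar (d1 := d1) K h * M + 1).
  by ring.
have xy : x + y - x = y by rewrite addrAC subrr add0r.
apply: (Lop_diff GE lam0 h0) => [k|k|||z|z].
- by have [_ /(_ (clamp T t) (x + y) x)] := good_sigma GE alpha k; rewrite xy.
- by have [_ /(_ (clamp T t) (x + y) x)] := good_b GE alpha k; rewrite xy.
- have [_ /(_ (clamp T t) (x + y) x)] := good_c GE alpha.
  by rewrite xy opprB addrA subrK.
- by have [_ /(_ (clamp T t) (x + y) x)] := good_f GE alpha; rewrite xy.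
- rewrite addrAC; exact: (flow_lipschitz alpha0 K1 lam0 h0 T0 th thl GE fu).
- exact: uM.
Qed.

Lemma flow_jc_ut : jc ut.
Proof.
have [L [_ HL]] := flow_ut_lipx; split => [t|t e e0]; first by exists L.
have [C HC] := flow_mod fu.
have [r r0 Hr] := modulus_small C e0; exists r => // s sr x.
by apply: le_trans (HC s t x) _; apply: Hr.
Qed.

(** Test functions are of class [C12] on the whole line of times, so a Lipschitz bound is needed
    outside [[0, T]] too. It is propagated from time [T] by that of [ut], with a constant growing
    with [|t - T|]. *)
Lemma flow_jc : jc u.
Proof.
have [L [L0 HL]] := flow_ut_lipx; split=> [t|t e e0]; last first.
  have [C HC] := flow_lip fu.
  have c0 : 0 < `|C| + 1 by rewrite ltr_wpDl.
  exists (e / (`|C| + 1)); first by rewrite divr_gt0.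
  move=> s; rewrite ltr_pdivlMr// => sr x; apply: le_trans (HC s t x) _.
  apply: le_trans (ltW sr); rewrite mulrC ler_wpM2l//.
  by rewrite (le_trans (ler_norm _))// lerDl.
exists (lipc (d1 := d1) K (theta * T) + L * `|t - T|) => x y.
have H1 : `|u T (x + y) - u T x| <= lipc (d1 := d1) K (theta * T) * enorm y.
  by apply: (flow_lipschitz alpha0 K1 lam0 h0 T0 th thl GE fu); rewrite lexx ltW.
have [C HC] := flow_der fu.
pose c : R := if T <= t then 1 else -1.
have ct : T + c * `|t - T| = t.
  rewrite /c; case: leP => Tt; first by rewrite ger0_norm ?subr_ge0//; ring.
  by rewrite ler0_norm ?subr_le0 ?(ltW Tt)//; ring.
have dy : gder (fun s => u (T + c * s) (x + y) - u (T + c * s) x)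
    (fun s => c * ut (T + c * s) (x + y) - c * ut (T + c * s) x).
  have dz z : gder (fun s => u (T + c * s) z) (fun s => c * ut (T + c * s) z).
    have cc : `|c| = 1 by rewrite /c; case: ifP; rewrite ?normrN normr1.
    move=> a b s; apply: (@modulus_der_on R a b s _ C) => r.
    have E1 : T + c * r - (T + c * s) = c * (r - s) by ring.
    have := HC (T + c * r) (T + c * s) z; rewrite E1 normrM cc mul1r.
    have -> : c * ut (T + c * s) z * (r - s) = ut (T + c * s) z * (c * (r - s)) by ring.
    exact.
  by move=> a b s; apply: der_onB; exact: dz.
have := @mean_value_bound R `|t - T| (L * enorm y) _ _ (normr_ge0 _) (gder_within dy)
  (fun s _ => dy 0 `|t - T| s).
rewrite ct mulr0 addr0 => H.
have {}H : `|u t (x + y) - u t x - (u T (x + y) - u T x)| <= L * enorm y * `|t - T|.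
  apply: H => s _; rewrite -mulrBr normrM.
  have -> : `|c| = 1 by rewrite /c; case: ifP; rewrite ?normrN normr1.
  by rewrite mul1r; exact: HL.
by move: H H1; rewrite mulrDl mulrAC !ler_norml; lra.
Qed.

Lemma flow_is_derive_avg vs (t : R) x : is_derive t 1 (fun s : R => avg vs (u s) x) (avg vs (ut t) x).
Proof.
have [C HC] := flow_der fu.
have [ju _] := flow_jc; have [jut _] := flow_jc_ut.
apply: derive_from_bound => e e0; have [r r0 Hr] := modulus_small C e0.
exists r => // s sr; have [L1 HL1] := ju (t + s); have [L2 HL2] := ju t.
have [L3 HL3] := jut t.
rewrite -[s *: 1]/(s * 1) mulr1.
have L12 := lipxB HL1 HL2.
have E1 : avg vs (u (t + s)) x - avg vs (u t) x = avg vs (fun y => u (t + s) y - u t y) x.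
  have := avg_lin vs 1 (-1) x HL1 HL2; rewrite mul1r mulN1r => <-.
  by congr avg; apply/funext => y; rewrite mul1r mulN1r.
have := avg_lin vs 1 (- s) x L12 HL3; rewrite mul1r mulNr => E2.
rewrite E1 -E2; apply: (avg_norm vs (lipx_lin 1 (- s) L12 HL3)) => y.
have := HC (t + s) t y; have -> : t + s - t = s by ring.
rewrite mul1r mulNr [s * _]mulrC => /le_trans; apply.
by rewrite ler_wpM2r//; apply: Hr.
Qed.

End time_regularity.

Section smooth_approximation.
Context {R : realType} {d d1 : nat}.
Implicit Types (p : 'rV[R]_d -> R) (h : R) (l x y : 'rV[R]_d) (vs : seq 'rV[R]_d).

Lemma UD_sum (I : Type) (r : seq I) (e : 'rV[R]_d) (p q : I -> 'rV[R]_d -> R) (c : I -> R) :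
  (forall i, UD e (p i) (q i)) ->
  UD e (fun x => \sum_(i <- r) p i x * c i) (fun x => \sum_(i <- r) q i x * c i).
Proof.
move=> H; elim: r => [|i r IH].
  exists 0 => x s; rewrite !big_nil subrr mulr0 subr0 normr0 mul0r//.
apply: UD_ext (UD_lin (c i) 1 (H i) IH); apply/funext => x.
  by rewrite big_cons mul1r mulrC.
by rewrite big_cons mul1r mulrC.
Qed.

Lemma count_mem_rem (T : eqType) (s : seq T) (x y : T) :
  (count_mem x s <= (count_mem x (rem y s)).+1)%N.
Proof.
have [ys|/rem_id ->//] := boolP (y \in s).
have /permP/(_ (pred1 x)) -> := perm_to_rem ys.
by rewrite /= addnC; case: (y == x); rewrite ?addn1 ?addn0.
Qed.

Lemma count_mem_gt0 (T : eqType) (s : seq T) (x : T) : (0 < count_mem x s)%N = (x \in s).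
Proof. by rewrite -has_count has_pred1. Qed.

Lemma avg_cst vs (c : R) (x : 'rV[R]_d) : avg vs (fun=> c) x = c.
Proof.
elim: vs x => //= v vs IH x; rewrite -[RHS](avg1_cst v c x); congr avg1.
by apply/funext => y; exact: IH.
Qed.

Lemma lipxZ M (c : R) (q : 'rV[R]_d -> R) : lipx M q -> lipx (`|c| * M) (fun y => c * q y).
Proof.
move=> Mq; have := lipx_lin c 0 Mq Mq; rewrite normr0 mul0r addr0; congr lipx.
by apply/funext => y; rewrite mul0r addr0.
Qed.

Lemma avgZ vs M (c : R) (q : 'rV[R]_d -> R) x : lipx M q ->
  avg vs (fun y => c * q y) x = c * avg vs q x.
Proof.
move=> Mq; have := avg_lin vs c 0 x Mq Mq; rewrite mul0r addr0 => <-; congr avg.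
by apply/funext => y; rewrite mul0r addr0.
Qed.

Lemma lipx_sum (I : Type) (r : seq I) (F : I -> 'rV[R]_d -> R) (L : R) :
  (forall i, lipx L (F i)) -> exists M, lipx M (fun y => \sum_(i <- r) F i y).
Proof.
move=> LF; elim: r => [|i r [M HM]].
  by exists 0 => y z; rewrite !big_nil subrr normr0 mul0r.
exists (`|1 : R| * L + `|1 : R| * M); have := lipx_lin 1 1 (LF i) HM; congr lipx.
by apply/funext => y; rewrite big_cons !mul1r.
Qed.

Lemma avg_sum (I : Type) (r : seq I) vs (F : I -> 'rV[R]_d -> R) (L : R) x :
  (forall i, lipx L (F i)) ->
  avg vs (fun y => \sum_(i <- r) F i y) x = \sum_(i <- r) avg vs (F i) x.
Proof.
move=> LF; elim: r => [|i r IH].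
  rewrite big_nil; under eq_fun do rewrite big_nil.
  elim: vs x => //= v vs IH x; rewrite -[RHS](avg1_cst v 0 x); congr avg1.
  by apply/funext => y; exact: IH.
have [M HM] := lipx_sum r LF; rewrite big_cons -IH.
have := avg_lin vs 1 1 x (LF i) HM; rewrite !mul1r => <-; congr avg.
by apply/funext => y; rewrite big_cons !mul1r.
Qed.

Lemma fd1_quot h l p : fd1 h l p = quot h (h *: l) p.
Proof. by apply/funext => x; rewrite /fd1 /quot mulrC. Qed.

Lemma fd2_quot h l p : h != 0 -> fd2 h l p = quot (- h) (- h *: l) (quot h (h *: l) p).
Proof.
move=> h0; apply/funext => x; rewrite /fd2 /quot scaleNr subrK.
by field; rewrite ?oppr_eq0 ?h0.
Qed.

Context {A : Type} (alpha0 : A).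

(** The coefficients stay frozen at [x] while the function is translated. Seen as a function of [y]
    this is a constant combination of difference quotients, which is why the operator commutes with
    averages in [avg_Lop]. *)
Lemma Lop_translate (E : bellman_data R d d1 A) h alpha t x p y :
  Lop E h alpha t (fun q => p (q + (y - x))) x =
  \sum_k a_ E alpha k t x * fd2 h (ell_ E k) p y +
  \sum_k b_ E alpha k t x * fd1 h (ell_ E k) p y - c_ E alpha t x * p y + f_ E alpha t x.
Proof.
have xy : x + (y - x) = y by rewrite addrC subrK.
rewrite /Lop /Lin xy; congr (_ + _ - _ + _); apply: eq_bigr => k _; congr (_ * _).
  by rewrite /fd2 xy (addrAC x) xy (addrAC x _ (y - x)) xy.
by rewrite /fd1 xy (addrAC x) xy.
Qed.

Section averaged_operator.
Context (E : bellman_data R d d1 A) (h : R) (h0 : h != 0) (alpha : A) (t : R).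
Context (x : 'rV[R]_d) (p : 'rV[R]_d -> R) (L : R) (Lp : lipx L p).

Let Ma : R := \sum_k `|a_ E alpha k t x|.
Let a_le_sum k : `|a_ E alpha k t x| <= Ma.
Proof. by rewrite /Ma (bigD1 k)//= lerDl sumr_ge0. Qed.
Let Mb : R := \sum_k `|b_ E alpha k t x|.
Let b_le_sum k : `|b_ E alpha k t x| <= Mb.
Proof. by rewrite /Mb (bigD1 k)//= lerDl sumr_ge0. Qed.

Let F2 k : lipx (2 * (2 * L / `|h|) / `|- h|) (fd2 h (ell_ E k) p).
Proof. by rewrite fd2_quot//; apply: quot_lipx; exact: quot_lipx. Qed.
Let F1 k : lipx (2 * L / `|h|) (fd1 h (ell_ E k) p).
Proof. by rewrite fd1_quot; exact: quot_lipx. Qed.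

Let F k y : R := a_ E alpha k t x * fd2 h (ell_ E k) p y.
Let G k y : R := b_ E alpha k t x * fd1 h (ell_ E k) p y.

Let LF : exists M, forall k, lipx M (F k).
Proof.
exists (Ma * `|2 * (2 * L / `|h|) / `|- h| |) => k.
apply: lipx_le (lipxZ _ (lipx_le (ler_norm _) (F2 k))).
by rewrite ler_wpM2r.
Qed.

Let LG : exists M, forall k, lipx M (G k).
Proof.
exists (Mb * `|2 * L / `|h| |) => k.
apply: lipx_le (lipxZ _ (lipx_le (ler_norm _) (F1 k))).
by rewrite ler_wpM2r.
Qed.

Let LopE : (fun y => Lop E h alpha t (fun q => p (q + (y - x))) x) =
  (fun y => 1 * (1 * (\sum_k F k y) + 1 * (\sum_k G k y)) +
            1 * (- c_ E alpha t x * p y + 1 * f_ E alpha t x)).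
Proof. by apply/funext => y; rewrite Lop_translate /F /G; ring. Qed.

Lemma Lop_lipx : exists M, lipx M (fun y => Lop E h alpha t (fun q => p (q + (y - x))) x).
Proof.
have [M1 H1] := LF; have [M2 H2] := LG.
have [M3 H3] := lipx_sum (index_enum _) H1; have [M4 H4] := lipx_sum (index_enum _) H2.
rewrite LopE; eexists.
exact: lipx_lin (lipx_lin 1 1 H3 H4) (lipx_lin (- c_ E alpha t x) 1 Lp (lipx_cst (f_ E alpha t x))).
Qed.

Lemma avg_Lop vs : avg vs (fun y => Lop E h alpha t (fun q => p (q + (y - x))) x) x =
  Lop E h alpha t (avg vs p) x.
Proof.
have [M1 H1] := LF; have [M2 H2] := LG.
have [M3 H3] := lipx_sum (index_enum _) H1; have [M4 H4] := lipx_sum (index_enum _) H2.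
rewrite LopE (avg_lin vs 1 1 x (lipx_lin 1 1 H3 H4)
  (lipx_lin (- c_ E alpha t x) 1 Lp (lipx_cst (f_ E alpha t x)))).
rewrite (avg_lin vs 1 1 x H3 H4) (avg_lin vs _ _ x Lp (lipx_cst _)).
rewrite (avg_sum _ _ _ H1) (avg_sum _ _ _ H2).
rewrite avg_cst /Lop /Lin.
have -> : \sum_k avg vs (F k) x = \sum_k a_ E alpha k t x * fd2 h (ell_ E k) (avg vs p) x.
  apply: eq_bigr => k _; rewrite /F (avgZ _ _ _ (F2 k)) !fd2_quot//.
  by rewrite (quot_avg _ _ vs Lp) (quot_avg _ _ vs (quot_lipx _ _ Lp)).
have -> : \sum_k avg vs (G k) x = \sum_k b_ E alpha k t x * fd1 h (ell_ E k) (avg vs p) x.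
  apply: eq_bigr => k _; rewrite /G (avgZ _ _ _ (F1 k)) !fd1_quot//.
  by rewrite (quot_avg _ _ vs Lp).
ring.
Qed.

End averaged_operator.

Context (E : bellman_data R d d1 A) (K lambda h theta T : R) (u ut : R -> 'rV[R]_d -> R).
Hypotheses (K1 : 1 <= K) (lam0 : 0 <= lambda) (h0 : 0 < h) (T0 : 0 < T).
Hypotheses (th : 0 <= theta <= 1) (thl : discount (d1 := d1) K * (1 - theta) <= lambda).
Hypotheses (GE : good K lambda E) (fu : flow E h T u ut).
Context (eps : R) (eps0 : 0 < eps).

Let Lp := lipc (d1 := d1) K (theta * T).
Let K0 : 0 <= K := le_trans ler01 K1.

Definition axes : seq 'rV[R]_d := [seq eps *: delta_mx ord0 i | i <- enum 'I_d].
Definition rays : seq 'rV[R]_d := [seq eps *: ell_ E (true, i) | i <- enum 'I_d1].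
(** Two copies of the axes provide the second coordinate derivatives that [C12] asks for. The third
    copy of the rays provides a Lipschitz third derivative along each [ell_k], the regularity behind
    the error [s ^+ 2] of a symmetric second difference. One sign of the index is enough, as [ell_k]
    and its opposite span the same line. *)
Definition windows : seq 'rV[R]_d := axes ++ axes ++ rays ++ rays ++ rays.

Definition window_size : R := 2 * d%:R + 3 * d1%:R * K + 1.

Lemma windows_size : \sum_(v <- windows) enorm v <= eps * window_size.
Proof.
have Hax : \sum_(v <- axes) enorm v <= eps * d%:R.
  rewrite big_map big_enum/= mulr_natr -[X in _ <= _ *+ X]card_ord -sumr_const.
  apply: ler_sum => i _; rewrite enormZ gtr0_norm// ler_piMr ?(ltW eps0)//.
  rewrite -(ler_pXn2r (n := 2)) ?nnegrE ?enorm_ge0// enorm_sqr expr1n (bigD1 i)//=.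
  rewrite big1 => [|j ji]; first by rewrite mxE !eqxx expr1n addr0.
  by rewrite mxE (negPf ji) andbF expr0n.
have Hra : \sum_(v <- rays) enorm v <= eps * (d1%:R * K).
  rewrite big_map big_enum/= mulrCA [d1%:R * _]mulrC mulr_natr.
  rewrite -[X in _ <= _ *+ X]card_ord -sumr_const.
  apply: ler_sum => i _; rewrite enormZ gtr0_norm// ler_wpM2l ?(ltW eps0)//.
  exact: good_ell GE _.
rewrite /windows !big_cat/= /window_size; move: eps0; lra.
Qed.

Lemma axes_count i : (2 <= count_mem (eps *: delta_mx ord0 i : 'rV[R]_d) windows)%N.
Proof.
have : eps *: delta_mx ord0 i \in axes by apply: map_f; rewrite mem_enum.
rewrite -count_mem_gt0 /windows !count_cat; case: (count_mem _ axes) => // n _.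
by rewrite !addnA addSn addnS -addnA.
Qed.

Lemma rays_count k : exists c : R, [/\ c != 0, `|c| = eps &
  (3 <= count_mem (c *: ell_ E k) windows)%N].
Proof.
have H (i : 'I_d1) : (3 <= count_mem (eps *: ell_ E (true, i)) windows)%N.
  have : eps *: ell_ E (true, i) \in rays by apply: map_f; rewrite mem_enum.
  rewrite -count_mem_gt0 /windows !count_cat; case: (count_mem _ rays) => // n _.
  by rewrite !addnA !(addSn, addnS).
case: k => -[] i.
  by exists eps; rewrite gt_eqF// gtr0_norm.
exists (- eps); rewrite oppr_eq0 gt_eqF// normrN gtr0_norm//; split => //.
by rewrite (good_ell_opp GE) scalerN scaleNr opprK; exact: H.
Qed.

Definition smoothc : R := 2 * (Lp * window_size).
Definition consc : R := 16 * Lp * K.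

(* Average the shaken solution over a window of size eps; repeating each direction makes
   the average as many times differentiable along it. *)
Lemma smooth_approximation : exists w : R -> 'rV[R]_d -> R,
  [/\ C12 w,
     (forall (t : R) x, is_derive t 1 (fun s : R => w s x) (Defs.dt w t x)),
     (forall t x, 0 <= t <= T -> `|w t x - u t x| <= smoothc * eps),
     (forall alpha t x, 0 <= t < T -> Defs.dt w t x + Lop E h alpha t (w t) x <= 0) &
     (forall k t x s, 0 <= t <= T -> 0 < s ->
       `|fd2 s (ell_ E k) (w t) x - Defs.D2 (ell_ E k) w t x| <= consc * (s ^+ 2 / eps ^+ 3) /\
       `|fd1 s (ell_ E k) (w t) x - Defs.D1 (ell_ E k) w t x| <= consc * (s / eps))].
Proof.
(* The displacements must reach every point over which the average extends. *)
pose rho := eps * window_size.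
have ws0 : 0 < window_size.
  by rewrite /window_size ltr_wpDl// addr_ge0 ?mulr_ge0.
have rho0 : 0 < rho by rewrite mulr_gt0.
have [v [vt [fv Hv]]] := flow_shake alpha0 K1 lam0 h0 T0 th thl GE fu rho0.
have GS := good_shake 1 rho GE.
have e0 : enorm (0 : 'rV[R]_d) <= rho by rewrite enorm0 ltW.
pose beta0 : @shakes R d A rho := (alpha0, exist _ 0 e0).
have jv := flow_jc beta0 K1 lam0 h0 T0 th thl GS fv.
have jvt := flow_jc_ut beta0 K1 lam0 h0 T0 th thl GS fv.
have Lv t : 0 <= t <= T -> lipx Lp (v t).
  by move=> tT x y; exact: (flow_lipschitz beta0 K1 lam0 h0 T0 th thl GS fv).
have Lp0 : 0 <= Lp by exact: lipc_ge0.
pose w t := avg windows (v t).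
have dw (t : R) x : is_derive t 1 (fun s : R => w s x) (avg windows (vt t) x).
  exact: (flow_is_derive_avg beta0 K1 lam0 h0 T0 th thl GS fv).
have dtw : Defs.dt w = fun t x => avg windows (vt t) x.
  by apply/funext => t; apply/funext => x; have [_ <-] := dw t x.
pose ei (i : 'I_d) : 'rV[R]_d := delta_mx ord0 i.
have epsn0 : eps != 0 by rewrite gt_eqF.
pose w1 (i : 'I_d) (t : R) := quot eps (eps *: ei i) (avg (rem (eps *: ei i) windows) (v t)).
pose w2 (i j : 'I_d) (t : R) := quot eps (eps *: ei i) (quot eps (eps *: ei j)
   (avg (rem (eps *: ei j) (rem (eps *: ei i) windows)) (v t))).
have lv t : exists L, 0 <= L /\ lipx L (v t).
  have [L HL] := jv.1 t; exists `|L|; split=> //.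
  by apply: lipx_le HL; exact: ler_norm.
have U1 i t : UD (ei i) (w t) (w1 i t).
  have [L [L0 HL]] := lv t; apply: (UD_avg L0 HL epsn0) => //.
  by rewrite -count_mem_gt0; apply: leq_trans (axes_count i).
have U2 i j t : UD (ei j) (w1 i t) (w2 i j t).
  have [L [L0 HL]] := lv t; apply: UD_quot; apply: (UD_avg L0 HL epsn0) => //.
  rewrite -count_mem_gt0 -ltnS; apply: leq_trans (axes_count j) _.
  exact: count_mem_rem.
have dxw i : Defs.dx i w = w1 i.
  apply/funext => t; apply/funext => x.
  by have [_ <-] := UD_is_derive x (U1 i t).
have dxxw i j : Defs.dx j (Defs.dx i w) = w2 i j.
  apply/funext => t; apply/funext => x; rewrite dxw.
  by have [_ <-] := UD_is_derive x (U2 i j t).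
have jw1 i : jc (w1 i) by apply: jc_quot; exact: jc_avg.
have jw2 i j : jc (w2 i j) by apply: jc_quot; apply: jc_quot; exact: jc_avg.
exists w; split.
- split.
  + by apply: jc_continuous; exact: jc_avg.
  + by move=> t x; have [] := dw t x.
  + by rewrite dtw; apply: jc_continuous; exact: jc_avg.
  + by move=> i t x; have [] := UD_is_derive x (U1 i t).
  + by move=> i; rewrite dxw; exact: jc_continuous.
  + by move=> i j t x; rewrite dxw; have [] := UD_is_derive x (U2 i j t).
  + by move=> i j; rewrite dxxw; exact: jc_continuous.
- by move=> t x; rewrite dtw.
- move=> t x tT; rewrite (le_trans (ler_distD (v t x) _ _))//.
  have -> : smoothc * eps = Lp * rho + Lp * rho by rewrite /smoothc /rho; ring.
  rewrite lerD//; last exact: Hv.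
  apply: le_trans (avg_near windows x Lp0 (Lv t tT)) _.
  by rewrite ler_wpM2l// windows_size.
- move=> alpha t x tT; rewrite dtw.
  have [L [_ HL]] := lv t; have [M HM] := jvt.1 t.
  rewrite -(avg_Lop E (lt0r_neq0 h0) alpha t x HL windows).
  have [L' HL'] := Lop_lipx E (lt0r_neq0 h0) alpha t x HL.
  have := avg_lin windows 1 1 x HM HL'; rewrite !mul1r => <-.
  apply: (avg_local_le0 (lipx_lin 1 1 HM HL')) => y yw.
  rewrite !mul1r [x + y - x]addrAC subrr add0r.
  apply: (flow_shake_le alpha0 lam0 h0 GE rho0 fv) => //.
  exact: le_trans yw windows_size.
- move=> k t x s tT s0.
  have [c [c0 ce ck]] := rays_count k.
  set l := ell_ E k in ck *; set z := c *: l in ck.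
  have m1 : z \in windows by rewrite -count_mem_gt0; apply: leq_trans ck.
  have m2 : z \in rem z windows.
    by rewrite -count_mem_gt0 -ltnS (leq_trans _ (count_mem_rem windows z z))// (leq_trans _ ck).
  have m3 : z \in rem z (rem z windows).
    rewrite -count_mem_gt0 -ltnS (leq_trans _ (count_mem_rem _ z z))// -ltnS.
    by rewrite (leq_trans _ (count_mem_rem windows z z)).
  have V0 := UD_avg Lp0 (Lv t tT) c0 (erefl z) m1.
  have V1 := UD_quot c z (UD_avg Lp0 (Lv t tT) c0 (erefl z) m2).
  have V2 := UD_quot c z (UD_quot c z (UD_avg Lp0 (Lv t tT) c0 (erefl z) m3)).
  have cw p M : lipx M p -> lipx (2 * M / eps) (quot c z p).
    by move=> Mp; rewrite -ce; exact: quot_lipx.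
  have lK : enorm l <= K by exact: good_ell GE k.
  have L1 i : lipx (2 * Lp / `|eps|) (w1 i t).
    by apply: quot_lipx; exact: avg_lipx (Lv t tT).
  have L2 i j : lipx (2 * (2 * Lp / `|eps|) / `|eps|) (w2 i j t).
    by apply: quot_lipx; apply: quot_lipx; exact: avg_lipx (Lv t tT).
  (* By uniqueness of derivatives the coordinate expressions [D1] and [D2] are also iterated
     quotients along the ray, which can be bounded by the Lipschitz constant of [v] and powers of
     [eps]. *)
  have E1 := UD_uniq V0 (UD_coord l L1 (fun i => U1 i t)).
  have E2 : quot c z (quot c z (avg (rem z (rem z windows)) (v t))) =
      fun x => \sum_i (\sum_j w2 i j t x * l ord0 j) * l ord0 i.
    apply: UD_uniq V1 _; rewrite E1; apply: UD_sum => i.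
    exact: UD_coord (L2 i) (fun j => U2 i j t).
  have D1E : Defs.D1 l w t x = quot c z (avg (rem z windows) (v t)) x.
    by rewrite E1 /Defs.D1; apply: eq_bigr => i _; rewrite dxw.
  have D2E : Defs.D2 l w t x = quot c z (quot c z (avg (rem z (rem z windows)) (v t))) x.
    rewrite E2 /Defs.D2; apply: eq_bigr => i _; rewrite mulr_suml; apply: eq_bigr => j _.
    by rewrite dxxw mulrAC.
  rewrite D1E D2E.
  have N2 y : `|quot c z (quot c z (avg (rem z (rem z windows)) (v t))) y| <= 2 * Lp / eps * K.
    apply: le_trans (quot_le y (cw _ _ (avg_lipx _ (Lv t tT))) (erefl z) c0) _.
    by rewrite ler_wpM2l// divr_ge0 ?(ltW eps0)// mulr_ge0.
  have N4 y r : `|quot c z (quot c z (quot c z (avg (rem z (rem z (rem z windows))) (v t)))) (y + r *: l)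
      - quot c z (quot c z (quot c z (avg (rem z (rem z (rem z windows))) (v t)))) y|
      <= 8 * Lp / eps ^+ 3 * K * `|r|.
    apply: le_trans (cw _ _ (cw _ _ (cw _ _ (avg_lipx _ (Lv t tT)))) y (r *: l)) _.
    rewrite enormZ [`|r| * _]mulrC [leLHS]mulrA; apply: ler_wpM2r => //.
    have -> : 2 * (2 * (2 * Lp / eps) / eps) / eps = 8 * Lp / eps ^+ 3.
      by field.
    by rewrite ler_wpM2l// divr_ge0 ?exprn_ge0 ?(ltW eps0)// mulr_ge0.
  have [F1 F2] := fd_consistency x s0 V0 V1 V2 N2 N4; split.
    apply: le_trans F1 _; apply: eq_ler; rewrite /consc; ring.
  apply: le_trans F2 _; rewrite /consc.
  have -> : 2 * Lp / eps * K * s = 2 * Lp * K * (s / eps) by ring.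
  rewrite ler_wpM2r ?divr_ge0 ?(ltW eps0) ?(ltW s0)//.
  have : 0 <= Lp * K by rewrite mulr_ge0.
  by rewrite -!mulrA; lra.
Qed.

End smooth_approximation.

(** * Viscosity subsolutions *)

Section test_functions.
Context {R : realType} {d : nat}.
Implicit Types (x e : 'rV[R]_d).

Definition sqn x : R := \sum_(i < d) x ord0 i ^+ 2.

Lemma UD_sqn e : UD e sqn (fun x => 2 * \sum_(i < d) x ord0 i * e ord0 i).
Proof.
exists (sqn e) => x s; rewrite /sqn mulr_suml !mulr_sumr -!sumrB.
rewrite ger0_norm; last first.
  apply: sumr_ge0 => i _; rewrite !mxE.
  have -> : (x ord0 i + s * e ord0 i) ^+ 2 - x ord0 i ^+ 2 - s * (2 * (x ord0 i * e ord0 i)) =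
    (s * e ord0 i) ^+ 2 by ring.
  exact: sqr_ge0.
by apply: ler_sum => i _; rewrite !mxE; apply: eq_ler; ring.
Qed.

Lemma UD_coordinate e i : UD e (fun x => 2 * x ord0 i) (fun=> 2 * e ord0 i).
Proof.
exists 0 => x s; rewrite mul0r !mxE.
by rewrite (_ : _ - _ = 0) ?normr0//; ring.
Qed.

Lemma C12D (f g : R -> 'rV[R]_d -> R) : C12 f -> C12 g ->
  [/\ C12 (fun t x => f t x + g t x),
      Defs.dt (fun t x => f t x + g t x) = (fun t x => Defs.dt f t x + Defs.dt g t x),
      (forall i, Defs.dx i (fun t x => f t x + g t x) =
                 (fun t x => Defs.dx i f t x + Defs.dx i g t x)) &
      (forall i j, Defs.dx j (Defs.dx i (fun t x => f t x + g t x)) =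
         (fun t x => Defs.dx j (Defs.dx i f) t x + Defs.dx j (Defs.dx i g) t x))].
Proof.
move=> Cf Cg.
have Edt : Defs.dt (fun t x => f t x + g t x) = (fun t x => Defs.dt f t x + Defs.dt g t x).
  apply/funext => t; apply/funext => x; rewrite /Defs.dt.
  rewrite -[LHS]/('D_1 ((fun s : R => f s x) + (fun s : R => g s x)) t) deriveD//.
    exact: (C12_dt Cf).
  exact: (C12_dt Cg).
have Edx i : Defs.dx i (fun t x => f t x + g t x) =
    (fun t x => Defs.dx i f t x + Defs.dx i g t x).
  apply/funext => t; apply/funext => x; rewrite /Defs.dx.
  rewrite -[LHS]/('D_(delta_mx ord0 i) (f t + g t) x) deriveD//.
    exact: (C12_dx Cf).
  exact: (C12_dx Cg).
have Edxx i j : Defs.dx j (Defs.dx i (fun t x => f t x + g t x)) =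
    (fun t x => Defs.dx j (Defs.dx i f) t x + Defs.dx j (Defs.dx i g) t x).
  rewrite Edx; apply/funext => t; apply/funext => x; rewrite /Defs.dx.
  rewrite -[LHS]/('D_(delta_mx ord0 j) (Defs.dx i f t + Defs.dx i g t) x) deriveD//.
    exact: (C12_dxx Cf).
  exact: (C12_dxx Cg).
split => //; split.
- by move=> z; apply: cvgD; [exact: (C12_cont Cf)|exact: (C12_cont Cg)].
- by move=> t x; apply: derivableD; [exact: (C12_dt Cf)|exact: (C12_dt Cg)].
- by rewrite Edt => z; apply: cvgD; [exact: (C12_dt_cont Cf)|exact: (C12_dt_cont Cg)].
- by move=> i t x; apply: derivableD; [exact: (C12_dx Cf)|exact: (C12_dx Cg)].
- by move=> i; rewrite Edx => z; apply: cvgD; [exact: (C12_dx_cont Cf)|exact: (C12_dx_cont Cg)].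
- move=> i j t x; rewrite Edx.
  by apply: derivableD; [exact: (C12_dxx Cf)|exact: (C12_dxx Cg)].
- move=> i j; rewrite Edxx => z.
  by apply: cvgD; [exact: (C12_dxx_cont Cf)|exact: (C12_dxx_cont Cg)].
Qed.

Definition barrier (beta nu T kappa : R) (t : R) x : R := beta + nu * (T - t) + kappa * sqn x.

Lemma coord_snd_continuous (i : 'I_d) : continuous (fun z : R * 'rV[R]_d => z.2 ord0 i).
Proof.
move=> z; apply: (@continuous_comp _ _ _ snd (fun x : 'rV[R]_d => x ord0 i)).
  exact: cvg_snd.
exact: coord_continuous.
Qed.

Lemma continuous_bigsum (V : topologicalType) (I : Type) (r : seq I) (F : I -> V -> R) :
  (forall i, continuous (F i)) -> continuous (fun z => \sum_(i <- r) F i z).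
Proof.
move=> cF; elim: r => [|i r IH] z.
  by under eq_fun do rewrite big_nil; exact: cvg_cst.
by under eq_fun do rewrite big_cons; apply: cvgD; [exact: cF|exact: IH].
Qed.

Lemma C12_barrier beta nu T kappa :
  [/\ C12 (barrier beta nu T kappa),
      Defs.dt (barrier beta nu T kappa) = (fun _ _ => - nu),
      (forall i, Defs.dx i (barrier beta nu T kappa) = (fun _ x => kappa * (2 * x ord0 i))) &
      (forall i j, Defs.dx j (Defs.dx i (barrier beta nu T kappa)) =
         (fun _ _ => kappa * (2 * (i == j)%:R)))].
Proof.
have Dt (t : R) x : is_derive t 1 (fun s : R => barrier beta nu T kappa s x) (- nu).
  apply: derive_from_bound => e e0; exists 1 => // s _.
  rewrite -[s *: 1]/(s * 1) mulr1 /barrier.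
  by rewrite (_ : _ - _ = 0) ?normr0 ?mulr_ge0 ?(ltW e0)//; ring.
have Dx i t x : is_derive x (delta_mx ord0 i) (barrier beta nu T kappa t) (kappa * (2 * x ord0 i)).
  have U := @UD_sqn (delta_mx ord0 i).
  apply: (@UD_is_derive R d _ _ (fun y => kappa * (2 * y ord0 i))).
  have [C HC] := UD_lin kappa 0 U U; exists C => y s; have := HC y s.
  rewrite !mul0r !addr0 /barrier.
  have -> : \sum_(j < d) y ord0 j * (delta_mx ord0 i : 'rV[R]_d) ord0 j = y ord0 i.
    rewrite (bigD1 i)//= mxE !eqxx mulr1 big1 ?addr0// => j ji.
    by rewrite mxE (negPf ji) andbF mulr0.
  by congr (`|_ - _| <= _); ring.
have Edx i : Defs.dx i (barrier beta nu T kappa) = (fun _ x => kappa * (2 * x ord0 i)).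
  by apply/funext => t; apply/funext => x; have [_ <-] := Dx i t x.
have Dxx i j (t : R) x : is_derive x (delta_mx ord0 j) (fun y : 'rV[R]_d => kappa * (2 * y ord0 i))
    (kappa * (2 * (i == j)%:R)).
  have U := @UD_coordinate (delta_mx ord0 j) i.
  have := UD_is_derive x (UD_lin kappa 0 U U).
  have -> : (fun y : 'rV[R]_d => kappa * (2 * y ord0 i) + 0 * (2 * y ord0 i)) =
    (fun y => kappa * (2 * y ord0 i)) by apply/funext => y; rewrite mul0r addr0.
  by rewrite mul0r addr0 mxE eqxx.
have Edxx i j : Defs.dx j (Defs.dx i (barrier beta nu T kappa)) =
    (fun _ _ => kappa * (2 * (i == j)%:R)).
  by rewrite Edx; apply/funext => t; apply/funext => x; have [_ <-] := Dxx i j t x.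
have Edt : Defs.dt (barrier beta nu T kappa) = (fun _ _ => - nu).
  by apply/funext => t; apply/funext => x; have [_ <-] := Dt t x.
split => //; split.
- move=> z; apply: cvgD.
    apply: cvgD; first exact: cvg_cst.
    apply: cvgM; first exact: cvg_cst.
    by apply: cvgB; [exact: cvg_cst|exact: cvg_fst].
  apply: cvgM; first exact: cvg_cst.
  apply: continuous_bigsum => i y.
  by apply: cvgM; exact: coord_snd_continuous.
- by move=> t x; have [] := Dt t x.
- by rewrite Edt => z; exact: cvg_cst.
- by move=> i t x; have [] := Dx i t x.
- move=> i; rewrite Edx => z; apply: cvgM; first exact: cvg_cst.
  by apply: cvgM; [exact: cvg_cst|exact: coord_snd_continuous].
- by move=> i j t x; rewrite Edx; have [] := Dxx i j t x.
- by move=> i j; rewrite Edxx => z; exact: cvg_cst.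
Qed.

Lemma D1_barrier beta nu T kappa l t x :
  Defs.D1 l (barrier beta nu T kappa) t x = 2 * kappa * \sum_(i < d) x ord0 i * l ord0 i.
Proof.
rewrite /Defs.D1 mulr_sumr; apply: eq_bigr => i _.
by have [_ _ E _] := C12_barrier beta nu T kappa; rewrite E/=; ring.
Qed.

Lemma D2_barrier beta nu T kappa l t x :
  Defs.D2 l (barrier beta nu T kappa) t x = 2 * kappa * enorm l ^+ 2.
Proof.
rewrite /Defs.D2 enorm_sqr mulr_sumr; apply: eq_bigr => i _.
have [_ _ _ E] := C12_barrier beta nu T kappa.
rewrite (bigD1 i)//= E eqxx big1 => [|j ji]; first by rewrite mulr1n; ring.
by rewrite E eq_sym (negPf ji) !mulr0 !mul0r.
Qed.

Lemma D1_add (f g : R -> 'rV[R]_d -> R) l t x : C12 f -> C12 g ->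
  Defs.D1 l (fun t x => f t x + g t x) t x = Defs.D1 l f t x + Defs.D1 l g t x.
Proof.
move=> Cf Cg; have [_ _ E _] := C12D Cf Cg.
by rewrite /Defs.D1 -big_split/=; apply: eq_bigr => i _; rewrite E mulrDl.
Qed.

Lemma D2_add (f g : R -> 'rV[R]_d -> R) l t x : C12 f -> C12 g ->
  Defs.D2 l (fun t x => f t x + g t x) t x = Defs.D2 l f t x + Defs.D2 l g t x.
Proof.
move=> Cf Cg; have [_ _ _ E] := C12D Cf Cg.
rewrite /Defs.D2 -big_split/=; apply: eq_bigr => i _.
by rewrite -big_split/=; apply: eq_bigr => j _; rewrite E !mulrDl.
Qed.

End test_functions.

Section viscosity_comparison.
Context {R : realType} {d d1 : nat} {A : Type} (alpha0 : A).
Context (E : bellman_data R d d1 A) (K lambda T : R).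
Hypotheses (GE : good K lambda E) (lam0 : 0 <= lambda) (T0 : 0 < T).

Let K0 := good_K_ge0 GE.

Definition Ldiff (alpha : A) (phi : R -> 'rV[R]_d -> R) (r t : R) x : R :=
  \sum_k a_ E alpha k t x * Defs.D2 (ell_ E k) phi t x +
  \sum_k b_ E alpha k t x * Defs.D1 (ell_ E k) phi t x - c_ E alpha t x * r + f_ E alpha t x.

Lemma sqn_dot (x l : 'rV[R]_d) s : 0 < s ->
  \sum_(i < d) x ord0 i * l ord0 i <= s * sqn x + enorm l ^+ 2 / s.
Proof.
move=> s0; rewrite enorm_sqr /sqn mulr_sumr mulr_suml -big_split/=.
apply: ler_sum => i _.
have := sqr_ge0 (s * x ord0 i - l ord0 i).
have -> : s * x ord0 i ^+ 2 + l ord0 i ^+ 2 / s =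
   (s ^+ 2 * x ord0 i ^+ 2 + l ord0 i ^+ 2) / s by field; rewrite gt_eqF.
rewrite ler_pdivlMr// sqrrB exprMn => H.
have := sqr_ge0 (s * x ord0 i); have := sqr_ge0 (l ord0 i); rewrite exprMn; lra.
Qed.

(** The gradient of the penalty grows linearly. The parameter [s] splits the drift term into a part
    proportional to [kappa * sqn x], which stays bounded at a maximum, and one proportional to
    [kappa / s]; [s] and then [kappa] are taken small. *)
Lemma Ldiff_barrier alpha kappa s beta nu t x : 0 <= kappa -> 0 < s ->
  \sum_k a_ E alpha k t x * Defs.D2 (ell_ E k) (barrier beta nu T kappa) t x +
  \sum_k b_ E alpha k t x * Defs.D1 (ell_ E k) (barrier beta nu T kappa) t x <=
  ndirs (d1 := d1) * (K ^+ 4 * kappa) + ndirs (d1 := d1) * (K * (2 * (s * (kappa * sqn x) + K ^+ 2 * kappa / s))).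
Proof.
move=> kap0 s0; apply: lerD; rewrite /ndirs -sumr_cst; apply: ler_sum => k _.
  rewrite D2_barrier.
  have lK : enorm (ell_ E k) ^+ 2 <= K ^+ 2.
    by rewrite ler_pXn2r ?nnegrE ?enorm_ge0//; exact: (good_ell GE).
  have : a_ E alpha k t x * (2 * kappa * enorm (ell_ E k) ^+ 2) <= K ^+ 2 / 2 * (2 * kappa * K ^+ 2).
    apply: ler_pM; [exact: a_ge0|by rewrite mulr_ge0 ?sqr_ge0// mulr_ge0|exact: a_le GE|].
    by rewrite ler_wpM2l// mulr_ge0.
  by move=> /le_trans; apply; apply: eq_ler; field.
rewrite D1_barrier.
have bK : b_ E alpha k t x <= K.
  by have [/(_ t x) + _ _] := good_b GE alpha k; exact/le_trans/ler_norm.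
have b0 := good_b_ge0 GE alpha k t x.
have q0 : 0 <= sqn x by apply: sumr_ge0 => i _; exact: sqr_ge0.
have H : 2 * kappa * (\sum_(i < d) x ord0 i * ell_ E k ord0 i) <=
    2 * (s * (kappa * sqn x) + K ^+ 2 * kappa / s).
  have := sqn_dot x (ell_ E k) s0.
  have lK : enorm (ell_ E k) ^+ 2 / s <= K ^+ 2 / s.
    by rewrite ler_pM2r ?invr_gt0// ler_pXn2r ?nnegrE ?enorm_ge0//; exact: (good_ell GE).
  move=> H; have {}H := ler_wpM2l kap0 (le_trans H (lerD (lexx _) lK)).
  have -> : K ^+ 2 * kappa / s = kappa * (K ^+ 2 / s) by ring.
  lra.
apply: le_trans (ler_wpM2l b0 H) _.
rewrite ler_wpM2r// mulr_ge0// addr_ge0//; first by rewrite !mulr_ge0// ltW.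
by rewrite divr_ge0 ?(ltW s0)// mulr_ge0// sqr_ge0.
Qed.

Definition nbd (r : R) : set (R * 'rV[R]_d) :=
  `[0, T] `*` [set x : 'rV[R]_d | forall i : 'I_d, `[- r, r]%classic (x ord0 i)].

Lemma nbd_compact r : compact (nbd r).
Proof.
apply: compact_setX; first exact: segment_compact.
by apply: (@rV_compact _ _ (fun=> `[- r, r]%classic)) => i; exact: segment_compact.
Qed.

(* Penalization by a small multiple of |x|^2 localizes the maximum. *)
Lemma viscosity_comparison (v w : R -> 'rV[R]_d -> R) e beta nu M :
  viscosity_sub T E v ->
  {within `[0, T] `*` [set: 'rV[R]_d], continuous (fun z : R * 'rV[R]_d => v z.1 z.2)} ->
  C12 w -> (forall t x, 0 <= t <= T -> `|v t x| <= M) ->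
  (forall t x, 0 <= t <= T -> `|w t x| <= M) ->
  (forall alpha t x, 0 <= t < T -> Defs.dt w t x + Ldiff alpha w (w t x) t x <= e) ->
  0 <= beta -> 0 <= nu -> e <= nu + lambda * beta ->
  (forall x, v T x - w T x <= beta) ->
  forall t x, 0 <= t <= T -> v t x - w t x <= beta + nu * (T - t).
Proof.
move=> vsub vcont Cw vM wM wsup be0 nu0 enu term t1 x1 t1T.
rewrite leNgt; apply/negP => viol.
pose g := v t1 x1 - w t1 x1 - (beta + nu * (T - t1)).
have g0 : 0 < g by rewrite /g; lra.
(* The steeper slope costs at most [g / 4] on [[0, T]], and [kappa * sqn x1] will cost at most
   another [g / 4], so the violation persists. The gain [g / (4 * T)] must beat the contribution of
   the penalty to the operator; [s] and [kappa] keep that below half of it. *)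
pose mu := nu + g / (4 * T).
have mug : mu - nu = g / (4 * T) by rewrite /mu; ring.
have gT0 : 0 < g / (4 * T) by rewrite divr_gt0// mulr_gt0.
pose M2 := 2 * M + 1.
have M0 : 0 <= M by apply: le_trans (vM t1 x1 t1T).
have M20 : 0 < M2 by rewrite /M2; lra.
pose nd : R := ndirs (d1 := d1).
have nd0 : 0 <= nd by rewrite /nd /ndirs.
pose s := g / (4 * T) / (8 * (nd * K * M2 + 1)).
have s0 : 0 < s by rewrite divr_gt0// mulr_gt0// ltr_wpDl// !mulr_ge0// ltW.
pose Q := nd * K ^+ 4 + nd * (K * (2 * (K ^+ 2 / s))).
have Q0 : 0 <= Q.
  by rewrite /Q addr_ge0 ?mulr_ge0 ?exprn_ge0// ?invr_ge0// ltW.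
pose kappa := Num.min (g / (4 * (sqn x1 + 1))) (g / (4 * T) / (4 * (Q + 1))).
have q1 : 0 <= sqn x1 by apply: sumr_ge0 => i _; exact: sqr_ge0.
have kap0 : 0 < kappa.
  by rewrite lt_min !divr_gt0 ?mulr_gt0// ltr_wpDl.
have [Cb dtb _ _] := C12_barrier (d := d) beta mu T kappa.
pose phi t x := w t x + barrier beta mu T kappa t x.
have [Cphi dtphi _ _] := C12D Cw Cb.
(* [Psi] is negative once a coordinate exceeds [r - 1]; the margin 1 makes the maximum over the box
   a local one. *)
pose r := Num.sqrt (M2 / kappa) + 1.
pose Psi (z : R * 'rV[R]_d) := v z.1 z.2 - phi z.1 z.2.
have sq0 (y : 'rV[R]_d) : 0 <= sqn y by apply: sumr_ge0 => i _; exact: sqr_ge0.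
have mu0 : 0 <= mu by rewrite /mu addr_ge0// ltW.
have Psi1 : 0 < Psi (t1, x1).
  rewrite /Psi /phi /barrier /=.
  have k1 : kappa * sqn x1 <= g / 4.
    have : kappa <= g / (4 * (sqn x1 + 1)) by rewrite ge_min lexx.
    move=> /(ler_wpM2r q1)/le_trans; apply.
    have -> : g / (4 * (sqn x1 + 1)) * sqn x1 = g / 4 * (sqn x1 / (sqn x1 + 1)).
      by field; rewrite gt_eqF// ltr_wpDl.
    rewrite ler_piMr ?divr_ge0 ?(ltW g0)// ler_pdivrMr ?ltr_wpDl// mul1r lerDl//.
  have k2 : (mu - nu) * (T - t1) <= g / 4.
    rewrite mug; have -> : g / 4 = g / (4 * T) * T by field; rewrite gt_eqF.
    rewrite ler_wpM2l ?(ltW gT0)// gerBl; by case/andP: t1T.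
  move: g0 k1 k2; rewrite /g; lra.
have bnd (z : R * 'rV[R]_d) : 0 <= z.1 <= T -> 0 <= Psi z -> kappa * sqn z.2 <= M2.
  move=> zT; rewrite /Psi /phi /barrier.
  have := vM z.1 z.2 zT; have := wM z.1 z.2 zT.
  have : 0 <= mu * (T - z.1) by rewrite mulr_ge0// subr_ge0; case/andP: zT.
  by rewrite !ler_norml /M2; lra.
have r0 : 0 < r by rewrite ltr_wpDl// sqrtr_ge0.
have box (y : 'rV[R]_d) i : kappa * sqn y <= M2 -> `|y ord0 i| <= r - 1.
  move=> H; rewrite /r addrK -sqrtr_sqr ler_wsqrtr// ler_pdivlMr// mulrC.
  apply: le_trans H; rewrite ler_wpM2l ?(ltW kap0)// /sqn (bigD1 i)//= lerDl.
  by apply: sumr_ge0 => j _; exact: sqr_ge0.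
have in_nbd (z : R * 'rV[R]_d) : 0 <= z.1 <= T -> (forall i, `|z.2 ord0 i| <= r) -> nbd r z.
  move=> zT H; split; first by rewrite /= in_itv.
  by move=> i /=; rewrite in_itv/= -ler_norml; exact: H.
have nz1 : nbd r (t1, x1).
  apply: in_nbd => //= i; apply: (@le_trans _ _ (r - 1)); last by rewrite gerBl.
  by apply: box; apply: (bnd (t1, x1)) => //; exact: ltW.
have cPsi : {within nbd r, continuous Psi}.
  have sub : nbd r `<=` `[0, T] `*` [set: 'rV[R]_d] by move=> z [h1 _]; split.
  have c1 := continuous_subspaceW sub vcont.
  have c2 : {within nbd r, continuous (fun z : R * 'rV[R]_d => phi z.1 z.2)}.
    by apply: continuous_subspaceT => z; exact: (C12_cont Cphi).
  by move=> z; apply: cvgB; [exact: c1|exact: c2].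
have [z0 z0n Hz0] := compact_EVT_max (ex_intro _ _ nz1) (@nbd_compact r) cPsi.
have {}Hz0 z : nbd r z -> Psi z <= Psi z0 by move=> nz; apply: Hz0; rewrite inE.
have Psi0 : 0 < Psi z0 by apply: lt_le_trans Psi1 (Hz0 _ nz1).
have z0T : 0 <= z0.1 <= T by move: z0n; rewrite inE => -[]; rewrite /= in_itv.
have kz0 := bnd z0 z0T (ltW Psi0).
have z0T' : 0 <= z0.1 < T.
  case/andP: z0T => h1 h2; rewrite h1 lt_neqAle h2 andbT; apply/eqP => zT.
  move: Psi0; rewrite /Psi /phi /barrier zT.
  have := term z0.2; have : 0 <= kappa * sqn z0.2 by rewrite mulr_ge0// ltW.
  lra.
have touch : touches_above T v phi z0.1 z0.2.
  rewrite /touches_above -surjective_pairing.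
  exists (ball z0.1 1, ball z0.2 1) => /=; first by split; exact: nbhsx_ballx.
  move=> [t x] [/= _ B2] /andP[t0 /ltW tT].
  have := Hz0 (t, x); rewrite /Psi /=; apply.
  apply: in_nbd => /=; first by rewrite t0.
  move=> i; have := box z0.2 i kz0.
  have : `|z0.2 ord0 i - x ord0 i| < 1.
    move: B2; rewrite -ball_normE /ball_/=; apply: le_lt_trans.
    by have := coord_le_mxnorm (z0.2 - x) i; rewrite !mxE.
  have := ler_normB (z0.2 ord0 i) (z0.2 ord0 i - x ord0 i).
  have -> : z0.2 ord0 i - (z0.2 ord0 i - x ord0 i) = x ord0 i by ring.
  lra.
have := vsub phi z0.1 z0.2 Cphi z0T' touch.
apply/negP; rewrite -ltNge /bellman_at.
rewrite [X in X + _](_ : _ = Defs.dt w z0.1 z0.2 - mu); last by rewrite dtphi dtb.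
have vw : beta <= v z0.1 z0.2 - w z0.1 z0.2.
  move: Psi0; rewrite /Psi /phi /barrier.
  have : 0 <= mu * (T - z0.1) by rewrite mulr_ge0// subr_ge0; case/andP: z0T.
  have : 0 <= kappa * sqn z0.2 by rewrite mulr_ge0// ltW.
  lra.
have kq : 0 <= kappa * sqn z0.2 by rewrite mulr_ge0// ltW.
have bound alpha : \sum_k a_ E alpha k z0.1 z0.2 * Defs.D2 (ell_ E k) phi z0.1 z0.2 +
    \sum_k b_ E alpha k z0.1 z0.2 * Defs.D1 (ell_ E k) phi z0.1 z0.2 -
    c_ E alpha z0.1 z0.2 * v z0.1 z0.2 + f_ E alpha z0.1 z0.2 <=
    e - Defs.dt w z0.1 z0.2 - lambda * beta + g / (4 * T) / 2.
  have -> : \sum_k a_ E alpha k z0.1 z0.2 * Defs.D2 (ell_ E k) phi z0.1 z0.2 =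
     \sum_k a_ E alpha k z0.1 z0.2 * Defs.D2 (ell_ E k) w z0.1 z0.2 +
     \sum_k a_ E alpha k z0.1 z0.2 * Defs.D2 (ell_ E k) (barrier beta mu T kappa) z0.1 z0.2.
    by rewrite -big_split/=; apply: eq_bigr => k _; rewrite (D2_add _ _ _ Cw Cb) mulrDr.
  have -> : \sum_k b_ E alpha k z0.1 z0.2 * Defs.D1 (ell_ E k) phi z0.1 z0.2 =
     \sum_k b_ E alpha k z0.1 z0.2 * Defs.D1 (ell_ E k) w z0.1 z0.2 +
     \sum_k b_ E alpha k z0.1 z0.2 * Defs.D1 (ell_ E k) (barrier beta mu T kappa) z0.1 z0.2.
    by rewrite -big_split/=; apply: eq_bigr => k _; rewrite (D1_add _ _ _ Cw Cb) mulrDr.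
  have Hb := Ldiff_barrier alpha beta mu z0.1 z0.2 (ltW kap0) s0.
  have Hw := wsup alpha z0.1 z0.2 z0T'.
  have Hc : lambda * beta <= c_ E alpha z0.1 z0.2 * (v z0.1 z0.2 - w z0.1 z0.2).
    by apply: ler_pM => //; exact: (good_c_ge GE).
  have small : nd * (K ^+ 4 * kappa) + nd * (K * (2 * (s * (kappa * sqn z0.2) + K ^+ 2 * kappa / s)))
      <= g / (4 * T) / 2.
    have -> : nd * (K ^+ 4 * kappa) + nd * (K * (2 * (s * (kappa * sqn z0.2) + K ^+ 2 * kappa / s)))
      = kappa * Q + 2 * s * (nd * K * (kappa * sqn z0.2)) by rewrite /Q; ring.
    have p1 : kappa * Q <= g / (4 * T) / 4.
      have : kappa <= g / (4 * T) / (4 * (Q + 1)) by rewrite ge_min lexx orbT.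
      move=> /(ler_wpM2r Q0)/le_trans; apply.
      have Qn : Q + 1 != 0 by rewrite gt_eqF// ltr_wpDl.
      have -> : g / (4 * T) / (4 * (Q + 1)) * Q = g / (4 * T) / 4 * (Q / (Q + 1)).
        by field; rewrite Qn gt_eqF.
      rewrite ler_piMr ?divr_ge0 ?(ltW g0) ?mulr_ge0 ?(ltW T0)//.
      by rewrite ler_pdivrMr ?ltr_wpDl// mul1r lerDl.
    have p2 : 2 * s * (nd * K * (kappa * sqn z0.2)) <= g / (4 * T) / 4.
      have nK : 0 <= nd * K * M2 by rewrite !mulr_ge0// ltW.
      have : nd * K * (kappa * sqn z0.2) <= nd * K * M2 by rewrite ler_wpM2l ?mulr_ge0.
      have s20 : 0 <= 2 * s by rewrite mulr_ge0// ltW.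
      move=> /(ler_wpM2l s20)/le_trans; apply.
      have nKn : nd * K * M2 + 1 != 0 by rewrite gt_eqF// ltr_wpDl.
      have -> : 2 * s * (nd * K * M2) = g / (4 * T) / 4 * (nd * K * M2 / (nd * K * M2 + 1)).
        by rewrite /s; field; rewrite nKn gt_eqF.
      rewrite ler_piMr ?divr_ge0 ?(ltW g0) ?mulr_ge0 ?(ltW T0)//.
      by rewrite ler_pdivrMr ?ltr_wpDl// mul1r lerDl.
    have -> : g / (4 * T) / 2 = g / (4 * T) / 4 + g / (4 * T) / 4 by field; rewrite gt_eqF.
    exact: lerD.
  have {}Hb := le_trans Hb small.
  move: Hw Hb Hc; rewrite /Ldiff mulrBr.
  move: (\sum_k _) (\sum_k _) (\sum_k _) (\sum_k _) => S1 S2 S3 S4; lra.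
have supb : bellmanF E (fun k => Defs.D2 (ell_ E k) phi z0.1 z0.2)
    (fun k => Defs.D1 (ell_ E k) phi z0.1 z0.2) (v z0.1 z0.2) z0.1 z0.2 <=
    e - Defs.dt w z0.1 z0.2 - lambda * beta + g / (4 * T) / 2.
  apply: ge_sup; first by eexists; exists alpha0.
  by move=> _ [alpha _ <-]; exact: bound.
apply: (@le_lt_trans _ _ (Defs.dt w z0.1 z0.2 - mu +
   (e - Defs.dt w z0.1 z0.2 - lambda * beta + g / (4 * T) / 2))).
  by rewrite lerD2l.
rewrite /mu; move: enu gT0; lra.
Qed.

End viscosity_comparison.

(** * Rates of convergence from smooth supersolutions *)

Section rates.
Context {R : realType} {d d1 : nat} {A : Type} (alpha0 : A).
Context (E : bellman_data R d d1 A) (K lambda theta T : R).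
Hypotheses (K1 : 1 <= K) (lam0 : 0 <= lambda) (T0 : 0 < T).
Hypotheses (th : 0 <= theta <= 1) (thl : discount (d1 := d1) K * (1 - theta) <= lambda).
Hypotheses (GE : good K lambda E).

Let K0 : 0 <= K := le_trans ler01 K1.
Let th0 : 0 <= theta. Proof. by case/andP: th. Qed.
Let thl1 : 1 - theta <= lambda.
Proof.
apply: le_trans thl; rewrite ler_peMl ?subr_ge0//; first by case/andP: th.
by rewrite /discount; have := @cdrate_ge1 R d1 K; lra.
Qed.

Let C1 : R := smoothc (d := d) (d1 := d1) K theta T.
Let C2 : R := consc (d1 := d1) K theta T.

(** The factor 2 is for comparing two meshes, each measured against the differential operator. *)
Definition consistency : R := 2 * (ndirs (d1 := d1) * (K ^+ 2 / 2 * C2) + ndirs (d1 := d1) * (K * C2)).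

(** The distance [C1] from the smoothed solution is paid at the terminal time and again at time [t];
    the consistency error is paid once through the terminal bound and [theta * T] times through the
    slope in time. *)
Definition ratec : R := 2 * C1 + consistency * (1 + theta * T).

Lemma window_size_gt0 : 0 < window_size (d := d) (d1 := d1) K.
Proof. by rewrite /window_size ltr_wpDl// addr_ge0 ?mulr_ge0. Qed.

Lemma smoothc_ge0 : 0 <= C1.
Proof.
by rewrite /C1 /smoothc mulr_ge0// mulr_ge0 ?lipc_ge0// ltW// window_size_gt0.
Qed.

Lemma consc_ge0 : 0 <= C2.
Proof. by rewrite /C2 /consc mulr_ge0// mulr_ge0// lipc_ge0. Qed.

Lemma consistency_ge0 : 0 <= consistency.
Proof.
have c2 := consc_ge0.
have q : 0 <= K ^+ 2 / 2 * C2 by rewrite mulr_ge0// divr_ge0// sqr_ge0.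
have q' : 0 <= K * C2 by rewrite mulr_ge0.
by rewrite /consistency mulr_ge0// addr_ge0// mulr_ge0.
Qed.

Lemma operator_gap alpha (t : R) (x : 'rV[R]_d) (P Q P' Q' : dindex d1 -> R) e :
  (forall k, `|P k - P' k| <= C2 * e) -> (forall k, `|Q k - Q' k| <= C2 * e) ->
  \sum_k a_ E alpha k t x * P k + \sum_k b_ E alpha k t x * Q k <=
  \sum_k a_ E alpha k t x * P' k + \sum_k b_ E alpha k t x * Q' k + consistency / 2 * e.
Proof.
move=> HP HQ.
have -> : consistency / 2 * e = ndirs (d1 := d1) * (K ^+ 2 / 2 * (C2 * e)) +
  ndirs (d1 := d1) * (K * (C2 * e)) by rewrite /consistency; field.
rewrite addrACA; apply: lerD; rewrite /ndirs -sumr_cst -big_split/=; apply: ler_sum => k _.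
  rewrite -lerBlDl -mulrBr.
  apply: le_trans (ler_norm _) _; rewrite normrM ler_pM//.
  by rewrite ger0_norm ?a_ge0//; exact: a_le GE.
rewrite -lerBlDl -mulrBr.
apply: le_trans (ler_norm _) _; rewrite normrM ler_pM//.
by have [] := good_b GE alpha k.
Qed.

Let smooth_bounded (w u : R -> 'rV[R]_d -> R) (c M : R) :
  (forall (t : R) (x : 'rV[R]_d), 0 <= t <= T -> `|u t x| <= M) ->
  (forall (t : R) (x : 'rV[R]_d), 0 <= t <= T -> `|w t x - u t x| <= c) ->
  forall (t : R) (x : 'rV[R]_d), 0 <= t <= T -> `|w t x| <= M + c.
Proof.
move=> uM wu t x tT; rewrite -[w t x](subrK (u t x)) (le_trans (ler_normD _ _))//.
by rewrite addrC lerD ?uM ?wu.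
Qed.

(** At the scale [eps = h ^ (1/2)] both consistency errors [h ^ 2 / eps ^ 3] and [h / eps] are equal
    to [eps], the order of the smoothing error: this is where the exponent [1/2] comes from. *)
Let sqrt_pow (h : R) : 0 < h -> h ^+ 2 / Num.sqrt h ^+ 3 = Num.sqrt h /\ h / Num.sqrt h = Num.sqrt h.
Proof.
move=> h0; have s0 : Num.sqrt h != 0 by rewrite gt_eqF// sqrtr_gt0.
have hE : Num.sqrt h ^+ 2 = h by rewrite sqr_sqrtr// ltW.
by move: s0 hE; move: (Num.sqrt h) => r r0 <-; split; field.
Qed.

Let rate_sum (h : R) : 0 < h -> 2 * (C1 * Num.sqrt h) + consistency * Num.sqrt h * (1 + theta * T) =
   ratec * Num.sqrt h.
Proof. by move=> h0; rewrite /ratec; ring. Qed.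

(** The slack [beta0] in the terminal condition permits iteration over successive time intervals,
    where the terminal values are themselves known up to an error. *)
Lemma viscosity_le_flow (h : R) u ut (v : R -> 'rV[R]_d -> R) (M beta0 : R) : 0 < h ->
  flow E h T u ut -> viscosity_sub T E v ->
  {within `[0, T] `*` [set: 'rV[R]_d], continuous (fun z : R * 'rV[R]_d => v z.1 z.2)} ->
  (forall (t : R) (x : 'rV[R]_d), 0 <= t <= T -> `|v t x| <= M) -> 0 <= beta0 ->
  (forall x, v T x <= g_ E x + beta0) ->
  forall (t : R) (x : 'rV[R]_d), 0 <= t <= T -> v t x - u t x <= beta0 + ratec * Num.sqrt h.
Proof.
move=> h0 fu vsub vcont vM b0 term t x tT.
have s0 : 0 < Num.sqrt h by rewrite sqrtr_gt0.
have [w [Cw _ wu wsup wcons]] :=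
  smooth_approximation alpha0 K1 lam0 h0 T0 th thl GE fu s0.
rewrite -/C1 -/C2 in wu wcons.
have [M' uM] := flow_bd fu.
have c1 := smoothc_ge0; have c2 := consc_ge0; have c3 := consistency_ge0.
have cs : 0 <= C1 * Num.sqrt h by rewrite mulr_ge0// ltW.
have wM := smooth_bounded uM wu.
have M'0 : 0 <= M' by apply: le_trans (uM t x tT).
have M0 : 0 <= M by apply: le_trans (vM t x tT).
pose e := consistency * Num.sqrt h.
have e0 : 0 <= e by rewrite mulr_ge0// ltW.
have wle alpha s y : 0 <= s < T -> Defs.dt w s y + Ldiff E alpha w (w s y) s y <= e.
  move=> sT; have sT' : 0 <= s <= T by case/andP: sT => -> /ltW.
  have := @operator_gap alpha s y (fun k => Defs.D2 (ell_ E k) w s y)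
    (fun k => Defs.D1 (ell_ E k) w s y) (fun k => fd2 h (ell_ E k) (w s) y)
    (fun k => fd1 h (ell_ E k) (w s) y) (Num.sqrt h).
  have [q1 q2] := sqrt_pow h0.
  move=> H; have {}H := H _ _.
  have Hg : \sum_k a_ E alpha k s y * Defs.D2 (ell_ E k) w s y +
      \sum_k b_ E alpha k s y * Defs.D1 (ell_ E k) w s y <=
      \sum_k a_ E alpha k s y * fd2 h (ell_ E k) (w s) y +
      \sum_k b_ E alpha k s y * fd1 h (ell_ E k) (w s) y + consistency / 2 * Num.sqrt h.
    apply: H => k; have [h1 h2] := wcons k s y h sT' h0.
      by rewrite distrC; move: h1; rewrite q1.
    by rewrite distrC; move: h2; rewrite q2.
  have := wsup alpha s y sT; move: Hg e0; rewrite /Lop /Lin /Ldiff /e.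
  move: (\sum_k _) (\sum_k _) (\sum_k _) (\sum_k _) => S1 S2 S3 S4; lra.
have vM2 s y : 0 <= s <= T -> `|v s y| <= M + (M' + C1 * Num.sqrt h).
  by move=> sT; apply: le_trans (vM s y sT) _; rewrite lerDl addr_ge0.
have wM2 s y : 0 <= s <= T -> `|w s y| <= M + (M' + C1 * Num.sqrt h).
  by move=> sT; apply: le_trans (wM s y sT) _; rewrite lerDr.
have be0 : 0 <= beta0 + C1 * Num.sqrt h + e by rewrite !addr_ge0.
have nu0 : 0 <= theta * e by rewrite mulr_ge0.
(* The error is split: [theta * e] becomes a slope in time, and adding [e] to the terminal bound
   lets the discount pay [lambda * e], at least [(1 - theta) * e]. *)
have gap : e <= theta * e + lambda * (beta0 + C1 * Num.sqrt h + e).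
  have : (1 - theta) * e <= lambda * e by rewrite ler_wpM2r.
  have : 0 <= lambda * (beta0 + C1 * Num.sqrt h) by rewrite mulr_ge0// addr_ge0.
  rewrite mulrDr; lra.
have termw y : v T y - w T y <= beta0 + C1 * Num.sqrt h + e.
  have := wu T y; rewrite (flow_T fu) lexx ltW// => /(_ isT).
  by have := term y; rewrite ler_norml; lra.
have := viscosity_comparison alpha0 GE lam0 T0 vsub vcont Cw vM2 wM2 wle be0 nu0 gap termw x tT.
move=> H1; have := wu t x tT; rewrite ler_norml => /andP[_ H2].
have : theta * e * (T - t) <= theta * e * T.
  by rewrite ler_wpM2l// gerBl; case/andP: tT.
rewrite -rate_sum// -/e; lra.
Qed.

(** The finer solution is smoothed at the scale [h ^ (1/2)] of the coarser mesh, at which both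
    meshes have a consistency error of order [h ^ (1/2)]. *)
Lemma flow_rate (h h' : R) u ut u' ut' : 0 < h' -> h' <= h ->
  flow E h T u ut -> flow E h' T u' ut' ->
  forall (t : R) (x : 'rV[R]_d), 0 <= t <= T -> u t x - u' t x <= ratec * Num.sqrt h.
Proof.
move=> h'0 hh fu fu' t x tT; have h0 : 0 < h := lt_le_trans h'0 hh.
have s0 : 0 < Num.sqrt h by rewrite sqrtr_gt0.
have [w [Cw dw wu wsup wcons]] :=
  smooth_approximation alpha0 K1 lam0 h'0 T0 th thl GE fu' s0.
rewrite -/C1 -/C2 in wu wcons.
have [M uM] := flow_bd fu; have [M' uM'] := flow_bd fu'.
have c1 := smoothc_ge0; have c2 := consc_ge0; have c3 := consistency_ge0.
have cs : 0 <= C1 * Num.sqrt h by rewrite mulr_ge0// ltW.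
have wM := smooth_bounded uM' wu.
pose e := consistency * Num.sqrt h.
have e0 : 0 <= e by rewrite mulr_ge0// ltW.
have [q1 q2] := sqrt_pow h0.
have wsup' : supersol E h 0 T e w (Defs.dt w).
  split; first split.
  - move=> y; apply: continuous_subspaceT => s.
    by apply: (@der_on_continuous _ _ (fun s => Defs.dt w s y)) => a b r;
      apply: is_derive_der_on.
  - by move=> s y _; apply: is_derive_der_on.
  move=> s y alpha sT; have sT' : 0 <= s <= T by case/andP: sT => -> /ltW.
  have Hg : \sum_k a_ E alpha k s y * fd2 h (ell_ E k) (w s) y +
      \sum_k b_ E alpha k s y * fd1 h (ell_ E k) (w s) y <=
      \sum_k a_ E alpha k s y * fd2 h' (ell_ E k) (w s) y +
      \sum_k b_ E alpha k s y * fd1 h' (ell_ E k) (w s) y + consistency / 2 * (2 * Num.sqrt h).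
    apply: operator_gap => k.
      have [h1 _] := wcons k s y h sT' h0; have [h2 _] := wcons k s y h' sT' h'0.
      rewrite (le_trans (ler_distD (Defs.D2 (ell_ E k) w s y) _ _))//.
      rewrite mulr2n mulrDl mul1r mulrDr lerD//; first by move: h1; rewrite q1.
      rewrite distrC; apply: le_trans h2 _; rewrite ler_wpM2l// -[leRHS]q1.
      by rewrite ler_pM2r ?invr_gt0 ?exprn_gt0// ler_pXn2r ?nnegrE// ltW.
    have [_ h1] := wcons k s y h sT' h0; have [_ h2] := wcons k s y h' sT' h'0.
    rewrite (le_trans (ler_distD (Defs.D1 (ell_ E k) w s y) _ _))//.
    rewrite mulr2n mulrDl mul1r mulrDr lerD//; first by move: h1; rewrite q2.
    rewrite distrC; apply: le_trans h2 _; rewrite ler_wpM2l// -[leRHS]q2.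
    by rewrite ler_pM2r ?invr_gt0.
  have := wsup alpha s y sT; move: Hg e0; rewrite /Lop /Lin /e.
  move: (\sum_k _) (\sum_k _) (\sum_k _) (\sum_k _) => S1 S2 S3 S4; lra.
have be0 : 0 <= C1 * Num.sqrt h + e by rewrite addr_ge0.
have nu0 : 0 <= theta * e by rewrite mulr_ge0.
have gap : e <= theta * e + lambda * (C1 * Num.sqrt h + e).
  have : (1 - theta) * e <= lambda * e by rewrite ler_wpM2r.
  have : 0 <= lambda * (C1 * Num.sqrt h) by rewrite mulr_ge0.
  rewrite mulrDr; lra.
have bdd : exists M, forall s y, 0 <= s <= T -> u s y - w s y <= M.
  exists (M + (M' + C1 * Num.sqrt h)) => s y sT.
  by have := uM s y sT; have := wM s y sT; rewrite !ler_norml; lra.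
have termw y : u T y - w T y <= C1 * Num.sqrt h + e.
  have := wu T y; rewrite (flow_T fu) (flow_T fu') lexx ltW// => /(_ isT).
  by rewrite ler_norml; lra.
have H1 := comparison GE lam0 h0 (ltW T0) (flow_subsol alpha0 GE lam0 h0 fu) wsup' bdd
  be0 nu0 gap termw x tT.
have := wu t x tT; rewrite ler_norml => /andP[_ H2].
have : theta * e * (T - t) <= theta * e * T.
  by rewrite ler_wpM2l// gerBl; case/andP: tT.
rewrite -rate_sum// -/e; lra.
Qed.

End rates.

(** * Piecewise constant policies *)

Section single_controls.
Context {R : realType} {d d1 : nat}.

Definition tame (p : 'rV[R]_d -> R) : Prop :=
  exists2 M, (forall x, `|p x| <= M) & lipx M p.

Definition single (A : Type) (E : bellman_data R d d1 A) (alpha : A) phi :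
    bellman_data R d d1 unit :=
  BellmanData (ell_ E) (fun=> sigma_ E alpha) (fun=> b_ E alpha) (fun=> c_ E alpha)
    (fun=> f_ E alpha) phi.

Lemma coef_le K K' (psi : R -> 'rV[R]_d -> R) : K <= K' -> coef K psi -> coef K' psi.
Proof.
move=> KK [h1 h2 h3]; split=> [t x|t x y|x t s]; first exact: le_trans (h1 t x) KK.
  by apply: le_trans (h2 t x y) _; rewrite ler_wpM2r// enorm_ge0.
by apply: le_trans (h3 x t s) _; rewrite ler_wpM2r// sqrtr_ge0.
Qed.

Lemma lipx_dist L (p : 'rV[R]_d -> R) x y : lipx L p -> `|p x - p y| <= L * enorm (x - y).
Proof. by move=> /(_ y (x - y)); rewrite [y + _]addrC subrK. Qed.

Lemma tame_shift p y : tame p -> tame (fun x => p (x + y)).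
Proof. by move=> [M pM pL]; exists M => [x|]; [exact: pM|exact: lipx_shift]. Qed.

Context {A : Type}.
Implicit Types (E : bellman_data R d d1 A) (p phi : 'rV[R]_d -> R).

Lemma good_single K lambda E phi M alpha : good K lambda E ->
  (forall x, `|phi x| <= M) -> lipx M phi -> good (K + M) lambda (single E alpha phi).
Proof.
move=> G pM pL; have K0 := good_K_ge0 G.
have M0 : 0 <= M by apply: le_trans (pM 0).
have KM : K <= K + M by rewrite lerDl.
have MK : M <= K + M by rewrite lerDr.
split => //=; try by case: G.
- by move=> k; apply: le_trans (good_ell G k) KM.
- by move=> _ k; exact: (coef_le KM (good_sigma G alpha k)).
- by move=> _ k; exact: (coef_le KM (good_b G alpha k)).
- by move=> _; exact: (coef_le KM (good_c G alpha)).
- by move=> _; exact: (coef_le KM (good_f G alpha)).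
- split=> [_ x|_ x y|x t s]; first exact: le_trans (pM x) MK.
    by apply: le_trans (lipx_dist x y pL) _; rewrite ler_wpM2r// enorm_ge0.
  by rewrite subrr normr0 mulr_ge0 ?sqrtr_ge0// (le_trans K0).
Qed.

(** [Lop] does not see the terminal function. Flows with any terminal value are therefore sub- and
    supersolutions for the data with terminal value [g_ E], and the constant stays [K] over many
    steps instead of growing as in [good_single]. *)
Lemma good_solo K lambda E alpha : good K lambda E -> good K lambda (single E alpha (g_ E)).
Proof. by move=> G; split => //=; case: G. Qed.

Context (K lambda h : R).
Hypotheses (lam0 : 0 <= lambda) (h0 : 0 < h).

Section one_flow.
Context (E : bellman_data R d d1 A) (GE : good K lambda E) (b : R) (b0 : 0 < b).
Context (alpha : A).

Let K0 : 0 <= K := good_K_ge0 GE.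

Lemma single_exists phi : tame phi -> exists u ut, flow (single E alpha phi) h b u ut.
Proof. by move=> [M pM pL]; apply: (flow_exists tt (good_single alpha GE pM pL) lam0 h0 b0). Qed.

Lemma single_subsol phi u ut : tame phi -> flow (single E alpha phi) h b u ut ->
  subsol (single E alpha (g_ E)) h 0 b u ut.
Proof. by move=> [M pM pL] fu; exact: (flow_subsol tt (good_single alpha GE pM pL) lam0 h0 fu). Qed.

Lemma single_supersol phi u ut : tame phi -> flow (single E alpha phi) h b u ut ->
  supersol (single E alpha (g_ E)) h 0 b 0 u ut.
Proof. by move=> [M pM pL] fu; exact: (flow_supersol tt (good_single alpha GE pM pL) lam0 h0 fu). Qed.

Lemma single_compare phi psi u ut w wt beta : tame phi -> tame psi ->
  flow (single E alpha phi) h b u ut -> flow (single E alpha psi) h b w wt -> 0 <= beta ->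
  (forall x, phi x <= psi x + beta) -> forall (t : R) x, 0 <= t <= b -> u t x <= w t x + beta.
Proof.
move=> tp tq fu fw be0 pq t x tb.
have [M uM] := flow_bd fu; have [N wN] := flow_bd fw.
have bdd : exists M, forall (t : R) x, 0 <= t <= b -> u t x - w t x <= M.
  exists (M + N) => s y sb; have := uM s y sb; have := wN s y sb.
  by rewrite !ler_norml; lra.
have gap : 0 <= 0 + lambda * beta by rewrite add0r mulr_ge0.
have term y : u b y - w b y <= beta by rewrite (flow_T fu) (flow_T fw) lerBlDl pq.
have := comparison (good_solo alpha GE) lam0 h0 (ltW b0) (single_subsol tp fu)
  (single_supersol tq fw) bdd be0 (lexx 0) gap term x tb.
by rewrite mul0r addr0 lerBlDl.
Qed.

Lemma single_bounded phi u ut M : tame phi -> (forall x, `|phi x| <= M) ->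
  flow (single E alpha phi) h b u ut -> forall (t : R) x, 0 <= t <= b -> `|u t x| <= M + K * (b - t).
Proof.
move=> tp pM fu t x tb; have M0 : 0 <= M by apply: le_trans (pM 0).
have fK s y : `|f_ E alpha s y| <= K by have [] := good_f GE alpha.
have c0 s y : 0 <= c_ E alpha s y by apply: le_trans lam0 _; exact: (good_c_ge GE).
have w0 s : s <= b -> 0 <= M + K * (b - s) by move=> sb; rewrite addr_ge0 ?mulr_ge0 ?subr_ge0.
have Bsup : supersol (single E alpha (g_ E)) h 0 b 0 (fun t _ => M + K * (b - t)) (fun _ _ => - K).
  apply: supersol_cst => s y _ /andP[_ /ltW sb] /=.
  have := mulr_ge0 (c0 s y) (w0 s sb); have := fK s y; rewrite ler_norml; lra.
have Bsub : subsol (single E alpha (g_ E)) h 0 b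
    (fun t _ => - (M + K * (b - t))) (fun _ _ => - - K).
  split; first by have := evolN Bsup.1.
  move=> s y e /andP[_ /ltW sb] e0; exists tt; rewrite /Lop Lin_cst /=.
  have := mulr_ge0 (c0 s y) (w0 s sb); have := fK s y; rewrite ler_norml; lra.
have [N uN] := flow_bd fu.
have gap : 0 <= 0 + lambda * 0 by rewrite mulr0 addr0.
have cp y yt z zt := @comparison R d d1 _ (single E alpha (g_ E)) h K lambda 0 b 0 0 0 y yt z zt
   (good_solo alpha GE) lam0 h0 (ltW b0).
have wM (s : R) : 0 <= s <= b -> M + K * (b - s) <= M + K * b.
  by case/andP=> s0 _; rewrite lerD2l ler_wpM2l// gerBl.
have H1 : u t x - (M + K * (b - t)) <= 0 + 0 * (b - t).
  apply: (cp _ _ _ _ (single_subsol tp fu) Bsup) => //.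
    exists N => s y sb; have := uN s y sb; have /andP[_ /w0] := sb; rewrite ler_norml; lra.
  move=> y; rewrite (flow_T fu) subrr mulr0 addr0 subr_le0 /=.
  by apply: le_trans (pM y); exact: ler_norm.
have H2 : - (M + K * (b - t)) - u t x <= 0 + 0 * (b - t).
  apply: (cp _ _ _ _ Bsub (single_supersol tp fu)) => //.
    exists N => s y sb; have := uN s y sb; have /andP[_ /w0] := sb; rewrite ler_norml; lra.
  move=> y; rewrite (flow_T fu) subrr mulr0 addr0 /=.
  by have := pM y; rewrite ler_norml; lra.
by rewrite ler_norml; move: H1 H2; rewrite mul0r addr0; lra.
Qed.

End one_flow.
End single_controls.

Section piecewise_constant_policies.
Context {R : realType} {d d1 : nat} {A : Type} (alpha0 : A).
Implicit Types (E : bellman_data R d d1 A) (p q phi : 'rV[R]_d -> R).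

Lemma negp_near (r r' c : R) : 0 <= c -> r' - c <= r ->
  negp r ^+ 2 <= (1 + c) * negp r' ^+ 2 + c * (1 + c).
Proof.
move=> c0 rr.
have H : negp r <= negp r' + c.
  rewrite {1}/negp ge_max addr_ge0 ?negp_ge0//=.
  by have := negp_ge r'; lra.
apply: (@le_trans _ _ ((negp r' + c) ^+ 2)).
  by rewrite ler_pXn2r ?nnegrE ?negp_ge0// addr_ge0 ?negp_ge0.
by have := mulr_ge0 c0 (sqr_ge0 (negp r' - 1)); nra.
Qed.

Definition cdV h eps E p q x : R :=
  negp ((q x - p x) / eps) ^+ 2 + \sum_k negp (fd1 h (ell_ E k) p x) ^+ 2.

Lemma cdV_ge0 h eps E p q x : 0 <= cdV h eps E p q x.
Proof. by rewrite addr_ge0 ?sqr_ge0// sumr_ge0// => k _; exact: sqr_ge0. Qed.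

(* The supremum of a family does not increase [cdV]: a control nearly optimal at [x]
   bounds all its entries at once. *)
Lemma cdV_sup (I : Type) h eps E p q (F G : I -> 'rV[R]_d -> R) x B :
  0 < eps -> eps <= h -> (forall i y, F i y <= p y) -> (forall i y, G i y <= q y) ->
  (forall e, 0 < e -> exists i, p x - e <= F i x) ->
  (forall i, cdV h eps E (F i) (G i) x <= B) -> cdV h eps E p q x <= B.
Proof.
move=> e0 eh Fp Gq near FB; have h0 := lt_le_trans e0 eh.
pose N : R := ndirs (d1 := d1) + 1.
have N0 : 0 <= N by rewrite /N addr_ge0.
have B0 : 0 <= B by have [i _] := near 1 ltr01; apply: le_trans (cdV_ge0 _ _ _ _ _ _) (FB i).
suff H c : 0 < c -> c <= 1 -> cdV h eps E p q x <= B + c * (B + 2 * N).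
  rewrite leNgt; apply/negP => viol.
  pose D := B + 2 * N + 1; have D0 : 0 < D by rewrite /D; have := N0; lra.
  pose c := Num.min 1 ((cdV h eps E p q x - B) / (2 * D)).
  have c0 : 0 < c by rewrite lt_min ltr01/= divr_gt0 ?subr_gt0// mulr_gt0.
  have c1 : c <= 1 by rewrite ge_min lexx.
  have := H c c0 c1.
  have : c * (2 * D) <= cdV h eps E p q x - B.
    by rewrite -ler_pdivlMr ?mulr_gt0// ge_min lexx orbT.
  have := mulr_gt0 c0 D0; have : 0 < c * 1 by rewrite mulr1.
  move: viol; rewrite /D; nra.
move=> c0 c1; have [i Hi] := near (c * eps) (mulr_gt0 c0 e0).
have c0' := ltW c0.
have E1 : negp ((q x - p x) / eps) ^+ 2 <=
    (1 + c) * negp ((G i x - F i x) / eps) ^+ 2 + c * (1 + c).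
  apply: negp_near => //; rewrite ler_pdivlMr// mulrBl divfK ?gt_eqF//.
  by have := Gq i x; lra.
have E2 k : negp (fd1 h (ell_ E k) p x) ^+ 2 <=
    (1 + c) * negp (fd1 h (ell_ E k) (F i) x) ^+ 2 + c * (1 + c).
  apply: negp_near => //; rewrite /fd1 ler_pdivlMr// mulrBl divfK ?gt_eqF//.
  have := Fp i (x + h *: ell_ E k); have : c * eps <= c * h by rewrite ler_wpM2l.
  by move: Hi; lra.
have ES : \sum_k negp (fd1 h (ell_ E k) p x) ^+ 2 <=
   (1 + c) * \sum_k negp (fd1 h (ell_ E k) (F i) x) ^+ 2 + ndirs (d1 := d1) * (c * (1 + c)).
  by rewrite /ndirs -sumr_cst mulr_sumr -big_split/=; apply: ler_sum => k _.
have := FB i; move: E1 ES; rewrite /cdV.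
set a1 := negp _ ^+ 2; set a2 := negp _ ^+ 2; set s1 := \sum_k _; set s2 := \sum_k _.
move=> E1 ES H.
have : (1 + c) * (a2 + s2) <= (1 + c) * B by rewrite ler_wpM2l// addr_ge0.
have : N * (c * (1 + c)) <= N * (2 * c).
  by rewrite ler_wpM2l// mulrC ler_wpM2r//; lra.
rewrite /N; lra.
Qed.

(** The supremum over controls is pinned down by an upper bound and approximation, a form that
    translated and shaken families inherit directly. *)
Definition pcp_step E (h a b : R) phi U : Prop :=
  tame phi /\ exists w wt : A -> R -> 'rV[R]_d -> R,
  [/\ forall alpha, flow (single E alpha phi) h b (w alpha) (wt alpha),
      forall alpha x, w alpha a x <= U x &
      forall x e, 0 < e -> exists alpha, U x - e <= w alpha a x].

(* [U j] is the optimal value, for the scheme with step [h], when the controls are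
   switched only at the times [T - i * tau], seen from the time [T - j * tau]. *)
Definition pcp E (h T tau : R) (n : nat) (U : nat -> 'rV[R]_d -> R) : Prop :=
  (forall x, U 0%N x = g_ E x) /\
  forall j, (j < n)%N -> pcp_step E h (T - j.+1%:R * tau) (T - j%:R * tau) (U j) (U j.+1).

Lemma pcp_shift E h T tau n U y : pcp E h T tau n U ->
  pcp (shiftE y E) h T tau n (fun j x => U j (x + y)).
Proof.
move=> [H1 H2]; split=> [x|j jn]; first exact: H1.
have [tU [w [wt [fw wU wn]]]] := H2 j jn; split; first exact: tame_shift.
exists (fun alpha t x => w alpha t (x + y)), (fun alpha t x => wt alpha t (x + y)).
split=> [alpha|alpha x|x e e0]; last 2 first.
- exact: wU.
- by have [alpha Ha] := wn (x + y) e e0; exists alpha.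
by have := flow_shift y (fw alpha).
Qed.

Context (K lambda h T tau : R).
Hypotheses (K1 : 1 <= K) (lam0 : 0 <= lambda) (h0 : 0 < h) (T0 : 0 < T) (tau0 : 0 < tau).

Let K0 : 0 <= K := le_trans ler01 K1.

Let node (n j : nat) : n%:R * tau <= T -> (j < n)%N ->
  [/\ 0 <= T - j.+1%:R * tau, 0 < T - j%:R * tau &
      T - j.+1%:R * tau <= T - j%:R * tau <= T].
Proof.
move=> nT jn.
have jn' : j.+1%:R * tau <= n%:R * tau by rewrite ler_pM2r// ler_nat.
have jj : j.+1%:R * tau = j%:R * tau + tau by rewrite -natr1 mulrDl mul1r.
have j0 : 0 <= j%:R * tau by rewrite mulr_ge0// ltW.
by split; have := tau0; lra.
Qed.

Lemma pcp_bounded E n U : good K lambda E -> n%:R * tau <= T -> pcp E h T tau n U ->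
  forall j, (j <= n)%N -> forall x, `|U j x| <= K + K * (j%:R * tau).
Proof.
move=> G nT [H1 H2]; elim=> [_ x|j IH jn x].
  by rewrite mul0r mulr0 addr0 H1; have [gK _ _] := good_g G; exact: gK 0 x.
have [a0 b0 /andP[ab bT]] := node nT jn.
have [tU [w [wt [fw wU wn]]]] := H2 j jn.
have wB alpha : `|w alpha (T - j.+1%:R * tau) x| <= K + K * (j.+1%:R * tau).
  have aab : 0 <= T - j.+1%:R * tau <= T - j%:R * tau by rewrite a0.
  apply: le_trans (single_bounded lam0 h0 G b0 tU (IH (ltnW jn)) (fw alpha) x aab) _.
  by rewrite -natr1 mulrDl mul1r; have := K0; lra.
rewrite ler_norml; apply/andP; split.
  by apply: le_trans (wU alpha0 x); have := wB alpha0; rewrite ler_norml => /andP[].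
apply/ler_addgt0Pr => e e0; have [alpha Ha] := wn x e e0.
by have := wB alpha; rewrite ler_norml; lra.
Qed.

Let M0 : R := K + K * T.
Let B n : R := expR (cdrate (d1 := d1) K * (n%:R * tau)) * cdbase (d1 := d1) K M0.

Let B_base n : (cdlin (d1 := d1) K * (M0 + 1) + 1) ^+ 2 <= B n.
Proof.
have c0 := @cdbase_ge0 R d1 K M0.
apply: (@le_trans _ _ (cdbase (d1 := d1) K M0)).
  by rewrite /cdbase lerDl mulr_ge0 ?sqr_ge0// addr_ge0.
rewrite ler_peMl// -expR0 ler_expR mulr_ge0//; last by rewrite mulr_ge0// ltW.
by rewrite (le_trans ler01)// cdrate_ge1.
Qed.

Let rate0 : 0 <= cdrate (d1 := d1) K. Proof. by rewrite (le_trans ler01)// cdrate_ge1. Qed.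

(** A step multiplies the bound by [expR (cdrate K * tau)] for each frozen control, and the supremum
    over controls costs nothing. The factors combine into a bound by elapsed time, uniform in [h]
    and [tau]. Growth with [T] is harmless here, since these constants disappear in the limit. *)
Lemma pcp_cdV E E' eps n U U' : good K lambda E -> good K lambda E' ->
  closeto (K ^+ 2 * eps) E E' -> 0 < eps -> eps <= h -> n%:R * tau <= T ->
  pcp E h T tau n U -> pcp E' h T tau n U' ->
  (forall x, `|g_ E' x - g_ E x| <= K ^+ 2 * eps) ->
  forall j, (j <= n)%N -> forall x, cdV h eps E (U j) (U' j) x <= B j.
Proof.
move=> G G' cE eps0 eh nT pU pU' gg.
have bU := pcp_bounded G nT pU; have bU' := pcp_bounded G' nT pU'.
have [H1 H2] := pU; have [H1' H2'] := pU'.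
elim=> [_ x|j IH jn x].
  rewrite /B mul0r mulr0 expR0 mul1r /cdV.
  have np (r : R) : `|r| <= K ^+ 2 -> negp r ^+ 2 <= (K ^+ 2) ^+ 2.
    move=> rK; rewrite ler_pXn2r ?nnegrE ?negp_ge0 ?sqr_ge0// /negp ge_max sqr_ge0/=.
    by apply: le_trans rK; rewrite -normrN ler_norm.
  apply: (@le_trans _ _ ((K ^+ 2) ^+ 2 + \sum_(k : dindex d1) (K ^+ 2) ^+ 2)).
    apply: lerD.
      apply: np; rewrite H1 H1' normrM.
      by rewrite (@gtr0_norm _ eps^-1) ?invr_gt0// ler_pdivrMr.
    apply: ler_sum => k _; apply: np.
    have -> : U 0%N = g_ E by apply/funext => z; exact: H1.
    exact: (fd1_terminal K1 h0 k x G).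
  rewrite sumr_cst -/ndirs /cdbase.
  by have := sqr_ge0 (cdlin (d1 := d1) K * (M0 + 1) + 1); rewrite mulrDl mul1r; lra.
have [a0 b0 /andP[ab bT]] := node nT jn.
have aab : 0 <= T - j.+1%:R * tau <= T - j%:R * tau by rewrite a0.
have [tU [w [wt [fw wU wn]]]] := H2 j jn.
have [tU' [w' [wt' [fw' wU' _]]]] := H2' j jn.
apply: (cdV_sup eps0 eh wU wU' (wn x)) => alpha.
have bound (D : bellman_data R d d1 A) (beta : A) (GD : good K lambda D) (p : 'rV[R]_d -> R) y yt (tp : tame p)
    (pM : forall x, `|p x| <= K + K * (j%:R * tau))
    (fy : flow (single D beta p) h (T - j%:R * tau) y yt) :
    forall (s : R) x, 0 <= s <= T - j%:R * tau -> `|y s x| <= M0.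
  move=> s z sb; apply: le_trans (single_bounded lam0 h0 GD b0 tp pM fy z sb) _.
  have : K * (T - j%:R * tau - s) <= K * (T - j%:R * tau).
    by rewrite ler_wpM2l// gerBl; case/andP: sb.
  by rewrite /M0; lra.
have cE1 : closeto (K ^+ 2 * eps) (single E alpha (g_ E)) (single E' alpha (g_ E')).
  by have [c1 c2] := cE; split=> // -[] t y; exact: c2.
have rate : cdrate (d1 := d1) K <= cdrate (d1 := d1) K + 2 * lambda by rewrite lerDl mulr_ge0.
have := cd_estimate (good_solo alpha G) (good_solo alpha G') eps0 eh cE1 rate0 rate (ltW b0)
  (single_subsol lam0 h0 G tU (fw alpha)) (single_supersol lam0 h0 G tU (fw alpha))
  (single_supersol lam0 h0 G' tU' (fw' alpha))
  (bound E alpha G _ _ _ tU (bU j (ltnW jn)) (fw alpha))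
  (bound E' alpha G' _ _ _ tU' (bU' j (ltnW jn)) (fw' alpha)) (B_base j).
move=> Hcd; have {}Hcd := Hcd _ _ x aab.
rewrite /cdV; apply: le_trans (Hcd _) _.
  move=> y; rewrite (_ : w alpha (T - j%:R * tau) = U j); last first.
    by apply/funext => z; rewrite (flow_T (fw alpha)).
  rewrite (_ : w' alpha (T - j%:R * tau) = U' j); last first.
    by apply/funext => z; rewrite (flow_T (fw' alpha)).
  exact: IH (ltnW jn) y.
rewrite le_eqVlt; apply/orP; left; apply/eqP.
rewrite /B mulrA -expRD; congr (expR _ * _).
by rewrite -natr1; ring.
Qed.

Let L : R := lipc (d1 := d1) K T.

Lemma pcp_cd_oneside E E' eps n U U' : good K lambda E -> good K lambda E' ->
  closeto (K ^+ 2 * eps) E E' -> 0 < eps -> eps <= h -> n%:R * tau <= T ->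
  pcp E h T tau n U -> pcp E' h T tau n U' ->
  (forall x, `|g_ E' x - g_ E x| <= K ^+ 2 * eps) ->
  forall j, (j <= n)%N -> forall x, U j x - U' j x <= L * eps.
Proof.
move=> G G' cE eps0 eh nT pU pU' gg j jn x.
have := pcp_cdV G G' cE eps0 eh nT pU pU' gg jn x; rewrite /cdV.
set V := negp _ ^+ 2; set S := \sum_k _ => VS.
have S0 : 0 <= S by apply: sumr_ge0 => k _; exact: sqr_ge0.
have VL : V <= L ^+ 2.
  rewrite sqr_sqrtr; last by rewrite mulr_ge0 ?expR_ge0 ?cdbase_ge0.
  apply: (@le_trans _ _ (B j)); first by apply: le_trans VS; rewrite lerDl.
  rewrite ler_wpM2r ?cdbase_ge0// ler_expR ler_wpM2l//.
  by apply: le_trans nT; rewrite ler_pM2r// ler_nat.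
have : negp ((U' j x - U j x) / eps) <= L.
  by move: VL; rewrite /V ler_pXn2r ?nnegrE ?negp_ge0 ?lipc_ge0.
have := negp_ge ((U' j x - U j x) / eps) => H1 H2.
by have := le_trans H1 H2; rewrite -mulNr opprB ler_pdivrMr.
Qed.

Lemma pcp_lipx E n U : good K lambda E -> n%:R * tau <= T -> pcp E h T tau n U ->
  forall j, (j <= n)%N -> lipx L (U j).
Proof.
move=> G nT pU j jn; apply: (lipschitz_chain h0) => {}x {}y yh.
have [y0|y0] := eqVneq (enorm y) 0.
  have -> : y = 0.
    apply/rowP => i; rewrite mxE; apply/eqP; rewrite -normr_le0 -y0.
    exact: coord_le_enorm.
  by rewrite addr0 subrr normr0 mulr_ge0 ?lipc_ge0 ?enorm_ge0.
have yp : 0 < enorm y by rewrite lt_def y0 enorm_ge0.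
have KK : K * enorm y <= K ^+ 2 * enorm y.
  by rewrite expr2 -mulrA ler_peMl// mulr_ge0// ltW.
have cl := closeto_shift G KK.
have gg z : `|g_ (shiftE y E) z - g_ E z| <= K ^+ 2 * enorm y.
  have [_ /(_ 0 (z + y) z) H _] := good_g G.
  by apply: le_trans KK; apply: le_trans H _; rewrite addrAC subrr add0r.
have H1 := pcp_cd_oneside G (good_shift y G) cl yp yh nT pU (pcp_shift y pU) gg jn x.
have H2 := pcp_cd_oneside (good_shift y G) G (closeto_sym cl) yp yh nT (pcp_shift y pU) pU
  (fun z => etrans (congr1 (fun z => z <= _) (distrC _ _)) (gg z)) jn x.
by rewrite ler_norml; move: H1 H2; lra.
Qed.

(** A supremum over controls can serve as terminal value of the next step because [pcp_lipx] bounds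
    its Lipschitz constant; hence the induction on the whole sequence. *)
Lemma pcp_exists E n : good K lambda E -> n%:R * tau <= T -> exists U, pcp E h T tau n U.
Proof.
move=> G; elim: n => [_|n IH nT]; first by exists (fun=> g_ E).
have nT' : n%:R * tau <= T by apply: le_trans nT; rewrite ler_pM2r// ler_nat.
have [U pU] := IH nT'.
have [a0 b0 /andP[ab bT]] := node nT (ltnSn n).
have aab : 0 <= T - n.+1%:R * tau <= T - n%:R * tau by rewrite a0.
have bU := pcp_bounded G nT' pU (leqnn n).
have tU : tame (U n).
  exists (Num.max (K + K * (n%:R * tau)) L) => [x|].
    by apply: le_trans (bU x) _; rewrite le_max lexx.
  by apply: lipx_le (pcp_lipx G nT' pU (leqnn n)); rewrite le_max lexx orbT.
have /choice[w Hw] alpha : exists w : (R -> 'rV[R]_d -> R) * (R -> 'rV[R]_d -> R),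
    flow (single E alpha (U n)) h (T - n%:R * tau) w.1 w.2.
  by have [u [ut fu]] := single_exists lam0 h0 G b0 alpha tU; exists (u, ut).
pose S x := [set (w alpha).1 (T - n.+1%:R * tau) x | alpha in [set: A]].
have Ss x : has_sup (S x).
  split; first by exists ((w alpha0).1 (T - n.+1%:R * tau) x); exists alpha0.
  exists (K + K * (n%:R * tau) + K * (T - n%:R * tau - (T - n.+1%:R * tau))) => _ [alpha _ <-].
  apply: le_trans (ler_norm _) _.
  exact: (single_bounded lam0 h0 G b0 tU bU (Hw alpha) x aab).
exists (fun j => if (j <= n)%N then U j else fun x => sup (S x)); split=> [x|j].
  by rewrite leq0n; exact: pU.1.
rewrite ltnS leq_eqVlt => /predU1P[->|jn]; last first.
  by rewrite /= jn orbT; exact: pU.2.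
rewrite eqxx ltnn; split=> //; exists (fun alpha => (w alpha).1), (fun alpha => (w alpha).2).
split=> // [alpha x|x e e0].
  by apply: ub_le_sup; [exact: (Ss x).2|exists alpha].
by have [_ [alpha _ <-] /ltW H] := sup_adherent e0 (Ss x); exists alpha.
Qed.

End piecewise_constant_policies.

Section shaken_policies.
Context {R : realType} {d d1 : nat} {A : Type} (alpha0 : A).
Implicit Types (E : bellman_data R d d1 A) (p q phi : 'rV[R]_d -> R).

Lemma single_shake0 rho E (beta : shakes (R := R) (d := d) (A := A) rho) phi :
  single (shakeE 0 rho E) beta phi = single E beta.1 phi.
Proof.
by rewrite /single /shakeE /=; congr BellmanData; apply/funext => _; do ?[apply/funext => ?];
  rewrite scale0r addr0.
Qed.

Lemma single_shake_shift rho E (beta : shakes (R := R) (d := d) (A := A) rho) phi z :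
  sval beta.2 = - z ->
  shiftE z (single (shakeE 1 rho E) beta phi) = single E beta.1 (fun x => phi (x + z)).
Proof.
move=> bz; rewrite /shiftE /single /shakeE /=.
by congr BellmanData; apply/funext => _; do ?[apply/funext => ?]; rewrite bz scale1r addrK.
Qed.

Context (K lambda h T tau : R).
Hypotheses (K1 : 1 <= K) (lam0 : 0 <= lambda) (h0 : 0 < h) (T0 : 0 < T) (tau0 : 0 < tau).

Let L : R := lipc (d1 := d1) K T.

Lemma pcp_shake0 E n rho U : 0 <= rho -> pcp E h T tau n U -> pcp (shakeE 0 rho E) h T tau n U.
Proof.
move=> r0 [H1 H2]; split=> // j jn.
have [tU [w [wt [fw wU wn]]]] := H2 j jn; split=> //.
have e0 : enorm (0 : 'rV[R]_d) <= rho by rewrite enorm0.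
exists (fun beta => w beta.1), (fun beta => wt beta.1); split=> [beta|beta x|x e ep].
- by rewrite single_shake0.
- exact: wU.
- by have [alpha H] := wn x e ep; exists (alpha, exist _ 0 e0).
Qed.

Lemma pcp_cd (B : Type) (beta0 : B) (E E' : bellman_data R d d1 B) eps n U U' :
  good K lambda E -> good K lambda E' ->
  closeto (K ^+ 2 * eps) E E' -> 0 < eps -> eps <= h -> n%:R * tau <= T ->
  pcp E h T tau n U -> pcp E' h T tau n U' -> g_ E' = g_ E ->
  forall j, (j <= n)%N -> forall x, `|U' j x - U j x| <= L * eps.
Proof.
move=> G G' cE e0 eh nT pU pU' gg j jn x.
have K0 : 0 <= K := le_trans ler01 K1.
have g1 y : `|g_ E' y - g_ E y| <= K ^+ 2 * eps.
  by rewrite gg subrr normr0 mulr_ge0 ?sqr_ge0// ltW.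
have g2 y : `|g_ E y - g_ E' y| <= K ^+ 2 * eps by rewrite distrC g1.
have H1 := pcp_cd_oneside beta0 K1 lam0 h0 tau0 G G' cE e0 eh nT pU pU' g1 jn x.
have H2 := pcp_cd_oneside beta0 K1 lam0 h0 tau0 G' G (closeto_sym cE) e0 eh nT pU' pU g2 jn x.
by rewrite ler_norml; move: H1 H2; rewrite -/L; lra.
Qed.

Lemma pcp_shake E n U rho : good K lambda E -> n%:R * tau <= T -> pcp E h T tau n U -> 0 < rho ->
  exists2 Us, pcp (shakeE 1 rho E) h T tau n Us &
    forall j, (j <= n)%N -> forall x, `|Us j x - U j x| <= L * rho.
Proof.
move=> G nT pU r0; pose N := Num.bound (rho / h); pose m : R := N.+1%:R.
have m0 : 0 < m by rewrite ltr0n.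
have rm0 : 0 < rho / m by rewrite divr_gt0.
have rh : rho / m <= h.
  rewrite ler_pdivrMr// mulrC -ler_pdivrMr//; apply: ltW.
  apply: lt_le_trans (archi_boundP _) _; first by rewrite divr_ge0 ?ltW.
  by rewrite ler_nat.
have K0 : 0 <= K := le_trans ler01 K1.
have e0 : enorm (0 : 'rV[R]_d) <= rho by rewrite enorm0 ltW.
suff H i : exists2 Us, pcp (shakeE (i%:R / m) rho E) h T tau n Us &
    forall j, (j <= n)%N -> forall x, `|Us j x - U j x| <= L * (rho * (i%:R / m)).
  have [Us pUs Hv] := H N.+1; exists Us; first by move: pUs; rewrite divff// gt_eqF.
  by move=> j jn x; have := Hv j jn x; rewrite -/m divff ?gt_eqF// mulr1.
elim: i => [|i [Us pUs Hv]].
  exists U; rewrite mul0r; first by apply: pcp_shake0 => //; exact: ltW.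
  by move=> j jn x; rewrite subrr normr0 !mulr0.
have Gi := good_shake (i%:R / m) rho G; have GSi := good_shake (i.+1%:R / m) rho G.
pose beta0 : shakes rho := (alpha0, exist _ 0 e0).
have [U' pU'] := pcp_exists beta0 K1 lam0 h0 tau0 GSi nT.
exists U' => // j jn x.
have cl : closeto (K ^+ 2 * (rho / m)) (shakeE (i%:R / m) rho E) (shakeE (i.+1%:R / m) rho E).
  have [c1 c2] := closeto_shake (i%:R / m) (i.+1%:R / m) rho G.
  have D : K * (`|i.+1%:R / m - i%:R / m| * rho) <= K ^+ 2 * (rho / m).
    rewrite -mulrBl -natr1 addrAC subrr add0r mul1r (@ger0_norm _ m^-1) ?invr_ge0 ?(ltW m0)//.
    by rewrite [m^-1 * _]mulrC expr2 -mulrA ler_peMl// mulr_ge0// ltW.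
  split => // beta s y; have [a1 a2 a3 a4] := c2 beta s y.
  by split => [k|k||]; apply: le_trans D.
have H1 := pcp_cd beta0 Gi GSi cl rm0 rh nT pUs pU' erefl jn x.
have H2 := Hv j jn x.
have -> : L * (rho * (i.+1%:R / m)) = L * (rho / m) + L * (rho * (i%:R / m)).
  by rewrite -natr1; ring.
by rewrite (le_trans (ler_distD (Us j x) _ _))// lerD.
Qed.

(** The control [alpha] with the displacement [- z] is available in the shaken problem, and its flow
    translated by [z] is a flow of the unshaken coefficients. *)
Lemma pcp_shake_le E n Us rho : good K lambda E -> n%:R * tau <= T ->
  pcp (shakeE 1 rho E) h T tau n Us -> forall j alpha z u ut, (j < n)%N -> enorm z <= rho ->
  flow (single E alpha (fun x => Us j (x + z))) h (T - j%:R * tau) u ut ->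
  forall x, u (T - j.+1%:R * tau) x <= Us j.+1 (x + z).
Proof.
move=> G nT [_ H2] j alpha z u ut jn zr fu x.
have zr' : enorm (- z) <= rho by rewrite enormN.
have [tU [w [wt [fw wU _]]]] := H2 j jn.
pose beta : shakes rho := (alpha, exist _ (- z) zr').
have jn' : j.+1%:R * tau <= n%:R * tau by rewrite ler_pM2r// ler_nat.
have jj : j.+1%:R * tau = j%:R * tau + tau by rewrite -natr1 mulrDl mul1r.
have b0 : 0 < T - j%:R * tau by move: nT jn' jj tau0; lra.
have aab : 0 <= T - j.+1%:R * tau <= T - j%:R * tau by move: nT jn' jj tau0; lra.
have fz := flow_shift z (fw beta); rewrite single_shake_shift// in fz.
have tz := tame_shift z tU.
have := single_compare lam0 h0 G b0 tz tz fu fz (lexx 0) _ x aab.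
rewrite addr0 => H; apply: le_trans (wU beta (x + z)).
by apply: H => y; rewrite addr0.
Qed.

End shaken_policies.

(** * One-step expansion *)

Section difference_bounds.
Context {R : realType} {d d1 : nat} {A : Type}.
Context (E : bellman_data R d d1 A) (K lambda : R) (GE : good K lambda E).
Implicit Types (p q : 'rV[R]_d -> R) (e x y : 'rV[R]_d) (h : R).

Let K0 : 0 <= K := good_K_ge0 GE.

Lemma fd1_le_UD h e p q N x : 0 < h -> UD e p q -> (forall x, `|q x| <= N) ->
  `|fd1 h e p x| <= N.
Proof.
move=> h0 U qN; rewrite /fd1 normrM (@gtr0_norm _ h^-1) ?invr_gt0// ler_pdivrMr//.
have := mean_value_bound (ltW h0) (gder_within (a := 0) (b := h) (UD_gder x U))
  (fun t _ => UD_gder x U 0 h t) (fun t _ => qN _).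
by rewrite scale0r addr0.
Qed.

Lemma fd2_le_UD h e p q r N x : 0 < h -> UD e p q -> UD e q r -> (forall x, `|r x| <= N) ->
  `|fd2 h e p x| <= N.
Proof.
move=> h0 U U' rN.
have Uf : UD e (fd1 h e p) (fd1 h e q).
  rewrite !fd1_quot; exact: UD_quot.
have -> : fd2 h e p x = fd1 h e (fd1 h e p) (x - h *: e).
  by rewrite /fd2 /fd1 subrK; field; rewrite gt_eqF.
exact: fd1_le_UD h0 Uf (fun y => fd1_le_UD y h0 U' rN).
Qed.

Section averages.
Context (eps : R) (eps0 : 0 < eps) (p : 'rV[R]_d -> R) (L M : R).
Hypotheses (pL : lipx L p) (pM : forall x, `|p x| <= M).

Let L0 : 0 <= `|L|. Proof. by []. Qed.
Let pL' : lipx `|L| p. Proof. by apply: lipx_le pL; exact: ler_norm. Qed.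

Let quot_bound c v q N x : `|c| = eps -> (forall x, `|q x| <= N) -> `|quot c v q x| <= 2 * N / eps.
Proof.
move=> ce qN; rewrite /quot normrM normfV ce mulrC ler_pM2r ?invr_gt0//.
by rewrite (le_trans (ler_normB _ _))// mulr2n mulrDl mul1r lerD.
Qed.

(** Difference quotients are bounded by derivatives, hence uniformly in [h]. Each derivative costs a
    factor [2 / eps], except that the Lipschitz constant of [p], when known, can replace one of
    these factors. *)
Lemma avg_fd_le h k x : 0 < h ->
  [/\ `|fd1 h (ell_ E k) (avg (windows E eps) p) x| <= 2 * M / eps,
      `|fd2 h (ell_ E k) (avg (windows E eps) p) x| <= 4 * M / eps ^+ 2,
      `|fd1 h (ell_ E k) (avg (windows E eps) p) x| <= `|L| * K &
      `|fd2 h (ell_ E k) (avg (windows E eps) p) x| <= 2 * (`|L| * K) / eps].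
Proof.
move=> h0; have [c [c0 ce ck]] := rays_count GE eps0 k.
set e := ell_ E k in ck *; set ws := windows E eps in ck *; set v := c *: e in ck *.
have v1 : v \in ws by rewrite -count_mem_gt0; apply: leq_trans ck.
have v2 : v \in rem v ws.
  by rewrite -count_mem_gt0 -ltnS; apply: leq_trans (count_mem_rem _ _ _); apply: leq_trans ck.
have U1 : UD e (avg ws p) (quot c v (avg (rem v ws) p)) by exact: (UD_avg L0 pL' c0 erefl v1).
have U2 : UD e (quot c v (avg (rem v ws) p)) (quot c v (quot c v (avg (rem v (rem v ws)) p))).
  by apply: UD_quot; exact: (UD_avg L0 pL' c0 erefl v2).
have aM vs y : `|avg vs p y| <= M by exact: avg_norm pL pM y.
have aq vs y : `|quot c v (avg vs p) y| <= 2 * M / eps by exact: quot_bound.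
have aL vs y : `|quot c v (avg vs p) y| <= `|L| * K.
  apply: le_trans (quot_le y (avg_lipx vs pL') erefl c0) _.
  by rewrite ler_wpM2l// (good_ell GE).
split.
- by apply: (fd1_le_UD _ h0 U1) => y; exact: aq.
- apply: (fd2_le_UD _ h0 U1 U2) => y.
  apply: le_trans (quot_bound v y ce (aq _)) _.
  by rewrite le_eqVlt; apply/orP; left; apply/eqP; field; rewrite gt_eqF.
- by apply: (fd1_le_UD _ h0 U1) => y; exact: aL.
- by apply: (fd2_le_UD _ h0 U1 U2) => y; exact: quot_bound (aL _).
Qed.

End averages.

Definition regular h P p : Prop :=
  [/\ forall x, `|p x| <= P, lipx P p,
      forall k x, `|fd1 h (ell_ E k) p x| <= P /\ `|fd2 h (ell_ E k) p x| <= P &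
      forall k, lipx P (fd1 h (ell_ E k) p) /\ lipx P (fd2 h (ell_ E k) p)].

Lemma avg_regular eps p L M P h : 0 < eps -> 0 < h -> 0 <= L -> 0 <= M ->
  (forall x, `|p x| <= M) -> lipx L p ->
  M + L + (2 * M / eps + 4 * M / eps ^+ 2) + (2 * L / eps + 4 * L / eps ^+ 2) <= P ->
  regular h P (avg (windows E eps) p).
Proof.
move=> e0 h0 L0 M0 pM pL HP.
have q1 N : 0 <= N -> 0 <= 2 * N / eps by move=> N0; apply: divr_ge0; [rewrite mulr_ge0|rewrite ltW].
have q2 N : 0 <= N -> 0 <= 4 * N / eps ^+ 2 by move=> N0; apply: divr_ge0; [rewrite mulr_ge0|rewrite exprn_ge0// ltW].
have := q1 M M0; have := q1 L L0; have := q2 M M0; have := q2 L L0.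
move=> L2 M2 L1 M1; split.
- by move=> x; apply: le_trans (avg_norm _ pL pM x) _; lra.
- by apply: lipx_le (avg_lipx _ pL); lra.
- by move=> k x; have [H1 H2 _ _] := avg_fd_le e0 pL pM k x h0; lra.
(* The increment of [p] by [y] is bounded by [L * enorm y]; [avg_fd_le] applied to it in place of
   [p] gives the Lipschitz bounds of the difference quotients. *)
have D y : forall x, `|p (x + y) - p x| <= L * enorm y by move=> x; exact: pL.
have Dl y : lipx (L + L) (fun x => p (x + y) - p x) by apply: lipxB => //; exact: lipx_shift.
have avD y z : avg (windows E eps) p (z + y) - avg (windows E eps) p z =
    avg (windows E eps) (fun x => p (x + y) - p x) z.
  have := avg_lin (windows E eps) 1 (-1) z (lipx_shift y pL) pL.
  under eq_fun do rewrite mul1r mulN1r.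
  by rewrite mul1r mulN1r avg_shift => ->.
have fD1 k y x : fd1 h (ell_ E k) (avg (windows E eps) p) (x + y) -
    fd1 h (ell_ E k) (avg (windows E eps) p) x =
    fd1 h (ell_ E k) (avg (windows E eps) (fun x => p (x + y) - p x)) x.
  by rewrite /fd1 -!avD (addrAC x y); field; rewrite gt_eqF.
have fD2 k y x : fd2 h (ell_ E k) (avg (windows E eps) p) (x + y) -
    fd2 h (ell_ E k) (avg (windows E eps) p) x =
    fd2 h (ell_ E k) (avg (windows E eps) (fun x => p (x + y) - p x)) x.
  by rewrite /fd2 -!avD (addrAC x y) (addrAC x y (- _)); field; rewrite gt_eqF.
have ey y : 0 <= enorm y by exact: enorm_ge0.
move=> k; split=> x y; rewrite ?fD1 ?fD2; have [H1 H2 _ _] := avg_fd_le e0 (Dl y) (D y) k x h0.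
  apply: le_trans H1 _; rewrite mulrA [2 * L * _ / _]mulrAC ler_wpM2r//; lra.
apply: le_trans H2 _; rewrite mulrA [4 * L * _ / _]mulrAC ler_wpM2r//; lra.
Qed.

Lemma prod_diff (a b p q alpha P beta pi : R) : `|a - b| <= alpha -> `|p| <= P ->
  `|b| <= beta -> `|p - q| <= pi -> `|a * p - b * q| <= alpha * P + beta * pi.
Proof.
move=> H1 H2 H3 H4; rewrite (_ : _ - _ = (a - b) * p + b * (p - q)); last by ring.
by rewrite (le_trans (ler_normD _ _))// !normrM lerD// ler_pM.
Qed.

Definition lin_bound (P2 P1 P0 : R) : R :=
  ndirs (d1 := d1) * (K ^+ 2 / 2 * P2) + ndirs (d1 := d1) * (K * P1) + (lambda + K) * P0.

Hypothesis lam0 : 0 <= lambda.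

Let c_le alpha t x : `|c_ E alpha t x| <= lambda + K.
Proof.
have [cK _ _] := good_c GE alpha; have := cK t x.
have := good_c_ge GE alpha t x; have := lam0; rewrite ler_norml => l c.
by rewrite ger0_norm; lra.
Qed.

Let a_norm alpha k t x : `|a_ E alpha k t x| <= K ^+ 2 / 2.
Proof. by rewrite ger0_norm ?a_ge0//; exact: a_le GE. Qed.

Lemma Lin_bound h alpha t p x P2 P1 P0 : (forall k, `|fd2 h (ell_ E k) p x| <= P2) ->
  (forall k, `|fd1 h (ell_ E k) p x| <= P1) -> `|p x| <= P0 ->
  `|Lin E h alpha t p x| <= lin_bound P2 P1 P0.
Proof.
move=> H2 H1 H0; rewrite /Lin /lin_bound (le_trans (ler_normB _ _))// lerD//; last first.
  by rewrite normrM ler_pM.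
rewrite (le_trans (ler_normD _ _))// lerD//; rewrite /ndirs -sumr_cst (le_trans (ler_norm_sum _ _ _))//;
  apply: ler_sum => k _; rewrite normrM ler_pM//.
by have [] := good_b GE alpha k.
Qed.

Definition lop_lip (P : R) : R :=
  ndirs (d1 := d1) * (K ^+ 2 * P + K ^+ 2 / 2 * P) + ndirs (d1 := d1) * (K * P + K * P) +
  (K * P + (lambda + K) * P) + K.

Lemma Lop_regular h alpha t s p x y P D : regular h P p -> Num.sqrt `|t - s| + enorm (x - y) <= D ->
  `|Lop E h alpha t p x - Lop E h alpha s p y| <= lop_lip P * D.
Proof.
move=> [pP pL pf pfl] HD.
have sq0 : 0 <= Num.sqrt `|t - s| by exact: sqrtr_ge0.
have D0 : 0 <= D by apply: le_trans HD; rewrite addr_ge0 ?enorm_ge0.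
have P0 : 0 <= P by apply: le_trans (pP x).
have co psi : coef K psi -> `|psi t x - psi s y| <= K * D.
  move=> [_ h2 h3]; rewrite (le_trans (ler_distD (psi s x) _ _))//.
  apply: (@le_trans _ _ (K * (Num.sqrt `|t - s| + enorm (x - y)))); last by rewrite ler_wpM2l.
  by rewrite mulrDr lerD.
have lip q : lipx P q -> `|q x - q y| <= P * D.
  move=> ql; apply: le_trans (lipx_dist x y ql) _; rewrite ler_wpM2l//.
  by apply: le_trans HD; rewrite lerDr.
have aD k : `|a_ E alpha k t x - a_ E alpha k s y| <= K ^+ 2 * D.
  have [sK _ _] := good_sigma GE alpha k; have := co _ (good_sigma GE alpha k).
  rewrite /a_ -mulrBr subr_sqr => H.
  rewrite normrM normrM (@gtr0_norm _ 2^-1) ?invr_gt0//.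
  apply: (@le_trans _ _ (2^-1 * (K * D * (2 * K)))).
    rewrite ler_wpM2l// ler_pM// (le_trans (ler_normD _ _))// mulr2n mulrDl mul1r lerD//.
  by rewrite le_eqVlt; apply/orP; left; apply/eqP; field.
have cD : `|c_ E alpha t x - c_ E alpha s y| <= K * D.
  by have := co _ (good_c GE alpha); rewrite /= opprB addrA subrK.
have fD := co _ (good_f GE alpha).
have S2 : `|\sum_k a_ E alpha k t x * fd2 h (ell_ E k) p x -
   \sum_k a_ E alpha k s y * fd2 h (ell_ E k) p y| <=
   ndirs (d1 := d1) * (K ^+ 2 * D * P + K ^+ 2 / 2 * (P * D)).
  rewrite -sumrB /ndirs -sumr_cst (le_trans (ler_norm_sum _ _ _))//; apply: ler_sum => k _.
  apply: prod_diff => //; first by have [] := pf k x.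
  by apply: lip; have [] := pfl k.
have S1 : `|\sum_k b_ E alpha k t x * fd1 h (ell_ E k) p x -
   \sum_k b_ E alpha k s y * fd1 h (ell_ E k) p y| <=
   ndirs (d1 := d1) * (K * D * P + K * (P * D)).
  rewrite -sumrB /ndirs -sumr_cst (le_trans (ler_norm_sum _ _ _))//; apply: ler_sum => k _.
  apply: prod_diff => //; first exact: co (good_b GE alpha k).
  - by have [] := pf k x.
  - by have [] := good_b GE alpha k.
  by apply: lip; have [] := pfl k.
have S0 : `|c_ E alpha t x * p x - c_ E alpha s y * p y| <= K * D * P + (lambda + K) * (P * D).
  by apply: prod_diff => //; exact: lip.
have -> : lop_lip P * D = ndirs (d1 := d1) * (K ^+ 2 * D * P + K ^+ 2 / 2 * (P * D)) +
  ndirs (d1 := d1) * (K * D * P + K * (P * D)) + (K * D * P + (lambda + K) * (P * D)) + K * D.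
  by rewrite /lop_lip; ring.
rewrite /Lop /Lin; move: S2 S1 S0 fD; set w1 := \sum_k _; set w2 := \sum_k _.
set w3 := \sum_k _; set w4 := \sum_k _; rewrite !ler_norml; lra.
Qed.

(** [C1] bounds the oscillation of the slope in time and space. Smoothing the slope is paid twice,
    in the operator and when the slope is restored; the last term is the operator applied to the
    smoothed slope. *)
Definition expansionc (P : R) : R :=
  let C1 := lop_lip P in
  2 * (C1 * window_size (d := d) (d1 := d1) K) + C1 +
  lin_bound (2 * (C1 * K)) (C1 * K) (lin_bound P P P + K).

End difference_bounds.

Section one_step_expansion.
Context {R : realType} {d d1 : nat} {A : Type}.
Context (E : bellman_data R d d1 A) (K lambda h a b P : R) (p : 'rV[R]_d -> R).
Hypotheses (GE : good K lambda E) (lam0 : 0 <= lambda) (h0 : 0 < h).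
Hypotheses (ab : a < b) (ab1 : b - a <= 1) (rp : regular E h P p).

Let K0 : 0 <= K := good_K_ge0 GE.
Let P0 : 0 <= P. Proof. by have [pP _ _ _] := rp; apply: le_trans (pP 0). Qed.

Let delta : R := Num.sqrt (b - a).
Let delta0 : 0 < delta. Proof. by rewrite sqrtr_gt0 subr_gt0. Qed.
Let deltaE : delta * delta = b - a.
Proof. by rewrite -expr2 sqr_sqrtr// subr_ge0 ltW. Qed.
Let delta1 : delta <= 1.
Proof. by rewrite -(@ler_pXn2r _ 2) ?nnegrE ?(ltW delta0)// expr1n expr2 deltaE. Qed.

Let C1 : R := lop_lip (d1 := d1) K lambda P.
Let C0 : R := lin_bound (d1 := d1) K lambda P P P + K.
Let ws : R := window_size (d := d) (d1 := d1) K.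
Let C2 : R := lin_bound (d1 := d1) K lambda (2 * (C1 * K)) (C1 * K) C0.
Let C : R := expansionc (d := d) (d1 := d1) K lambda P.

Let lam_K : 0 <= lambda + K. Proof. by rewrite addr_ge0. Qed.
Let C1_ge0 : 0 <= C1.
Proof.
have q : 0 <= K ^+ 2 / 2 by rewrite divr_ge0// sqr_ge0.
have q2 : 0 <= K ^+ 2 := sqr_ge0 K.
by rewrite /C1 /lop_lip !addr_ge0// ?mulr_ge0// !addr_ge0// mulr_ge0.
Qed.
Let ws0 : 0 <= ws. Proof. by rewrite /ws /window_size !addr_ge0// !mulr_ge0. Qed.
Let C1ws : 0 <= C1 * ws. Proof. by rewrite mulr_ge0. Qed.
Let CE : C = 2 * (C1 * ws) + C1 + C2. Proof. by []. Qed.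

Let lin_ge0 (P2 P1 Q : R) : 0 <= P2 -> 0 <= P1 -> 0 <= Q ->
  0 <= lin_bound (d1 := d1) K lambda P2 P1 Q.
Proof.
move=> H2 H1 H0; have q : 0 <= K ^+ 2 / 2 * P2 by rewrite mulr_ge0// divr_ge0// sqr_ge0.
by rewrite /lin_bound addr_ge0 ?mulr_ge0// addr_ge0// mulr_ge0// mulr_ge0.
Qed.
Let C0_ge0 : 0 <= C0. Proof. by rewrite addr_ge0// lin_ge0. Qed.
Let C2_ge0 : 0 <= C2. Proof. by rewrite lin_ge0// ?mulr_ge0// mulr_ge0. Qed.

Section smoothed_slope.
Context (G : 'rV[R]_d -> R) (GL : lipx C1 G) (GC : forall x, `|G x| <= C0).

Let Gd : 'rV[R]_d -> R := avg (windows E delta) G.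

Let Gd_near x : `|Gd x - G x| <= C1 * ws * delta.
Proof.
apply: le_trans (avg_near (windows E delta) x C1_ge0 GL) _.
by rewrite -mulrA ler_wpM2l// [ws * _]mulrC; exact: (windows_size GE).
Qed.

Let Gd_bound x : `|Gd x| <= C0. Proof. exact: avg_norm GL GC x. Qed.

Let Gd_Lin alpha t x : `|Lin E h alpha t Gd x| <= C2 / delta.
Proof.
have dm (r : R) : 0 <= r -> r <= r / delta by move=> r0; rewrite ler_pdivlMr// ler_piMr.
have C1K : 0 <= C1 * K by rewrite mulr_ge0.
have C00 : 0 <= C0 by apply: le_trans (GC x).
have -> : C2 / delta = lin_bound (d1 := d1) K lambda (2 * (C1 * K) / delta) (C1 * K / delta) (C0 / delta).
  by rewrite /C2 /lin_bound; field; rewrite gt_eqF.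
apply: (Lin_bound GE lam0) => [k|k|].
- by have [_ _ _] := avg_fd_le GE delta0 GL GC k x h0; rewrite (ger0_norm C1_ge0).
- have [_ _ H _] := avg_fd_le GE delta0 GL GC k x h0.
  by move: H; rewrite (ger0_norm C1_ge0) => H; apply: le_trans H (dm _ C1K).
- exact: le_trans (Gd_bound x) (dm _ C00).
Qed.

Let z (t : R) (x : 'rV[R]_d) : R := p x + (b - t) * Gd x.

Let z_evol c : evol a b (fun t x => z t x + c * (b - t)) (fun _ x => - Gd x - c).
Proof.
split=> [x|t x _].
  apply: (lipschitz_within (C := `|Gd x| + `|c|)) => s t.
  have -> : z s x + c * (b - s) - (z t x + c * (b - t)) = (- Gd x - c) * (s - t).
    by rewrite /z; ring.
  by rewrite normrM ler_wpM2r// (le_trans (ler_normB _ _))// normrN.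
move=> e e0; exists 1 => // s _ _.
have -> : z s x + c * (b - s) - (z t x + c * (b - t)) - (- Gd x - c) * (s - t) = 0.
  by rewrite /z; ring.
by rewrite normr0 mulr_ge0// ltW.
Qed.

Let z_Lop alpha t x c : Lop E h alpha t (fun y => z t y + c * (b - t)) x =
  Lop E h alpha t p x + (b - t) * Lin E h alpha t Gd x - c_ E alpha t x * (c * (b - t)).
Proof. by rewrite /Lop LinD Lin_cst LinD LinZ; ring. Qed.

Let step_Lin alpha t x : a <= t < b -> `|(b - t) * Lin E h alpha t Gd x| <= C2 * delta.
Proof.
case/andP=> at_ tb; have bt : 0 <= b - t by rewrite subr_ge0 ltW.
rewrite normrM (ger0_norm bt).
apply: (@le_trans _ _ ((b - a) * (C2 / delta))); last first.
  by rewrite -deltaE le_eqVlt; apply/orP; left; apply/eqP; field; rewrite gt_eqF.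
apply: ler_pM (Gd_Lin alpha t x) => //.
by rewrite lerD2l lerN2.
Qed.

Let rate : R := (C1 * ws + C1 + C2) * delta.
Let rate0 : 0 <= rate.
Proof. by rewrite mulr_ge0 ?(ltW delta0)// addr_ge0 ?C2_ge0// addr_ge0. Qed.

Let z_bound t x : a <= t <= b -> `|z t x| <= P + C0.
Proof.
case/andP=> at_ tb; rewrite (le_trans (ler_normD _ _))// lerD//; first by have [pP _ _ _] := rp.
rewrite normrM ger0_norm ?subr_ge0// -[leRHS]mul1r ler_pM ?subr_ge0//.
by move: ab1; lra.
Qed.

(* The slope G is only Lipschitz; averaging it at scale (b - a)^(1/2) balances its second
   differences against the averaging error. *)
Lemma slope_upper u ut beta : subsol E h a b u ut ->
  (exists M, forall t x, a <= t <= b -> `|u t x| <= M) -> 0 <= beta ->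
  (forall x, u b x <= p x + beta) ->
  (forall alpha t x, a <= t < b -> Lop E h alpha t p x <= G x + C1 * delta) ->
  forall x, u a x <= p x + beta + (b - a) * G x + C * ((b - a) * delta).
Proof.
move=> usub [M uM] be0 term HG x.
have zsup : supersol E h a b rate (fun t x => z t x + 0 * (b - t)) (fun _ x => - Gd x - 0).
  split=> [|t y alpha tab]; first exact: z_evol.
  rewrite z_Lop; have := step_Lin alpha y tab; have := HG alpha t y tab; have := Gd_near y.
  by rewrite /rate !ler_norml; lra.
have bdd : exists M, forall t y, a <= t <= b -> u t y - (z t y + 0 * (b - t)) <= M.
  exists (M + (P + C0)) => t y tab; have := uM t y tab; have := z_bound y tab.
  by rewrite !ler_norml; lra.
have gap : rate <= rate + lambda * beta by rewrite lerDl mulr_ge0.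
have termz y : u b y - (z b y + 0 * (b - b)) <= beta.
  by rewrite /z subrr !mul0r !addr0; have := term y; lra.
have aab : a <= a <= b by rewrite lexx ltW.
have := comparison GE lam0 h0 (ltW ab) usub zsup bdd be0 rate0 gap termz x aab.
have ba : 0 <= b - a by rewrite subr_ge0 ltW.
have := ler_wpM2r ba (ler_normlW (Gd_near x)).
by rewrite /z CE /rate; lra.
Qed.

Lemma slope_lower v vt alpha : supersol E h a b 0 v vt ->
  (exists M, forall t x, a <= t <= b -> `|v t x| <= M) ->
  (forall x, p x <= v b x) ->
  (forall t x, a <= t < b -> G x - C1 * delta <= Lop E h alpha t p x) ->
  forall x, p x + (b - a) * G x - C * ((b - a) * delta) <= v a x.
Proof.
move=> vsup [M vM] term HG x.
have zsub : subsol E h a b (fun t x => z t x + - rate * (b - t)) (fun _ x => - Gd x - - rate).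
  split=> [|t y e tab e0]; first exact: z_evol.
  exists alpha; rewrite z_Lop; have := step_Lin alpha y tab; have := HG t y tab; have := Gd_near y.
  have : 0 <= c_ E alpha t y * (rate * (b - t)).
    rewrite mulr_ge0 ?(le_trans lam0 (good_c_ge GE _ _ _))// mulr_ge0// subr_ge0.
    by case/andP: tab => _ /ltW.
  by move: (rate0); rewrite {-1}/rate !ler_norml; lra.
have zM t y : a <= t <= b -> `|z t y + - rate * (b - t)| <= P + C0 + rate.
  move=> tab; rewrite (le_trans (ler_normD _ _))// lerD// ?z_bound//.
  rewrite normrM normrN (ger0_norm rate0) ger0_norm ?subr_ge0; last by case/andP: tab.
  by rewrite ler_piMr//; case/andP: tab; move: ab1; lra.
have bdd : exists M, forall t y, a <= t <= b -> z t y + - rate * (b - t) - v t y <= M.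
  exists (M + (P + C0 + rate)) => t y tab; have := vM t y tab; have := zM t y tab.
  by rewrite !ler_norml; lra.
have gap : 0 <= 0 + lambda * 0 by rewrite mulr0 addr0.
have termz y : z b y + - rate * (b - b) - v b y <= 0.
  by rewrite /z subrr mul0r mulr0 !addr0; have := term y; lra.
have aab : a <= a <= b by rewrite lexx ltW.
have := comparison GE lam0 h0 (ltW ab) zsub vsup bdd (lexx 0) (lexx 0) gap termz x aab.
have ba : 0 <= b - a by rewrite subr_ge0 ltW.
have := Gd_near x; rewrite distrC => /ler_normlW/(ler_wpM2r ba).
by rewrite /z CE /rate; lra.
Qed.

End smoothed_slope.

Let Lop_bound alpha t x : `|Lop E h alpha t p x| <= C0.
Proof.
have [pP _ pf _] := rp.
rewrite /Lop /C0 (le_trans (ler_normD _ _))// lerD//; last by have [] := good_f GE alpha.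
by apply: (Lin_bound GE lam0) => // k; have [] := pf k x.
Qed.

Let Lop_time alpha t x : a <= t < b -> `|Lop E h alpha t p x - Lop E h alpha a p x| <= C1 * delta.
Proof.
case/andP=> at_ tb; apply: (Lop_regular GE lam0) rp _.
rewrite subrr enorm0 addr0 ler_wsqrtr// ger0_norm ?subr_ge0//.
by rewrite lerD2r ltW.
Qed.

Let Lop_space alpha x y : `|Lop E h alpha a p x - Lop E h alpha a p y| <= C1 * enorm (x - y).
Proof.
have H : Num.sqrt `|a - a| + enorm (x - y) <= enorm (x - y).
  by rewrite subrr normr0 sqrtr0 add0r.
exact: (Lop_regular GE lam0 alpha rp H).
Qed.

(** A subsolution grows at most at the rate [Fop], whereas [expansion_lower] gives a frozen control
    at least the rate of its own [Lop]. Taking the supremum of the latter makes the two rates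
    cancel, up to the order [3/2] in the length of the step. *)
Lemma expansion_upper (alpha0 : A) u ut beta : subsol E h a b u ut ->
  (exists M, forall t x, a <= t <= b -> `|u t x| <= M) -> 0 <= beta ->
  (forall x, u b x <= p x + beta) ->
  forall x, u a x <= p x + beta + (b - a) * Fop E h a p x + C * ((b - a) * Num.sqrt (b - a)).
Proof.
move=> usub uM be0 term; have [pP _ _ _] := rp.
have GL : lipx C1 (Fop E h a p).
  move=> x y; apply: (Fop_diff GE lam0 h0 alpha0 pP pP) => alpha.
  by have := Lop_space alpha (x + y) x; rewrite [x + y - x]addrAC subrr add0r.
have GC x : `|Fop E h a p x| <= C0.
  rewrite ler_norml; apply/andP; split.
    apply: le_trans (Lop_le_Fop GE lam0 h0 alpha0 alpha0 a x pP).
    by have := Lop_bound alpha0 a x; rewrite ler_norml => /andP[].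
  by apply: (Fop_le alpha0) => alpha; apply: le_trans (Lop_bound alpha a x); exact: ler_norm.
apply: (slope_upper GL GC usub uM be0 term) => alpha t x tab.
have := Lop_time alpha x tab; have := Lop_le_Fop GE lam0 h0 alpha0 alpha a x pP.
by rewrite ler_norml; lra.
Qed.

Lemma expansion_lower v vt alpha : supersol E h a b 0 v vt ->
  (exists M, forall t x, a <= t <= b -> `|v t x| <= M) ->
  (forall x, p x <= v b x) ->
  forall x, p x + (b - a) * Lop E h alpha a p x - C * ((b - a) * Num.sqrt (b - a)) <= v a x.
Proof.
move=> vsup vM term.
have GL : lipx C1 (Lop E h alpha a p).
  by move=> x y; have := Lop_space alpha (x + y) x; rewrite [x + y - x]addrAC subrr add0r.
apply: (slope_lower GL (Lop_bound alpha a) vsup vM term (alpha := alpha)) => t x tab.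
by have := Lop_time alpha x tab; rewrite ler_norml; lra.
Qed.

End one_step_expansion.

Lemma expansionc_ge0 (R : realType) (d d1 : nat) (K lambda P : R) : 0 <= K -> 0 <= lambda -> 0 <= P ->
  0 <= expansionc (d := d) (d1 := d1) K lambda P.
Proof.
move=> K0 l0 P0; have q : 0 <= K ^+ 2 / 2 by rewrite divr_ge0// sqr_ge0.
have q2 : 0 <= K ^+ 2 := sqr_ge0 K.
have lK : 0 <= lambda + K by rewrite addr_ge0.
have C1 : 0 <= lop_lip (d1 := d1) K lambda P.
  by rewrite /lop_lip !addr_ge0// ?mulr_ge0// !addr_ge0// mulr_ge0.
have lin (x y z : R) : 0 <= x -> 0 <= y -> 0 <= z -> 0 <= lin_bound (d1 := d1) K lambda x y z.
  by move=> x0 y0 z0; rewrite /lin_bound !addr_ge0// ?mulr_ge0// mulr_ge0.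
have w0 : 0 <= window_size (d := d) (d1 := d1) K by rewrite /window_size !addr_ge0// !mulr_ge0.
have CK : 0 <= lop_lip (d1 := d1) K lambda P * K by rewrite mulr_ge0.
rewrite /expansionc /= addr_ge0//; last by rewrite lin ?mulr_ge0// addr_ge0// lin.
by rewrite addr_ge0// mulr_ge0// mulr_ge0.
Qed.

Section averaged_flows.
Context {R : realType} {d : nat}.

Lemma gder_uniq (y z l : R -> R) : gder y l -> gder z l -> y 1 - y 0 = z 1 - z 0.
Proof.
move=> Hy Hz; have H : gder (fun s => y s - z s) (fun s => l s - l s).
  by move=> a b t; exact: der_onB.
have H0 : `|(y 1 - z 1) - (y 0 - z 0)| <= 0 * 1.
  apply: (mean_value_bound ler01 (gder_within (a := 0) (b := 1) H) (fun t _ => H 0 1 t)) => t _.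
  by rewrite subrr normr0.
by move: H0; rewrite mul0r normr_le0 subr_eq0 => /eqP; lra.
Qed.

(* A change of variables, obtained from uniqueness of primitives. *)
Lemma segint_halve (G : R -> R) r : continuous G ->
  segint (fun s : R => G (2^-1 * s + r)) 0 1 = 2 * (prim G (2^-1 + r) - prim G r).
Proof.
move=> cG; have cH : continuous (fun s : R => G (2^-1 * s + r)).
  move=> s; apply: (@continuous_comp _ _ _ (fun s : R => 2^-1 * s + r) G); last exact: cG.
  by apply: cvgD; [apply: cvgMr; exact: cvg_id|exact: cvg_cst].
rewrite -primB//.
have D1 : gder (prim (fun s : R => G (2^-1 * s + r))) (fun s : R => G (2^-1 * s + r)).
  by move=> a b t; exact: prim_der_on.
have D2 : gder (fun s : R => 2 * prim G (2^-1 * s + r)) (fun s : R => G (2^-1 * s + r)).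
  move=> a b t e e0; have := prim_der_on (2^-1 * a + r) (2^-1 * b + r) (2^-1 * t + r) cG e0.
  move=> [rr rr0 H]; exists rr => // s sab st.
  have E0 : 2^-1 * s + r - (2^-1 * t + r) = 2^-1 * (s - t) by ring.
  have nE : `|2^-1 * (s - t)| = 2^-1 * `|s - t| by rewrite normrM gtr0_norm.
  have s0 := normr_ge0 (s - t).
  have := H (2^-1 * s + r); rewrite E0 nE => {}H.
  have {}H : `|prim G (2^-1 * s + r) - prim G (2^-1 * t + r) - G (2^-1 * t + r) * (2^-1 * (s - t))|
     <= e * (2^-1 * `|s - t|) by apply: H; [move: sab; lra|lra].
  rewrite (_ : _ - _ - _ = 2 * (prim G (2^-1 * s + r) - prim G (2^-1 * t + r) -
     G (2^-1 * t + r) * (2^-1 * (s - t)))); last by field.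
  rewrite normrM (ger0_norm (ler0n R 2)); move: H; lra.
by have /= := gder_uniq D1 D2; rewrite mulr1 mulr0 add0r => ->; ring.
Qed.

Lemma avg1_halve L (v : 'rV[R]_d) p x : lipx L p ->
  avg1 v p x = 2^-1 * (avg1 (2^-1 *: v) p x + avg1 (2^-1 *: v) p (x + 2^-1 *: v)).
Proof.
move=> pL; pose G s := p (x + s *: v).
have cG : continuous G by exact: lipx_line_continuous pL.
have -> : avg1 (2^-1 *: v) p x = 2 * (prim G (2^-1 + 0) - prim G 0).
  rewrite -segint_halve//; congr segint; apply/funext => s.
  by rewrite /G addr0 scalerA mulrC.
have -> : avg1 (2^-1 *: v) p (x + 2^-1 *: v) = 2 * (prim G (2^-1 + 2^-1) - prim G 2^-1).
  rewrite -segint_halve//; congr segint; apply/funext => s.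
  rewrite /G -addrA scalerA -scalerDl; congr (p (_ + _)); congr (_ *: _); ring.
rewrite addr0 (_ : 2^-1 + 2^-1 = 1); last by field.
by rewrite /avg1 -/G -primB//; field.
Qed.

Lemma tame_avg1 v p : tame p -> tame (avg1 (R := R) (d := d) v p).
Proof.
move=> [M pM pL]; exists M; last exact: avg1_lipx.
by move=> x; apply: avg1_norm pL _ => s _; exact: pM.
Qed.

Lemma tame_avg vs p : tame p -> tame (avg (R := R) (d := d) vs p).
Proof. by move=> tp; elim: vs => //= v vs; exact: tame_avg1. Qed.

Context {d1 : nat} {A : Type} (E : bellman_data R d d1 A) (K lambda h a b : R) (alpha : A).
Hypotheses (GE : good K lambda E) (lam0 : 0 <= lambda) (h0 : 0 < h) (b0 : 0 < b).
Hypotheses (ab : 0 <= a <= b).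

Lemma single_midpoint phi phi1 phi2 u ut u1 ut1 u2 ut2 :
  tame phi -> tame phi1 -> tame phi2 -> flow (single E alpha phi) h b u ut ->
  flow (single E alpha phi1) h b u1 ut1 -> flow (single E alpha phi2) h b u2 ut2 ->
  (forall x, phi x <= 2^-1 * (phi1 x + phi2 x)) ->
  forall x, u a x <= 2^-1 * (u1 a x + u2 a x).
Proof.
move=> tp t1 t2 fu f1 f2 pp x.
have [[c1 d1'] s1] := single_supersol lam0 h0 GE t1 f1.
have [[c2 d2] s2] := single_supersol lam0 h0 GE t2 f2.
have sup : supersol (single E alpha (g_ E)) h 0 b 0
    (fun t y => 2^-1 * u1 t y + 2^-1 * u2 t y) (fun t y => 2^-1 * ut1 t y + 2^-1 * ut2 t y).
  split; first split.
  - by move=> y; apply: within_continuousD; apply: within_continuousM; [exact: within_continuous_cst|exact: c1|exact: within_continuous_cst|exact: c2].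
  - by move=> t y tb; apply: der_onD; apply: der_onZ; [exact: d1'|exact: d2].
  move=> t y [] tb; have := s1 t y tt tb; have := s2 t y tt tb.
  by rewrite /Lop LinD !LinZ; lra.
have [M uM] := flow_bd fu; have [M1 uM1] := flow_bd f1; have [M2 uM2] := flow_bd f2.
have bdd : exists N, forall t y, 0 <= t <= b -> u t y - (2^-1 * u1 t y + 2^-1 * u2 t y) <= N.
  exists (M + M1 + M2) => t y tb; have := uM t y tb; have := uM1 t y tb; have := uM2 t y tb.
  by rewrite !ler_norml; lra.
have gap : 0 <= 0 + lambda * 0 by rewrite mulr0 addr0.
have term y : u b y - (2^-1 * u1 b y + 2^-1 * u2 b y) <= 0.
  by rewrite (flow_T fu) (flow_T f1) (flow_T f2) /=; have := pp y; lra.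
have := comparison (good_solo alpha GE) lam0 h0 (ltW b0) (single_subsol lam0 h0 GE tp fu) sup bdd
  (lexx 0) (lexx 0) gap term x ab.
lra.
Qed.

(** For one frozen control the flow of an average is the average of the flows. Only the inequality
    is kept, for all translates within [r]; averaging along [v] spends [enorm v] of this radius. *)
Definition dominated (r : R) (phi Phi : 'rV[R]_d -> R) : Prop :=
  forall z, enorm z <= r -> forall u ut,
    flow (single E alpha (fun x => phi (x + z))) h b u ut -> forall x, u a x <= Phi (x + z).

(* Domination is stable under midpoints by linearity; an average over a segment is a limit
   of iterated midpoints. *)
Lemma dominated_dyadic r phi Phi L L' n : dominated r phi Phi -> tame phi -> 0 <= L -> 0 <= L' ->
  lipx L phi -> lipx L' Phi -> forall v z u ut, enorm z + enorm v <= r ->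
  flow (single E alpha (fun x => avg1 v phi (x + z))) h b u ut ->
  forall x, u a x <= avg1 v Phi (x + z) + (L + L') * enorm v / 2 ^+ n.
Proof.
move=> dom tp L0 L'0 pL PL; elim: n => [|n IH] v z u ut zv fu x.
  have [u0 [ut0 f0]] := single_exists lam0 h0 GE b0 alpha (tame_shift z tp).
  have zr : enorm z <= r by apply: le_trans zv; rewrite lerDl enorm_ge0.
  have H := dom z zr _ _ f0 x.
  have Lv : 0 <= L * enorm v by rewrite mulr_ge0// enorm_ge0.
  have term y : avg1 v phi (y + z) <= phi (y + z) + L * enorm v.
    by have := avg1_near v (y + z) L0 pL; rewrite ler_norml; lra.
  have := single_compare lam0 h0 GE b0 (tame_shift z (tame_avg1 v tp)) (tame_shift z tp) fu f0 Lv
    term x ab.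
  have := avg1_near v (x + z) L'0 PL; rewrite expr0 divr1 mulrDl ler_norml; lra.
pose w := 2^-1 *: v.
have wE : enorm w = 2^-1 * enorm v by rewrite enormZ gtr0_norm.
have v0 := enorm_ge0 v.
have [u1 [ut1 f1]] := single_exists lam0 h0 GE b0 alpha (tame_shift z (tame_avg1 w tp)).
have [u2 [ut2 f2]] := single_exists lam0 h0 GE b0 alpha (tame_shift (z + w) (tame_avg1 w tp)).
have z1 : enorm z + enorm w <= r by rewrite wE; lra.
have z2 : enorm (z + w) + enorm w <= r by have := ler_enormD z w; rewrite wE; lra.
have H1 := IH _ _ _ _ z1 f1 x; have H2 := IH _ _ _ _ z2 f2 x.
have tA := tame_shift z (tame_avg1 v tp).
have half y : avg1 v phi (y + z) <= 2^-1 * (avg1 w phi (y + z) + avg1 w phi (y + (z + w))).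
  by rewrite (avg1_halve v _ pL) addrA.
have := single_midpoint tA (tame_shift z (tame_avg1 w tp)) (tame_shift (z + w) (tame_avg1 w tp))
  fu f1 f2 half x.
rewrite (avg1_halve v _ PL) -/w -addrA; move: H1 H2; rewrite wE exprS invfM.
move: (2 ^+ n)^-1 => q; lra.
Qed.

Lemma dominated_avg1 r phi Phi v : 0 <= r -> dominated (r + enorm v) phi Phi -> tame phi -> tame Phi ->
  dominated r (avg1 v phi) (avg1 v Phi).
Proof.
move=> r0 dom tp tP z zr u ut fu x.
have [M pM pL] := tp; have [N PN PL] := tP.
have M0 : 0 <= M by apply: le_trans (pM 0).
have N0 : 0 <= N by apply: le_trans (PN 0).
have C0 : 0 <= (M + N) * enorm v by rewrite mulr_ge0 ?enorm_ge0// addr_ge0.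
have zv : enorm z + enorm v <= r + enorm v by rewrite lerD2r.
apply/ler_addgt0Pr => e e0; pose n := Num.bound ((M + N) * enorm v / e).
apply: le_trans (dominated_dyadic n dom tp M0 N0 pL PL zv fu x) _.
rewrite lerD2l ler_pdivrMr ?exprn_gt0// [e * _]mulrC -ler_pdivrMr//.
have q : 0 <= (M + N) * enorm v / e by rewrite divr_ge0// ltW.
apply: le_trans (ltW (archi_boundP q)) _.
by rewrite -natrX ler_nat ltnW// ltn_expl.
Qed.

Lemma dominated_avg vs r phi Phi : 0 <= r -> dominated (r + \sum_(v <- vs) enorm v) phi Phi ->
  tame phi -> tame Phi -> dominated r (avg vs phi) (avg vs Phi).
Proof.
move=> + + tp tP; elim: vs r => [|v vs IH] r r0; first by rewrite big_nil addr0.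
rewrite big_cons addrA => dom; apply: dominated_avg1 => //; try exact: tame_avg.
by apply: IH => //; rewrite addr_ge0// enorm_ge0.
Qed.

End averaged_flows.

Section convergence_of_policies.
Context {R : realType} {d d1 : nat} {A : Type} (alpha0 : A).
Context (E : bellman_data R d d1 A) (K lambda T : R).
Hypotheses (K1 : 1 <= K) (lam0 : 0 <= lambda) (T0 : 0 < T) (GE : good K lambda E).

Let K0 : 0 <= K := le_trans ler01 K1.
Let L : R := lipc (d1 := d1) K T.
Let M0 : R := K + K * T.
Let ws : R := window_size (d := d) (d1 := d1) K.

Definition regc (eps : R) : R :=
  M0 + L + (2 * M0 / eps + 4 * M0 / eps ^+ 2) + (2 * L / eps + 4 * L / eps ^+ 2).

Definition policyc (eps : R) : R := expansionc (d := d) (d1 := d1) K lambda (regc eps).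

(** [W j], the averaged shaken policy value, plays the supersolution in discrete time. A step loses
    [2 * C * tau ^ (3/2)], and at most [T / tau] steps lose [2 * C * T * tau ^ (1/2)]. The term
    [2 * L] pays for shaking and averaging, [K] for averaging the terminal value. *)
Lemma flow_le_pcp h tau n eps u ut U : 0 < h -> 0 < tau -> tau <= 1 -> n%:R * tau <= T ->
  0 < eps -> flow E h T u ut -> pcp E h T tau n U ->
  forall x, u (T - n%:R * tau) x <=
    U n x + (2 * L + K) * (eps * ws) + 2 * policyc eps * T * Num.sqrt tau.
Proof.
move=> h0 tau0 tau1 nT e0 fu pU x0.
have ws0 : 0 < ws := window_size_gt0 (d := d) (d1 := d1) K1.
pose rho := eps * ws; have rho0 : 0 < rho by rewrite mulr_gt0.
have [Us pUs Hs] := pcp_shake alpha0 K1 lam0 h0 tau0 GE nT pU rho0.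
have r00 : enorm (0 : 'rV[R]_d) <= rho by rewrite enorm0 ltW.
pose beta0 : shakes rho := (alpha0, exist _ 0 r00).
have GS := good_shake 1 rho GE.
have L0 : 0 <= L := lipc_ge0 K T.
have M00 : 0 <= M0 by rewrite addr_ge0// mulr_ge0// ltW.
have UsM j : (j <= n)%N -> forall x, `|Us j x| <= M0.
  move=> jn x; apply: le_trans (pcp_bounded beta0 K1 lam0 h0 tau0 GS nT pUs jn x) _.
  rewrite lerD2l ler_wpM2l//; apply: le_trans nT.
  by rewrite ler_pM2r// ler_nat.
have UsL j : (j <= n)%N -> lipx L (Us j) by exact: (pcp_lipx beta0 K1 lam0 h0 tau0 GS nT pUs).
have tUs j : (j <= n)%N -> tame (Us j).
  move=> jn; exists (M0 + L) => [x|].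
    by apply: le_trans (UsM j jn x) _; rewrite lerDl.
  by apply: lipx_le (UsL j jn); rewrite lerDr.
pose W j := avg (windows E eps) (Us j).
have rW j : (j <= n)%N -> regular E h (regc eps) (W j).
  by move=> jn; apply: (avg_regular GE e0 h0 L0 M00 (UsM j jn) (UsL j jn)).
have wsum := windows_size GE e0.
pose C := policyc eps; pose q := tau * Num.sqrt tau.
have P0 : 0 <= regc eps.
  by have [H _ _ _] := rW 0%N (leq0n n); apply: le_trans (H 0).
have C0 : 0 <= C by exact: expansionc_ge0.
have q0 : 0 <= q by rewrite mulr_ge0 ?sqrtr_ge0// ltW.
have [uM uMb] := flow_bd fu.
have usub := flow_subsol alpha0 GE lam0 h0 fu.
suff H j : (j <= n)%N -> forall x, u (T - j%:R * tau) x <= W j x + (K * rho + j%:R * (2 * C * q)).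
  have := H n (leqnn n) x0.
  have := avg_near (windows E eps) x0 L0 (UsL n (leqnn n)).
  have := Hs n (leqnn n) x0; rewrite -/L -/(W n).
  have := ler_wpM2l L0 wsum; rewrite -/ws -/rho.
  have : n%:R * (2 * C * q) <= 2 * C * T * Num.sqrt tau.
    rewrite (_ : n%:R * (2 * C * q) = 2 * C * (n%:R * tau) * Num.sqrt tau); last by rewrite /q; ring.
    by rewrite ler_wpM2r ?sqrtr_ge0// ler_wpM2l// mulr_ge0.
  by rewrite -/C !ler_norml; lra.
elim: j => [_ x|j IH jn x].
  rewrite !mul0r subr0 addr0 (flow_T fu).
  have [_ gK _] := good_g GE.
  have gL : lipx K (g_ E).
    by move=> y z; have := gK 0 (y + z) y; rewrite [y + z - y]addrAC subrr add0r.
  have := avg_near (windows E eps) x K0 gL; have := ler_wpM2l K0 wsum; rewrite -/ws -/rho.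
  have -> : W 0%N x = avg (windows E eps) (g_ E) x.
    by rewrite /W; congr avg; apply/funext => y; exact: pUs.1.
  by rewrite ler_norml; lra.
have jn' := ltnW jn.
pose a := T - j.+1%:R * tau; pose b := T - j%:R * tau.
have bE : b - a = tau by rewrite /a /b -natr1; ring.
have a0 : 0 <= a.
  by rewrite subr_ge0; apply: le_trans nT; rewrite ler_pM2r// ler_nat.
have ab : a < b by rewrite -subr_gt0 bE.
have b0 : 0 < b by apply: le_lt_trans ab.
have bT : b <= T by rewrite gerBl mulr_ge0// ltW.
have ab1 : b - a <= 1 by rewrite bE.
have aab : 0 <= a <= b by rewrite a0 ltW.
have usub' := subsol_sub a0 bT usub.
have uB : exists M, forall t x, a <= t <= b -> `|u t x| <= M.
  exists uM => t y /andP[at_ tb]; apply: uMb.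
  by rewrite (le_trans a0 at_) (le_trans tb bT).
have e_ge0 : 0 <= K * rho + j%:R * (2 * C * q).
  by rewrite addr_ge0 ?mulr_ge0// ltW.
have term y : u b y <= W j y + (K * rho + j%:R * (2 * C * q)) by exact: IH.
have up := expansion_upper GE lam0 h0 ab ab1 (rW j jn') alpha0 usub' uB e_ge0 term x.
have tW : tame (W j) by exact: tame_avg (tUs j jn').
have W1 alpha : W j x + tau * Lop E h alpha a (W j) x - C * q <= W j.+1 x.
  have [w [wt fw]] := single_exists lam0 h0 GE b0 alpha tW.
  have wsup := supersol_sub a0 (lexx b) (single_supersol lam0 h0 GE tW fw).
  have [wM wMb] := flow_bd fw.
  have wB : exists M, forall t x, a <= t <= b -> `|w t x| <= M.
    by exists wM => t y /andP[at_ tb]; apply: wMb; rewrite (le_trans a0 at_).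
  have wT y : W j y <= w b y by rewrite (flow_T fw).
  have := @expansion_lower R d d1 unit (single E alpha (g_ E)) K lambda h a b (regc eps) (W j)
    (good_solo alpha GE) lam0 h0 ab ab1 (rW j jn') w wt tt wsup wB wT x.
  rewrite bE => H1; apply: le_trans H1 _.
  have dom : dominated E h a b alpha (0 + \sum_(v <- windows E eps) enorm v) (Us j) (Us j.+1).
    move=> z zr y yt fy s.
    have zr' : enorm z <= rho by apply: le_trans zr _; rewrite add0r.
    exact: (pcp_shake_le lam0 h0 tau0 GE nT pUs jn zr' fy).
  have := dominated_avg GE lam0 h0 b0 aab (lexx 0) dom (tUs j jn') (tUs j.+1 jn).
  move=> /(_ 0); rewrite enorm0 => /(_ (lexx 0) w wt).
  have -> : (fun x => avg (windows E eps) (Us j) (x + 0)) = W j.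
    by apply/funext => y; rewrite addr0.
  by move=> /(_ fw x); rewrite addr0.
(* The bound [W1] holds for every control with the same error, so it passes to the supremum. *)
have Fop1 : tau * Fop E h a (W j) x <= W j.+1 x - W j x + C * q.
  rewrite -ler_pdivlMl//; apply: (Fop_le alpha0) => alpha; rewrite ler_pdivlMl//.
  by have := W1 alpha; lra.
have EN : j.+1%:R = j%:R + 1 :> R by rewrite -natr1.
have {}up : u a x <= W j x + (K * rho + j%:R * (2 * C * q)) + tau * Fop E h a (W j) x + C * q.
  by move: up; rewrite bE.
move: up Fop1; rewrite -/a EN; lra.
Qed.

End convergence_of_policies.

(** * Viscosity supersolutions *)

Section viscosity_supersolutions.
Context {R : realType} {d : nat}.

Lemma C12N (f : R -> 'rV[R]_d -> R) : C12 f ->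
  [/\ C12 (fun t x => - f t x),
      Defs.dt (fun t x => - f t x) = (fun t x => - Defs.dt f t x),
      (forall i, Defs.dx i (fun t x => - f t x) = (fun t x => - Defs.dx i f t x)) &
      (forall i j, Defs.dx j (Defs.dx i (fun t x => - f t x)) =
         (fun t x => - Defs.dx j (Defs.dx i f) t x))].
Proof.
move=> Cf.
have Edt : Defs.dt (fun t x => - f t x) = (fun t x => - Defs.dt f t x).
  apply/funext => t; apply/funext => x; rewrite /Defs.dt.
  by rewrite -[LHS]/('D_1 (- (fun s : R => f s x)) t) deriveN//; exact: (C12_dt Cf).
have Edx i : Defs.dx i (fun t x => - f t x) = (fun t x => - Defs.dx i f t x).
  apply/funext => t; apply/funext => x; rewrite /Defs.dx.
  by rewrite -[LHS]/('D_(delta_mx ord0 i) (- (f t)) x) deriveN//; exact: (C12_dx Cf).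
have Edxx i j : Defs.dx j (Defs.dx i (fun t x => - f t x)) =
    (fun t x => - Defs.dx j (Defs.dx i f) t x).
  apply/funext => t; apply/funext => x; rewrite Edx /Defs.dx.
  by rewrite -[LHS]/('D_(delta_mx ord0 j) (- (Defs.dx i f t)) x) deriveN//; exact: (C12_dxx Cf).
have cN (g : R -> 'rV[R]_d -> R) : jointly_continuous g -> jointly_continuous (fun t x => - g t x).
  by move=> cg z; apply: cvgN; exact: cg.
split=> //; split.
- exact: (cN _ (C12_cont Cf)).
- by move=> t x; apply: derivableN; exact: (C12_dt Cf).
- by rewrite Edt; exact: (cN _ (C12_dt_cont Cf)).
- by move=> i t x; apply: derivableN; exact: (C12_dx Cf).
- by move=> i; rewrite Edx; exact: (cN _ (@C12_dx_cont _ _ _ Cf i)).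
- by move=> i j t x; rewrite Edx; apply: derivableN; exact: (C12_dxx Cf).
- by move=> i j; rewrite Edxx; exact: (cN _ (@C12_dxx_cont _ _ _ Cf i j)).
Qed.

Lemma D1_opp (f : R -> 'rV[R]_d -> R) l t x : C12 f ->
  Defs.D1 l (fun t x => - f t x) t x = - Defs.D1 l f t x.
Proof.
move=> Cf; have [_ _ H _] := C12N Cf.
by rewrite /Defs.D1 -sumrN; apply: eq_bigr => i _; rewrite H mulNr.
Qed.

Lemma D2_opp (f : R -> 'rV[R]_d -> R) l t x : C12 f ->
  Defs.D2 l (fun t x => - f t x) t x = - Defs.D2 l f t x.
Proof.
move=> Cf; have [_ _ _ H] := C12N Cf.
rewrite /Defs.D2 -sumrN; apply: eq_bigr => i _; rewrite -sumrN.
by apply: eq_bigr => j _; rewrite H !mulNr.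
Qed.

Context {d1 : nat} {A : Type} (alpha0 : A).
Context (E : bellman_data R d d1 A) (K lambda T : R).
Hypotheses (K1 : 1 <= K) (lam0 : 0 <= lambda) (T0 : 0 < T) (GE : good K lambda E).

Let K0 : 0 <= K := le_trans ler01 K1.

Lemma bellmanF_ge alpha (p q : dindex d1 -> R) r (t : R) x :
  \sum_k a_ E alpha k t x * p k + \sum_k b_ E alpha k t x * q k - c_ E alpha t x * r
    + f_ E alpha t x <= bellmanF E p q r t x.
Proof.
apply: ub_le_sup; last by exists alpha.
exists (\sum_k K ^+ 2 / 2 * `|p k| + \sum_k K * `|q k| + (lambda + K) * `|r| + K) => _ [beta _ <-].
have [fK _ _] := good_f GE beta; have [cK _ _] := good_c GE beta.
apply: lerD; last by apply: le_trans (fK t x); exact: ler_norm.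
apply: lerD; first apply: lerD.
- apply: ler_sum => k _; apply: le_trans (ler_norm _) _; rewrite normrM ler_wpM2r//.
  by rewrite ger0_norm ?a_ge0//; exact: a_le GE.
- apply: ler_sum => k _; apply: le_trans (ler_norm _) _; rewrite normrM ler_wpM2r//.
  by have [] := good_b GE beta k.
apply: le_trans (ler_norm _) _; rewrite normrN normrM ler_wpM2r//.
have := cK t x; have := good_c_ge GE beta t x; have := lam0.
by rewrite ler_norml => l c; rewrite ger0_norm; lra.
Qed.

(** The linear problem solved by the opposite of a solution with control [alpha]: the source and the
    terminal value change sign, the operator does not. *)
Definition opposite (alpha : A) (phi : 'rV[R]_d -> R) : bellman_data R d d1 unit :=
  BellmanData (ell_ E) (fun=> sigma_ E alpha) (fun=> b_ E alpha) (fun=> c_ E alpha)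
    (fun=> fun t x => - f_ E alpha t x) (fun x => - phi x).

Lemma coefN C (psi : R -> 'rV[R]_d -> R) : coef C psi -> coef C (fun t x => - psi t x).
Proof.
move=> [h1 h2 h3]; split=> [t x|t x y|x t s]; first by rewrite normrN.
  by rewrite -opprD normrN.
by rewrite -opprD normrN.
Qed.

Lemma good_opposite phi M alpha : (forall x, `|phi x| <= M) -> lipx M phi ->
  good (K + M) lambda (opposite alpha phi).
Proof.
move=> pM pL; have G := good_single alpha GE pM pL; split => //=; try by case: G.
  by move=> _; exact: coefN (good_f G tt).
by have := coefN (good_g G).
Qed.

Lemma opposite_viscosity_sub (v : R -> 'rV[R]_d -> R) alpha phi b : b <= T ->
  viscosity_super T E v -> viscosity_sub b (opposite alpha phi) (fun t x => - v t x).
Proof.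
move=> bT vsup psi t x Cpsi /andP[t0 tb] tou.
have [CN dtN _ _] := C12N Cpsi.
have tT : 0 <= t < T by rewrite t0 (lt_le_trans tb).
have tou' : touches_below T v (fun t x => - psi t x) t x.
  (* Touching is known only on [[0, b)]; as [t < b], all nearby times lie below [b], so nothing
     changes locally on [[0, T)]. *)
  have nb : \forall z \near (t, x), z.1 < b.
    exists ([set s | s < b], setT) => /=; last by move=> [s y] [].
    by split; [exact: lt_nbhsl|exact: filterT].
  move: tou nb; rewrite /touches_above /touches_below => tou nb.
  near=> z => /andP[z0 zT].
  have zb : z.1 < b by near: z.
  have : 0 <= z.1 < b -> - v z.1 z.2 - psi z.1 z.2 <= - v t x - psi t x by near: z.
  by rewrite z0 zb => /(_ isT); lra.
have := vsup _ t x CN tT tou'; rewrite /bellman_at dtN => H.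
have := bellmanF_ge alpha (fun k => Defs.D2 (ell_ E k) (fun t x => - psi t x) t x)
  (fun k => Defs.D1 (ell_ E k) (fun t x => - psi t x) t x) (v t x) t x.
under eq_bigr do rewrite D2_opp// mulrN.
under [X in _ + X - _ + _ <= _]eq_bigr do rewrite D1_opp// mulrN.
rewrite !sumrN => H2.
have -> : bellmanF (opposite alpha phi) (fun k => Defs.D2 (ell_ (opposite alpha phi) k) psi t x)
    (fun k => Defs.D1 (ell_ (opposite alpha phi) k) psi t x) (- v t x) t x =
  \sum_k a_ E alpha k t x * Defs.D2 (ell_ E k) psi t x +
  \sum_k b_ E alpha k t x * Defs.D1 (ell_ E k) psi t x - c_ E alpha t x * - v t x - f_ E alpha t x.
  rewrite /bellmanF -[RHS]sup1; congr sup; apply/seteqP; split=> y; first by move=> [[] _ <-].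
  by move=> ->; exists tt.
by move: H H2; lra.
Unshelve. all: by end_near. Qed.
End viscosity_supersolutions.

Section lower_bound.
Context {R : realType} {d d1 : nat} {A : Type} (alpha0 : A).
Context (E : bellman_data R d d1 A) (K lambda T : R).
Hypotheses (K1 : 1 <= K) (lam0 : 0 <= lambda) (T0 : 0 < T) (GE : good K lambda E).

Let K0 : 0 <= K := le_trans ler01 K1.

Lemma opposite_subsol h b alpha phi u ut : subsol (opposite E alpha phi) h 0 b u ut ->
  supersol (single E alpha (g_ E)) h 0 b 0 (fun t x => - u t x) (fun t x => - ut t x).
Proof.
move=> [ev sub]; split; first exact: evolN.
move=> t x [] tb; apply/ler_addgt0Pr => e e0; have [[] H] := sub t x e tb e0.
move: H; rewrite /Lop LinN /=; rewrite -[Lin (opposite _ _ _) _ _ _ _ _]/(Lin (single E alpha (g_ E)) h tt t (u t) x).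
lra.
Qed.

Context (v : R -> 'rV[R]_d -> R).
Hypothesis vbd : bounded_upto T v.
Hypothesis vcont :
  {within `[0, T] `*` [set: 'rV[R]_d], continuous (fun z : R * 'rV[R]_d => v z.1 z.2)}.
Hypothesis vsup : viscosity_super T E v.
Hypothesis vT : forall x, g_ E x <= v T x.

Let full : 0 <= (1 : R) <= 1. Proof. by rewrite ler01 lexx. Qed.
Let slack (K' : R) : discount (d1 := d1) K' * (1 - 1) <= lambda.
Proof. by rewrite subrr mulr0. Qed.

(** On each step [viscosity_le_flow] with [theta = 1] is applied to the opposite of [v] and one
    frozen control. The constant accumulates over the steps and depends on [tau], but it is fixed
    before [h]. *)
Lemma pcp_le_viscosity tau n : 0 < tau -> n%:R * tau <= T ->
  forall j, (j <= n)%N -> exists2 N, 0 <= N & forall h U, 0 < h -> pcp E h T tau n U ->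
  forall x, U j x <= v (T - j%:R * tau) x + N * Num.sqrt h.
Proof.
move=> tau0 nT; elim=> [_|j IH jn].
  exists 0 => // h U h0 pU x; rewrite mul0r subr0 mul0r addr0 pU.1; exact: vT.
have [N N0 HN] := IH (ltnW jn).
pose a := T - j.+1%:R * tau; pose b := T - j%:R * tau.
have bE : b - a = tau by rewrite /a /b -natr1; ring.
have a0 : 0 <= a.
  by rewrite subr_ge0; apply: le_trans nT; rewrite ler_pM2r// ler_nat.
have ab : a < b by rewrite -subr_gt0 bE.
have b0 : 0 < b by apply: le_lt_trans ab.
have bT : b <= T by rewrite gerBl mulr_ge0// ltW.
have aab : 0 <= a <= b by rewrite a0 ltW.
(* A bound and a Lipschitz constant for [U j] valid at every mesh, which is why the added error
   constant does not depend on [h]. *)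
pose M := K + K * T + lipc (d1 := d1) K T.
have M0 : 0 <= M by rewrite addr_ge0 ?lipc_ge0// addr_ge0// mulr_ge0// ltW.
exists (N + `|ratec (d := d) (d1 := d1) (K + M) 1 b|); first by rewrite addr_ge0.
move=> h U h0 pU x.
have UM y : `|U j y| <= M.
  apply: le_trans (pcp_bounded alpha0 K1 lam0 h0 tau0 GE nT pU (ltnW jn) y) _.
  apply: (@le_trans _ _ (K + K * T)); last by rewrite lerDl lipc_ge0.
  by rewrite lerD2l ler_wpM2l//; move: (T0) b0; rewrite /b; lra.
have UL : lipx M (U j).
  apply: lipx_le (pcp_lipx alpha0 K1 lam0 h0 tau0 GE nT pU (ltnW jn)).
  by rewrite lerDr addr_ge0// mulr_ge0// ltW.
have [tU [w [wt [fw _ wn]]]] := pU.2 j jn.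
have KM1 : 1 <= K + M by apply: le_trans K1 _; rewrite lerDl.
apply/ler_addgt0Pr => e e0; have [alpha Ha] := wn x e e0.
have GO := good_opposite GE alpha UM UL.
have [y [yt fy]] := flow_exists tt GO lam0 h0 b0.
have ysup := opposite_subsol (flow_subsol tt GO lam0 h0 fy).
have [Mv Hv] := vbd.
have vM (t : R) z : 0 <= t <= b -> `|- v t z| <= Mv.
  by move=> /andP[t0 tb]; rewrite normrN Hv// t0 (le_trans tb).
have vc : {within `[0, b] `*` [set: 'rV[R]_d],
    continuous (fun z : R * 'rV[R]_d => - v z.1 z.2)}.
  move=> z; apply: cvgN; move: z.
  apply: continuous_subspaceW vcont => -[t z] [/= tb _]; split=> //=.
  by move: tb; rewrite /= !in_itv/= => /andP[-> /le_trans]; apply.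
have beta0 : 0 <= N * Num.sqrt h by rewrite mulr_ge0 ?sqrtr_ge0.
have term z : - v b z <= g_ (opposite E alpha (U j)) z + N * Num.sqrt h.
  by have := HN h U h0 pU z; rewrite -/b /=; lra.
have H1 := viscosity_le_flow tt KM1 lam0 b0 full (slack (K + M)) GO h0 fy
  (opposite_viscosity_sub lam0 GE alpha (U j) bT vsup) vc vM beta0 term x aab.
have H2 : w alpha a x - (- y a x) <= 0 + 0 * (b - a).
  have [Mw Hw] := flow_bd (fw alpha); have [My Hy] := flow_bd fy.
  have bdd : exists N, forall t z, 0 <= t <= b -> w alpha t z - (- y t z) <= N.
    exists (Mw + My) => t z tb; have := Hw t z tb; have := Hy t z tb.
    by rewrite !ler_norml; lra.
  have gap : 0 <= 0 + lambda * 0 by rewrite mulr0 addr0.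
  have termw z : w alpha b z - (- y b z) <= 0.
    by rewrite (flow_T (fw alpha)) (flow_T fy) /= opprK subrr.
  exact: (comparison (good_solo alpha GE) lam0 h0 (ltW b0)
    (single_subsol lam0 h0 GE tU (fw alpha)) ysup bdd (lexx 0) (lexx 0) gap termw x aab).
have : ratec (d := d) (d1 := d1) (K + M) 1 b * Num.sqrt h <=
    `|ratec (d := d) (d1 := d1) (K + M) 1 b| * Num.sqrt h.
  by rewrite ler_wpM2r ?sqrtr_ge0// ler_norm.
move: Ha H1 H2; rewrite -/a; lra.
Qed.

Let L : R := lipc (d1 := d1) K T.
Let ws : R := window_size (d := d) (d1 := d1) K.

(* The constants are chosen in the order: smoothing scale, length of the time steps,
   mesh of the auxiliary scheme. *)
Lemma viscosity_ge_flow theta h u ut : 0 <= theta <= 1 ->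
  discount (d1 := d1) K * (1 - theta) <= lambda -> 0 < h -> flow E h T u ut ->
  forall t x, 0 <= t < T -> u t x - v t x <= ratec (d := d) (d1 := d1) K theta T * Num.sqrt h.
Proof.
move=> th thl h0 fu t x /andP[t0 tT].
rewrite lerBlDr; apply/ler_addgt0Pr => e e0.
have e3 : 0 < e / 3 by rewrite divr_gt0.
have ws0 : 0 < ws := window_size_gt0 (d := d) (d1 := d1) K1.
have L0 : 0 <= L := lipc_ge0 K T.
have small (C : R) : 0 <= C -> exists2 s : R, 0 < s & C * s <= e / 3.
  move=> C0; exists (e / 3 / (C + 1)); first by rewrite divr_gt0// ltr_wpDl.
  rewrite mulrCA ger_pMr// ler_pdivrMr ?ltr_wpDl// mul1r lerDl //.
have [eps eps0 Heps] : exists2 s : R, 0 < s & (2 * L + K) * ws * s <= e / 3.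
  by apply: small; rewrite mulr_ge0 ?(ltW ws0)// addr_ge0// mulr_ge0.
pose C := 2 * policyc (d := d) (d1 := d1) K lambda T eps * T.
have [s s0 Hs] := small `|C| (normr_ge0 _).
(* With [tau = (T - t) / n] the time [t] is the last node. The factor [1 + s ^- 2] yields both
   [tau <= 1] and [Num.sqrt tau <= s]. *)
pose n := (Num.bound ((T - t) * (1 + s ^- 2))).+1.
have n0 : 0 < n%:R :> R by rewrite ltr0n.
have Tt : 0 < T - t by rewrite subr_gt0.
have s2 : 0 < s ^- 2 by rewrite invr_gt0 exprn_gt0.
pose tau := (T - t) / n%:R.
have tau0 : 0 < tau by rewrite divr_gt0.
have nb : (T - t) * (1 + s ^- 2) <= n%:R.
  apply: le_trans (ltW (archi_boundP _)) _; first by rewrite mulr_ge0 ?(ltW Tt)// addr_ge0// ltW.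
  by rewrite ler_nat.
have tau_le : tau * (1 + s ^- 2) <= 1.
  by rewrite /tau mulrAC ler_pdivrMr// mul1r.
have tau1 : tau <= 1 by have := mulr_gt0 tau0 s2; move: tau_le; rewrite mulrDr mulr1; lra.
have tau_s : Num.sqrt tau <= s.
  rewrite -(ger0_norm (ltW s0)) -sqrtr_sqr ler_wsqrtr//.
  have : tau * s ^- 2 <= 1 by move: tau_le; rewrite mulrDr mulr1; have := tau0; lra.
  by rewrite ler_pdivrMr ?exprn_gt0// mul1r.
have nE : n%:R * tau = T - t by rewrite /tau mulrC divfK// gt_eqF.
have nT : n%:R * tau <= T by rewrite nE gerBl.
have [N N0 HN] := pcp_le_viscosity tau0 nT (leqnn n).
have [r r0 Hr] := small N N0.
pose h' := Num.min h (r ^+ 2).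
have h'0 : 0 < h' by rewrite lt_min h0 exprn_gt0.
have h'h : h' <= h by rewrite ge_min lexx.
have h'r : Num.sqrt h' <= r.
  by rewrite -(ger0_norm (ltW r0)) -sqrtr_sqr ler_wsqrtr// ge_min lexx orbT.
have [u' [ut' fu']] := flow_exists alpha0 GE lam0 h'0 T0.
have [U pU] := pcp_exists alpha0 K1 lam0 h'0 tau0 GE nT.
have t_in : 0 <= t <= T by rewrite t0 ltW.
have H1 := flow_rate alpha0 K1 lam0 T0 th thl GE h'0 h'h fu fu' x t_in.
have H2 := flow_le_pcp alpha0 K1 lam0 T0 GE h'0 tau0 tau1 nT eps0 fu' pU x.
have H3 := HN h' U h'0 pU x.
rewrite nE subKr in H2 H3.
have H4 : C * Num.sqrt tau <= `|C| * s.
  by apply: le_trans (ler_norm _) _; rewrite normrM ler_wpM2l// ger0_norm ?sqrtr_ge0.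
have H5 : N * Num.sqrt h' <= N * r by rewrite ler_wpM2l.
move: H1 H2 H3 H4 H5 Heps Hs Hr; rewrite -/C -/L -/ws -mulrA [ws * eps]mulrC; lra.
Qed.

End lower_bound.

(** * Reduction to data bounded at all times, uniqueness, and the theorem *)

Section clamped_data.
Context {R : realType} {d d1 : nat}.

(* The hypotheses bound the coefficients for times in [0, T] only. *)
Definition clampE (A : Type) (T : R) (E : bellman_data R d d1 A) : bellman_data R d d1 A :=
  BellmanData (ell_ E) (fun alpha k t => sigma_ E alpha k (clamp T t))
    (fun alpha k t => b_ E alpha k (clamp T t)) (fun alpha t => c_ E alpha (clamp T t))
    (fun alpha t => f_ E alpha (clamp T t)) (g_ E).

Lemma coef_clamp (K T : R) psi : 0 <= K -> 0 <= T -> bounded_lipschitz (d := d) K T psi ->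
  holder_half K psi -> coef K (fun t => psi (clamp T t)).
Proof.
move=> K0 T0 bl hh; split=> [t x|t x y|x t s].
- by have [] := bl (clamp T t) x x (clamp_bnd t T0).
- by have [] := bl (clamp T t) x y (clamp_bnd t T0).
apply: le_trans (hh x (clamp T t) (clamp T s)) _; rewrite ler_wpM2l// ler_wsqrtr//.
exact: clamp_lip.
Qed.

Lemma good_clampE (A : topologicalType) (K T lambda : R) (E : bellman_data R d d1 A) :
  0 <= K -> 0 <= T -> standing_assumptions K T lambda E -> time_holder K lambda E ->
  good K lambda (clampE T E).
Proof.
move=> K0 T0 S H; split => //=.
- exact: ell_opp S.
- exact: ell_le S.
- by move=> alpha k t x; exact: (sigma_opp S).
- by move=> alpha k t x; exact: (b_ge0 S).
- by move=> alpha t x; exact: (c_ge S).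
- by move=> alpha k; apply: (coef_clamp K0 T0); [exact: (sigma_bl S)|exact: (sigma_holder H)].
- by move=> alpha k; apply: (coef_clamp K0 T0); [exact: (b_bl S)|exact: (b_holder H)].
- move=> alpha.
  exact: (coef_clamp K0 T0 (c_bl S alpha) (c_holder H alpha)).
- by move=> alpha; apply: (coef_clamp K0 T0); [exact: (f_bl S)|exact: (f_holder H)].
split=> [t x|t x y|x t s].
- by have [] := @g_bl _ _ _ _ _ _ _ _ S 0 x x; rewrite ?lexx.
- by have [] := @g_bl _ _ _ _ _ _ _ _ S 0 x y; rewrite ?lexx.
by rewrite subrr normr0 mulr_ge0// sqrtr_ge0.
Qed.

Lemma bellmanF_clamp (A : Type) (T : R) (E : bellman_data R d d1 A) p q r t x : 0 <= t <= T ->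
  bellmanF (clampE T E) p q r t x = bellmanF E p q r t x.
Proof. by move=> tT; rewrite /bellmanF /a_ /= clamp_id. Qed.

Lemma der_on_time_derivative (T : R) (u : R -> 'rV[R]_d -> R) t x l :
  der_on 0 T (fun s => u s x) t l <-> has_time_derivative T u t x l.
Proof.
split=> [H|H].
  apply/cvgrPdist_lt => e e0; have e2 : 0 < e / 2 by rewrite divr_gt0.
  have [r r0 Hr] := H _ e2.
  exists r => //= s /=; rewrite distrC => st ns; rewrite in_itv/= => sT.
  have sn : s - t != 0 by rewrite subr_eq0.
  have sp : 0 < `|s - t| by rewrite normr_gt0.
  rewrite distrC (_ : _ - _ = (u s x - u t x - l * (s - t)) / (s - t)); last by field.
  rewrite normrM normfV ltr_pdivrMr//; apply: le_lt_trans (Hr s sT st) _.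
  by rewrite ltr_pM2r// ltr_pdivrMr// mulrDr mulr1 ltrDl.
move=> e e0; move/cvgrPdist_lt : H => /(_ e e0) [r /= r0 Hr]; exists r => // s sT st.
have [->|ns] := eqVneq s t; first by rewrite !subrr mulr0 subr0 normr0 mulr0.
have sn : s - t != 0 by rewrite subr_eq0.
have := Hr s; rewrite /= distrC => /(_ st ns); rewrite in_itv/= => /(_ sT) /ltW.
have -> : u s x - u t x - l * (s - t) = - (l - (u s x - u t x) / (s - t)) * (s - t) by field.
by rewrite normrM normrN => h1; rewrite ler_wpM2r.
Qed.

Context {A : Type} (alpha0 : A) (E : bellman_data R d d1 A) (K lambda h T : R).
Hypotheses (lam0 : 0 <= lambda) (h0 : 0 < h) (T0 : 0 < T) (G : good K lambda (clampE T E)).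

Let FopE (u : R -> 'rV[R]_d -> R) (t : R) x : 0 <= t <= T -> Fop (clampE T E) h t (u t) x =
  bellmanF E (fun k => fDelta h (ell_ E k) u t x) (fun k => fdelta h (ell_ E k) u t x) (u t x) t x.
Proof. by move=> tT; rewrite -(bellmanF_clamp E _ _ _ _ tT). Qed.

Lemma flow_solution u ut : flow (clampE T E) h T u ut -> bounded_fd_solution T h E u.
Proof.
move=> fu; have [ucont uder] := flow_evol fu; split.
- exact: (flow_bd fu).
- exact: ucont.
- move=> t x tT; exists (ut t x); first by apply/der_on_time_derivative; exact: uder.
  have tT' : 0 <= t <= T by case/andP: tT => -> /ltW.
  by rewrite (flow_eq fu) clamp_id// FopE// addNr.
- exact: (flow_T fu).
Qed.

Lemma solution_sub_super u : bounded_fd_solution T h E u -> exists ut,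
  subsol (clampE T E) h 0 T u ut /\ supersol (clampE T E) h 0 T 0 u ut.
Proof.
move=> [[M uM] ucont ueq uT]; exists (fun t x => - Fop (clampE T E) h t (u t) x).
have tT (t : R) : 0 <= t < T -> 0 <= t <= T by case/andP => -> /ltW.
have ev : evol 0 T u (fun t x => - Fop (clampE T E) h t (u t) x).
  split=> // t x tT1; have [l /der_on_time_derivative Hl] := ueq t x tT1.
  by rewrite -(FopE _ _ (tT _ tT1)) => /eqP; rewrite addr_eq0 => /eqP <-.
split; split=> //; first last.
  move=> t x alpha tT1.
  by have := Lop_le_Fop G lam0 h0 alpha0 alpha t x (fun y => uM t y (tT _ tT1)); lra.
move=> t x e tT1 e0.
have [alpha Ha] := Fop_adherent G lam0 h0 alpha0 t x (fun y => uM t y (tT _ tT1)) e0.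
by exists alpha; move: Ha; lra.
Qed.

Lemma solution_le u w : bounded_fd_solution T h E u -> bounded_fd_solution T h E w ->
  forall t x, 0 <= t <= T -> u t x <= w t x.
Proof.
move=> su sw t x tT.
have [ut [usub _]] := solution_sub_super su; have [wt [_ wsup]] := solution_sub_super sw.
have [[M uM] _ _ uT] := su; have [[N wN] _ _ wT] := sw.
have bdd : exists M, forall t x, 0 <= t <= T -> u t x - w t x <= M.
  exists (M + N) => s y sT; have := uM s y sT; have := wN s y sT.
  by rewrite !ler_norml; lra.
have gap : 0 <= 0 + lambda * 0 by rewrite mulr0 addr0.
have term y : u T y - w T y <= 0 by rewrite uT wT subrr.
have := comparison G lam0 h0 (ltW T0) usub wsup bdd (lexx 0) (lexx 0) gap term x tT; lra.
Qed.

End clamped_data.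

Lemma ratec0 (R : realType) (d d1 : nat) (K T : R) :
  ratec (d := d) (d1 := d1) K 0 T = ratec (d := d) (d1 := d1) K 0 0.
Proof. by rewrite /ratec /consistency /smoothc /consc !mul0r. Qed.

Theorem theorem2p4 (R : realType) :
  exists (N1 : R -> R -> nat -> nat -> R) (N1' : R -> nat -> nat -> R)
         (N2 : R -> nat -> R),
  forall (d d1 : nat) (A : metricType R) (K T lambda h : R)
         (E : bellman_data R d d1 A),
    (0 < d)%N -> (0 < d1)%N ->
    [set: A] !=set0 -> separable_space A ->
    0 < T -> 1 <= K -> 0 <= lambda ->
    standing_assumptions K T lambda E ->
    time_holder K lambda E ->
    0 < h ->
    exists vh : R -> 'rV[R]_d -> R,
      [/\ bounded_fd_solution T h E vh,
          forall w : R -> 'rV[R]_d -> R, bounded_fd_solution T h E w ->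
            forall (t : R) (x : 'rV[R]_d), 0 <= t <= T -> w t x = vh t x
        & forall v : R -> 'rV[R]_d -> R, bounded_viscosity_solution T E v ->
            (forall (t : R) (x : 'rV[R]_d), 0 <= t < T ->
               `|v t x - vh t x| <= N1 K T d d1 * Num.sqrt h) /\
            (N2 K d1 <= lambda ->
               forall (t : R) (x : 'rV[R]_d), 0 <= t < T ->
                 `|v t x - vh t x| <= N1' K d d1 * Num.sqrt h)].
Proof.
(* The choice [theta = 1] asks nothing of the discount; [theta = 0] asks [lambda] to exceed
   [discount K] and removes the horizon from the constant. *)
exists (fun K T d d1 => ratec (d := d) (d1 := d1) K 1 T),
  (fun K d d1 => ratec (d := d) (d1 := d1) K 0 0), (fun K d1 => discount (d1 := d1) K).
move=> d d1 A K T lambda h E _ _ [alpha0 _] _ T0 K1 lam0 S H h0.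
have K0 : 0 <= K := le_trans ler01 K1.
have G := good_clampE K0 (ltW T0) S H.
have [u [ut fu]] := flow_exists alpha0 G lam0 h0 T0.
have su := flow_solution fu.
exists u; split=> // [w sw t x tT|v [vbd vcont vsub vsup vT]].
  apply/eqP; rewrite eq_le.
  by rewrite (solution_le alpha0 lam0 h0 T0 G sw su) ?(solution_le alpha0 lam0 h0 T0 G su sw).
have tW (t : R) : 0 <= t < T -> 0 <= t <= T by case/andP => -> /ltW.
(* Test points have times in [[0, T)], where clamping is the identity. *)
have vsub' : viscosity_sub T (clampE T E) v.
  move=> phi t x Cphi tT tou; rewrite /bellman_at bellmanF_clamp ?tW//.
  exact: vsub.
have vsup' : viscosity_super T (clampE T E) v.
  move=> phi t x Cphi tT tou; rewrite /bellman_at bellmanF_clamp ?tW//.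
  exact: vsup.
have [M vM] := vbd.
have rate theta : 0 <= theta <= 1 -> discount (d1 := d1) K * (1 - theta) <= lambda ->
    forall (t : R) x, 0 <= t < T ->
    `|v t x - u t x| <= ratec (d := d) (d1 := d1) K theta T * Num.sqrt h.
  move=> th thl t x tT.
  have term y : v T y <= g_ (clampE T E) y + 0 by rewrite addr0 vT.
  have H1 := viscosity_le_flow alpha0 K1 lam0 T0 th thl G h0 fu vsub' vcont vM (lexx 0) term x
    (tW t tT).
  have term' y : g_ (clampE T E) y <= v T y by rewrite vT.
  have H2 := viscosity_ge_flow alpha0 K1 lam0 T0 G vbd vcont vsup' term' th thl h0 fu x tT.
  by move: H1 H2; rewrite ler_norml; lra.
split=> [|lamN] t x tT.
  by apply: rate => //; [rewrite ler01 lexx|rewrite subrr mulr0].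
rewrite -(ratec0 d d1 K T); apply: rate => //; first by rewrite lexx ler01.
by rewrite subr0 mulr1.
Qed.
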